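(* Let $g(z)=\sum_{n=0}^\infty \eta_n z^n$ be analytic in the unit disc $\mathbb D$, let $\mathcal R_\eta$ and $\mathcal H_g$ be the associated Rhaly and generalized Hilbert operators, and let $2<p<q<\infty$ with $\frac2p-\frac1q<1$. (i) The following are equivalent: $\mathcal R_{\eta}\in\mathcal B(A^p,A^q)$; $\mathcal H_g\in\mathcal B(A^p,A^q)$; $g\in\Lambda^q_{\frac2p-\frac1q}$. (ii) The following are equivalent: $\mathcal R_{\eta}\in\mathcal K(A^p,A^q)$; $\mathcal H_g\in\mathcal K(A^p,A^q)$; $g\in\lambda^q_{\frac2p-\frac1q}$.
   Context: $\mathbb D=\{z\in\mathbb C:|z|<1\}$, $\mathrm{Hol}(\mathbb D)$ is the space of analytic functions in $\mathbb D$, and $dA$ is area Lebesgue measure on $\mathbb D$. For $0<p<\infty$ the Bergman space $A^p$ consists of those $f\in\mathrm{Hol}(\mathbb D)$ with $\|f\|_{A^p}^p=\int_{\mathbb D}|f(z)|^p\,dA(z)<\infty$. For $0<r<1$, $M_p(r,f)=\left(\frac1{2\pi}\int_0^{2\pi}|f(re^{it})|^p\,dt\right)^{1/p}$. Rhaly operator: for $f(z)=\sum_{k=0}^\infty a_kz^k\in\mathrm{Hol}(\mathbb D)$, $\mathcal R_{\eta}(f)(z)=\sum_{n=0}^\infty\eta_n\left(\sum_{k=0}^n a_k\right)z^n$, $z\in\mathbb D$. Generalized Hilbert operator: for $f(z)=\sum_{k=0}^\infty a_kz^k\in A^p$ with $p>2$, $\mathcal H_g(f)(z)=\sum_{n=0}^\infty(n+1)\eta_{n+1}\left(\sum_{k=0}^\infty\frac{a_k}{n+k+1}\right)z^n=\int_0^1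 f(t)\,g'(tz)\,dt$, $z\in\mathbb D$ (the integral converges absolutely and the two expressions agree for $f\in A^p$, $p>2$). Mean Lipschitz spaces: for $1\le p<\infty$ and $0<\alpha\le1$, $\Lambda^p_\alpha$ is the space of $f\in\mathrm{Hol}(\mathbb D)$ with $M_p(r,f')=O\left((1-r)^{\alpha-1}\right)$ as $r\to1^-$; $\lambda^p_\alpha$ is the corresponding space with $O$ replaced by $o$. For Banach spaces $X,Y$ of analytic functions in $\mathbb D$, $\mathcal B(X,Y)$ denotes the continuous linear operators from $X$ into $Y$, and $\mathcal K(X,Y)$ the compact linear operators from $X$ into $Y$; membership of an operator means that it maps $X$ into $Y$ and is bounded (resp. compact). *)

(* Defs.v *)
From HB Require Import structures.
From mathcomp Require Import all_boot all_order all_algebra.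
From mathcomp Require Import all_classical all_reals all_analysis.
From mathcomp Require Import complex.

Set Implicit Arguments.
Unset Strict Implicit.
Unset Printing Implicit Defensive.

Import Order.TTheory GRing.Theory Num.Theory.
Import numFieldNormedType.Exports.

Local Open Scope classical_set_scope.
Local Open Scope ring_scope.
Local Open Scope complex_scope.

(* R[i] seen as a numClosedFieldType, so that it gets
   its canonical topology and normed structure over itself; [derivable] and
   [derive1] on functions Cplx R -> Cplx R are thus complex derivatives. *)
Definition Cplx (R : realType) : numClosedFieldType := R[i].

(* The norm `|z| of Cplx R is complex-valued; this is its real value. *)
Definition cmod (R : realType) (z : Cplx R) : R := complex.Re `|z|.

Definition disc (R : realType) : set (Cplx R) := [set z | `|z| < 1].
Arguments disc : clear implicits.

(* Functions on the disc are represented by total functions on the plane;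
   their values outside the disc are irrelevant. *)
Definition Hol (R : realType) (f : Cplx R -> Cplx R) : Prop :=
  forall z, disc R z -> derivable f z 1.

Definition has_pseries (R : realType) (a : nat -> Cplx R)
    (f : Cplx R -> Cplx R) : Prop :=
  forall z, disc R z -> series (fun n => a n * z ^+ n) @ \oo --> f z.

Definition taylor_coef (R : realType) (f : Cplx R -> Cplx R) (k : nat) :
    Cplx R :=
  derive1n k f 0 / (k`!)%:R.

(* Area measure on the plane is Lebesgue measure of R * R, not normalised. *)
Definition bergman_int (R : realType) (p : R) (f : Cplx R -> Cplx R) : \bar R :=
  (\int[(@lebesgue_measure R \x @lebesgue_measure R)]_(w in
      [set w : R * R | disc R (w.1 +i* w.2)])
    ((cmod (f (w.1 +i* w.2))) `^ p)%:E)%E.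

Definition Bergman (R : realType) (p : R) (f : Cplx R -> Cplx R) : Prop :=
  Hol f /\ (bergman_int p f < +oo)%E.

Definition bergman_norm (R : realType) (p : R) (f : Cplx R -> Cplx R) : R :=
  (fine (bergman_int p f)) `^ p^-1.

Definition pmean (R : realType) (p r : R) (f : Cplx R -> Cplx R) : R :=
  ((2 * pi)^-1 *
   \int[@lebesgue_measure R]_(t in `[0, 2 * pi])
     (cmod (f (r%:C * (cos t +i* sin t)))) `^ p) `^ p^-1.

Definition Lip (R : realType) (p alpha : R) (f : Cplx R -> Cplx R) : Prop :=
  Hol f /\
  (fun r : R => pmean p r (derive1 f)) =O_ ((1 : R)^'-)
  (fun r : R => (1 - r) `^ (alpha - 1)).

Definition lip (R : realType) (p alpha : R) (f : Cplx R -> Cplx R) : Prop :=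
  Hol f /\
  (fun r : R => pmean p r (derive1 f)) =o_ ((1 : R)^'-)
  (fun r : R => (1 - r) `^ (alpha - 1)).

(* [limn] is total. In [Rhaly] the series converges on the disc as soon as
   [\sum_n eta n * z ^+ n] does and f is holomorphic there; in [genHilbert] the
   inner series converges for f in A^p with p > 2. *)
Definition Rhaly (R : realType) (eta : nat -> Cplx R) (f : Cplx R -> Cplx R) :
    Cplx R -> Cplx R :=
  fun z => limn (series (fun n =>
    eta n * (\sum_(k < n.+1) taylor_coef f k) * z ^+ n)).

Definition genHilbert (R : realType) (eta : nat -> Cplx R)
    (f : Cplx R -> Cplx R) : Cplx R -> Cplx R :=
  fun z => limn (series (fun n =>
    n.+1%:R * eta n.+1 *
    limn (series (fun k => taylor_coef f k / (n + k + 1)%:R)) * z ^+ n)).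

(* T belongs to a class of operators from A^p to A^q when it maps A^p into A^q
   linearly and is bounded, resp. compact; equalities between elements of A^q
   are equalities on the disc. *)
Definition linear_Bergman (R : realType) (p q : R)
    (T : (Cplx R -> Cplx R) -> (Cplx R -> Cplx R)) : Prop :=
  (forall f, Bergman p f -> Bergman q (T f)) /\
  (forall (c : Cplx R) f h, Bergman p f -> Bergman p h ->
     forall z, disc R z ->
       T (fun w => c * f w + h w) z = c * T f z + T h z).

Definition bounded_Bergman (R : realType) (p q : R)
    (T : (Cplx R -> Cplx R) -> (Cplx R -> Cplx R)) : Prop :=
  linear_Bergman p q T /\
  exists M : R, forall f, Bergman p f ->
    bergman_norm q (T f) <= M * bergman_norm p f.

(* Images of bounded sequences have norm-convergent subsequences. *)
Definition compact_Bergman (R : realType) (p q : R)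
    (T : (Cplx R -> Cplx R) -> (Cplx R -> Cplx R)) : Prop :=
  linear_Bergman p q T /\
  forall (f_ : nat -> Cplx R -> Cplx R) (M : R),
    (forall n, Bergman p (f_ n) /\ bergman_norm p (f_ n) <= M) ->
    exists (phi : nat -> nat) (h : Cplx R -> Cplx R),
      [/\ {homo phi : m n / (m < n)%N}, Bergman q h &
          (fun n => bergman_norm q (fun z => T (f_ (phi n)) z - h z))
            @ \oo --> (0 : R)].

(* Main.v *)
Require Import Defs.
From HB Require Import structures.
From mathcomp Require Import all_boot all_order all_algebra.
From mathcomp Require Import all_classical all_reals all_analysis measurable_realfun.
From mathcomp Require Import complex ring lra.

Set Implicit Arguments.
Unset Strict Implicit.
Unset Printing Implicit Defensive.

Import Order.TTheory GRing.Theory Num.Theory.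
Import numFieldNormedType.Exports.

Local Open Scope classical_set_scope.
Local Open Scope ring_scope.
Local Open Scope complex_scope.

(** Both operators have the form [h = sum of eta (n + 1) * b n * z ^ n], up to a
    constant term and a factor [z] in the case of the Rhaly operator, where [b]
    depends linearly on [f]: [b n] is the partial sum of order [n + 1] of the
    Taylor coefficients of [f] for the Rhaly operator, and [n + 1] times the
    [n]-th moment of [f] for the Hilbert operator. Hence the derivative of [z h]
    is the Hadamard product of [g'] with [Phi = sum of b n * z ^ n].

    Sufficiency. A Hardy inequality ([hardy]) bounds the norm of [h] in [A^q] by
    a weighted integral of the means of order [q] of the derivative of [z h].
    Young's inequality on the circle ([hadamard_young]) bounds these means by
    those of [g'] times the mean modulus of [Phi]. The norm of [f] in [A^p]
    controls a monotone majorant of the latter ([mean_dom]): by Hoelder's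
    inequality against the Cauchy kernel for partial sums ([mean_dom_psums]), and
    by Schur's test for the integral of [f t / (1 - t z) ^ 2] over the radius, which
    is [Phi] in the case of moments ([mean_dom_moments]). With the exponent
    [2 / p - 1 / q] the powers of the distance to the circle cancel
    ([hadamard_tail_bound], [split_bound]). Under the little-o condition the
    contribution of radii close to 1 is uniformly small, whereas on smaller discs
    coefficientwise convergence is uniform convergence ([lip_bergman_vanish]).

    Compactness. An operator that is continuous for coefficientwise convergence
    is compact if and only if it maps bounded sequences that tend to 0
    coefficientwise to sequences that tend to 0 in norm ([compact_vanishing]).
    Bounded sequences have convergent subsequences in this sense, and Fatou's
    lemma keeps the limit in [A^p] ([bergman_subsequence]).

    Necessity. Normalized Szego kernels and two related families are bounded in
    [A^p] and tend to 0 coefficientwise as the parameter [a] tends to 1, and their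
    images control the mean of [g'] at the radius [a ^ 2]: for the Rhaly operator
    because partial sums telescope ([Rhaly_detects]), for the Hilbert operator
    because [(n + 1) / (n + k + 1) + k / (n + k + 1) = 1] ([genHilbert_detects]).

    These arguments rest on the elementary function theory of the disc, developed
    from Goursat's lemma on: Cauchy's formula, Taylor expansions, the Poisson
    kernel, monotonicity of integral means, and polar coordinates, which express
    Bergman integrals through integral means. *)

(** * Modulus and convergence in the plane *)

Section ComplexModulus.
Context {R : realType}.
Implicit Types z w : Cplx R.

Lemma normC_cmod z : `|z| = (cmod z)%:C.
Proof. by rewrite /cmod normc_def. Qed.

Lemma cmodE (x y : R) : cmod (x +i* y : Cplx R) = Num.sqrt (x ^+ 2 + y ^+ 2).
Proof. by rewrite /cmod normc_def. Qed.

Lemma cmod_ge0 z : 0 <= cmod z.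
Proof. by rewrite -lecR -normC_cmod; exact: normr_ge0. Qed.

Lemma cmod0 : cmod (0 : Cplx R) = 0.
Proof. by apply: complexI; rewrite -normC_cmod normr0. Qed.

Lemma cmod1 : cmod (1 : Cplx R) = 1.
Proof. by apply: complexI; rewrite -normC_cmod normr1. Qed.

Lemma cmodM z w : cmod (z * w) = cmod z * cmod w.
Proof. by apply: complexI; rewrite rmorphM /= -!normC_cmod normrM. Qed.

Lemma cmodN z : cmod (- z) = cmod z.
Proof. by apply: complexI; rewrite -!normC_cmod normrN. Qed.

Lemma cmodB z w : cmod (z - w) = cmod (w - z).
Proof. by rewrite -opprB cmodN. Qed.

Lemma cmodX z n : cmod (z ^+ n) = cmod z ^+ n.
Proof. by apply: complexI; rewrite rmorphXn /= -!normC_cmod normrX. Qed.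

Lemma cmodV z : cmod (z^-1) = (cmod z)^-1.
Proof. by apply: complexI; rewrite fmorphV /= -!normC_cmod normfV. Qed.

Lemma cmodD z w : cmod (z + w) <= cmod z + cmod w.
Proof. by rewrite -lecR rmorphD /= -!normC_cmod ler_normD. Qed.

Lemma cmodBD z w : cmod (z - w) <= cmod z + cmod w.
Proof. by rewrite -(cmodN w) cmodD. Qed.

Lemma cmod_tri a z w : cmod (z - w) <= cmod (z - a) + cmod (a - w).
Proof. by apply: le_trans (cmodD _ _); rewrite addrA subrK. Qed.

Lemma cmod_sub z w : cmod z - cmod w <= cmod (z - w).
Proof. by rewrite lerBlDr (le_trans _ (cmodD _ _))// subrK. Qed.

Lemma cmod_eq0 z : cmod z = 0 -> z = 0.
Proof. by move=> h; apply/eqP; rewrite -normr_eq0 normC_cmod h. Qed.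

Lemma cmod_gt0 z : z != 0 -> 0 < cmod z.
Proof.
move=> z0; rewrite lt_neqAle cmod_ge0 andbT eq_sym.
by apply: contra z0 => /eqP /cmod_eq0 ->.
Qed.

Lemma cmod_real (x : R) : cmod (x%:C : Cplx R) = `|x|.
Proof. by rewrite cmodE expr0n /= addr0 sqrtr_sqr. Qed.

Lemma cmod_nat n : cmod (n%:R : Cplx R) = n%:R.
Proof. by apply: complexI; rewrite -normC_cmod normr_nat rmorph_nat. Qed.

Lemma cmod_sum (I : Type) (s : seq I) (F : I -> Cplx R) :
  cmod (\sum_(i <- s) F i) <= \sum_(i <- s) cmod (F i).
Proof.
elim: s => [|a s IH]; first by rewrite !big_nil cmod0.
by rewrite !big_cons; apply: le_trans (cmodD _ _) _; rewrite lerD2l.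
Qed.

Lemma Re_cmod z : `|complex.Re z| <= cmod z.
Proof. by rewrite -lecR -normC_cmod normc_ge_Re. Qed.

Lemma Im_cmod z : `|complex.Im z| <= cmod z.
Proof.
case: z => x y; rewrite cmodE /= -sqrtr_sqr ler_wsqrtr//.
by rewrite lerDr sqr_ge0.
Qed.

Lemma cmod_ReIm z : cmod z <= `|complex.Re z| + `|complex.Im z|.
Proof.
case: z => x y; have -> : x +i* y = x%:C + 'i * y%:C :> Cplx R.
  by rewrite {1}(complexE (x +i* y)).
apply: le_trans (cmodD _ _) _; rewrite cmodM !cmod_real cmodE.
by rewrite expr0n /= add0r expr1n sqrtr1 !mul0r !mul1r ?add0r ?subr0 ?addr0 ?sub0r ?oppr0 ?addr0.
Qed.

Lemma discE z : disc R z <-> cmod z < 1.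
Proof. by rewrite /disc /= normC_cmod -(ltcR (cmod z) 1). Qed.

Lemma ReD z w : complex.Re (z + w) = complex.Re z + complex.Re w.
Proof. by case: z; case: w. Qed.
Lemma ImD z w : complex.Im (z + w) = complex.Im z + complex.Im w.
Proof. by case: z; case: w. Qed.
Lemma ReN z : complex.Re (- z) = - complex.Re z.
Proof. by case: z. Qed.
Lemma ImN z : complex.Im (- z) = - complex.Im z.
Proof. by case: z. Qed.
Lemma ReM z w : complex.Re (z * w) =
  complex.Re z * complex.Re w - complex.Im z * complex.Im w.
Proof. by case: z => a b; case: w. Qed.
Lemma ImM z w : complex.Im (z * w) =
  complex.Re z * complex.Im w + complex.Im z * complex.Re w.
Proof. by case: z => a b; case: w. Qed.

Lemma eqC z w : complex.Re z = complex.Re w -> complex.Im z = complex.Im w -> z = w.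
Proof. by case: z => a b; case: w => c d /= -> ->. Qed.

Lemma gt0_cplx (e : Cplx R) : 0 < e -> 0 < complex.Re e /\ e = (complex.Re e)%:C.
Proof. by case: e => x y; rewrite ltcE /= => /andP[/eqP -> ->]. Qed.

(** The norm of [Cplx R] takes its values in [Cplx R] itself; limits are restated
    with the real-valued modulus. *)
Lemma cvg_cmodP {T : Type} (F : set_system T) {FF : Filter F}
    (f : T -> Cplx R) (l : Cplx R) :
  f @ F --> l <-> forall e : R, 0 < e -> \forall x \near F, cmod (l - f x) < e.
Proof.
split=> [/cvgrPdist_lt h e e0|h].
  have e0' : (0 : Cplx R) < e%:C by rewrite ltcR.
  by near do rewrite -ltcR -normC_cmod; apply: h.
apply/cvgrPdist_lt => e /gt0_cplx [e0 ->].
by near do rewrite normC_cmod ltcR; apply: h.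
Unshelve. all: by end_near. Qed.

Lemma cvg_seqP (u : nat -> Cplx R) (l : Cplx R) :
  u @ \oo --> l <->
  forall e : R, 0 < e -> exists N, forall n, (N <= n)%N -> cmod (u n - l) < e.
Proof.
rewrite cvg_cmodP; split=> h e e0.
  have [N _ hN] := h e e0.
  by exists N => n Nn; rewrite cmodB; apply: hN.
have [N hN] := h e e0.
by exists N => // n /= Nn; rewrite cmodB hN.
Qed.

Lemma nbhs_cmodP (A : set (Cplx R)) (z : Cplx R) :
  nbhs z A <-> exists2 e : R, 0 < e & forall w, cmod (w - z) < e -> A w.
Proof.
split=> [/nbhs_ballP[e /= e0 h]|[e e0 h]].
  have [re0 ee] := gt0_cplx e0.
  exists (complex.Re e) => // w hw; apply: h.
  by rewrite -ball_normE /= normC_cmod ee ltcR cmodB.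
apply/nbhs_ballP; exists e%:C; first by rewrite /= ltcR.
by move=> w; rewrite -ball_normE /= normC_cmod ltcR cmodB; exact: h.
Qed.

Lemma cvg_nbhs_cmod (f : Cplx R -> R) z :
  (forall e : R, 0 < e -> forall w, cmod (w - z) < e -> `|f z - f w| < e) ->
  {for z, continuous f}.
Proof.
move=> h; apply/(@cvgrPdist_lt R R^o (Cplx R) (nbhs z) (nbhs_filter z)) => e e0.
by apply/nbhs_cmodP; exists e => // w hw; exact: h.
Qed.

Lemma continuous_cmod : continuous (@cmod R).
Proof.
move=> z; apply: cvg_nbhs_cmod => e e0 w hw.
rewrite (le_lt_trans _ hw)// ler_norml lerBrDr addrC -lerBrDr.
have h1 := cmod_sub z w; have h2 := cmod_sub w z.
by rewrite (cmodB z w) in h1; apply/andP; split; lra.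
Qed.

Lemma continuous_Re : continuous (@complex.Re R : Cplx R -> R).
Proof.
move=> z; apply: cvg_nbhs_cmod => e e0 w hw.
by rewrite (le_lt_trans _ hw)// -ReN -ReD cmodB Re_cmod.
Qed.

Lemma continuous_Im : continuous (@complex.Im R : Cplx R -> R).
Proof.
move=> z; apply: cvg_nbhs_cmod => e e0 w hw.
by rewrite (le_lt_trans _ hw)// -ImN -ImD cmodB Im_cmod.
Qed.

Lemma continuous_Cplx (T : topologicalType) (f g : T -> R) x :
  {for x, continuous f} -> {for x, continuous g} ->
  {for x, continuous (fun t => f t +i* g t : Cplx R)}.
Proof.
move=> /cvgrPdist_lt cf /cvgrPdist_lt cg; apply/cvg_cmodP => e e0.
have e2 : 0 < e / 2 by rewrite divr_gt0.
near=> t; rewrite (le_lt_trans (cmod_ReIm _))// [ltRHS](splitr e).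
rewrite ltrD//=; [near: t; exact: cf|near: t; exact: cg].
Unshelve. all: by end_near. Qed.

Lemma real_series_cvg (u : nat -> R) (l : R) (e : R) : u @ \oo --> l -> 0 < e ->
  exists N, forall n, (N <= n)%N -> `|u n - l| < e.
Proof.
move=> /cvgrPdist_lt h e0; have [N _ hN] := h e e0.
by exists N => n Nn; rewrite distrC; apply: hN.
Qed.

(** Completeness of the plane, obtained from that of the line. *)
Lemma cplx_cauchy_cvg (u : nat -> Cplx R) :
  (forall e : R, 0 < e -> exists N, forall m n, (N <= m)%N -> (N <= n)%N ->
     cmod (u m - u n) < e) ->
  exists l : Cplx R, u @ \oo --> l.
Proof.
move=> hu.
have cc (v : nat -> R) : (forall m n, `|v m - v n| <= cmod (u m - u n)) ->
    exists l : R, v @ \oo --> l.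
  move=> hv; suff : cvg (v @ \oo) by move=> cv; exists (lim (v @ \oo)).
  apply: cauchy_cvg; apply: cauchy_exP => e e0.
  have [N hN] := hu _ e0; exists (v N); exists N => // n /= Nn.
  by rewrite /ball /=; exact: le_lt_trans (hv _ _) (hN _ _ _ _).
have [a ha] := cc (fun n => complex.Re (u n)) (fun m n => ltac:(by rewrite -ReN -ReD Re_cmod)).
have [b hb] := cc (fun n => complex.Im (u n)) (fun m n => ltac:(by rewrite -ImN -ImD Im_cmod)).
exists (a +i* b); apply/cvg_seqP => e e0.
have e2 : 0 < e / 2 by rewrite divr_gt0.
have [N1 h1] := real_series_cvg ha e2; have [N2 h2] := real_series_cvg hb e2.
exists (maxn N1 N2) => n; rewrite geq_max => /andP[n1 n2].
rewrite (le_lt_trans (cmod_ReIm _))// [ltRHS](splitr e).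
by rewrite ltrD// ?ReD ?ReN ?ImD ?ImN /= ?h1 ?h2.
Qed.

End ComplexModulus.

(** * Power series *)

Section PowerSeries.
Context {R : realType}.
Implicit Types (z w : Cplx R) (a b : nat -> Cplx R) (f g : Cplx R -> Cplx R).

Lemma cvgCc (c : Cplx R) : (fun _ : nat => c) @ \oo --> c.
Proof. exact: cvg_cst. Qed.

Lemma cvgCD (u v : nat -> Cplx R) (l m : Cplx R) : u @ \oo --> l -> v @ \oo --> m ->
  (fun n => u n + v n) @ \oo --> l + m.
Proof. by move=> hu hv; exact: (@cvgD _ (Cplx R) nat \oo _ u v l m hu hv). Qed.

Lemma cvgCB (u v : nat -> Cplx R) (l m : Cplx R) : u @ \oo --> l -> v @ \oo --> m ->
  (fun n => u n - v n) @ \oo --> l - m.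
Proof. by move=> hu hv; exact: (@cvgB _ (Cplx R) nat \oo _ u v l m hu hv). Qed.

Lemma cvgCM (u v : nat -> Cplx R) (l m : Cplx R) : u @ \oo --> l -> v @ \oo --> m ->
  (fun n => u n * v n) @ \oo --> l * m.
Proof. by move=> hu hv; exact: (@cvgM _ nat \oo _ u v l m hu hv). Qed.

Lemma cvgCS (u : nat -> Cplx R) (l : Cplx R) : u @ \oo --> l -> (fun n => u n.+1) @ \oo --> l.
Proof.
move=> /cvg_seqP hu; apply/cvg_seqP => e e0; have [N hN] := hu e e0.
by exists N => n Nn; apply: hN; exact: leqW.
Qed.

Definition psum a z n : Cplx R := \sum_(k < n) a k * z ^+ k.

Lemma psumS a z n : psum a z n.+1 = psum a z n + a n * z ^+ n.
Proof. by rewrite /psum big_ord_recr. Qed.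

Lemma series_psum a z : series (fun n => a n * z ^+ n) = psum a z.
Proof. by apply/funext => n; rewrite /series /= /psum big_mkord. Qed.

Lemma has_pseriesP a f : has_pseries a f <->
  forall z, cmod z < 1 -> psum a z @ \oo --> f z.
Proof.
split=> h z hz; first by rewrite -series_psum; apply: h; apply/discE.
by rewrite series_psum; apply: h; apply/discE.
Qed.

(** Cauchy-Hadamard: radius of convergence at least one. *)
Definition radius1 a := forall r : R, 0 <= r < 1 ->
  exists M : R, forall n, cmod (a n) * r ^+ n <= M.

Lemma geo_sum_le (t : R) n : 0 <= t < 1 -> \sum_(k < n) t ^+ k <= (1 - t)^-1.
Proof.
move=> /andP[t0 t1]; rewrite -div1r ler_pdivlMr ?subr_gt0//.
suff -> : (\sum_(k < n) t ^+ k) * (1 - t) = 1 - t ^+ n.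
  by rewrite lerBlDr lerDl exprn_ge0.
elim: n => [|n IH]; first by rewrite big_ord0 mul0r expr0 subrr.
by rewrite big_ord_recr /= mulrDl IH exprSr; ring.
Qed.

Lemma lin_geo_le (t : R) n : 0 <= t < 1 -> n.+1%:R * t ^+ n <= (1 - t)^-1.
Proof.
move=> ht; apply: le_trans (geo_sum_le n.+1 ht).
have {ht} /andP[t0 t1] := ht.
rewrite mulr_natl -[X in _ *+ X](card_ord n.+1) -sumr_const ler_sum// => i _.
by rewrite ler_wiXn2l// ?ltW// -ltnS.
Qed.

Lemma psum_cvg_bound a z (l : Cplx R) : psum a z @ \oo --> l ->
  exists M : R, forall n, cmod (a n * z ^+ n) <= M.
Proof.
move=> /cvg_seqP /(_ 1 ltr01) [N hN].
exists (2 + \sum_(k < N) cmod (a k * z ^+ k)) => n.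
have [nN|Nn] := ltnP n N.
  rewrite (bigD1 (Ordinal nN))//= addrCA lerDl addr_ge0// ?sumr_ge0// => i _.
  exact: cmod_ge0.
have -> : a n * z ^+ n = psum a z n.+1 - psum a z n by rewrite psumS addrC addKr.
rewrite (le_trans (cmod_tri l _ _))// ler_wpDr//.
  by apply: sumr_ge0 => i _; exact: cmod_ge0.
rewrite (_ : 2 = 1 + 1)// lerD// ltW// ?hN//; last by rewrite cmodB hN.
exact: leqW.
Qed.

Lemma has_pseries_radius1 a f : has_pseries a f -> radius1 a.
Proof.
move=> /has_pseriesP h r /andP[r0 r1].
have [|M hM] := psum_cvg_bound (h r%:C _); first by rewrite cmod_real ger0_norm.
exists M => n; have := hM n.
by rewrite cmodM cmodX cmod_real ger0_norm.
Qed.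

Lemma radius1_sum a (r : R) : radius1 a -> 0 <= r < 1 ->
  exists2 M : R, 0 <= M & forall n, \sum_(k < n) cmod (a k) * r ^+ k <= M.
Proof.
move=> ha /andP[r0 r1]; pose s := (1 + r) / 2.
have s01 : 0 <= s < 1 by rewrite /s; apply/andP; split; lra.
have s0 : 0 < s by rewrite /s; lra.
have [M hM] := ha s s01.
have t01 : 0 <= r / s < 1.
  by rewrite divr_ge0// ?ltW//= ltr_pdivrMr// mul1r /s; lra.
have M0 : 0 <= M by apply: le_trans (hM 0%N); rewrite mulr_ge0 ?cmod_ge0.
exists (M * (1 - r / s)^-1) => [|n].
  by rewrite mulr_ge0// invr_ge0 subr_ge0 ltW//; case/andP: t01.
apply: le_trans (ler_wpM2l M0 (geo_sum_le n t01)).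
rewrite mulr_sumr ler_sum// => k _.
rewrite expr_div_n mulrA ler_pdivlMr ?exprn_gt0//.
rewrite mulrAC ler_wpM2r ?exprn_ge0//.
Qed.

Lemma psum_norm_le a z (r : R) n : cmod z <= r ->
  cmod (psum a z n) <= \sum_(k < n) cmod (a k) * r ^+ k.
Proof.
move=> zr; apply: le_trans (cmod_sum _ _) _; apply: ler_sum => k _.
by rewrite cmodM cmodX ler_wpM2l ?cmod_ge0// lerXn2r// ?nnegrE ?cmod_ge0//
  (le_trans (cmod_ge0 z)).
Qed.

Lemma cmod_lim_le (u : nat -> Cplx R) (l : Cplx R) (B : R) N :
  u @ \oo --> l -> (forall n, (N <= n)%N -> cmod (u n) <= B) -> cmod l <= B.
Proof.
move=> /cvg_seqP ul hB; apply/ler_addgt0Pr => e e0.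
have [N' hN] := ul e e0; set n := maxn N N'.
have -> : l = u n - (u n - l) by rewrite subKr.
by rewrite (le_trans (cmodBD _ _))// lerD ?hB ?leq_maxl// ltW// hN// leq_maxr.
Qed.

Lemma radius1_cvg a z : radius1 a -> cmod z < 1 ->
  exists l : Cplx R, psum a z @ \oo --> l.
Proof.
move=> ha z1; apply: cplx_cauchy_cvg => e e0.
have z01 : 0 <= cmod z < 1 by rewrite cmod_ge0.
have [M M0 hM] := radius1_sum ha z01.
pose v n : R := \sum_(k < n) cmod (a k) * cmod z ^+ k.
have vi : {homo v : m n / (m <= n)%N >-> m <= n}.
  apply/nondecreasing_seqP => n.
  by rewrite /v big_ord_recr /= lerDl mulr_ge0 ?exprn_ge0 ?cmod_ge0.
have cv : cvgn v.
  apply: nondecreasing_is_cvgn => //; exists M => _ [n _ <-]; exact: hM.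
have e2 : 0 < e / 2 by rewrite divr_gt0.
have [N hN] := real_series_cvg cv e2.
exists N => m n Nm Nn.
wlog mn : m n Nm Nn / (m <= n)%N.
  by move=> hw; case: (leqP m n) => [|/ltnW] mn; [|rewrite cmodB]; exact: hw.
rewrite cmodB; apply: (@le_lt_trans _ _ (v n - v m)).
  rewrite /psum /v -!(big_mkord xpredT (fun k => a k * z ^+ k)).
  rewrite -!(big_mkord xpredT (fun k => cmod (a k) * cmod z ^+ k)).
  rewrite !(big_cat_nat (leq0n m) mn)//= [X in cmod X]addrAC subrr add0r.
  rewrite [leRHS]addrAC subrr add0r (le_trans (cmod_sum _ _))// ler_sum// => k _.
  by rewrite cmodM cmodX.
have h1 := hN _ Nm; have h2 := hN _ Nn; move: h1 h2; rewrite !ltr_norml.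
by move=> /andP[? ?] /andP[? ?]; lra.
Qed.

Definition psfun a z : Cplx R := limn (series (fun n => a n * z ^+ n)).

Lemma cvg_limC (u : nat -> Cplx R) (l : Cplx R) : u @ \oo --> l -> limn u = l.
Proof. by move=> h; apply: cvg_lim. Qed.

Lemma psfunP a : radius1 a -> has_pseries a (psfun a).
Proof.
move=> ha; apply/has_pseriesP => z z1; have [l hl] := radius1_cvg ha z1.
by rewrite /psfun series_psum (cvg_limC hl).
Qed.

Lemma has_pseries_psfun a f z : has_pseries a f -> cmod z < 1 -> psfun a z = f z.
Proof.
by move=> /has_pseriesP h z1; rewrite /psfun series_psum; apply: cvg_limC; apply: h.
Qed.

Lemma has_pseries_ext a f g : has_pseries a f ->
  (forall z, cmod z < 1 -> f z = g z) -> has_pseries a g.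
Proof.
move=> /has_pseriesP h fg; apply/has_pseriesP => z z1.
by rewrite -fg//; apply: h.
Qed.

Lemma has_pseries_norm a f z (r B : R) : has_pseries a f -> cmod z <= r -> r < 1 ->
  (forall n, \sum_(k < n) cmod (a k) * r ^+ k <= B) -> cmod (f z) <= B.
Proof.
move=> /has_pseriesP h zr r1 hB.
apply: (cmod_lim_le (N := 0%N) (h z (le_lt_trans zr r1))) => n _.
exact: le_trans (psum_norm_le _ _ zr) (hB n).
Qed.

(** The tail is dominated by a geometric series at an intermediate radius, hence
    the uniformity on the disc of radius [r]. *)
Lemma has_pseries_tail a f (r : R) : has_pseries a f -> 0 <= r < 1 ->
  forall e : R, 0 < e -> exists N, forall n z, (N <= n)%N -> cmod z <= r ->
    cmod (f z - psum a z n) < e.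
Proof.
move=> hf r01 e e0.
have ra := has_pseries_radius1 hf.
have [M M0 hM] := radius1_sum ra r01.
pose v n : R := \sum_(k < n) cmod (a k) * r ^+ k.
have {r01} /andP[r0 r1] := r01.
have vi : {homo v : m n / (m <= n)%N >-> m <= n}.
  apply/nondecreasing_seqP => n.
  by rewrite /v big_ord_recr /= lerDl mulr_ge0 ?exprn_ge0 ?cmod_ge0.
have cv : cvgn v.
  apply: nondecreasing_is_cvgn => //; exists M => _ [n _ <-]; exact: hM.
have e2 : 0 < e / 4 by rewrite divr_gt0.
have [N hN] := real_series_cvg cv e2.
exists N => n z Nn zr.
have /has_pseriesP hf' := hf.
have := hf' z (le_lt_trans zr r1) => /cvg_seqP /(_ _ e2) [N' hN'].
set m := maxn n N'.
have h1 : cmod (f z - psum a z m) < e / 4 by rewrite cmodB hN'// leq_maxr.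
suff h2 : cmod (psum a z m - psum a z n) < e / 2.
  apply: le_lt_trans (cmod_tri (psum a z m) _ _) _.
  by apply: lt_le_trans (ltrD h1 h2) _; lra.
have nm : (n <= m)%N by rewrite leq_maxl.
apply: (@le_lt_trans _ _ (v m - v n)).
  rewrite /psum /v -!(big_mkord xpredT (fun k => a k * z ^+ k)).
  rewrite -!(big_mkord xpredT (fun k => cmod (a k) * r ^+ k)).
  rewrite !(big_cat_nat (leq0n n) nm)//= [X in cmod X]addrAC subrr add0r.
  rewrite [leRHS]addrAC subrr add0r (le_trans (cmod_sum _ _))// ler_sum// => k _.
  rewrite cmodM cmodX ler_wpM2l ?cmod_ge0// lerXn2r// nnegrE ?cmod_ge0//.
have := hN _ Nn; have := hN _ (leq_trans Nn nm); rewrite !ltr_norml.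
by move=> /andP[? ?] /andP[? ?]; lra.
Qed.

(** A factor of linear growth is absorbed by passing to a larger radius;
    differentiation costs no more than that. *)
Lemma radius1_le a b (C : R) : radius1 a ->
  (forall n, cmod (b n) <= C * n.+1%:R * cmod (a n)) -> radius1 b.
Proof.
move=> ha hb r /andP[r0 r1]; pose s := (1 + r) / 2.
have s01 : 0 <= s < 1 by rewrite /s; apply/andP; split; lra.
have s0 : 0 < s by rewrite /s; lra.
have [M hM] := ha s s01.
have t01 : 0 <= r / s < 1.
  by rewrite divr_ge0// ?ltW//= ltr_pdivrMr// mul1r /s; lra.
have M0 : 0 <= M by apply: le_trans (hM 0%N); rewrite mulr_ge0 ?cmod_ge0.
exists (`|C| * ((1 - r / s)^-1 * M)) => n.
apply: (@le_trans _ _ (`|C| * n.+1%:R * cmod (a n) * r ^+ n)).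
  rewrite ler_wpM2r ?exprn_ge0// (le_trans (hb n))// ler_wpM2r ?cmod_ge0//.
  by rewrite ler_wpM2r// ler_norm.
have -> : r ^+ n = (r / s) ^+ n * s ^+ n by rewrite -exprMn divfK ?gt_eqF.
rewrite (_ : _ * _ = `|C| * ((n.+1%:R * (r / s) ^+ n) * (cmod (a n) * s ^+ n))).
  rewrite ler_wpM2l// ler_pM//.
  - by rewrite mulr_ge0// exprn_ge0//; case/andP: t01.
  - by rewrite mulr_ge0 ?cmod_ge0// exprn_ge0// ltW.
  - exact: lin_geo_le.
by ring.
Qed.

Lemma radius1_shift a : radius1 a -> radius1 (fun n => a n.+1).
Proof.
move=> ha r /andP[r0 r1]; pose s := (1 + r) / 2.
have s01 : 0 <= s < 1 by rewrite /s; apply/andP; split; lra.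
have s0 : 0 < s by rewrite /s; lra.
have [M hM] := ha s s01; exists (M / s) => n.
rewrite ler_pdivlMr//; apply: le_trans (hM n.+1).
rewrite -mulrA ler_wpM2l ?cmod_ge0//.
rewrite exprSr ler_wpM2r ?(ltW s0)// lerXn2r// ?nnegrE ?(ltW s0)//.
by rewrite /s; lra.
Qed.

Lemma radius1_deriv a : radius1 a -> radius1 (fun n => n.+1%:R * a n.+1).
Proof.
move=> /radius1_shift ha; apply: (radius1_le (C := 1) ha) => n.
by rewrite cmodM cmod_nat mul1r.
Qed.

Lemma has_pseries_lin a b f g (c : Cplx R) : has_pseries a f -> has_pseries b g ->
  has_pseries (fun n => c * a n + b n) (fun z => c * f z + g z).
Proof.
move=> /has_pseriesP hf /has_pseriesP hg; apply/has_pseriesP => z z1.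
have -> : psum (fun n => c * a n + b n) z = (fun n => c * psum a z n + psum b z n).
  apply/funext => n; rewrite /psum mulr_sumr -big_split /=; apply: eq_bigr => k _.
  by ring.
have h1 := cvgCM (@cvgCc c) (hf z z1); have h2 := cvgCD h1 (hg z z1).
exact: h2.
Qed.

(** The first-order expansion avoids difference quotients. *)
Definition is_cderiv f z (l : Cplx R) := forall e : R, 0 < e ->
  exists2 d : R, 0 < d & forall w, cmod (w - z) < d ->
    cmod (f w - f z - l * (w - z)) <= e * cmod (w - z).

Lemma is_cderiv_cvg f z l : is_cderiv f z l <->
  (fun h : Cplx R => h^-1 *: (f (h *: (1 : Cplx R) + z) - f z)) @ 0^' --> l.
Proof.
split=> [h|/cvg_cmodP h e e0].
  apply/cvg_cmodP => e e0; have e2 : 0 < e / 2 by rewrite divr_gt0.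
  have [d d0 hd] := h _ e2.
  suff : nbhs (0 : Cplx R) (fun w => w != 0 ->
      cmod (l - w^-1 *: (f (w *: (1 : Cplx R) + z) - f z)) < e) by [].
  apply/nbhs_cmodP; exists d => // w; rewrite subr0 => wd w0.
  have w00 : 0 < cmod w by apply: cmod_gt0.
  have := hd (w + z); rewrite addrK => /(_ wd) hw.
  rewrite /GRing.scale /= mulr1 cmodB.
  have -> : w^-1 * (f (w + z) - f z) - l = w^-1 * (f (w + z) - f z - l * w).
    by rewrite [RHS]mulrBr (mulrC l) mulKf.
  rewrite cmodM cmodV mulrC ltr_pdivrMr//.
  by rewrite (le_lt_trans hw)// ltr_pM2r// ltr_pdivrMr// ltr_pMr// ltr1n.
have /nbhs_cmodP[d d0 hd] : nbhs (0 : Cplx R) (fun w => w != 0 ->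
      cmod (l - w^-1 *: (f (w *: (1 : Cplx R) + z) - f z)) < e) by exact: h e e0.
exists d => // w wd; have [->|wz] := eqVneq w z.
  by rewrite !subrr mulr0 subr0 cmod0 mulr0.
have wz0 : w - z != 0 by rewrite subr_eq0.
have := hd (w - z); rewrite subr0 => /(_ wd wz0) /=.
rewrite /GRing.scale /= mulr1 subrK cmodB => hw.
have -> : f w - f z - l * (w - z) = (w - z) * ((w - z)^-1 * (f w - f z) - l).
  by rewrite [RHS]mulrBr mulVKf// (mulrC _ l).
by rewrite cmodM mulrC ler_wpM2r ?cmod_ge0// ltW.
Qed.

Lemma is_cderivP f z l : is_cderiv f z l <-> derivable f z 1 /\ derive1 f z = l.
Proof.
rewrite is_cderiv_cvg; split=> [h|[]].
  split; first by apply/cvg_ex; exists l.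
  by rewrite derive1E; apply: cvg_lim.
by rewrite /derivable => dv <-; rewrite derive1E; exact: dv.
Qed.

Lemma cderivable f z : derivable f z 1 -> is_cderiv f z (derive1 f z).
Proof. by move=> h; apply/is_cderivP. Qed.

Lemma is_cderiv_ext f g z l (r : R) : 0 < r ->
  (forall w, cmod (w - z) < r -> f w = g w) -> is_cderiv f z l -> is_cderiv g z l.
Proof.
move=> r0 fg h e e0; have [d d0 hd] := h e e0.
exists (Num.min r d) => [|w]; first by rewrite lt_min r0.
by rewrite lt_min => /andP[wr wd]; rewrite -!fg ?subrr ?cmod0//; exact: hd.
Qed.

(** The explicit growth [n ^ 2] of the remainder makes the sum over [n] converge
    in [has_pseries_cderiv]. *)
Lemma pow_taylor1 (r : R) z w n : cmod z <= r -> cmod w <= r -> r <= 1 ->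
  r ^+ 2 * cmod (w ^+ n - z ^+ n - n%:R * z ^+ n.-1 * (w - z)) <=
  n%:R ^+ 2 * r ^+ n * cmod (w - z) ^+ 2.
Proof.
move=> zr wr r1; have r0 : 0 <= r := le_trans (cmod_ge0 z) zr.
elim: n => [|n IH].
  by rewrite !expr0 subrr !mul0r subrr cmod0 mulr0 expr0n /= !mul0r.
have -> : w ^+ n.+1 - z ^+ n.+1 - n.+1%:R * z ^+ n.+1.-1 * (w - z) =
    w * (w ^+ n - z ^+ n - n%:R * z ^+ n.-1 * (w - z)) +
    n%:R * z ^+ n.-1 * (w - z) ^+ 2.
  case: n {IH} => [|n] /=; first by rewrite !expr0 !expr1; ring.
  by rewrite !exprS -!natr1; ring.
apply: (@le_trans _ _ (r * (n%:R ^+ 2 * r ^+ n * cmod (w - z) ^+ 2) +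
    n%:R * r ^+ n.+1 * cmod (w - z) ^+ 2)).
  apply: (@le_trans _ _ (r ^+ 2 * (cmod w * cmod (w ^+ n - z ^+ n - n%:R * z ^+ n.-1 * (w - z))
     + n%:R * cmod z ^+ n.-1 * cmod (w - z) ^+ 2))).
    rewrite ler_wpM2l ?exprn_ge0// (le_trans (cmodD _ _))// !cmodM !cmodX.
    by rewrite cmod_nat.
  rewrite mulrDr lerD//.
    rewrite mulrCA ler_pM ?cmod_ge0//.
    by rewrite mulr_ge0 ?cmod_ge0 ?exprn_ge0.
  rewrite mulrA ler_wpM2r ?exprn_ge0 ?cmod_ge0// mulrCA ler_wpM2l//.
  case: n {IH} => [|n] /=.
    by rewrite expr0 mulr1 expr1 expr2 ler_piMr.
  rewrite -[leRHS]/(r ^+ n.+2) (_ : n.+2 = (2 + n)%N)// exprD ler_wpM2l ?exprn_ge0//.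
  by rewrite lerXn2r// ?nnegrE ?cmod_ge0.
have -> : r * (n%:R ^+ 2 * r ^+ n * cmod (w - z) ^+ 2) +
    n%:R * r ^+ n.+1 * cmod (w - z) ^+ 2 =
   (n%:R ^+ 2 + n%:R) * r ^+ n.+1 * cmod (w - z) ^+ 2.
  by rewrite (exprS r n); move: (r ^+ n) (n%:R) (cmod _) => A B C; ring.
rewrite ler_wpM2r ?exprn_ge0 ?cmod_ge0// ler_wpM2r ?exprn_ge0//.
by rewrite -natr1; have : 0 <= n%:R :> R by []; lra.
Qed.

(** Termwise differentiation: the quadratic remainders of [pow_taylor1] sum up on
    a slightly larger disc. *)
Lemma has_pseries_cderiv a f g z : has_pseries a f ->
  has_pseries (fun n => n.+1%:R * a n.+1) g -> cmod z < 1 ->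
  is_cderiv f z (g z).
Proof.
move=> hf hg z1 e e0; have ra := has_pseries_radius1 hf.
pose r := (1 + cmod z) / 2; have z0 := cmod_ge0 z.
have r01 : 0 <= r < 1 by rewrite /r; apply/andP; split; lra.
have r0 : 0 < r by rewrite /r; lra.
have zr : cmod z < r by rewrite /r; lra.
have r1 : r < 1 by rewrite /r; lra.
have ra2 : radius1 (fun n => n%:R ^+ 2 * a n).
  have ra1 : radius1 (fun n => n%:R * a n).
    apply: (radius1_le (C := 1) ra) => n.
    by rewrite cmodM cmod_nat mul1r ler_wpM2r ?cmod_ge0// ler_nat.
  apply: (radius1_le (C := 1) ra1) => n.
  rewrite expr2 -mulrA cmodM cmod_nat mul1r ler_wpM2r ?cmod_ge0// ler_nat//.
have [K K0 hK] := radius1_sum ra2 r01.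
have r2 : 0 < r ^+ 2 by rewrite exprn_gt0.
have main w : cmod w <= r ->
    r ^+ 2 * cmod (f w - f z - g z * (w - z)) <= K * cmod (w - z) ^+ 2.
  move=> wr; rewrite mulrC -ler_pdivlMr//.
  have /has_pseriesP hf' := hf; have /has_pseriesP hg' := hg.
  have cw := hf' w (le_lt_trans wr r1); have cz := hf' z z1.
  have cg := hg' z z1.
  have cc : (fun n => psum a w n.+1 - psum a z n.+1 -
      psum (fun n => n.+1%:R * a n.+1) z n * (w - z)) @ \oo -->
      f w - f z - g z * (w - z).
    exact: (cvgCB (cvgCB (cvgCS cw) (cvgCS cz)) (cvgCM cg (@cvgCc _))).
  apply: (cmod_lim_le (N := 0%N) cc) => n _.
  rewrite ler_pdivlMr// mulrC.
  have -> : psum a w n.+1 - psum a z n.+1 - psum (fun n => n.+1%:R * a n.+1) z n * (w - z)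
     = \sum_(k < n.+1) a k * (w ^+ k - z ^+ k - k%:R * z ^+ k.-1 * (w - z)).
    rewrite /psum mulr_suml [in RHS]big_ord_recl /= !expr0 subrr !mul0r subrr mulr0 add0r.
    rewrite -sumrB [X in X - _]big_ord_recl /= !expr0 subrr add0r -sumrB.
    by apply: eq_bigr => i _; rewrite /bump /= add1n /=; ring.
  apply: (@le_trans _ _ (\sum_(k < n.+1) cmod (k%:R ^+ 2 * a k) * r ^+ k * cmod (w - z) ^+ 2)).
    apply: le_trans (ler_wpM2l (ltW r2) (cmod_sum _ _)) _.
    rewrite mulr_sumr ler_sum// => k _.
    rewrite [cmod (a k * _)]cmodM [cmod (_ ^+ 2 * a k)]cmodM cmodX cmod_nat mulrCA.
    apply: le_trans (ler_wpM2l (cmod_ge0 _) (pow_taylor1 k (ltW zr) wr (ltW r1))) _.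
    by rewrite le_eqVlt; apply/orP; left; apply/eqP; move: (r ^+ k) => rk; ring.
  by rewrite -mulr_suml ler_wpM2r ?exprn_ge0 ?cmod_ge0.
exists (Num.min (r - cmod z) (e * r ^+ 2 / (K + 1))) => [|w].
  by rewrite lt_min subr_gt0 zr /=; apply: divr_gt0; [exact: mulr_gt0|lra].
rewrite lt_min => /andP[w1 w2].
have wr : cmod w <= r.
  have -> : w = z + (w - z) by rewrite addrC subrK.
  by rewrite (le_trans (cmodD _ _))// addrC -lerBrDr ltW.
rewrite -(ler_pM2l r2) (le_trans (main w wr))// expr2 mulrA.
rewrite mulrA ler_wpM2r ?cmod_ge0//.
move: w2; rewrite ltr_pdivlMr ?ltr_wpDl// => /ltW; rewrite (mulrC _ (K + 1)) (mulrC (r ^+ 2)).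
by apply: le_trans; rewrite mulrDl mul1r lerDl cmod_ge0.
Qed.

Lemma has_pseries_derive1 a f : has_pseries a f ->
  has_pseries (fun n => n.+1%:R * a n.+1) (derive1 f).
Proof.
move=> hf; have hg := psfunP (radius1_deriv (has_pseries_radius1 hf)).
apply: (has_pseries_ext hg) => z z1.
by have /is_cderivP[_ ->] := has_pseries_cderiv hf hg z1.
Qed.

Lemma has_pseries_Hol a f : has_pseries a f -> Hol f.
Proof.
move=> hf z /discE z1.
by have /is_cderivP[] := has_pseries_cderiv hf (has_pseries_derive1 hf) z1.
Qed.

Lemma has_pseries0 a f : has_pseries a f -> f 0 = a 0%N.
Proof.
move=> /has_pseriesP /(_ 0); rewrite cmod0 => /(_ ltr01) h.
have <- := cvg_limC h; apply: cvg_limC; apply/cvg_seqP => e e0; exists 1%N => -[//|n] _.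
rewrite /psum big_ord_recl big1 ?addr0 ?expr0 ?mulr1 ?subrr ?cmod0// => i _.
by rewrite /bump /= expr0n /= mulr0.
Qed.

(** The [n]-fold derivative is again a power series, and its value at the origin
    is its constant coefficient. *)
Lemma taylor_coefE a f : has_pseries a f -> taylor_coef f = a.
Proof.
move=> hf; apply/funext => k; rewrite /taylor_coef.
have h n : has_pseries (fun j => ((j + n) ^_ n)%:R * a (j + n)%N) (derive1n n f).
  elim: n => [|n IH].
    by rewrite (_ : (fun _ => _) = a)//; apply/funext => j; rewrite addn0 ffactn0 mul1r.
  rewrite derive1nS.
  rewrite (_ : (fun _ => _) = (fun j => j.+1%:R * (((j.+1 + n) ^_ n)%:R * a (j.+1 + n)%N))).
    exact: (has_pseries_derive1 IH).
  apply/funext => j; rewrite mulrA -natrM addnS addSn; congr (_%:R * _).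
  by rewrite ffactnSr subSn ?leq_addl// addnK mulnC.
have := has_pseries0 (h k); rewrite add0n ffactnn => ->.
rewrite mulrC mulKf//.
Qed.

End PowerSeries.

(** * Contour integrals and Goursat's lemma *)

Section SegmentIntegral.
Context {R : realType}.
Notation mu := (@lebesgue_measure R).
Implicit Types (a b c : R) (u v : R -> R).

Definition rint a b u : R := \int[mu]_(t in `[a, b]) u t.

Lemma cont_integrable a b u : continuous u -> mu.-integrable `[a, b] (EFin \o u).
Proof.
move=> cu; apply: continuous_compact_integrable; first exact: segment_compact.
exact: continuous_subspaceT.
Qed.
Local Hint Resolve cont_integrable : core.

Lemma rintD a b u v : continuous u -> continuous v ->
  rint a b (fun t => u t + v t) = rint a b u + rint a b v.
Proof. by move=> cu cv; rewrite /rint RintegralD//; exact: cont_integrable. Qed.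

Lemma rintZ a b k u : continuous u -> rint a b (fun t => k * u t) = k * rint a b u.
Proof. by move=> cu; rewrite /rint RintegralZl//; exact: cont_integrable. Qed.

Lemma rintN a b u : continuous u -> rint a b (fun t => - u t) = - rint a b u.
Proof.
move=> cu; rewrite -mulN1r -rintZ//; congr rint; apply/funext => t.
by rewrite mulN1r.
Qed.

Lemma rint_le a b u v : continuous u -> continuous v ->
  (forall t, a <= t <= b -> u t <= v t) -> rint a b u <= rint a b v.
Proof.
move=> cu cv uv; rewrite /rint le_Rintegral//; try exact: cont_integrable.
Qed.

Lemma rint_cst a b k : a <= b -> rint a b (fun=> k) = k * (b - a).
Proof.
move=> ab; rewrite /rint Rintegral_cst//= lebesgue_measure_itv /= lte_fin.
have [ab'|] := ltP a b; first by rewrite -EFinB.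
by move=> ba; have -> : a = b; [apply/le_anti; rewrite ab|rewrite subrr].
Qed.

Lemma rint_split a b c u : continuous u -> a <= c <= b ->
  rint a b u = rint a c u + rint c b u.
Proof.
move=> cu /andP[ac cb]; rewrite addrC; apply/eqP; rewrite -subr_eq; apply/eqP.
rewrite /rint Rintegral_itvB ?bnd_simp//; last exact: cont_integrable.
rewrite Rintegral_itv_obnd_cbnd//.
apply: integrableS (cont_integrable c b cu) => //.
exact: subset_itv_oc_cc.
Qed.

Lemma rint_FTC a b (F f : R -> R) : a <= b -> continuous f ->
  (forall x, is_derive x (1 : R) F (f x)) -> rint a b f = F b - F a.
Proof.
rewrite le_eqVlt => /predU1P[->|ab] cf dF.
  by rewrite subrr /rint set_itv1 Rintegral_set1.
have cF : continuous F.
  move=> x; apply/differentiable_continuous/derivable1_diffP.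
  by have [] := dF x.
rewrite /rint /Rintegral (@continuous_FTC2 _ f F)//.
- exact: continuous_subspaceT.
- split; first by move=> x _; have [] := dF x.
  + exact/cvg_at_right_filter/cF.
  + exact/cvg_at_left_filter/cF.
- by move=> x _; rewrite derive1E; have [_ ->] := dF x.
Qed.

Definition cint a b (u : R -> Cplx R) : Cplx R :=
  rint a b (fun t => complex.Re (u t)) +i* rint a b (fun t => complex.Im (u t)).

Implicit Types f g : R -> Cplx R.

Lemma cont_Re f : continuous f -> continuous (fun t => complex.Re (f t)).
Proof.
by move=> cf t; exact: (continuous_comp (cf t) (@continuous_Re R (f t))).
Qed.

Lemma cont_Im f : continuous f -> continuous (fun t => complex.Im (f t)).
Proof.
by move=> cf t; exact: (continuous_comp (cf t) (@continuous_Im R (f t))).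
Qed.

Lemma cont_cmod f : continuous f -> continuous (fun t => cmod (f t)).
Proof.
by move=> cf t; exact: (continuous_comp (cf t) (@continuous_cmod R (f t))).
Qed.

Lemma cont_mulC f g : continuous f -> continuous g -> continuous (fun t => f t * g t).
Proof. by move=> cf cg t; apply: cvgM; [exact: cf|exact: cg]. Qed.

Lemma cont_addC f g : continuous f -> continuous g -> continuous (fun t => f t + g t).
Proof. by move=> cf cg t; apply: cvgD; [exact: cf|exact: cg]. Qed.

Lemma cont_subC f g : continuous f -> continuous g -> continuous (fun t => f t - g t).
Proof. by move=> cf cg t; apply: cvgB; [exact: cf|exact: cg]. Qed.

Lemma cont_cstC (k : Cplx R) : continuous (fun _ : R => k).
Proof. by move=> t; apply: cvg_cst. Qed.
#[global] Arguments cont_cstC : clear implicits.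

Lemma cont_mulR (f g : R -> R) : continuous f -> continuous g ->
  continuous (fun t => f t * g t).
Proof. by move=> cf cg t; apply: cvgM; [exact: cf|exact: cg]. Qed.

Lemma cont_addR (f g : R -> R) : continuous f -> continuous g ->
  continuous (fun t => f t + g t).
Proof. by move=> cf cg t; apply: cvgD; [exact: cf|exact: cg]. Qed.

Lemma cont_oppR (f : R -> R) : continuous f -> continuous (fun t => - f t).
Proof. by move=> cf t; apply: cvgN; exact: cf. Qed.

Lemma cint_ext a b f g : (forall t, a <= t <= b -> f t = g t) -> cint a b f = cint a b g.
Proof.
move=> fg; rewrite /cint /rint; congr Complex; apply: eq_Rintegral => t /set_mem /=;
by rewrite in_itv /= => /fg ->.
Qed.

Lemma cintD a b f g : continuous f -> continuous g ->
  cint a b (fun t => f t + g t) = cint a b f + cint a b g.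
Proof.
move=> cf cg; rewrite /cint.
have -> : (fun t => complex.Re (f t + g t)) =
  (fun t => complex.Re (f t) + complex.Re (g t)) by apply/funext => t; rewrite ReD.
have -> : (fun t => complex.Im (f t + g t)) =
  (fun t => complex.Im (f t) + complex.Im (g t)) by apply/funext => t; rewrite ImD.
by rewrite rintD ?rintD//; (exact: cont_Re || exact: cont_Im).
Qed.

Lemma cintZ a b (k : Cplx R) f : continuous f ->
  cint a b (fun t => k * f t) = k * cint a b f.
Proof.
move=> cf; have cr := cont_Re cf; have ci := cont_Im cf.
have cst (x : R) : continuous (fun _ : R => x) by move=> t; apply: cvg_cst.
apply: eqC; rewrite ?ReM ?ImM /=.
  rewrite -!rintZ// -rintN; last exact: cont_mulR.
  rewrite -rintD; [|exact: cont_mulR|exact/cont_oppR/cont_mulR].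
  by congr rint; apply/funext => t; rewrite ReM.
rewrite -!rintZ// -rintD; [|exact: cont_mulR|exact: cont_mulR].
by congr rint; apply/funext => t; rewrite ImM.
Qed.

Lemma cintB a b f g : continuous f -> continuous g ->
  cint a b (fun t => f t - g t) = cint a b f - cint a b g.
Proof.
move=> cf cg; have cNg := cont_mulC (cont_cstC (-1)) cg.
have -> : (fun t => f t - g t) = (fun t => f t + -1 * g t).
  by apply/funext => t; rewrite mulN1r.
by rewrite (cintD a b cf cNg) cintZ// mulN1r.
Qed.

Lemma cint_split a b c f : continuous f -> a <= c <= b ->
  cint a b f = cint a c f + cint c b f.
Proof.
by move=> cf acb; apply: eqC; rewrite ?ReD ?ImD /=; apply: rint_split => //;
  (exact: cont_Re || exact: cont_Im).
Qed.

Lemma cint_norm a b f : continuous f ->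
  cmod (cint a b f) <= rint a b (fun t => cmod (f t)).
Proof.
move=> cf; have [->|c0] := eqVneq (cint a b f) 0.
  rewrite cmod0 /rint Rintegral_ge0// => t _; exact: cmod_ge0.
set c := cint a b f in c0 *.
have n0 : 0 < cmod c by apply: cmod_gt0.
pose z : Cplx R := (cmod c)%:C / c.
have z1 : cmod z = 1.
  by rewrite cmodM cmodV cmod_real ger0_norm ?cmod_ge0// divff ?gt_eqF.
have -> : cmod c = complex.Re (cint a b (fun t => z * f t)).
  by rewrite cintZ// -/c /z divfK.
apply: rint_le => [||t _].
- exact: (cont_Re (cont_mulC (cont_cstC z) cf)).
- exact: cont_cmod.
- by rewrite (le_trans (ler_norm _))// (le_trans (Re_cmod _))// cmodM z1 mul1r.
Qed.

Lemma cint_norm_le a b f (M : R) : a <= b -> continuous f ->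
  (forall t, a <= t <= b -> cmod (f t) <= M) -> cmod (cint a b f) <= M * (b - a).
Proof.
move=> ab cf fM; rewrite (le_trans (cint_norm _ _ cf))// -rint_cst//.
apply: rint_le => //; first exact: cont_cmod.
by move=> t; apply: cvg_cst.
Qed.

Lemma cint_cst a b (k : Cplx R) : a <= b -> cint a b (fun=> k) = k * (b - a)%:C.
Proof.
by move=> ab; apply: eqC; rewrite ?ReM ?ImM /= rint_cst// mulr0 ?subr0 ?add0r.
Qed.

Lemma cint_id a b : a <= b ->
  cint a b (fun t => t%:C) = ((b ^+ 2 - a ^+ 2) / 2)%:C.
Proof.
move=> ab; apply: eqC => /=; last by rewrite rint_cst// mul0r.
have dF (x : R) : is_derive x (1 : R) (fun t => t ^+ 2 / 2) x.
  by apply: is_derive_eq; rewrite /GRing.scale /= ?expr1 ?mulr0; field.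
rewrite (rint_FTC ab _ dF) ?mulrBl//.
by move=> x; exact: cvg_id.
Qed.

End SegmentIntegral.

Section Goursat.
Context {R : realType}.
Variable F : R -> R -> Cplx R.
Hypotheses (cFx : forall y, continuous (F ^~ y)) (cFy : forall x, continuous (F x)).

(** The integral of [F] with respect to [d (x + i y)] along the boundary of the
    box with corner [(a, c)], width [w] and height [h]. *)
Definition box (a w c h : R) : Cplx R :=
  cint a (a + w) (F ^~ c) - cint a (a + w) (F ^~ (c + h)) +
  'i * (cint c (c + h) (F (a + w)) - cint c (c + h) (F a)).

(** Complex differentiability of [F] in the variable [x + i y]. *)
Definition planar_cderiv (x y : R) (l : Cplx R) := forall e : R, 0 < e ->
  exists2 d : R, 0 < d & forall x' y', `|x' - x| < d -> `|y' - y| < d ->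
    cmod (F x' y' - F x y - l * ((x' - x) +i* (y' - y))) <=
    e * (`|x' - x| + `|y' - y|).

Lemma box_quarter a w c h : 0 <= w -> 0 <= h ->
  box a (w + w) c (h + h) =
  box a w c h + box (a + w) w c h + (box a w (c + h) h + box (a + w) w (c + h) h).
Proof.
move=> w0 h0; rewrite /box !addrA.
rewrite !(@cint_split _ a (a + w + w) (a + w)) ?cFx//; try by apply/andP; split; lra.
rewrite !(@cint_split _ c (c + h + h) (c + h)) ?cFy//; try by apply/andP; split; lra.
by ring.
Qed.

(** On a box of diameter [r] where [F] differs from an affine function of
    [x +i y] by at most [e * r], the boundary integral is [O(e * r^2)], since
    the affine part integrates to zero. *)
Lemma box_affine (a w c h x y : R) (l : Cplx R) (e : R) : 0 <= w -> 0 <= h ->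
  (forall x' y', a <= x' <= a + w -> c <= y' <= c + h ->
    cmod (F x' y' - F x y - l * ((x' - x) +i* (y' - y))) <= e) ->
  cmod (box a w c h) <= 2 * e * (w + h).
Proof.
move=> w0 h0 hF.
pose G x' y' : Cplx R := (F x y - l * (x +i* y)) + l * (x'%:C + 'i * y'%:C).
pose D x' y' : Cplx R := F x' y' - G x' y'.
have DE x' y' : D x' y' = F x' y' - F x y - l * ((x' - x) +i* (y' - y)).
  rewrite /D /G (_ : x'%:C + _ = x' +i* y'); last by rewrite {1}(complexE (x' +i* y')).
  rewrite (_ : (x' - x) +i* (y' - y) = x' +i* y' - x +i* y)//; ring.
have cre : continuous (fun t : R => t%:C : Cplx R).
  by move=> t; apply: continuous_Cplx => //; exact: cvg_cst.
have cst (k : Cplx R) : continuous (fun _ : R => k) by exact: cont_cstC.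
have cGx y' : continuous (G ^~ y').
  exact: (cont_addC (cst _) (cont_mulC (cst _) (cont_addC cre (cst _)))).
have cGy x' : continuous (G x').
  exact: (cont_addC (cst _) (cont_mulC (cst _) (cont_addC (cst _) (cont_mulC (cst _) cre)))).
have aw : a <= a + w by lra.
have ch : c <= c + h by lra.
have Gx y' : cint a (a + w) (G ^~ y') = (F x y - l * (x +i* y) + l * ('i * y'%:C)) * w%:C
    + l * (((a + w) ^+ 2 - a ^+ 2) / 2)%:C.
  have -> : (G ^~ y') = (fun t => (F x y - l * (x +i* y) + l * ('i * y'%:C)) + l * t%:C).
    by apply/funext => t; rewrite /G; ring.
  rewrite (cintD _ _ (cst _) (cont_mulC (cst l) cre)).
  rewrite cint_cst// cintZ// cint_id//.
  by rewrite (_ : a + w - a = w)//; ring.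
have Gy x' : cint c (c + h) (G x') = (F x y - l * (x +i* y) + l * x'%:C) * h%:C
    + l * 'i * (((c + h) ^+ 2 - c ^+ 2) / 2)%:C.
  have -> : G x' = (fun t => (F x y - l * (x +i* y) + l * x'%:C) + (l * 'i) * t%:C).
    by apply/funext => t; rewrite /G; ring.
  rewrite (cintD _ _ (cst _) (cont_mulC (cst (l * 'i)) cre)).
  rewrite cint_cst// cintZ// cint_id//.
  by rewrite (_ : c + h - c = h)//; ring.
have Dx y' : cint a (a + w) (D ^~ y') = cint a (a + w) (F ^~ y') - cint a (a + w) (G ^~ y').
  by rewrite -(cintB a (a + w) (@cFx y') (cGx y')).
have Dy x' : cint c (c + h) (D x') = cint c (c + h) (F x') - cint c (c + h) (G x').
  by rewrite -(cintB c (c + h) (@cFy x') (cGy x')).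
have -> : box a w c h = cint a (a + w) (D ^~ c) - cint a (a + w) (D ^~ (c + h)) +
  'i * (cint c (c + h) (D (a + w)) - cint c (c + h) (D a)).
  have ch' : (c + h)%:C = c%:C + h%:C :> Cplx R by rewrite rmorphD.
  have aw' : (a + w)%:C = a%:C + w%:C :> Cplx R by rewrite rmorphD.
  rewrite !Dx !Dy !Gx !Gy /box ch' aw'.
  by move: (_ / 2)%:C (_ / 2)%:C => q1 q2; ring.
have cDx y' : continuous (D ^~ y') by exact: (cont_subC (@cFx y') (cGx y')).
have cDy x' : continuous (D x') by exact: (cont_subC (@cFy x') (cGy x')).
clearbody D.
have e1 y' : c <= y' <= c + h -> cmod (cint a (a + w) (D ^~ y')) <= e * w.
  move=> hy; rewrite [X in e * X](_ : w = a + w - a); last by rewrite addrAC subrr add0r.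
  by apply: (cint_norm_le aw (@cDx y')) => t ht; rewrite DE; exact: hF.
have e2 x' : a <= x' <= a + w -> cmod (cint c (c + h) (D x')) <= e * h.
  move=> hx; rewrite [X in e * X](_ : h = c + h - c); last by rewrite addrAC subrr add0r.
  by apply: (cint_norm_le ch (@cDy x')) => t ht; rewrite DE; exact: hF.
have ci : cmod ('i : Cplx R) = 1 by rewrite cmodE expr0n /= add0r expr1n sqrtr1.
apply: le_trans (cmodD _ _) _; rewrite cmodM ci mul1r.
apply: le_trans (lerD (cmodBD _ _) (cmodBD _ _)) _.
have := e1 c; have := e1 (c + h); have := e2 a; have := e2 (a + w).
by rewrite !lexx aw ch /= => /(_ isT) ? /(_ isT) ? /(_ isT) ? /(_ isT) ?; lra.
Qed.

Lemma pigeonhole4 (z1 z2 z3 z4 : Cplx R) (k : R) :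
  4 * k <= cmod (z1 + z2 + (z3 + z4)) ->
  [\/ k <= cmod z1, k <= cmod z2, k <= cmod z3 | k <= cmod z4].
Proof.
move=> h; case: (lerP k (cmod z1)) => h1; first by constructor.
case: (lerP k (cmod z2)) => h2; first by constructor.
case: (lerP k (cmod z3)) => h3; first by constructor.
case: (lerP k (cmod z4)) => h4; first by constructor.
have := le_trans h (cmodD _ _); have := cmodD z1 z2; have := cmodD z3 z4; lra.
Qed.

(** Goursat's lemma: boxes are bisected, keeping each time a quarter carrying
    at least a quarter of the boundary integral; at the common point of the
    nested boxes differentiability bounds that integral by a vanishing fraction
    of the area. *)
Theorem goursat (a w c h : R) : 0 <= w -> 0 <= h ->
  (forall x y, a <= x <= a + w -> c <= y <= c + h -> exists l, planar_cderiv x y l) ->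
  box a w c h = 0.
Proof.
move=> w0 h0 dF; apply: cmod_eq0; apply/le_anti; rewrite cmod_ge0 andbT.
set k := cmod (box a w c h).
pose s n : R := (2 ^+ n)^-1.
have s0 n : 0 < s n by rewrite invr_gt0 exprn_gt0.
have sS n : s n.+1 + s n.+1 = s n.
  by rewrite /s exprS invfM; have := s0 n; rewrite /s => ?; field; rewrite expf_neq0.
pose good n (p : R * R) := k * s n ^+ 2 <= cmod (box p.1 (w * s n) p.2 (h * s n)).
have step (np : nat * (R * R)) : exists p' : R * R,
    (good np.1 np.2 -> good np.1.+1 p') /\
    (np.2.1 <= p'.1 <= np.2.1 + w * s np.1.+1) /\
    (np.2.2 <= p'.2 <= np.2.2 + h * s np.1.+1).
  case: np => n [x y] /=; rewrite /good /=.
  have ws : 0 <= w * s n.+1 by rewrite mulr_ge0// ltW.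
  have hs : 0 <= h * s n.+1 by rewrite mulr_ge0// ltW.
  case: (pselect (k * s n ^+ 2 <= cmod (box x (w * s n) y (h * s n)))); last first.
    by move=> ng; exists (x, y); split => //=; rewrite !lexx !lerDl ws hs.
  rewrite -[in w * _](sS n) -[in h * _](sS n) !mulrDr box_quarter// => hg.
  have {}hg : 4 * (k * s n.+1 ^+ 2) <= cmod (box x (w * s n.+1) y (h * s n.+1) +
    box (x + w * s n.+1) (w * s n.+1) y (h * s n.+1) +
    (box x (w * s n.+1) (y + h * s n.+1) (h * s n.+1) +
     box (x + w * s n.+1) (w * s n.+1) (y + h * s n.+1) (h * s n.+1))).
    by apply: le_trans hg; rewrite le_eqVlt -(sS n); apply/orP; left; apply/eqP; ring.
  have [] := pigeonhole4 hg => hq.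
  - by exists (x, y); split => //=; split; apply/andP; split; lra.
  - by exists (x + w * s n.+1, y); split => //=; split; apply/andP; split; lra.
  - by exists (x, y + h * s n.+1); split => //=; split; apply/andP; split; lra.
  - by exists (x + w * s n.+1, y + h * s n.+1); split => //=; split; apply/andP; split; lra.
have [nxt hnxt] := choice step.
pose p := fix p n := if n is m.+1 then nxt (m, p m) else (a, c).
have pgood n : good n (p n).
  elim: n => [|n IH]; last by have [+ _] := hnxt (n, p n); apply.
  by rewrite /good /s /= expr0 invr1 expr1n !mulr1.
have [x hx] : exists x, forall n, (p n).1 <= x <= (p n).1 + w * s n.
  have px n : (p n).1 <= (p n.+1).1 <= (p n).1 + w * s n.+1.
    by have [_ []] := hnxt (n, p n).
  have nd : nondecreasing_seq (fun n => (p n).1).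
    by apply/nondecreasing_seqP => n; case/andP: (px n).
  have ni : nonincreasing_seq (fun n => (p n).1 + w * s n).
    apply/nonincreasing_seqP => n; case/andP: (px n) => _ h1.
    by rewrite -(sS n) mulrDr addrA lerD2r.
  have le1 m n : (p n).1 <= (p m).1 + w * s m.
    have ws j : 0 <= w * s j by rewrite mulr_ge0// ltW.
    apply: le_trans (nd _ _ (leq_maxr m n)) _.
    by apply: le_trans (ni _ _ (leq_maxl m n)); rewrite lerDl.
  have cv : cvgn (fun n => (p n).1).
    by apply: nondecreasing_is_cvgn => //; exists (a + w * s 0%N) => _ [n _ <-]; exact: (le1 0%N n).
  exists (limn (fun n => (p n).1)) => n; apply/andP; split.
    exact: nondecreasing_cvgn_le.
  by apply: limr_le => //; near=> m; exact: le1.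
have [y hy] : exists y, forall n, (p n).2 <= y <= (p n).2 + h * s n.
  have py n : (p n).2 <= (p n.+1).2 <= (p n).2 + h * s n.+1.
    by have [_ []] := hnxt (n, p n).
  have nd : nondecreasing_seq (fun n => (p n).2).
    by apply/nondecreasing_seqP => n; case/andP: (py n).
  have ni : nonincreasing_seq (fun n => (p n).2 + h * s n).
    apply/nonincreasing_seqP => n; case/andP: (py n) => _ h1.
    by rewrite -(sS n) mulrDr addrA lerD2r.
  have le1 m n : (p n).2 <= (p m).2 + h * s m.
    have hs j : 0 <= h * s j by rewrite mulr_ge0// ltW.
    apply: le_trans (nd _ _ (leq_maxr m n)) _.
    by apply: le_trans (ni _ _ (leq_maxl m n)); rewrite lerDl.
  have cv : cvgn (fun n => (p n).2).
    by apply: nondecreasing_is_cvgn => //; exists (c + h * s 0%N) => _ [n _ <-]; exact: (le1 0%N n).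
  exists (limn (fun n => (p n).2)) => n; apply/andP; split.
    exact: nondecreasing_cvgn_le.
  by apply: limr_le => //; near=> m; exact: le1.
have [l hl] : exists l, planar_cderiv x y l.
  by apply: dF; [have := hx 0%N|have := hy 0%N]; rewrite /s /= expr0 invr1 mulr1.
apply/ler_addgt0Pr => e e0; rewrite add0r.
pose e' := e / (2 * (w + h) ^+ 2 + 1).
have wh2 : 0 <= 2 * (w + h) ^+ 2 by rewrite mulr_ge0// sqr_ge0.
have e'0 : 0 < e' by rewrite divr_gt0// ltr_wpDl.
have [d d0 hd] := hl _ e'0.
have [n sn] : exists n, (w + h) * s n < d.
  have cv : (fun n => (w + h) * s n) @ \oo --> (0 : R).
    rewrite -[0](mulr0 (w + h)); apply: cvgM; first exact: cvg_cst.
    rewrite (_ : s = GRing.exp (2^-1)); last by apply/funext => j; rewrite /s exprVn.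
    by apply: cvg_expr; rewrite ger0_norm ?invr_ge0// invf_lt1 ?ltr1n.
  have [N hN] := real_series_cvg cv d0; exists N.
  by have := hN _ (leqnn N); rewrite subr0 => /(le_lt_trans (ler_norm _)).
have ws : 0 <= w * s n by rewrite mulr_ge0// ltW.
have hs : 0 <= h * s n by rewrite mulr_ge0// ltW.
have := pgood n; rewrite /good => hk.
have : cmod (box (p n).1 (w * s n) (p n).2 (h * s n)) <=
    2 * (e' * ((w + h) * s n)) * (w * s n + h * s n).
  apply: (box_affine (x := x) (y := y) (l := l)) => // x' y' hx' hy'.
  have dx : `|x' - x| <= w * s n.
    by rewrite ler_norml; have := hx n; case/andP: hx' => ? ? /andP[? ?]; apply/andP; split; lra.
  have dy : `|y' - y| <= h * s n.
    by rewrite ler_norml; have := hy n; case/andP: hy' => ? ? /andP[? ?]; apply/andP; split; lra.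
  rewrite mulrDl in sn.
  apply: le_trans (hd _ _ _ _) _; [by lra|by lra|].
  by rewrite ler_pM2l// mulrDl lerD.
move/(le_trans hk); have -> : 2 * (e' * ((w + h) * s n)) * (w * s n + h * s n) =
  (2 * (w + h) ^+ 2 * e') * s n ^+ 2 by ring.
rewrite ler_pM2r ?exprn_gt0// => /le_trans; apply.
by rewrite /e' mulrCA ler_piMr ?(ltW e0)// ler_pdivrMr ?ltr_wpDl// mul1r lerDl.
Unshelve. all: by end_near. Qed.

End Goursat.

(** * Integrals over circles *)

Section Circle.
Context {R : realType}.
Implicit Types (r t : R) (f k : Cplx R -> Cplx R).

Definition circ r t : Cplx R := r%:C * (cos t +i* sin t).

Lemma circE r t : circ r t = (r * cos t) +i* (r * sin t).
Proof. by apply: eqC; rewrite /circ ?ReM ?ImM /= !mul0r ?subr0 ?addr0. Qed.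

Lemma cmod_circ r t : 0 <= r -> cmod (circ r t) = r.
Proof.
move=> r0; rewrite circE cmodE !exprMn -mulrDr cos2Dsin2 mulr1 sqrtr_sqr.
by rewrite ger0_norm.
Qed.

Lemma circ_neq0 r t : 0 < r -> circ r t != 0.
Proof.
move=> r0; apply/eqP => h; have := cmod_circ t (ltW r0).
by rewrite h cmod0 => r00; rewrite -r00 ltxx in r0.
Qed.

Lemma circM r s t u : circ r t * circ s u = circ (r * s) (t + u).
Proof.
rewrite !circE cosD sinD; apply: eqC; rewrite ?ReM ?ImM /=; ring.
Qed.

Lemma circX r t n : circ r t ^+ n = circ (r ^+ n) (n%:R * t).
Proof.
elim: n => [|n IH]; last by rewrite exprS IH circM -exprS -natr1 mulrDl mul1r addrC.
by rewrite !expr0 mul0r circE cos0 sin0 mulr1 mulr0.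
Qed.

Lemma circ10 : circ 1 0 = 1.
Proof. by rewrite circE cos0 sin0 mulr1 mulr0. Qed.

Lemma circV r t : (circ r t)^-1 = circ r^-1 (- t).
Proof.
have [->|r0] := eqVneq r 0; first by rewrite /circ invr0 !mul0r invr0.
have h : circ r t * circ r^-1 (- t) = 1 by rewrite circM divff// subrr circ10.
have c0 : circ r t != 0.
  by apply/eqP => c0; move: h; rewrite c0 mul0r => /eqP; rewrite eq_sym oner_eq0.
by apply: (mulfI c0); rewrite h divff.
Qed.

Lemma circ_2pi r : circ r (pi *+ 2) = circ r 0.
Proof. by rewrite !circE cos2pi sin2pi cos0 sin0. Qed.

Lemma circ_scale r s t : s%:C * circ r t = circ (s * r) t.
Proof. by rewrite /circ mulrA -rmorphM. Qed.

Lemma continuous_circ2 (T : topologicalType) (u v : T -> R) x :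
  {for x, continuous u} -> {for x, continuous v} ->
  {for x, continuous (fun y => circ (u y) (v y))}.
Proof.
move=> cu cv; rewrite (_ : (fun y => _) =
  (fun y => (u y * cos (v y)) +i* (u y * sin (v y)))); last by apply/funext => y; rewrite circE.
have cc : {for x, continuous (fun y => cos (v y))} by exact: (continuous_comp cv (@continuous_cos R _)).
have cs : {for x, continuous (fun y => sin (v y))} by exact: (continuous_comp cv (@continuous_sin R _)).
by apply: continuous_Cplx; apply: cvgM.
Qed.

Lemma continuous_circ r : continuous (circ r).
Proof. by move=> t; apply: continuous_circ2; [exact: cvg_cst|exact: cvg_id]. Qed.

Lemma deriv_approx (f : R -> R) x (l : R) : is_derive x (1 : R) f l ->
  forall e, 0 < e -> exists2 d, 0 < d & forall y, `|y| < d ->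
    `|f (y + x) - f x - l * y| <= e * `|y|.
Proof.
move=> [df dv] e e0.
have := df; rewrite /derivable -/('D_1 f x) => h.
have : (fun h : R => h^-1 *: (f (h *: (1 : R) + x) - f x)) @ 0^' --> l.
  by rewrite -dv; exact: df.
move=> /cvgrPdist_lt /(_ _ e0) /nbhs_ballP[d /= d0 hd].
exists d => // y yd; have [->|y0] := eqVneq y 0.
  by rewrite add0r subrr mulr0 subr0 normr0 mulr0.
have := hd y; rewrite -ball_normE /= sub0r normrN => /(_ yd y0).
rewrite /GRing.scale /= mulr1 distrC => hy.
have -> : f (y + x) - f x - l * y = y * (y^-1 * (f (y + x) - f x) - l).
  by rewrite mulrBr mulVKf// (mulrC l).
by rewrite normrM mulrC ler_wpM2r// ltW.
Qed.

(** [circ (expR x) y] is the exponential of [x + i y]: logarithmic coordinates of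
    the punctured disc, in which circles become segments. *)
Lemma planar_cderiv_exp (x y : R) :
  planar_cderiv (fun x y => circ (expR x) y) x y (circ (expR x) y).
Proof.
move=> e e0; set E := circ (expR x) y.
have cE : 0 <= cmod E := cmod_ge0 E.
pose e1 := Num.min 1 (e / (7 * (cmod E + 1))).
have e10 : 0 < e1 by rewrite lt_min ltr01 divr_gt0//; lra.
have e11 : e1 <= 1 by rewrite ge_min lexx.
have e1e : e1 * (7 * (cmod E + 1)) <= e.
  by rewrite -ler_pdivlMr ?ge_min ?lexx ?orbT//; lra.
clearbody e1.
have [d1 d10 h1] := deriv_approx (is_derive_expR 0) e10.
have [d2 d20 h2] := deriv_approx (is_derive_cos 0) e10.
have [d3 d30 h3] := deriv_approx (is_derive_sin 0) e10.
exists (Num.min e1 (Num.min d1 (Num.min d2 d3))) => [|x' y'].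
  by rewrite !lt_min e10 d10 d20 d30.
rewrite !lt_min; set s := x' - x; set t := y' - y.
move=> /andP[s1 /andP[s2 _]] /andP[t1 /andP[_ /andP[t2 t3]]].
have -> : circ (expR x') y' = E * circ (expR s) t.
  by rewrite /E circM -expRD /s /t !(addrC _ (_ - _)) !subrK.
have -> : E * circ (expR s) t - E - E * (s +i* t) = E * (circ (expR s) t - 1 - s +i* t).
  by ring.
rewrite cmodM; have st : 0 <= `|s| + `|t| by rewrite addr_ge0.
apply: (@le_trans _ _ (cmod E * (7 * e1 * (`|s| + `|t|)))); last first.
  rewrite mulrA ler_wpM2r//; apply: le_trans e1e.
  by rewrite (mulrC _ (7 * e1)) -mulrA (mulrCA 7) mulrA -!mulrA ler_wpM2l ?(ltW e10)//; lra.
rewrite ler_wpM2l//.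
have {h1} := h1 s s2; have {h2} := h2 t t2; have {h3} := h3 t t3.
rewrite !addr0 cos0 sin0 expR0 oppr0 mul0r !subr0 !mul1r ?addr0 => h3 h2 h1.
apply: le_trans (cmod_ReIm _) _; rewrite circE /=.
have c1 := cos_max t.
have hRe : `|expR s * cos t - 1 - s| <= e1 * `|s| + 2 * (e1 * `|t|).
  have -> : expR s * cos t - 1 - s = (expR s - 1 - s) * cos t + (1 + s) * (cos t - 1) by ring.
  apply: le_trans (ler_normD _ _) _; rewrite !normrM lerD//.
    by apply: le_trans h1; rewrite ler_piMr.
  rewrite ler_pM//; apply: le_trans (ler_normD _ _) _; rewrite normr1; lra.
have es : `|expR s - 1| <= 2 * `|s|.
  have -> : expR s - 1 = (expR s - 1 - s) + s by ring.
  apply: le_trans (ler_normD _ _) _; have : e1 * `|s| <= 1 * `|s| by rewrite ler_wpM2r.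
  lra.
have hIm : `|expR s * sin t - t| <= 5 * (e1 * `|t|).
  have -> : expR s * sin t - t = (1 + (expR s - 1)) * (sin t - t) + (expR s - 1) * t by ring.
  apply: le_trans (ler_normD _ _) _; rewrite !normrM.
  have : `|1 + (expR s - 1)| <= 3.
    apply: le_trans (ler_normD _ _) _; rewrite normr1; lra.
  move=> h4; have := ler_pM (normr_ge0 _) (normr_ge0 _) h4 h3.
  have : `|expR s - 1| * `|t| <= 2 * e1 * `|t| by rewrite ler_wpM2r//; lra.
  lra.
have es0 : 0 <= e1 * `|s| by rewrite mulr_ge0// ltW.
rewrite ?subr0 ?oppr0 ?addr0; move: hRe hIm; rewrite mulrDr.
have : 0 <= e1 * `|t| by rewrite mulr_ge0// ltW.
lra.
Qed.

Lemma planar_cderiv_comp (E : R -> R -> Cplx R) k x y (m l : Cplx R) :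
  planar_cderiv E x y m -> is_cderiv k (E x y) l ->
  planar_cderiv (fun x y => k (E x y)) x y (l * m).
Proof.
move=> hE hk e e0.
have m0 := cmod_ge0 m; have l0 := cmod_ge0 l.
pose L := cmod m + 1.
have L0 : 0 < L by rewrite /L; lra.
have e1 : 0 < e / (2 * L) by rewrite divr_gt0// mulr_gt0.
pose e2 := Num.min 1 (e / (2 * (cmod l + 1))).
have e20 : 0 < e2 by rewrite lt_min ltr01 divr_gt0//; lra.
have e21 : e2 <= 1 by rewrite ge_min lexx.
have e2l : cmod l * e2 <= e / 2.
  apply: (@le_trans _ _ ((cmod l + 1) * (e / (2 * (cmod l + 1))))).
    by rewrite ler_pM ?(ltW e20)// ?ge_min ?lexx ?orbT//; lra.
  rewrite le_eqVlt; apply/orP; left; apply/eqP; field.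
  by rewrite gt_eqF//; lra.
clearbody e2.
have [d1 d10 h1] := hk _ e1; have [d2 d20 h2] := hE _ e20.
exists (Num.min d2 (d1 / (2 * L))) => [|x' y'].
  by rewrite lt_min d20 divr_gt0// mulr_gt0.
rewrite !lt_min => /andP[s1 s2] /andP[t1 t2].
have := h2 x' y' s1 t1; set s := x' - x in s1 s2 *; set t := y' - y in t1 t2 *.
set w := s +i* t => hE'.
have sw : cmod w <= `|s| + `|t| by exact: cmod_ReIm.
have st : 0 <= `|s| + `|t| by rewrite addr_ge0.
have hd : cmod (E x' y' - E x y) <= L * (`|s| + `|t|).
  have -> : E x' y' - E x y = (E x' y' - E x y - m * w) + m * w by rewrite subrK.
  apply: le_trans (cmodD _ _) _; rewrite cmodM /L mulrDl mul1r addrC lerD//.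
    by rewrite ler_wpM2l.
  by apply: le_trans hE' _; rewrite ler_piMl.
have hd1 : cmod (E x' y' - E x y) < d1.
  apply: le_lt_trans hd _; rewrite mulrC -ltr_pdivlMr//.
  have -> : d1 / L = d1 / (2 * L) + d1 / (2 * L) by field; rewrite gt_eqF.
  exact: ltrD.
have -> : k (E x' y') - k (E x y) - l * m * w =
  (k (E x' y') - k (E x y) - l * (E x' y' - E x y)) + l * (E x' y' - E x y - m * w).
  by ring.
apply: le_trans (cmodD _ _) _; rewrite cmodM [e in leRHS](splitr e) mulrDl lerD//.
  apply: le_trans (h1 _ hd1) _; apply: le_trans (ler_wpM2l (ltW e1) hd) _.
  by rewrite mulrA le_eqVlt; apply/orP; left; apply/eqP; congr (_ * _); field; rewrite gt_eqF.
apply: le_trans (ler_wpM2l l0 hE') _; rewrite mulrA ler_wpM2r//.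
Qed.

Lemma planar_cderiv_local (F G : R -> R -> Cplx R) x y l (c : R) : x < c ->
  (forall x' y', x' < c -> F x' y' = G x' y') ->
  planar_cderiv F x y l -> planar_cderiv G x y l.
Proof.
move=> xc FG h e e0; have [d d0 hd] := h e e0.
exists (Num.min d (c - x)) => [|x' y']; first by rewrite lt_min d0 subr_gt0.
rewrite !lt_min => /andP[s1 s2] /andP[t1 _].
rewrite -!FG//; first exact: hd.
by move: s2; rewrite ltr_norml => /andP[_]; lra.
Qed.

Definition disc_cont k := forall z, cmod z < 1 -> {for z, continuous k}.

Definition cperiod (u : R -> Cplx R) : Cplx R := cint 0 (pi *+ 2) u.

Lemma pi2_ge0 : 0 <= (pi : R) *+ 2.
Proof. by rewrite mulrn_wge0// pi_ge0. Qed.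

Lemma cont_circ k r : disc_cont k -> 0 <= r < 1 -> continuous (fun t => k (circ r t)).
Proof.
move=> ck /andP[r0 r1] t.
apply: (continuous_comp (@continuous_circ r t)); apply: ck.
by rewrite cmod_circ.
Qed.

(** Cauchy's theorem for an annulus, via [goursat] in logarithmic coordinates,
    where the two radial sides of the box cancel by periodicity; the integrand
    is [k] with respect to [dt], that is, the form [k dz / (i z)]. *)
Lemma circle_integral_cst k (r1 r2 : R) : 0 < r1 -> r1 <= r2 -> r2 < 1 ->
  disc_cont k -> (forall z, r1 <= cmod z <= r2 -> exists l, is_cderiv k z l) ->
  cperiod (fun t => k (circ r1 t)) = cperiod (fun t => k (circ r2 t)).
Proof.
move=> r10 r12 r21 ck dk; have r20 : 0 < r2 := lt_le_trans r10 r12.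
have lr : ln r1 <= ln r2 by rewrite ler_ln.
have lr2 : ln r2 < 0 by rewrite ln_lt0// r20.
pose c := ln r2 / 2.
have c0 : c < 0 by rewrite /c; lra.
have lc : ln r2 < c by rewrite /c; lra.
pose F x y := k (circ (expR (Num.min x c)) y).
have eb x : 0 <= expR (Num.min x c) < 1.
  by rewrite expR_ge0 expR_lt1 /= (le_lt_trans _ c0)// ge_min lexx orbT.
have cFy x : continuous (F x) by exact: cont_circ.
have cFx y : continuous (F ^~ y).
  move=> x; apply: (@continuous_comp _ _ _ (fun x => circ (expR (Num.min x c)) y) k).
    apply: continuous_circ2; last exact: cvg_cst.
    apply: (@continuous_comp _ _ _ (fun x => Num.min x c) (@expR R)).
      by apply: continuous_min; [exact: cvg_id|exact: cvg_cst].
    exact: continuous_expR.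
  by apply: ck; rewrite cmod_circ; case/andP: (eb x).
have := @goursat R F cFx cFy (ln r1) (ln r2 - ln r1) 0 (pi *+ 2).
rewrite subr_ge0 => /(_ lr pi2_ge0); rewrite /box !add0r.
have -> : ln r1 + (ln r2 - ln r1) = ln r2 by rewrite addrC subrK.
have -> : F ^~ (pi *+ 2) = F ^~ 0 by apply/funext => x; rewrite /F circ_2pi.
have F1 : F (ln r1) = fun t => k (circ r1 t).
  by apply/funext => t; rewrite /F min_l ?lnK//; exact: ltW (le_lt_trans lr lc).
have F2 : F (ln r2) = fun t => k (circ r2 t).
  by apply/funext => t; rewrite /F min_l ?lnK//; exact: ltW.
rewrite F1 F2 subrr add0r => /(_ _)/wrap[|/eqP].
  move=> x y /andP[x1 x2] _.
  have [|l hl] := dk (circ (expR x) y).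
    by rewrite cmod_circ ?expR_ge0// -(lnK r10) -(lnK r20) !ler_expR x1.
  exists (l * circ (expR x) y).
  apply: (planar_cderiv_local (c := c)) (planar_cderiv_comp (planar_cderiv_exp x y) hl).
    exact: le_lt_trans lc.
  by move=> x' y' xc; rewrite /F min_l// ltW.
rewrite mulf_eq0 => /orP[|]; last by rewrite subr_eq0 => /eqP.
by rewrite eq_complex /= oner_eq0 andbF.
Qed.

(** The circle being compact, continuity of [k] is uniform along it. *)
Lemma cperiod_continuous k (r0 : R) : disc_cont k -> 0 <= r0 < 1 ->
  forall e : R, 0 < e -> exists2 d : R, 0 < d & forall r, 0 <= r < 1 -> `|r - r0| < d ->
    cmod (cperiod (fun t => k (circ r t)) - cperiod (fun t => k (circ r0 t))) <= e.
Proof.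
move=> ck r01 e e0.
pose e' := e / (pi *+ 2 + 1).
have p0 : 0 < (pi : R) *+ 2 + 1 by rewrite ltr_wpDl// pi2_ge0.
have e'0 : 0 < e' by rewrite divr_gt0.
have e'2 : 0 < e' / 2 by rewrite divr_gt0.
have /compact_near_coveringP cov : compact (`[0, (pi : R) *+ 2] : set R) by exact: segment_compact.
have : \forall r \near r0, `[0, (pi : R) *+ 2]%classic `<=`
    (fun t => cmod (k (circ r t) - k (circ r0 t)) < e').
  apply: (cov R (nbhs r0) (fun r t => cmod (k (circ r t) - k (circ r0 t)) < e') (nbhs_filter r0)).
  move=> t _.
  have c1 : {for (t, r0), continuous (fun p : R * R => k (circ p.2 p.1))}.
    apply: (@continuous_comp _ _ _ (fun p : R * R => circ p.2 p.1) k).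
      by apply: continuous_circ2; [exact: cvg_snd|exact: cvg_fst].
    by apply: ck; rewrite cmod_circ; case/andP: r01.
  have n1 : \forall p \near filter_prod (nbhs t) (nbhs r0),
      cmod (k (circ r0 t) - k (circ p.2 p.1)) < e' / 2.
    by move/cvg_cmodP : c1 => /(_ _ e'2).
  have n2 : \forall t' \near t, cmod (k (circ r0 t) - k (circ r0 t')) < e' / 2.
    by move/cvg_cmodP : (@cont_circ k r0 ck r01 t) => /(_ _ e'2).
  have n2' : \forall p \near filter_prod (nbhs t) (nbhs r0),
      cmod (k (circ r0 t) - k (circ r0 p.1)) < e' / 2.
    exact: (@cvg_fst _ _ (nbhs t) (nbhs r0) (nbhs_filter r0) _ n2).
  suff : \forall p \near filter_prod (nbhs t) (nbhs r0),
    cmod (k (circ p.2 p.1) - k (circ r0 p.1)) < e' by [].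
  apply: filterS2 n1 n2' => p h1 h2.
  rewrite [e'](splitr e'); apply: le_lt_trans (cmod_tri (k (circ r0 t)) _ _) _.
  by rewrite ltrD// cmodB.
move=> /nbhs_ballP[d /= d0 hd]; exists d => // r hr rd.
rewrite -cintB; [|exact: cont_circ|exact: cont_circ].
apply: (@le_trans _ _ (e' * (pi *+ 2 - 0))).
  apply: cint_norm_le; first exact: pi2_ge0.
    exact: (cont_subC (cont_circ ck hr) (cont_circ ck r01)).
  move=> t ht; apply/ltW; apply: (hd r) => /=; last by rewrite in_itv.
  by rewrite -ball_normE /= distrC.
rewrite subr0 /e' mulrAC ler_pdivrMr// ler_wpM2l ?(ltW e0)//.
by rewrite lerDl.
Qed.

(** An exceptional point [a] is harmless: the circular integral vanishes at
    radius zero, is constant on either side of [cmod a], and is continuous. *)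
Lemma circle_integral_eq0 k (a : Cplx R) : disc_cont k -> k 0 = 0 ->
  (forall z, cmod z < 1 -> z != a -> exists l, is_cderiv k z l) ->
  forall r, 0 <= r < 1 -> cperiod (fun t => k (circ r t)) = 0.
Proof.
move=> ck k0 dk; set Psi := fun r => cperiod (fun t => k (circ r t)).
have step s u : 0 <= s -> Psi s = 0 -> u < 1 -> (u <= cmod a \/ cmod a <= s) ->
    forall r, s < r < u -> Psi r = 0.
  move=> s0 Ps u1 ua r /andP[sr ru].
  have s1 : 0 <= s < 1 by rewrite s0 (lt_trans sr)// (lt_trans ru).
  apply: cmod_eq0; apply/le_anti; rewrite cmod_ge0 andbT; apply/ler_addgt0Pr => e e0.
  have [d d0 hd] := cperiod_continuous ck s1 e0.
  pose x := Num.min r (s + d / 2).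
  have sx : s < x by rewrite lt_min sr ltrDl divr_gt0.
  have xr : x <= r by rewrite ge_min lexx.
  have xd : `|x - s| < d.
    rewrite ger0_norm ?subr_ge0 1?ltW// ltrBlDl.
    by apply: (@le_lt_trans _ _ (s + d / 2)); [rewrite ge_min lexx orbT|lra].
  have -> : Psi r = Psi x.
    symmetry; apply: circle_integral_cst => //.
    - exact: le_lt_trans sx.
    - exact: lt_trans u1.
    - move=> z /andP[z1 z2]; apply: dk; first by rewrite (le_lt_trans z2)// (lt_trans ru).
      apply/eqP => za; rewrite za in z1 z2.
      have h1 := lt_le_trans sx z1; have h2 := le_lt_trans z2 ru.
      by case: ua => /le_lt_trans h; [have := h _ h2|have := h _ h1]; rewrite ltxx.
  rewrite add0r -[Psi x]subr0 -Ps; apply: hd => //.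
  by rewrite (le_trans s0 (ltW sx))/= (le_lt_trans xr)// (lt_trans ru).
have Psi0 : Psi 0 = 0.
  rewrite /Psi (_ : (fun t => _) = (fun=> 0)); last first.
    by apply/funext => t; rewrite /circ mul0r k0.
  by rewrite /cperiod cint_cst ?mul0r// pi2_ge0.
have a0 := cmod_ge0 a.
have Psia r : 0 <= r < 1 -> r <= cmod a -> Psi r = 0.
  move=> r01 ra; have [->//|r0] := eqVneq r 0.
  have {r0} r0 : 0 < r by rewrite lt_neqAle eq_sym r0; case/andP: r01.
  apply: cmod_eq0; apply/le_anti; rewrite cmod_ge0 andbT; apply/ler_addgt0Pr => e e0.
  have [d d0 hd] := cperiod_continuous ck r01 e0.
  pose x := Num.max (r / 2) (r - d / 2).
  have xr : x < r by rewrite gt_max; apply/andP; split; lra.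
  have x0 : 0 < x by rewrite lt_max; apply/orP; left; lra.
  have xd : `|x - r| < d.
    rewrite ler0_norm ?opprB ?subr_le0 1?ltW// ltrBlDl -ltrBlDr.
    by apply: (@lt_le_trans _ _ (r - d / 2)); [lra|rewrite le_max lexx orbT].
  have Px : Psi x = 0.
    apply: (step 0 r) => //; [by case/andP: r01|by left|by rewrite x0].
  rewrite add0r -(subr0 (Psi r)) -Px cmodB; apply: hd => //.
  by rewrite (ltW x0) (lt_trans xr)//; case/andP: r01.
move=> r r01; case: (leP r (cmod a)) => ra; first exact: Psia.
have {r01} /andP[r0 r1] := r01.
apply: (step (cmod a) ((1 + r) / 2)) => //; [|lra|by right|by apply/andP; split; lra].
by apply: Psia => //; rewrite a0 (lt_trans ra).
Qed.

End Circle.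

(** * Cauchy's formula and Taylor expansions *)

Section CauchyFormula.
Context {R : realType}.
Implicit Types (f g h : Cplx R -> Cplx R) (u v : R -> Cplx R) (r s t : R) (a z w : Cplx R).

Lemma is_cderiv_cont f z l : is_cderiv f z l -> {for z, continuous f}.
Proof.
move=> df; apply/(@cvg_cmodP R (Cplx R) (nbhs z) (nbhs_filter z)) => e e0.
have [d d0 hd] := df 1 ltr01; have l0 := cmod_ge0 l.
apply/nbhs_cmodP; exists (Num.min d (e / (cmod l + 1))) => [|w].
  by rewrite lt_min d0 divr_gt0//; lra.
rewrite lt_min => /andP[wd we]; rewrite cmodB.
have -> : f w - f z = (f w - f z - l * (w - z)) + l * (w - z) by rewrite subrK.
apply: le_lt_trans (cmodD _ _) _; rewrite cmodM.
apply: (@le_lt_trans _ _ ((cmod l + 1) * cmod (w - z))).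
  by rewrite mulrDl addrC lerD// hd.
by rewrite mulrC -ltr_pdivlMr//; lra.
Qed.

Lemma is_cderiv_cst (c : Cplx R) z : is_cderiv (fun=> c) z 0.
Proof.
move=> e e0; exists 1 => // w _; rewrite subrr mul0r subr0 cmod0.
by rewrite mulr_ge0 ?cmod_ge0// ltW.
Qed.

Lemma is_cderiv_id z : is_cderiv id z 1.
Proof.
move=> e e0; exists 1 => // w _; rewrite mul1r subrr cmod0.
by rewrite mulr_ge0 ?cmod_ge0// ltW.
Qed.

Lemma is_cderiv_lin (c : Cplx R) f g z l m : is_cderiv f z l -> is_cderiv g z m ->
  is_cderiv (fun w => c * f w + g w) z (c * l + m).
Proof.
move=> hf hg e e0; have c0 := cmod_ge0 c.
have e1 : 0 < e / (2 * (cmod c + 1)) by rewrite divr_gt0//; lra.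
have e2 : 0 < e / 2 by rewrite divr_gt0.
have [d1 d10 h1] := hf _ e1; have [d2 d20 h2] := hg _ e2.
exists (Num.min d1 d2) => [|w]; first by rewrite lt_min d10.
rewrite lt_min => /andP[w1 w2].
have -> : c * f w + g w - (c * f z + g z) - (c * l + m) * (w - z) =
  c * (f w - f z - l * (w - z)) + (g w - g z - m * (w - z)) by ring.
apply: le_trans (cmodD _ _) _; rewrite cmodM [e in leRHS](splitr e) mulrDl lerD ?h2//.
apply: le_trans (ler_wpM2l c0 (h1 _ w1)) _; rewrite mulrA ler_wpM2r ?cmod_ge0//.
have -> : e / 2 = (cmod c + 1) * (e / (2 * (cmod c + 1))).
  by field; rewrite gt_eqF//; lra.
by rewrite ler_wpM2r ?(ltW e1)//; lra.
Qed.

Lemma is_cderiv_lip f z l : is_cderiv f z l ->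
  exists2 d : R, 0 < d & forall w, cmod (w - z) < d ->
    cmod (f w - f z) <= (cmod l + 1) * cmod (w - z).
Proof.
move=> hf; have [d d0 hd] := hf 1 ltr01; exists d => // w wd.
have -> : f w - f z = (f w - f z - l * (w - z)) + l * (w - z) by rewrite subrK.
apply: le_trans (cmodD _ _) _; rewrite cmodM mulrDl addrC lerD//.
exact: hd.
Qed.

Lemma is_cderivM f g z l m : is_cderiv f z l -> is_cderiv g z m ->
  is_cderiv (fun w => f w * g w) z (l * g z + f z * m).
Proof.
move=> hf hg e e0.
pose G := cmod (g z) + cmod m + 1.
have gz := cmod_ge0 (g z); have m0 := cmod_ge0 m; have l0 := cmod_ge0 l.
have fz := cmod_ge0 (f z).
have G0 : 0 < G by rewrite /G; lra.
have e1 : 0 < e / (3 * G) by rewrite divr_gt0// mulr_gt0.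
have e2 : 0 < e / (3 * (cmod (f z) + 1)) by rewrite divr_gt0//; lra.
have [d1 d10 h1] := hf _ e1; have [d2 d20 h2] := hg _ e2.
have [d3 d30 h3] := is_cderiv_lip hg.
pose d4 := e / (3 * ((cmod l + 1) * (cmod m + 1))).
have d40 : 0 < d4 by rewrite divr_gt0// !mulr_gt0//; lra.
exists (Num.min (Num.min 1 d1) (Num.min d2 (Num.min d3 d4))) => [|w].
  by rewrite !lt_min ltr01 d10 d20 d30 d40.
rewrite !lt_min => /andP[/andP[w0 w1] /andP[w2 /andP[w3 w4]]].
have {h1} := h1 _ w1; have {h2} := h2 _ w2; have {h3} := h3 _ w3.
set d := w - z in w0 w1 w2 w3 w4 *; have dd := cmod_ge0 d => h3 h2 h1.
have -> : f w * g w - f z * g z - (l * g z + f z * m) * d =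
  (f w - f z - l * d) * g w + ((l * d) * (g w - g z) + f z * (g w - g z - m * d)) by ring.
apply: le_trans (cmodD _ _) _; rewrite cmodM.
apply: le_trans (lerD (lexx _) (cmodD _ _)) _; rewrite !cmodM.
have gw : cmod (g w) <= G.
  have -> : g w = g z + (g w - g z) by rewrite addrC subrK.
  apply: le_trans (cmodD _ _) _; rewrite /G -addrA lerD2l.
  by apply: le_trans h3 _; rewrite ler_piMr ?ltW//; lra.
have -> : e * cmod d = e / 3 * cmod d + (e / 3 * cmod d + e / 3 * cmod d) by field.
apply: lerD; last apply: lerD.
- apply: (@le_trans _ _ (e / (3 * G) * cmod d * G)); first by rewrite ler_pM ?cmod_ge0.
  by rewrite le_eqVlt; apply/orP; left; apply/eqP; field; rewrite gt_eqF.
- apply: (@le_trans _ _ ((cmod l + 1) * cmod d * ((cmod m + 1) * d4))).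
    rewrite ler_pM ?mulr_ge0 ?cmod_ge0//; first by rewrite ler_wpM2r//; lra.
    by apply: le_trans h3 _; rewrite ler_wpM2l ?ltW//; lra.
  rewrite le_eqVlt; apply/orP; left; apply/eqP; rewrite /d4; field.
  by rewrite !gt_eqF//; lra.
- apply: (@le_trans _ _ ((cmod (f z) + 1) * (e / (3 * (cmod (f z) + 1)) * cmod d))).
    by rewrite ler_pM ?cmod_ge0//; lra.
  rewrite le_eqVlt; apply/orP; left; apply/eqP; field.
  by rewrite gt_eqF//; lra.
Qed.

Lemma is_cderivV g z m : g z != 0 -> is_cderiv g z m ->
  is_cderiv (fun w => (g w)^-1) z (- m / g z ^+ 2).
Proof.
move=> gz0 hg e e0; have gz : 0 < cmod (g z) by exact: cmod_gt0.
have m0 := cmod_ge0 m; pose c := cmod (g z).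
have e1 : 0 < e * c ^+ 2 / 4 by rewrite divr_gt0// mulr_gt0// exprn_gt0.
have [d1 d10 h1] := hg _ e1; have [d2 d20 h2] := is_cderiv_lip hg.
pose d3 := c / (2 * (cmod m + 1)).
have d30 : 0 < d3 by rewrite divr_gt0//; lra.
pose d4 := e * c ^+ 3 / (4 * ((cmod m + 1) * (cmod m + 1))).
have d40 : 0 < d4.
  by rewrite divr_gt0//; [rewrite mulr_gt0// exprn_gt0|rewrite !mulr_gt0//; lra].
exists (Num.min (Num.min d1 d2) (Num.min d3 d4)) => [|w].
  by rewrite !lt_min d10 d20 d30 d40.
rewrite !lt_min => /andP[/andP[w1 w2] /andP[w3 w4]].
have {h1} := h1 _ w1; have {h2} := h2 _ w2.
set d := w - z in w1 w2 w3 w4 *; have dd := cmod_ge0 d => h2 h1.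
have gw : c / 2 <= cmod (g w).
  have h := cmod_sub (g z) (g w); rewrite cmodB in h.
  have : (cmod m + 1) * cmod d <= c / 2.
    have -> : c / 2 = (cmod m + 1) * d3.
      by rewrite /d3; field; rewrite gt_eqF//; lra.
    by rewrite ler_wpM2l ?(ltW w3)//; lra.
  by rewrite /c in h *; clear -h h2; lra.
have gw0 : g w != 0.
  by apply/eqP => g0; rewrite g0 cmod0 leNgt divr_gt0 in gw.
have -> : (g w)^-1 - (g z)^-1 - - m / g z ^+ 2 * d =
  (- (g w - g z - m * d) * g z + m * d * (g w - g z)) / (g w * g z ^+ 2).
  by field; rewrite gz0 gw0.
rewrite cmodM cmodV cmodM cmodX ler_pdivrMr; last by rewrite mulr_gt0 ?exprn_gt0 ?cmod_gt0.
apply: (@le_trans _ _ (e * cmod d * (c / 2 * c ^+ 2))); last first.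
  by rewrite ler_wpM2l ?mulr_ge0 ?(ltW e0)// ler_wpM2r// exprn_ge0// ltW.
apply: le_trans (cmodD _ _) _; rewrite !cmodM cmodN.
have -> : e * cmod d * (c / 2 * c ^+ 2) =
  e * c ^+ 2 / 4 * cmod d * c + e * c ^+ 3 / 4 * cmod d by field.
apply: lerD; first by rewrite ler_wpM2r ?(ltW gz).
apply: (@le_trans _ _ ((cmod m + 1) * cmod d * ((cmod m + 1) * d4))).
  rewrite ler_pM ?mulr_ge0 ?cmod_ge0//; first by rewrite ler_wpM2r//; lra.
  by apply: le_trans h2 _; rewrite ler_wpM2l ?ltW//; lra.
rewrite le_eqVlt; apply/orP; left; apply/eqP; rewrite /d4; field.
by rewrite gt_eqF//; lra.
Qed.

Lemma contC_mul f g z : {for z, continuous f} -> {for z, continuous g} ->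
  {for z, continuous (fun w => f w * g w)}.
Proof.
move=> /(@cvg_cmodP R (Cplx R) (nbhs z) (nbhs_filter z)) cf.
move=> /(@cvg_cmodP R (Cplx R) (nbhs z) (nbhs_filter z)) cg.
apply/(@cvg_cmodP R (Cplx R) (nbhs z) (nbhs_filter z)) => e e0.
have fz := cmod_ge0 (f z); have gz := cmod_ge0 (g z).
have e1 : 0 < e / (2 * (cmod (g z) + 1)) by rewrite divr_gt0//; lra.
have e2 : 0 < e / (2 * (cmod (f z) + 1)) by rewrite divr_gt0//; lra.
have /nbhs_cmodP[d1 d10 h1] := cf _ e1.
have /nbhs_cmodP[d2 d20 h2] := cg _ e2.
have /nbhs_cmodP[d3 d30 h3] := cg _ ltr01.
apply/nbhs_cmodP; exists (Num.min d1 (Num.min d2 d3)) => [|w].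
  by rewrite !lt_min d10 d20.
rewrite !lt_min => /andP[/h1 w1 /andP[/h2 w2 /h3 w3]].
have -> : f z * g z - f w * g w = (f z - f w) * g w + f z * (g z - g w) by ring.
apply: le_lt_trans (cmodD _ _) _; rewrite !cmodM.
have gw : cmod (g w) <= cmod (g z) + 1.
  have -> : g w = g z - (g z - g w) by rewrite subKr.
  by apply: le_trans (cmodBD _ _) _; rewrite lerD2l ltW.
rewrite [ltRHS](splitr e); apply: ltr_leD.
  apply: (@le_lt_trans _ _ (cmod (f z - f w) * (cmod (g z) + 1))).
    by rewrite ler_wpM2l ?cmod_ge0.
  rewrite -ltr_pdivlMr; last by lra.
  by move: w1; rewrite invfM mulrA.
apply: (@le_trans _ _ ((cmod (f z) + 1) * (e / (2 * (cmod (f z) + 1))))).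
  by rewrite ler_pM ?cmod_ge0 ?(ltW w2)//; lra.
rewrite le_eqVlt; apply/orP; left; apply/eqP; field.
by rewrite gt_eqF//; lra.
Qed.

Lemma Hol_cderiv f z : Hol f -> cmod z < 1 -> is_cderiv f z (derive1 f z).
Proof. by move=> hf z1; apply: cderivable; apply: hf; apply/discE. Qed.

Lemma Hol_cont f : Hol f -> disc_cont f.
Proof. by move=> hf z z1; apply: is_cderiv_cont (Hol_cderiv hf z1). Qed.

Lemma cont_bounded (a b : R) u : continuous u -> exists2 M : R, 0 <= M &
  forall t, a <= t <= b -> cmod (u t) <= M.
Proof.
move=> cu; have [ab|ba] := leP a b; last first.
  by exists 0 => // t /andP[h1 h2]; have := le_trans h1 h2; rewrite leNgt ba.
have cm : {within `[a, b], continuous (fun t => cmod (u t))}.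
  by apply: continuous_subspaceT; exact: cont_cmod.
have [c _ hc] := EVT_max ab cm.
by exists (cmod (u c)) => [|t tab]; [exact: cmod_ge0|apply: hc; rewrite in_itv].
Qed.

Lemma cperiod_sum n (F : nat -> R -> Cplx R) : (forall k, continuous (F k)) ->
  continuous (fun t => \sum_(k < n) F k t) /\
  cperiod (fun t => \sum_(k < n) F k t) = \sum_(k < n) cperiod (F k).
Proof.
move=> cF; elim: n => [|n [IHc IH]].
  rewrite (_ : (fun t => _) = (fun=> 0)); last by apply/funext => t; rewrite big_ord0.
  split; first exact: cont_cstC.
  by rewrite /cperiod cint_cst ?mul0r ?big_ord0// pi2_ge0.
have E : (fun t => \sum_(k < n.+1) F k t) = (fun t => \sum_(k < n) F k t + F n t).
  by apply/funext => t; rewrite big_ord_recr.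
rewrite E; split; first exact: (cont_addC IHc (cF n)).
by rewrite /cperiod (cintD _ _ IHc (cF n)) big_ord_recr /= -IH.
Qed.

Lemma continuous_circV r : 0 < r -> continuous (fun t => (circ r t)^-1).
Proof.
move=> r0; rewrite (_ : (fun t => _) = (fun t => circ r^-1 (- t))).
  move=> t; apply: (@continuous_circ2 _ _ (fun=> r^-1) (fun t => - t) t).
    exact: cvg_cst.
  by apply: cvgN; exact: cvg_id.
by apply/funext => t; rewrite circV.
Qed.

Lemma cont_expC u n : continuous u -> continuous (fun t => u t ^+ n).
Proof.
move=> cu; elim: n => [|n IH].
  rewrite (_ : (fun t => _) = (fun=> 1)); first exact: cont_cstC.
  by apply/funext => t; rewrite expr0.
rewrite (_ : (fun t => _) = (fun t => u t * u t ^+ n)); first exact: cont_mulC.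
by apply/funext => t; rewrite exprS.
Qed.

#[local] Arguments cont_expC [u] n _.

Lemma cont_invC u : continuous u -> (forall t, u t != 0) -> continuous (fun t => (u t)^-1).
Proof. by move=> cu u0 t; apply: cvgV; [exact: u0|exact: cu]. Qed.

(** The geometric series of the Cauchy kernel converges uniformly on the circle. *)
Lemma geo_kernel u a r : continuous u -> 0 < r -> cmod a < r ->
  psum (fun k => cperiod (fun t => u t * (circ r t)^-1 ^+ k)) a @ \oo -->
  cperiod (fun t => u t / (1 - a * (circ r t)^-1)).
Proof.
move=> cu r0 ar; have a0 := cmod_ge0 a.
pose q t := a * (circ r t)^-1.
have cq : continuous q by exact: (cont_mulC (cont_cstC a) (continuous_circV r0)).
pose th := cmod a / r.
have qn t : cmod (q t) = th by rewrite cmodM cmodV cmod_circ// ltW.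
have th1 : th < 1 by rewrite ltr_pdivrMr ?mul1r.
have th0 : 0 <= th by rewrite divr_ge0// ltW.
have q1 t : cmod (1 - q t) >= 1 - th.
  by have := cmod_sub 1 (q t); rewrite cmod1 qn.
have q0 t : 1 - q t != 0.
  apply/eqP => h; have := q1 t; rewrite h cmod0; lra.
have cV : continuous (fun t => (1 - q t)^-1).
  exact: (cont_invC (cont_subC (cont_cstC 1) cq) q0).
have cR : continuous (fun t => u t / (1 - q t)) by exact: (cont_mulC cu cV).
have [M M0 hM] := cont_bounded 0 (pi *+ 2) cR.
apply/cvg_seqP => e e0.
have cv : (fun n => M * (pi *+ 2) * th ^+ n) @ \oo --> (0 : R).
  rewrite -[0](mulr0 (M * (pi *+ 2))); apply: cvgM; first exact: cvg_cst.
  by apply: cvg_expr; rewrite ger0_norm.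
have [N hN] := real_series_cvg cv e0; exists N => n Nn.
have ck k : continuous (fun t => u t * q t ^+ k) by exact: (cont_mulC cu (cont_expC k cq)).
have [cS ES] := cperiod_sum n ck.
have -> : psum (fun k => cperiod (fun t => u t * (circ r t)^-1 ^+ k)) a n =
    cperiod (fun t => \sum_(k < n) u t * q t ^+ k).
  rewrite ES /psum; apply: eq_bigr => k _; rewrite mulrC /cperiod -cintZ; last first.
    exact: (cont_mulC cu (cont_expC k (continuous_circV r0))).
  by congr cint; apply/funext => t; rewrite /q exprMn; ring.
rewrite cmodB /cperiod -(cintB _ _ cR cS).
have Er t : u t / (1 - q t) - \sum_(k < n) u t * q t ^+ k = q t ^+ n * (u t / (1 - q t)).
  rewrite -mulr_sumr; apply: (mulIf (q0 t)); rewrite mulrBl -mulrA mulVf// mulr1.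
  rewrite -!mulrA mulVf// mulr1; have : (\sum_(k < n) q t ^+ k) * (1 - q t) = 1 - q t ^+ n.
    elim: {+}n => [|m IH]; first by rewrite big_ord0 expr0 mul0r subrr.
    by rewrite big_ord_recr /= mulrDl IH exprSr; ring.
  by move=> ->; ring.
rewrite (cint_ext (g := fun t => q t ^+ n * (u t / (1 - q t)))); last by move=> t _; exact: Er.
apply: (@le_lt_trans _ _ (th ^+ n * M * (pi *+ 2 - 0))).
  apply: cint_norm_le; first exact: pi2_ge0.
    exact: (cont_mulC (cont_expC n cq) cR).
  move=> t tt; rewrite cmodM cmodX qn ler_wpM2l ?exprn_ge0//; exact: hM.
have := hN n Nn; rewrite subr0 ger0_norm; last by rewrite !mulr_ge0 ?pi2_ge0 ?exprn_ge0.
by rewrite subr0 (mulrC (th ^+ n)) mulrAC.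
Qed.

Lemma cperiod_circ_exp n : cperiod (fun t => (circ 1 t)^-1 ^+ n.+1) = 0.
Proof.
have n0 : (n.+1%:R : R) != 0 by rewrite pnatr_eq0.
rewrite (_ : (fun t => _) = (fun t => cos (n.+1%:R * t) +i* - sin (n.+1%:R * t))); last first.
  by apply/funext => t; rewrite circV invr1 circX expr1n mulrN circE cosN sinN !mul1r.
have dc (x : R) : is_derive x (1 : R) (fun t => sin (n.+1%:R * t) / n.+1%:R) (cos (n.+1%:R * x)).
  apply: is_derive_eq; rewrite /GRing.scale /= ?mulr0 ?addr0 ?mulr1 ?add0r; field.
  by rewrite nat1r.
have ds (x : R) : is_derive x (1 : R) (fun t => cos (n.+1%:R * t) / n.+1%:R) (- sin (n.+1%:R * x)).
  apply: is_derive_eq; rewrite /GRing.scale /= ?mulr0 ?addr0 ?mulr1 ?add0r; field.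
  by rewrite nat1r.
have cl : continuous (fun t : R => n.+1%:R * t).
  by move=> t; apply: cvgM; [exact: cvg_cst|exact: cvg_id].
have cc : continuous (fun t : R => cos (n.+1%:R * t)).
  by move=> t; exact: (continuous_comp (cl t) (@continuous_cos R _)).
have cs : continuous (fun t : R => - sin (n.+1%:R * t)).
  by apply: cont_oppR => t; exact: (continuous_comp (cl t) (@continuous_sin R _)).
have np : n.+1%:R * (pi *+ 2) = pi *+ 2 *+ n.+1 :> R by rewrite mulr_natl.
rewrite /cperiod /cint /=.
rewrite (rint_FTC pi2_ge0 cc dc) (rint_FTC pi2_ge0 cs ds) np.
have := periodicn (@sinD2pi R) n.+1 0; have := periodicn (@cosD2pi R) n.+1 0.
by rewrite !add0r mulr0 => -> ->; rewrite !subrr.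
Qed.

Definition cmean u : Cplx R := ((pi *+ 2)^-1)%:C * cperiod u.

Lemma pi2_gt0 : 0 < (pi : R) *+ 2.
Proof. by rewrite mulrn_wgt0// pi_gt0. Qed.

(** Only the constant term of the geometric series has a nonzero mean. *)
Lemma cperiod_cauchy_kernel a r : 0 < r -> cmod a < r ->
  cperiod (fun t => 1 / (1 - a * (circ r t)^-1)) = (pi *+ 2)%:C.
Proof.
move=> r0 ar; have h := geo_kernel (cont_cstC 1) r0 ar.
rewrite -(cvg_limC h); apply: cvg_limC; apply/cvg_seqP => e e0; exists 1%N => -[//|n] _.
rewrite /psum big_ord_recl /= expr0 mulr1 big1 ?addr0 => [|i _].
  rewrite (_ : (fun t => _) = (fun=> 1)); last by apply/funext => t; rewrite expr0 mulr1.
  by rewrite /cperiod cint_cst ?pi2_ge0// mul1r subr0 subrr cmod0.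
rewrite /bump /= add1n (_ : (fun t => _) =
   (fun t => (r^-1%:C) ^+ i.+1 * (circ 1 t)^-1 ^+ i.+1)); last first.
  by apply/funext => t; rewrite mul1r -exprMn !circV circ_scale invr1 mulr1.
rewrite /cperiod cintZ; last first.
  by apply: cont_expC; apply: continuous_circV.
by rewrite -/(cperiod _) cperiod_circ_exp mulr0 mul0r.
Qed.

(** Cauchy's integral formula, from [circle_integral_eq0] applied to
    [z * (f z - f a) / (z - a)], whose singularity at [a] is removable. *)
Lemma cauchy_formula f a r : Hol f -> 0 < r < 1 -> cmod a < r ->
  cperiod (fun t => f (circ r t) / (1 - a * (circ r t)^-1)) = f a * (pi *+ 2)%:C.
Proof.
move=> hf /andP[r0 r1] ar; have a1 : cmod a < 1 := lt_trans ar r1.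
pose h z : Cplx R := if z == a then (derive1 f a : Cplx R) else (f z - f a) / (z - a).
pose k z : Cplx R := z * h z.
have hne z : z != a -> h z = (f z - f a) / (z - a) by rewrite /h => /negbTE ->.
have dk z : cmod z < 1 -> z != a -> exists l, is_cderiv k z l.
  move=> z1 za; have za0 : z - a != 0 by rewrite subr_eq0.
  have dsub := is_cderiv_lin 1 (is_cderiv_id z) (is_cderiv_cst (- a) z).
  have dfa := is_cderiv_lin 1 (Hol_cderiv hf z1) (is_cderiv_cst (- f a) z).
  have za1 : 1 * z - a != 0 by rewrite mul1r.
  have hl := is_cderivM (is_cderiv_id z) (is_cderivM dfa (is_cderivV (g := fun w => 1 * w - a) za1 dsub)).
  eexists.
  apply: is_cderiv_ext hl; first exact: (cmod_gt0 za0).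
  move=> w hw; rewrite /k hne ?mul1r//; apply: contraTN hw => /eqP ->.
  by rewrite cmodB ltxx.
have ck : disc_cont k.
  move=> z z1; have [->|za] := eqVneq z a; last first.
    by have [l /is_cderiv_cont] := dk z z1 za.
  suff : {for a, continuous h}.
    by move=> ch; exact: (contC_mul (f := id) (g := h) (is_cderiv_cont (is_cderiv_id a)) ch).
  apply/(@cvg_cmodP R (Cplx R) (nbhs a) (nbhs_filter a)) => e e0.
  have e2 : 0 < e / 2 by rewrite divr_gt0.
  have [d d0 hd] := Hol_cderiv hf a1 e2.
  apply/nbhs_cmodP; exists d => // w wd.
  have [->|wa] := eqVneq w a; first by rewrite subrr cmod0.
  rewrite [h a]/h eqxx (hne w)// cmodB.
  have wa0 : w - a != 0 by rewrite subr_eq0.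
  have -> : (f w - f a) / (w - a) - derive1 f a =
    (f w - f a - derive1 f a * (w - a)) / (w - a).
    by rewrite [RHS]mulrBl mulfK.
  rewrite cmodM cmodV ltr_pdivrMr ?cmod_gt0//.
  apply: le_lt_trans (hd _ wd) _; rewrite ltr_pM2r ?cmod_gt0//.
  by clear -e0; lra.
have r01 : 0 <= r < 1 by rewrite ltW.
have k0 : k 0 = 0 by rewrite /k mul0r.
have := circle_integral_eq0 ck k0 dk r01.
have cq : continuous (fun t => (1 - a * (circ r t)^-1)^-1).
  apply: cont_invC => [|t].
    exact: (cont_subC (cont_cstC 1) (cont_mulC (cont_cstC a) (continuous_circV r0))).
  apply/eqP => h0; have := cmod_sub 1 (a * (circ r t)^-1).
  rewrite h0 cmod0 cmod1 cmodM cmodV cmod_circ ?(ltW r0)// => h1.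
  have : cmod a / r < 1 by rewrite ltr_pdivrMr// mul1r.
  by clear -h1; lra.
have cf := cont_circ (Hol_cont hf) r01.
rewrite (_ : (fun t => _) = (fun t => f (circ r t) / (1 - a * (circ r t)^-1) -
    f a * (1 / (1 - a * (circ r t)^-1)))); last first.
  apply/funext => t; rewrite /k hne; last first.
    by apply: contraTneq ar => <-; rewrite cmod_circ ?(ltW r0)// ltxx.
  have c0 := circ_neq0 t r0.
  have -> : circ r t - a = (1 - a * (circ r t)^-1) * circ r t.
    by rewrite mulrBl mul1r -mulrA mulVf// mulr1.
  rewrite invfM mul1r -mulrBl [LHS]mulrCA; congr (_ * _).
  by rewrite mulrCA divff ?mulr1.
have c1 : continuous (fun t => 1 / (1 - a * (circ r t)^-1)).
  exact: (cont_mulC (cont_cstC 1) cq).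
rewrite /cperiod (cintB _ _ (cont_mulC cf cq) (cont_mulC (cont_cstC (f a)) c1)).
rewrite (cintZ _ _ _ c1) -/(cperiod _) -/(cperiod _) (cperiod_cauchy_kernel r0 ar).
by move/eqP; rewrite subr_eq0 => /eqP.
Qed.

Definition circ_coef f r n : Cplx R := cmean (fun t => f (circ r t) * (circ r t)^-1 ^+ n).

Lemma circ_coef_cvg f a r : Hol f -> 0 < r < 1 -> cmod a < r ->
  psum (circ_coef f r) a @ \oo --> f a.
Proof.
move=> hf r01 ar; have /andP[r0 r1] := r01.
have r01' : 0 <= r < 1 by rewrite ltW.
have h := geo_kernel (cont_circ (Hol_cont hf) r01') r0 ar.
rewrite (cauchy_formula hf r01 ar) in h.
have h2 := cvgCM (@cvgCc R ((pi *+ 2)^-1)%:C) h.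
have p0 : (pi *+ 2 : R) != 0 by rewrite gt_eqF// pi2_gt0.
have E : ((pi *+ 2)^-1)%:C * (f a * (pi *+ 2)%:C) = f a.
  by rewrite mulrCA -rmorphM /= mulVf// mulr1.
rewrite E in h2.
rewrite (_ : psum _ a = (fun n => ((pi *+ 2)^-1)%:C *
  psum (fun k => cperiod (fun t => f (circ r t) * (circ r t)^-1 ^+ k)) a n)); first exact: h2.
by apply/funext => n; rewrite /psum mulr_sumr; apply: eq_bigr => k _; rewrite mulrA.
Qed.

Lemma circ_coef_dilate f r s : Hol f -> 0 < s -> s < r -> r < 1 ->
  has_pseries (fun n => circ_coef f r n * s%:C ^+ n) (fun z => f (s%:C * z)).
Proof.
move=> hf s0 sr r1; apply/has_pseriesP => z z1.
have r01 : 0 < r < 1 by rewrite (lt_trans s0).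
have szr : cmod (s%:C * z) < r.
  rewrite cmodM cmod_real gtr0_norm// (le_lt_trans _ sr)// ler_piMr//; exact: ltW.
have h := circ_coef_cvg hf r01 szr.
rewrite (_ : psum _ z = psum (circ_coef f r) (s%:C * z)) //.
by apply/funext => n; rewrite /psum; apply: eq_bigr => k _; rewrite exprMn mulrA.
Qed.

(** Rescaled to a common smaller circle, both sequences are the coefficients of
    the same power series. *)
Lemma circ_coef_indep f r r' : Hol f -> 0 < r < 1 -> 0 < r' < 1 ->
  circ_coef f r = circ_coef f r'.
Proof.
move=> hf /andP[r0 r1] /andP[r'0 r'1]; pose s := Num.min r r' / 2.
have s0 : 0 < s by rewrite divr_gt0// lt_min r0.
have sr : s < r.
  by apply: (@lt_le_trans _ _ (Num.min r r')); [rewrite /s; move: s0; rewrite /s; lra|rewrite ge_min lexx].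
have sr' : s < r'.
  by apply: (@lt_le_trans _ _ (Num.min r r')); [rewrite /s; move: s0; rewrite /s; lra|rewrite ge_min lexx orbT].
have h1 := taylor_coefE (circ_coef_dilate hf s0 sr r1).
have h2 := taylor_coefE (circ_coef_dilate hf s0 sr' r'1).
apply/funext => n; have := congr1 (fun F => F n) (etrans (esym h1) h2).
have sn : s%:C ^+ n != 0 :> Cplx R.
  by rewrite expf_neq0// eq_complex /= gt_eqF.
by move/(mulIf sn).
Qed.

(** Expanding the Cauchy kernel in Cauchy's formula gives a power series inside
    each circle, whose coefficients do not depend on the circle. *)
Theorem Hol_pseries f : Hol f -> has_pseries (taylor_coef f) f.
Proof.
move=> hf; have h12 : 0 < (2^-1 : R) < 1 by rewrite invr_gt0 ltr0n /= invf_lt1 ?ltr1n.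
have h : has_pseries (circ_coef f 2^-1) f.
  apply/has_pseriesP => z z1; have z0 := cmod_ge0 z.
  pose r := (1 + cmod z) / 2.
  have r01 : 0 < r < 1 by rewrite /r; apply/andP; split; lra.
  have zr : cmod z < r by rewrite /r; lra.
  by rewrite (circ_coef_indep hf h12 r01); exact: circ_coef_cvg.
by rewrite (taylor_coefE h).
Qed.

Lemma taylor_coef_cmean f s n : Hol f -> 0 < s < 1 ->
  taylor_coef f n * s%:C ^+ n = cmean (fun t => f (circ s t) * (circ 1 t)^-1 ^+ n).
Proof.
move=> hf s01; have /andP[s0 s1] := s01.
have h12 : 0 < (2^-1 : R) < 1 by rewrite invr_gt0 ltr0n /= invf_lt1 ?ltr1n.
have h : has_pseries (circ_coef f s) f.
  apply/has_pseriesP => z z1; have z0 := cmod_ge0 z.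
  pose r := (1 + cmod z) / 2.
  have r01 : 0 < r < 1 by rewrite /r; apply/andP; split; lra.
  have zr : cmod z < r by rewrite /r; lra.
  by rewrite (circ_coef_indep hf s01 r01); exact: circ_coef_cvg.
rewrite (taylor_coefE h) mulrC /circ_coef /cmean mulrCA; congr (_ * _).
have s01' : 0 <= s < 1 by rewrite ltW.
rewrite /cperiod -cintZ; last first.
  have c1 := cont_circ (Hol_cont hf) s01'.
  have c2 := cont_expC n (continuous_circV s0).
  exact: (cont_mulC c1 c2).
congr cint; apply/funext => t; rewrite mulrCA; congr (_ * _).
rewrite -exprMn; congr (_ ^+ _); rewrite !circV circ_scale divff ?invr1//.
by rewrite gt_eqF.
Qed.

End CauchyFormula.

(** * Polar coordinates *)

Section AffineChange.
Context {R : realType}.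
Notation mu := (@lebesgue_measure R).

Section Affine.
Variables (a b : R) (a0 : 0 < a).
Let phi (x : R) : measurableTypeR R := a * x + b.

Let mphi : measurable_fun [set: measurableTypeR R] phi.
Proof. by apply: measurable_funD => //; apply: measurable_funM. Qed.

Let pm : {measure set (measurableTypeR R) -> \bar R} :=
  measure_function_pushforward__canonical__measure_function_Measure mu mphi.
Let an : {nonneg R} := NngNum (ltW a0).
Let m := mscale an pm.

Let mE (A : set (measurableTypeR R)) : measurable A -> mu A = m A.
Proof.
move=> mA; apply: lebesgue_measure_unique => //= _ [[c d] _ <-].
rewrite /m /mscale /= /pushforward /=.
rewrite (_ : phi @^-1` `]c, d]%classic = `](c - b) / a, (d - b) / a]%classic); last first.
  apply/seteqP; split => x /=; rewrite !in_itv /= /phi ltr_pdivrMr// ler_pdivlMr//;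
  by rewrite ltrBlDr lerBrDr (mulrC x).
rewrite !lebesgue_measure_itv /= !lte_fin ltr_pM2r ?invr_gt0// ltrD2r.
case: ifPn => _; last by rewrite mule0.
by rewrite -!EFinB -EFinM; congr EFin; field; rewrite gt_eqF.
Qed.

Lemma ge0_integral_affine (G : R -> \bar R) : measurable_fun setT G ->
  (forall x, 0 <= G x)%E ->
  (\int[mu]_x G x = a%:E * \int[mu]_x G (a * x + b)%R)%E.
Proof.
move=> mG G0.
transitivity (\int[m]_x G x)%E.
  by apply: eq_measure_integral => A mA _; exact: mE.
rewrite /m ge0_integral_mscale//=; congr (_ * _)%E.
by rewrite (ge0_integral_pushforward mphi mu measurableT mG)// preimage_setT.
Qed.
End Affine.

Lemma ge0_integral_opp (G : R -> \bar R) : measurable_fun setT G ->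
  (forall x, 0 <= G x)%E -> (\int[mu]_x G x = \int[mu]_x G (- x)%R)%E.
Proof.
move=> mG G0.
have mN : measurable_fun [set: measurableTypeR R]
  (-%R : measurableTypeR R -> measurableTypeR R) by apply: continuous_measurable_fun; exact: opp_continuous.
have := ge0_integral_pushforward mN mu measurableT mG (fun y _ => G0 y).
rewrite preimage_setT => <-.
by apply: eq_measure_integral => A mA _; exact/esym/lebesgue_measureN.
Qed.

Lemma ge0_integral_shift (b : R) (G : R -> \bar R) : measurable_fun setT G ->
  (forall x, 0 <= G x)%E -> (\int[mu]_x G x = \int[mu]_x G (x + b)%R)%E.
Proof.
move=> mG G0; rewrite (ge0_integral_affine b ltr01 mG G0) mul1e.
by apply: eq_integral => x _; rewrite mul1r.
Qed.

Lemma rint_ge0E (a b : R) (v : R -> R) : continuous v -> 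
  (\int[mu]_(t in `[a, b]) (v t)%:E = (rint a b v)%:E)%E.
Proof.
move=> cv; rewrite /rint /Rintegral fineK//.
by apply: integrable_fin_num => //; exact: cont_integrable.
Qed.

Lemma rint_shift (a b c : R) (v : R -> R) : continuous v -> (forall t, 0 <= v t) ->
  rint (a + c) (b + c) v = rint a b (fun t => v (t + c)).
Proof.
move=> cv v0; have cvc : continuous (fun t => v (t + c)).
  move=> t; apply: (@continuous_comp _ _ _ (fun t => t + c) v); last exact: cv.
  by apply: cvgD; [exact: cvg_id|exact: cvg_cst].
have mv : measurable_fun setT v by exact: continuous_measurable_fun.
apply: EFin_inj; rewrite -!rint_ge0E// integral_mkcond [RHS]integral_mkcond.
rewrite (ge0_integral_shift c).
- apply: eq_integral => t _; rewrite !patchE !mem_setE !in_itv /=.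
  by rewrite !lerD2r.
- apply/(measurable_restrictT _ _).1 => //; apply/measurable_EFinP.
  exact: measurable_funTS.
- by move=> t; rewrite patchE; case: ifP => // _; rewrite lee_fin.
Qed.

Lemma rint_period (a : R) (v : R -> R) : continuous v -> (forall t, 0 <= v t) ->
  (forall t, v (t + pi *+ 2) = v t) -> `|a| <= pi *+ 2 ->
  rint 0 (pi *+ 2) (fun t => v (t + a)) = rint 0 (pi *+ 2) v.
Proof.
move=> cv v0 pv; have p0 := @pi2_ge0 R; rewrite ler_norml => /andP[a1 a2].
rewrite -rint_shift// add0r; have [a0|a0] := leP 0 a.
  rewrite (@rint_split _ a (pi *+ 2 + a) (pi *+ 2))//; last by apply/andP; split; lra.
  rewrite [X in _ + X](_ : _ = rint 0 a v); last first.
    rewrite -[X in rint X _ _]add0r (addrC _ a) rint_shift//.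
    by congr rint; apply/funext => t; rewrite pv.
  by rewrite addrC -rint_split// a0.
rewrite (@rint_split _ a (pi *+ 2 + a) 0)//; last by apply/andP; split; lra.
rewrite (_ : rint a 0 v = rint (pi *+ 2 + a) (pi *+ 2) v); last first.
  rewrite -[X in _ = rint _ X v]add0r (addrC _ a) rint_shift//.
  by congr rint; apply/funext => t; rewrite pv.
by rewrite addrC -rint_split//; apply/andP; split; lra.
Qed.

End AffineChange.

Section Polar.
Context {R : realType}.
Notation mu := (@lebesgue_measure R).

(** The substitution [u = tan t] on bounded intervals, which exhaust the line. *)
Lemma atan_subst (H : R -> R) : continuous H -> (forall t, 0 <= H t) ->
  (\int[mu]_u (H (atan u) / (1 + u ^+ 2))%:E = (rint (- (pi / 2)) (pi / 2) H)%:E)%E.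
Proof.
move=> cH H0.
pose I n : set R := `[- n%:R, n%:R]%classic.
pose J n : set R := `[atan (- n%:R), atan n%:R]%classic.
have c1 : continuous (fun u : R => (1 + u ^+ 2)^-1).
  by move=> u; exact: continuous_oneDsqrV.
have cHa : continuous (fun u => H (atan u) / (1 + u ^+ 2)).
  apply: cont_mulR => // u; apply: (@continuous_comp _ _ _ (@atan R) H); last exact: cH.
  exact: continuous_atan.
have d1 : derive1 (@atan R) = (fun u : R => (1 + u ^+ 2)^-1).
  by apply/funext => u; rewrite derive1_atan.
have IJ n : (\int[mu]_(u in I n) (H (atan u) / (1 + u ^+ 2))%:E =
    \int[mu]_(t in J n) (H t)%:E)%E.
  rewrite /I /J (@integration_by_substitution_increasing _ (@atan R) H).
  - by apply: eq_integral => u _; rewrite -derive1_atan.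
  - by rewrite lerNl -[leRHS]/(n%:R) (@le_trans _ _ 0)// oppr_le0.
  - by move=> x y _ _; exact: lt_atan.
  - by move=> x _; rewrite d1; exact: c1.
  - rewrite d1; apply/cvg_ex; exists (1 + (- n%:R) ^+ 2)^-1; exact/cvg_at_right_filter/c1.
  - rewrite d1; apply/cvg_ex; exists (1 + (n%:R) ^+ 2)^-1; exact/cvg_at_left_filter/c1.
  - split; first by move=> x _; exact: derivable_atan.
    + by apply/cvg_at_right_filter; exact: continuous_atan.
    + by apply/cvg_at_left_filter; exact: continuous_atan.
  - exact: continuous_subspaceT.
have mHa : measurable_fun setT (fun u => (H (atan u) / (1 + u ^+ 2))%:E).
  by apply/measurable_EFinP; exact: continuous_measurable_fun.
have mH : measurable_fun setT (fun u => (H u)%:E).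
  by apply/measurable_EFinP; exact: continuous_measurable_fun.
have UI : \bigcup_n I n = setT.
  apply/seteqP; split => // x _; exists (Num.truncn `|x|).+1 => //=.
  by rewrite /I /= in_itv /= -ler_norml ltW// truncnS_gt.
have UJ : \bigcup_n J n = `]- (pi / 2), pi / 2[%classic.
  apply/seteqP; split => [x [n _]|x]; rewrite /J /= !in_itv /=.
    by move=> /andP[h1 h2]; rewrite (lt_le_trans (atan_gtNpi2 _) h1) (le_lt_trans h2 (atan_ltpi2 _)).
  move=> xp; have xE : x = atan (tan x) by rewrite tanK// in_itv.
  have [n hn] : exists n : nat, `|tan x| < n%:R.
    by exists (Num.truncn `|tan x|).+1; exact: truncnS_gt.
  exists n => //; rewrite /J /= in_itv /=; apply/andP; split.
    rewrite [leRHS]xE le_atan// lerNl (le_trans (ler_norm _))// normrN.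
    exact: ltW.
  by rewrite [leLHS]xE le_atan// (le_trans (ler_norm _))// ltW.
have h1 : (\int[mu]_(u in I n) (H (atan u) / (1 + u ^+ 2))%:E @[n --> \oo] -->
    \int[mu]_u (H (atan u) / (1 + u ^+ 2))%:E)%E.
  rewrite -[X in _ --> integral _ X _]UI; apply: ge0_nondecreasing_set_cvg_integral => //.
  - apply/nondecreasing_seqP => n; apply/subsetPset => x; rewrite /I /J /= !in_itv /= => /andP[h1 h2].
    by rewrite (le_trans h2) ?ler_nat// (le_trans _ h1)// lerN2 ler_nat.
  - by move=> i; exact: measurable_itv.
  - by move=> i; exact: measurable_funTS.
  - by move=> i x _; rewrite lee_fin divr_ge0// addr_ge0// sqr_ge0.
have h2 : (\int[mu]_(u in J n) (H u)%:E @[n --> \oo] -->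
    \int[mu]_(u in `](- (pi / 2))%R, (pi / 2)%R[) (H u)%:E)%E.
  rewrite -UJ; apply: ge0_nondecreasing_set_cvg_integral => //.
  - apply/nondecreasing_seqP => n; apply/subsetPset => x; rewrite /I /J /= !in_itv /= => /andP[h3 h4].
    by rewrite (le_trans h4) ?le_atan ?ler_nat// (le_trans _ h3)// le_atan// lerN2 ler_nat.
  - by move=> i; exact: measurable_itv.
  - by move=> i; exact: measurable_funTS.
  - by move=> i x _; rewrite lee_fin.
have E : (\int[mu]_u (H (atan u) / (1 + u ^+ 2))%:E =
    \int[mu]_(u in `](- (pi / 2))%R, (pi / 2)%R[) (H u)%:E)%E.
  apply: (cvg_unique (@ereal_hausdorff R)) h1 _.
  by rewrite (_ : (fun n => _) = (fun n => \int[mu]_(u in J n) (H u)%:E)%E)//; apply/funext.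
rewrite E integral_itv_obnd_cbnd; last exact: measurable_funTS.
rewrite integral_itv_bndo_bndc; last exact: measurable_funTS.
exact: rint_ge0E.
Qed.

Let cs (u : R) : R := cos (atan u).

Let cs_gt0 u : 0 < cs u.
Proof. by apply: cos_gt0_pihalf; rewrite atan_gtNpi2 atan_ltpi2. Qed.

Let sin_atanE u : sin (atan u) = u * cs u.
Proof. by rewrite -{2}[u]atanK /tan divfK// gt_eqF// cs_gt0. Qed.

Let cs_sqr u : cs u ^+ 2 = (1 + u ^+ 2)^-1.
Proof. by rewrite -{2}[u]atanK -cos2_tan2 ?invrK// gt_eqF// cs_gt0. Qed.

Let mcs : measurable_fun setT cs.
Proof.
apply: continuous_measurable_fun => u.
by apply: (@continuous_comp _ _ _ (@atan R) (@cos R)); [exact: continuous_atan|exact: continuous_cos].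
Qed.

(** Slopes [u = y / x], then the radius [x = r cos t] on each ray, then the
    angle [u = tan t]: only one-dimensional substitutions occur. *)
Lemma polar_half (P F : R * R -> R) : measurable_fun setT P ->
  (forall x y, 0 < x -> P (x, y) = F (x, y)) -> (forall x y, x <= 0 -> P (x, y) = 0) ->
  (forall w, 0 <= F w) -> (forall r, 0 < r -> continuous (fun t => F (r * cos t, r * sin t))) ->
  (\int[mu]_x \int[mu]_y (P (x, y))%:E =
   \int[mu]_r (if (0 < r)%R then r * rint (- (pi / 2)) (pi / 2) (fun t => F (r * cos t, r * sin t)) else 0)%:E)%E.
Proof.
move=> mP PF P0 F0 cF.
have Pge0 w : 0 <= P w.
  case: w => x y; have [x0|x0] := ltP 0 x; first by rewrite PF.
  by rewrite P0.
have mP1 (f g : R * R -> R) : measurable_fun setT f -> measurable_fun setT g ->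
    measurable_fun setT (fun w => P (f w, g w)).
  by move=> mf mg; apply: (measurableT_comp mP); exact: measurable_fun_pair.
have mP2 (f g : R -> R) : measurable_fun setT f -> measurable_fun setT g ->
    measurable_fun setT (fun w => P (f w, g w)).
  by move=> mf mg; apply: (measurableT_comp mP); exact: measurable_fun_pair.
have mfst : measurable_fun setT (fst : R * R -> R) by exact: measurable_fst.
have msnd : measurable_fun setT (snd : R * R -> R) by exact: measurable_snd.
have mcs2 : measurable_fun setT (fun w : R * R => cs w.2) by exact: measurableT_comp.
(* [y = x u] for fixed [x] *)
transitivity (\int[mu]_x \int[mu]_u (`|x| * P (x, x * u)%R)%:E)%E.
  apply: eq_integral => x _; have [x0|x0] := ltP 0 x; last first.
    by rewrite !integral0_eq// => y _; rewrite P0 ?mulr0.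
  rewrite (ge0_integral_affine 0 x0); last 2 first.
  - by apply/measurable_EFinP; apply: (measurableT_comp mP); exact: measurable_pair1.
  - by move=> y; rewrite lee_fin.
  rewrite -ge0_integralZl//; last 3 first.
  - apply/measurable_EFinP; apply: (measurableT_comp mP).
    apply: measurable_fun_pair => //; exact: measurable_funD.
  - by move=> y _; rewrite lee_fin.
  - by rewrite lee_fin ltW.
  by apply: eq_integral => u _; rewrite addr0 gtr0_norm.
have m1 : measurable_fun setT (fun w : R * R => (`|w.1| * P (w.1, w.1 * w.2))%:E).
  apply/measurable_EFinP; apply: measurable_funM; first exact: measurableT_comp.
  by apply: mP1 => //; exact: measurable_funM.
rewrite (@fubini_tonelli _ _ _ _ R mu mu (fun w : R * R => (`|w.1| * P (w.1, w.1 * w.2))%:E))//;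
  last by move=> w; rewrite lee_fin mulr_ge0.
(* [x = r cos t] for fixed slope [u = tan t] *)
transitivity (\int[mu]_u \int[mu]_r (cs u * (`|cs u * r| * P (cs u * r, cs u * r * u)%R))%:E)%E.
  apply: eq_integral => u _; rewrite /= (ge0_integral_affine 0 (cs_gt0 u)); last 2 first.
  - apply/measurable_EFinP; apply: measurable_funM.
      by apply: continuous_measurable_fun; exact: norm_continuous.
    by apply: mP2 => //; exact: measurable_funM.
  - by move=> y; rewrite lee_fin mulr_ge0.
  rewrite -ge0_integralZl//; last 3 first.
  - have ma : measurable_fun setT (fun x : R => cs u * x + 0).
      by apply: measurable_funD => //; exact: measurable_funM.
    apply/measurable_EFinP; apply: measurable_funM; first exact: measurableT_comp.
    by apply: mP2 => //; exact: measurable_funM.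
  - by move=> y _; rewrite lee_fin mulr_ge0.
  - by rewrite lee_fin ltW// cs_gt0.
  by apply: eq_integral => r _; rewrite addr0.
have m2 : measurable_fun setT (fun w : R * R =>
    (cs w.2 * (`|cs w.2 * w.1| * P (cs w.2 * w.1, cs w.2 * w.1 * w.2)))%:E).
  apply/measurable_EFinP; apply: measurable_funM => //.
  have mc : measurable_fun setT (fun w : R * R => cs w.2 * w.1) by exact: measurable_funM.
  apply: measurable_funM; first exact: measurableT_comp.
  by apply: mP1 => //; exact: measurable_funM.
rewrite -(@fubini_tonelli _ _ _ _ R mu mu (fun w : R * R =>
    (cs w.2 * (`|cs w.2 * w.1| * P (cs w.2 * w.1, cs w.2 * w.1 * w.2)))%:E))//;
  last by move=> w; rewrite lee_fin !mulr_ge0// ltW// cs_gt0.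
(* [u = tan t] for fixed [r] *)
apply: eq_integral => r _ /=; case: ifPn => [r0|]; last first.
  rewrite -leNgt => r0; rewrite integral0_eq// => u _.
  by rewrite P0 ?mulr0// pmulr_rle0 ?cs_gt0.
rewrite EFinM -(atan_subst (cF r r0)); last by move=> t; exact: F0.
rewrite -ge0_integralZl//; last 3 first.
- apply/measurable_EFinP; apply: continuous_measurable_fun; apply: cont_mulR.
    move=> u; apply: (@continuous_comp _ _ _ (@atan R) (fun t => F (r * cos t, r * sin t))).
      exact: continuous_atan.
    exact: cF.
  by move=> u; exact: continuous_oneDsqrV.
- by move=> u _; rewrite lee_fin divr_ge0// addr_ge0// sqr_ge0.
- by rewrite lee_fin ltW.
apply: eq_integral => u _; rewrite -EFinM; congr EFin.
have cr : 0 < cs u * r by rewrite mulr_gt0// cs_gt0.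
rewrite PF// gtr0_norm// sin_atanE -cs_sqr -/(cs u) (mulrC r (cs u)).
rewrite (_ : r * (u * cs u) = cs u * r * u); last by ring.
by move: (F _) => FF; ring.
Qed.

Lemma measurable_rint (Q : R * R -> R) (a b : R) : measurable_fun setT Q ->
  (forall w, 0 <= Q w) -> (forall r, 0 < r -> continuous (fun t => Q (r, t))) ->
  measurable_fun setT (fun r : R => if 0 < r then r * rint a b (fun t => Q (r, t)) else 0).
Proof.
move=> mQ Q0 cQ; apply/measurable_EFinP.
pose q (w : R * R) := (if 0 < w.1 then w.1 * Q w else 0) * \1_(`[a, b]) w.2.
have mfst : measurable_fun setT (fst : R * R -> R) by exact: measurable_fst.
have mq : measurable_fun setT (EFin \o q).
  apply/measurable_EFinP; apply: measurable_funM.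
    apply: measurable_fun_ifT => //; last exact: measurable_funM.
    exact: measurable_fun_ltr.
  by apply: (measurableT_comp (measurable_indic _)) => //; exact: measurable_snd.
have q0 w : (0 <= (EFin \o q) w)%E.
  rewrite /= lee_fin mulr_ge0//; case: ifP => // /ltW w0.
  exact: mulr_ge0.
have := @measurable_fun_fubini_tonelli_F _ _ _ _ _ mu _ mq q0.
rewrite (_ : fubini_F _ _ = EFin \o (fun r => if 0 < r then r * rint a b (fun t => Q (r, t)) else 0))//.
apply/funext => r /=; rewrite /fubini_F /q /=; case: ifPn => r0; last first.
  by rewrite integral0_eq// => t _; rewrite mul0r.
rewrite EFinM -(rint_ge0E a b (cQ r r0)) -ge0_integralZl//; last 3 first.
- by apply/measurable_EFinP; apply: measurable_funTS; exact: continuous_measurable_fun (cQ r r0).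
- by move=> t _; rewrite lee_fin.
- by rewrite lee_fin ltW.
rewrite [RHS]integral_mkcond; apply: eq_integral => t _.
rewrite patchE /= indicE; case: ifPn => _; rewrite ?mulr1 ?EFinM//.
by rewrite mule0.
Qed.

(** The vertical axis is null, and the half-plane [x < 0] is the image of
    [x > 0] under a half turn. *)
Theorem polar (F : R * R -> R) : measurable_fun setT F -> (forall w, 0 <= F w) ->
  (forall r, 0 < r -> continuous (fun t => F (r * cos t, r * sin t))) ->
  (\int[mu \x mu]_w (F w)%:E =
   \int[mu]_r (if (0 < r)%R then r * rint 0 (pi *+ 2) (fun t => F (r * cos t, r * sin t)) else 0)%:E)%E.
Proof.
move=> mF F0 cF.
have mFE : measurable_fun setT (fun w : R * R => (F w)%:E) by exact/measurable_EFinP.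
rewrite (@fubini_tonelli1 _ _ _ _ R mu mu (fun w => (F w)%:E) mFE); last by move=> w; rewrite lee_fin.
rewrite /fubini_F /=.
pose F' (w : R * R) := F (- w.1, - w.2).
have mF' : measurable_fun setT F'.
  apply: (measurableT_comp mF); apply: measurable_fun_pair; exact: measurableT_comp.
pose P (w : R * R) := if 0 < w.1 then F w else 0.
pose P' (w : R * R) := if 0 < w.1 then F' w else 0.
have mgt0 : measurable_fun setT (fun w : R * R => 0 < w.1).
  by apply: measurable_fun_ltr => //; exact: measurable_fst.
have mP : measurable_fun setT P by apply: measurable_fun_ifT.
have mP' : measurable_fun setT P' by apply: measurable_fun_ifT.
have cF' r : 0 < r -> continuous (fun t => F' (r * cos t, r * sin t)).
  move=> r0; rewrite (_ : (fun t => _) = (fun t => F (r * cos (t + pi), r * sin (t + pi)))).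
    move=> t; apply: (@continuous_comp _ _ _ (fun t => t + pi) (fun t => F (r * cos t, r * sin t))).
      by apply: cvgD; [exact: cvg_id|exact: cvg_cst].
    exact: cF.
  by apply/funext => t; rewrite /F' /= cosDpi sinDpi !mulrN.
have mpol (K : R * R -> R) : measurable_fun setT K ->
    measurable_fun setT (fun w : R * R => K (w.1 * cos w.2, w.1 * sin w.2)).
  have mfst : measurable_fun setT (fst : R * R -> R) by exact: measurable_fst.
  have msnd : measurable_fun setT (snd : R * R -> R) by exact: measurable_snd.
  move=> mK; apply: (measurableT_comp mK); apply: measurable_fun_pair; apply: measurable_funM => //.
    by apply: (measurableT_comp (continuous_measurable_fun (@continuous_cos R))).
  by apply: (measurableT_comp (continuous_measurable_fun (@continuous_sin R))).
have PE := polar_half mP (F := F).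
have PE' := polar_half mP' (F := F').
pose G (x : R) : \bar R := (\int[mu]_y (F (x, y))%:E)%E.
have mG : measurable_fun setT G.
  apply: (@measurable_fun_fubini_tonelli_F _ _ _ _ _ mu _ mFE) => w.
  by rewrite lee_fin.
have G0 x : (0 <= G x)%E by apply: integral_ge0 => y _; rewrite lee_fin.
transitivity (\int[mu]_x \int[mu]_y (P (x, y))%:E + \int[mu]_x \int[mu]_y (P' (x, y))%:E)%E.
  have e1 : (\int[mu]_x \int[mu]_y (P (x, y))%:E = \int[mu]_(x in `]0%R, +oo[) G x)%E.
    rewrite [RHS]integral_mkcond; apply: eq_integral => x _.
    rewrite patchE mem_setE in_itv /= andbT /P /=; case: ifPn => // _.
    by rewrite integral0_eq.
  have e2 : (\int[mu]_x \int[mu]_y (P' (x, y))%:E = \int[mu]_(x in `]-oo, 0%R]) G x)%E.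
    have mGN : measurable_fun setT (fun x : R => G (- x)) by exact: measurableT_comp.
    transitivity (\int[mu]_(x in `]0%R, +oo[) G (- x)%R)%E.
      rewrite [RHS]integral_mkcond; apply: eq_integral => x _.
      rewrite patchE mem_setE in_itv /= andbT /P' /=; case: ifPn => // _; last by rewrite integral0_eq.
      rewrite /G ge0_integral_opp//.
      + by apply/measurable_EFinP; apply: (measurableT_comp mF); exact: measurable_pair1.
      + by move=> y; rewrite lee_fin.
    rewrite integral_itv_obnd_cbnd; last exact: measurable_funTS.
    rewrite (ge0_integration_by_substitution0 mGN)//.
    by apply: eq_integral => x _; rewrite opprK.
  rewrite e1 e2 -ge0_integral_setU//; last first.
  - apply/disj_setPS => x /= []; rewrite !in_itv /= andbT => x0 x0'.
    by have := lt_le_trans x0 x0'; rewrite ltxx.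
  - exact: measurable_funTS.
  congr (integral _ _ _); apply/seteqP; split => // x _ /=; rewrite !in_itv /= andbT.
  by case: (leP x 0) => x0; [right|left].
rewrite PE//; [|by move=> x y /= x0; rewrite /P /= x0|by move=> x y; rewrite leNgt /P /= => /negbTE ->].
rewrite PE'//; [|by move=> x y /= x0; rewrite /P' /= x0|by move=> x y; rewrite leNgt /P' /= => /negbTE ->|by move=> w; exact: F0].
have H0 r t : 0 <= F (r * cos t, r * sin t) by exact: F0.
rewrite -ge0_integralD//.
- apply: eq_integral => r _; rewrite -EFinD; congr EFin; case: ifPn => r0; last by rewrite addr0.
  rewrite -mulrDr; congr (_ * _); have cH := cF r r0.
  have p0 := @pi_gt0 R; have p2 : (pi : R) *+ 2 = 2 * pi by rewrite mulr_natl.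
  rewrite [X in _ + X](_ : _ = rint (pi / 2) (pi *+ 2 - pi / 2) (fun t => F (r * cos t, r * sin t))).
    rewrite -rint_split//; last by rewrite p2; apply/andP; split; lra.
    have Hs := @rint_shift R 0 (pi *+ 2) (- (pi / 2)) _ cH (H0 r).
    rewrite add0r in Hs; rewrite Hs (rint_period cH (H0 r))//.
    + by move=> t; rewrite cosD2pi sinD2pi.
    + by rewrite normrN ger0_norm ?p2; lra.
  rewrite (_ : pi *+ 2 - pi / 2 = pi / 2 + pi); last by rewrite p2; field.
  rewrite [in RHS](_ : pi / 2 = - (pi / 2) + pi); last by field.
  rewrite rint_shift//.
  rewrite [- (pi / 2) + pi](_ : _ = pi / 2); last by field.
  by congr rint; apply/funext => t; rewrite /F' /= cosDpi sinDpi !mulrN.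
- by move=> r _; rewrite lee_fin; case: ifP => // /ltW r0; rewrite mulr_ge0// Rintegral_ge0.
- apply/measurable_EFinP.
  apply: (measurable_rint (Q := fun w => F (w.1 * cos w.2, w.1 * sin w.2))) => //.
  exact: mpol.
- move=> r _; rewrite lee_fin; case: ifP => // /ltW r0; apply: mulr_ge0 => //.
  by apply: Rintegral_ge0 => t _; exact: F0.
- apply/measurable_EFinP.
  apply: (measurable_rint (Q := fun w => F' (w.1 * cos w.2, w.1 * sin w.2))) => //.
    exact: mpol.
  by move=> w; exact: F0.
Qed.

End Polar.

(** * Integral means and the Bergman integral *)

Section CircleMeans.
Context {R : realType}.
Notation mu := (@lebesgue_measure R).
Implicit Types (f g h : Cplx R -> Cplx R) (q r t : R) (w : R * R).

Lemma continuous_abs_powR q : 0 < q -> continuous (fun x : R => `|x| `^ q).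
Proof.
move=> q0 x; have [->|x0] := eqVneq x 0.
  apply/cvgrPdist_lt => e e0; apply/nbhs_ballP; exists (e `^ q^-1) => /=.
    exact: powR_gt0.
  move=> y; rewrite /= sub0r normrN normr0 powR0 ?gt_eqF// sub0r normrN => hy.
  rewrite ger0_norm ?powR_ge0//.
  have -> : e = (e `^ q^-1) `^ q by rewrite -powRrM mulVf ?gt_eqF// powRr1// ltW.
  by apply: gt0_ltr_powR => //; rewrite nnegrE ?powR_ge0.
apply: (@continuous_comp R R R (fun x => `|x|) (fun y => y `^ q)); first exact: norm_continuous.
apply/differentiable_continuous/derivable1_diffP; apply: derivable_powR.
by rewrite in_itv /= normr_gt0 x0.
Qed.

Lemma cont_powR q (u : R -> R) : 0 < q -> continuous u -> (forall t, 0 <= u t) ->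
  continuous (fun t => u t `^ q).
Proof.
move=> q0 cu u0; rewrite (_ : (fun t => _) = (fun t => `|u t| `^ q)); last first.
  by apply/funext => t; rewrite ger0_norm.
move=> t; apply: (@continuous_comp _ _ _ u (fun x => `|x| `^ q)); first exact: cu.
exact: continuous_abs_powR.
Qed.

(** Extension by zero makes the modulus measurable on the whole plane, whatever
    the values of [f] outside the disc. *)
Definition dmod f w : R := if w.1 ^+ 2 + w.2 ^+ 2 < 1 then cmod (f (w.1 +i* w.2)) else 0.

Lemma dmod_ge0 f w : 0 <= dmod f w.
Proof. by rewrite /dmod; case: ifP => // _; exact: cmod_ge0. Qed.

Lemma disc_pair (x y : R) : (cmod (x +i* y : Cplx R) < 1) = (x ^+ 2 + y ^+ 2 < 1).
Proof.
have s0 : 0 <= x ^+ 2 + y ^+ 2 by rewrite addr_ge0 ?sqr_ge0.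
by rewrite cmodE -[in X in _ < X]sqrtr1 ltr_sqrt.
Qed.

Lemma measurable_psum (a : nat -> Cplx R) n :
  measurable_fun setT (fun w => cmod (psum a (w.1 +i* w.2) n)).
Proof.
have mfst : measurable_fun setT (fst : R * R -> R) by exact: measurable_fst.
have msnd : measurable_fun setT (snd : R * R -> R) by exact: measurable_snd.
have mpow k : measurable_fun setT (fun w => complex.Re ((w.1 +i* w.2 : Cplx R) ^+ k)) /\
    measurable_fun setT (fun w => complex.Im ((w.1 +i* w.2 : Cplx R) ^+ k)).
  elim: k => [|k [IH1 IH2]].
    by split; [under eq_fun do rewrite expr0|under eq_fun do rewrite expr0]; exact: measurable_cst.
  split.
    under eq_fun do rewrite exprS ReM /=.
    by apply: measurable_funB; exact: measurable_funM.
  under eq_fun do rewrite exprS ImM /=.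
  by apply: measurable_funD; exact: measurable_funM.
have ms m : measurable_fun setT (fun w => complex.Re (psum a (w.1 +i* w.2) m)) /\
    measurable_fun setT (fun w => complex.Im (psum a (w.1 +i* w.2) m)).
  elim: m => [|m [IH1 IH2]].
    by split; [under eq_fun do rewrite /psum big_ord0|under eq_fun do rewrite /psum big_ord0];
      exact: measurable_cst.
  have [m1 m2] := mpow m.
  split.
    under eq_fun do rewrite psumS ReD ReM.
    by apply: measurable_funD => //; apply: measurable_funB; exact: measurable_funM.
  under eq_fun do rewrite psumS ImD ImM.
  by apply: measurable_funD => //; apply: measurable_funD; exact: measurable_funM.
have [m1 m2] := ms n.
rewrite (_ : (fun w => _) = (fun w => Num.sqrt (complex.Re (psum a (w.1 +i* w.2) n) ^+ 2 +
   complex.Im (psum a (w.1 +i* w.2) n) ^+ 2))); last first.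
  by apply/funext => w; case: (psum _ _ _) => x y; rewrite cmodE.
apply: (measurableT_comp (continuous_measurable_fun (@sqrt_continuous R))).
by apply: measurable_funD; exact: measurable_funX.
Qed.

(** A pointwise limit of moduli of Taylor polynomials. *)
Lemma measurable_dmod f : Hol f -> measurable_fun setT (dmod f).
Proof.
move=> /Hol_pseries /has_pseriesP hf; set a := taylor_coef f in hf.
have mfst : measurable_fun setT (fst : R * R -> R) by exact: measurable_fst.
have msnd : measurable_fun setT (snd : R * R -> R) by exact: measurable_snd.
pose S n w := if w.1 ^+ 2 + w.2 ^+ 2 < 1 then cmod (psum a (w.1 +i* w.2) n) else 0.
apply: (measurable_fun_cvg (h := S)) => [n|w _].
  apply: measurable_fun_ifT => //; last exact: measurable_psum.
  apply: measurable_fun_ltr => //.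
  by apply: measurable_funD; exact: measurable_funX.
rewrite /S /dmod; case: ifPn => w1; last exact: cvg_cst.
have := hf (w.1 +i* w.2); rewrite disc_pair => /(_ w1) h.
apply: (@cvg_comp _ _ _ _ _ _ _ _ h).
exact: continuous_cmod.
Qed.

Lemma bergman_int_dmod q f : q != 0 ->
  bergman_int q f = (\int[mu \x mu]_w (dmod f w `^ q)%:E)%E.
Proof.
move=> q0; rewrite /bergman_int integral_mkcond; apply: eq_integral => -[x y] _.
rewrite patchE /dmod /=; case: ifPn => h.
  have : cmod (x +i* y : Cplx R) < 1 by apply/discE; move: h; rewrite inE.
  by rewrite disc_pair => ->.
rewrite ifN ?powR0//; apply: contra h; rewrite -disc_pair => h; rewrite inE /=.
exact/discE.
Qed.

(** This is [2 pi] times the [q]-th power of the integral mean of order [q]. *)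
Definition cint_pow q r f : R := rint 0 (pi *+ 2) (fun t => cmod (f (circ r t)) `^ q).

Lemma cont_cmod_circ q r f : Hol f -> 0 < q -> 0 <= r < 1 ->
  continuous (fun t => cmod (f (circ r t)) `^ q).
Proof.
move=> hf q0 r01; apply: cont_powR => // [|t]; last exact: cmod_ge0.
exact: cont_cmod (cont_circ (Hol_cont hf) r01).
Qed.

Lemma dmod_circ f r t : dmod f (r * cos t, r * sin t) =
  if `|r| < 1 then cmod (f (circ r t)) else 0.
Proof.
rewrite /dmod /= !exprMn -mulrDr cos2Dsin2 mulr1 circE.
by rewrite -sqrtr_sqr -{2}sqrtr1 ltr_sqrt.
Qed.

Lemma cont_dmod q r f : Hol f -> 0 < q -> 0 < r ->
  continuous (fun t => dmod f (r * cos t, r * sin t) `^ q).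
Proof.
move=> hf q0 r0; under eq_fun do rewrite dmod_circ gtr0_norm//.
have [r1|r1] := ltP r 1; last exact: cst_continuous.
by apply: cont_cmod_circ => //; rewrite ltW.
Qed.

Lemma cint_pow_ge0 q r f : 0 <= cint_pow q r f.
Proof. by apply: Rintegral_ge0 => t _; exact: powR_ge0. Qed.

Lemma cint_pow_dmod q r f : 0 < r < 1 ->
  cint_pow q r f = rint 0 (pi *+ 2) (fun t => dmod f (r * cos t, r * sin t) `^ q).
Proof.
move=> /andP[r0 r1]; congr rint; apply/funext => t.
by rewrite dmod_circ gtr0_norm// r1.
Qed.

Lemma measurable_dmod_polar f : Hol f ->
  measurable_fun setT (fun w => dmod f (w.1 * cos w.2, w.1 * sin w.2)).
Proof.
move=> hf; have mfst : measurable_fun setT (fst : R * R -> R) by exact: measurable_fst.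
have msnd : measurable_fun setT (snd : R * R -> R) by exact: measurable_snd.
apply: (measurableT_comp (measurable_dmod hf)); apply: measurable_fun_pair; apply: measurable_funM => //.
  exact: (measurableT_comp (continuous_measurable_fun (@continuous_cos R))).
exact: (measurableT_comp (continuous_measurable_fun (@continuous_sin R))).
Qed.

Lemma measurable_dmod_pow q f : Hol f ->
  measurable_fun setT (fun w => dmod f w `^ q).
Proof. by move=> hf; apply: (measurableT_comp (measurable_powR q)); exact: measurable_dmod. Qed.

Lemma bergman_polar q f : Hol f -> 0 < q ->
  bergman_int q f = (\int[mu]_(r in `]0%R, 1%R[) (r * cint_pow q r f)%:E)%E.
Proof.
move=> hf q0; rewrite bergman_int_dmod ?gt_eqF// (polar (measurable_dmod_pow q hf)); last 2 first.
- by move=> w; exact: powR_ge0.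
- by move=> r r0; exact: cont_dmod.
rewrite [RHS]integral_mkcond; apply: eq_integral => r _; rewrite patchE mem_setE in_itv /=.
case: ifPn => [r0|_] //=; case: ifPn => r1.
  by rewrite cint_pow_dmod// r0.
rewrite (_ : (fun t => _) = (fun=> 0)); last first.
  by apply/funext => t; rewrite dmod_circ gtr0_norm// (negbTE r1) powR0// gt_eqF.
by rewrite rint_cst ?pi2_ge0// mul0r mulr0.
Qed.

Lemma measurable_cint_pow q f : Hol f -> 0 < q ->
  measurable_fun (`]0, 1[ : set R) (fun r => cint_pow q r f).
Proof.
move=> hf q0.
have := measurable_rint (Q := fun w => dmod f (w.1 * cos w.2, w.1 * sin w.2) `^ q) 0 (pi *+ 2).
move=> /(_ _ _ _)/wrap[||r r0|m].
- exact: (measurableT_comp (measurable_powR q) (measurable_dmod_polar hf)).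
- by move=> w; exact: powR_ge0.
- exact: cont_dmod.
have m2 : measurable_fun (`]0, 1[ : set R) (fun r : R => r^-1).
  apply: open_continuous_measurable_fun; first exact: interval_open.
  by move=> x; rewrite inE /= in_itv /= => /andP[x0 _]; apply: inv_continuous; rewrite gt_eqF.
refine (eq_measurable_fun _ _ (measurable_funM m2 (measurable_funTS m))) => r.
rewrite inE /= in_itv /= => /andP[r0 r1]; rewrite r0 mulrA mulVf ?gt_eqF// mul1r.
by rewrite cint_pow_dmod// r0.
Qed.

End CircleMeans.

Section WeightedJensen.
Context d (T : measurableType d) {R : realType} (mu : {measure set T -> \bar R}).

(** Jensen's inequality for the weight [k], which need not have total mass one.
    The tangent line of [x ^ q] at [m = N / I] gives it without any
    integrability assumption on the right. *)
Lemma weighted_jensen (D : set T) (k F : T -> R) (I N q : R) : measurable D ->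
  measurable_fun D k -> measurable_fun D F ->
  (forall x, D x -> 0 <= k x) -> (forall x, D x -> 0 <= F x) -> 1 <= q ->
  0 < I -> 0 <= N ->
  (\int[mu]_(x in D) (k x)%:E <= I%:E)%E ->
  (N%:E <= \int[mu]_(x in D) (k x * F x)%:E)%E ->
  ((N `^ q)%:E <= (I `^ (q - 1))%:E * \int[mu]_(x in D) (k x * F x `^ q)%:E)%E.
Proof.
move=> mD mk mF k0 F0 q1 I0 N0 kI NF.
have q0 : 0 < q by apply: lt_le_trans q1.
have mFq : measurable_fun D (fun x => F x `^ q).
  exact: (measurableT_comp (measurable_powR q)).
have RHS0 : (0 <= \int[mu]_(x in D) (k x * F x `^ q)%:E)%E.
  by apply: integral_ge0 => x Dx; rewrite lee_fin mulr_ge0 ?powR_ge0// k0.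
have [N00|Nn0] := eqVneq N 0.
  by rewrite N00 powR0 ?gt_eqF// mule_ge0// lee_fin powR_ge0.
have {Nn0} Np : 0 < N by rewrite lt_neqAle eq_sym Nn0.
have [->|fin] := eqVneq (\int[mu]_(x in D) (k x * F x `^ q)%:E)%E +oo%E.
  by rewrite gt0_muley ?leey// lte_fin powR_gt0.
have /fineK E : (\int[mu]_(x in D) (k x * F x `^ q)%:E)%E \is a fin_num.
  by rewrite ge0_fin_numE// ltey.
set X := fine _ in E; rewrite -E -EFinM lee_fin.
pose m := N / I; have m0 : 0 < m by rewrite divr_gt0.
have tangent x : 0 <= x -> q * m `^ (q - 1) * x <= x `^ q + (q - 1) * m `^ q.
  move=> x0; have [->|q1'] := eqVneq q 1.
    by rewrite !subrr powRr0 mul0r !mul1r addr0 powRr1.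
  have {q1'} q1' : 1 < q by rewrite lt_neqAle eq_sym q1'.
  pose q' := q / (q - 1).
  have qq : q - 1 != 0 by rewrite subr_eq0 gt_eqF.
  have q'0 : 0 < q' by rewrite divr_gt0// subr_gt0.
  have := @conjugate_powR R x (m `^ (q - 1)) q q' x0 (powR_ge0 _ _) q0 q'0.
  have -> : q^-1 + q'^-1 = 1 by rewrite /q'; field; rewrite qq gt_eqF.
  move=> /(_ erefl); rewrite -powRrM (_ : (q - 1) * q' = q); last by rewrite /q' mulrC divfK.
  move=> /(ler_wpM2l (ltW q0)); rewrite mulrDr.
  rewrite (_ : q * (x `^ q / q) = x `^ q); last by rewrite mulrC divfK ?gt_eqF.
  rewrite (_ : q * (m `^ q / q') = (q - 1) * m `^ q); last first.
    by rewrite /q'; field; rewrite qq gt_eqF.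
  by rewrite mulrA mulrAC.
have key : (\int[mu]_(x in D) ((q * m `^ (q - 1)) * (k x * F x))%:E <=
    \int[mu]_(x in D) (k x * F x `^ q + (q - 1) * m `^ q * k x)%:E)%E.
  apply: ge0_le_integral => //.
  - by move=> x Dx; rewrite lee_fin !mulr_ge0 ?powR_ge0 ?(ltW q0) ?k0 ?F0.
  - by apply/measurable_EFinP; do 2 apply: measurable_funM => //.
  - apply/measurable_EFinP; apply: measurable_funD; first exact: measurable_funM.
    exact: measurable_funM.
  - move=> x Dx; rewrite lee_fin mulrCA [X in _ <= _ + X]mulrC -mulrDr ler_wpM2l ?k0//.
    by apply: tangent; exact: F0.
move: key; under eq_integral do rewrite EFinM.
rewrite ge0_integralZl//; last 3 first.
- by apply/measurable_EFinP; exact: measurable_funM.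
- by move=> x Dx; rewrite lee_fin mulr_ge0 ?k0 ?F0.
- by rewrite lee_fin mulr_ge0 ?powR_ge0 ?(ltW q0).
under [X in (_ <= X)%E]eq_integral do rewrite EFinD.
rewrite ge0_integralD//; last 4 first.
- by move=> x Dx; rewrite lee_fin mulr_ge0 ?powR_ge0// k0.
- by apply/measurable_EFinP; exact: measurable_funM.
- by move=> x Dx; rewrite lee_fin !mulr_ge0 ?powR_ge0 ?k0 ?subr_ge0.
- by apply/measurable_EFinP; exact: measurable_funM.
under [X in (_ <= _ + X)%E]eq_integral do rewrite EFinM.
rewrite [X in (_ <= _ + X)%E]ge0_integralZl//; first last.
- by rewrite lee_fin mulr_ge0 ?powR_ge0 ?subr_ge0.
- exact/measurable_EFinP.
rewrite -E => key.
have c0 : 0 <= q * m `^ (q - 1) by rewrite mulr_ge0 ?powR_ge0 ?(ltW q0).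
have c1 : 0 <= (q - 1) * m `^ q by rewrite mulr_ge0 ?powR_ge0 ?subr_ge0.
have : q * m `^ (q - 1) * N <= X + (q - 1) * m `^ q * I.
  rewrite -lee_fin EFinM; apply: le_trans (lee_wpmul2l _ NF) _; first by rewrite lee_fin.
  apply: le_trans key _; rewrite EFinD; apply: leeD2l.
  rewrite [(_ * I)%:E]EFinM; apply: lee_wpmul2l => //.
have -> : (q - 1) * m `^ q * I = (q - 1) * (m `^ (q - 1) * N).
  rewrite -(mulr_powRB1 (ltW m0) q0) /m; field.
  by rewrite gt_eqF.
rewrite -mulrA mulrBl mul1r => h.
have {}h : m `^ (q - 1) * N <= X by lra.
have -> : N `^ q = I `^ (q - 1) * (m `^ (q - 1) * N).
  rewrite mulrA -powRM ?(ltW I0) ?(ltW m0)// /m mulrC mulrCA divff ?gt_eqF// mulr1.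
  by rewrite mulr_powRB1// ltW.
by rewrite ler_wpM2l// powR_ge0.
Qed.

End WeightedJensen.

(** * Convolution on the circle and the Poisson kernel *)

Section Tonelli.
Context {R : realType}.
Notation mu := (@lebesgue_measure R).

Lemma tonelli_set (A B : set R) (F : R * R -> \bar R) : measurable A -> measurable B ->
  measurable_fun (A `*` B) F -> (forall x y, A x -> B y -> (0 <= F (x, y))%E) ->
  (\int[mu]_(x in A) \int[mu]_(y in B) F (x, y) =
   \int[mu]_(y in B) \int[mu]_(x in A) F (x, y))%E.
Proof.
move=> mA mB mF F0; set G := F \_ (A `*` B).
have mAB : measurable (A `*` B) by exact: measurableX.
have mG : measurable_fun setT G by apply/(measurable_restrictT F mAB).
have G0 w : (0 <= G w)%E.
  by rewrite /G patchE; case: ifPn => //; case: w => x y; rewrite in_setX => /andP[/set_mem Ax /set_mem By]; exact: F0.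
have := @fubini_tonelli _ _ _ _ R mu mu G mG G0; rewrite /fubini_F /fubini_G.
have GE x y : G (x, y) = if (x \in A) && (y \in B) then F (x, y) else 0%E.
  by rewrite /G patchE in_setX.
move=> h; rewrite [LHS]integral_mkcond [RHS]integral_mkcond.
transitivity (\int[mu]_x \int[mu]_y G (x, y))%E.
  apply: eq_integral => x _; rewrite patchE; case: ifPn => xA.
    by rewrite integral_mkcond; apply: eq_integral => y _; rewrite patchE GE xA.
  by rewrite integral0_eq// => y _; rewrite GE (negbTE xA).
rewrite h; apply: eq_integral => y _; rewrite patchE; case: ifPn => yB.
  by rewrite [RHS]integral_mkcond; apply: eq_integral => x _; rewrite patchE GE yB andbT.
by rewrite integral0_eq// => x _; rewrite GE (negbTE yB) andbF.
Qed.

Lemma measurable_section_integral (A B : set R) (F : R * R -> \bar R) :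
  measurable A -> measurable B ->
  measurable_fun (A `*` B) F -> (forall x y, A x -> B y -> (0 <= F (x, y))%E) ->
  measurable_fun A (fun x => \int[mu]_(y in B) F (x, y))%E.
Proof.
move=> mA mB mF F0; set G := F \_ (A `*` B).
have mAB : measurable (A `*` B) by exact: measurableX.
have mG : measurable_fun setT G by apply/(measurable_restrictT F mAB).
have G0 w : (0 <= G w)%E.
  by rewrite /G patchE; case: ifPn => //; case: w => x y; rewrite in_setX => /andP[/set_mem Ax /set_mem By]; exact: F0.
have := @measurable_fun_fubini_tonelli_F _ _ _ _ _ mu G mG G0.
move=> /(measurable_funS measurableT (@subsetT _ A)).
apply: eq_measurable_fun => x xA; rewrite /fubini_F [RHS]integral_mkcond.
by apply: eq_integral => y _; rewrite /G !patchE in_setX xA.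
Qed.

Lemma continuous_measurable (u : R -> R) : continuous u -> measurable_fun setT u.
Proof. exact: continuous_measurable_fun. Qed.

Lemma cont_scaleR (k : R) (u : R -> R) : continuous u -> continuous (fun t => k * u t).
Proof. by move=> cu; exact: (cont_mulR (@cst_continuous R R k) cu). Qed.

(** Young's inequality for the circle: [weighted_jensen] at each angle, then an
    exchange of integrals and periodicity. The angle [w] of the rotation may be any
    function of the variable, which covers convolutions and Poisson averages. *)
Lemma young_circle (k u v w : R -> R) (I q : R) :
  continuous k -> continuous u -> continuous v -> continuous w ->
  (forall t, 0 <= k t) -> (forall t, 0 <= u t) -> (forall t, 0 <= v t) ->
  (forall t, u (t + pi *+ 2) = u t) ->
  (forall s, 0 <= s <= pi *+ 2 -> `|w s| <= pi *+ 2) ->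
  1 <= q -> 0 < I -> rint 0 (pi *+ 2) k <= I ->
  (forall t, v t <= rint 0 (pi *+ 2) (fun s => k s * u (t + w s))) ->
  rint 0 (pi *+ 2) (fun t => v t `^ q) <= I `^ q * rint 0 (pi *+ 2) (fun t => u t `^ q).
Proof.
move=> ck cu cv cw k0 u0 v0 pu w2 q1 I0 kI vle.
have q0 : 0 < q by apply: lt_le_trans q1.
have cuq : continuous (fun t => u t `^ q) by exact: cont_powR.
have cvq : continuous (fun t => v t `^ q) by exact: cont_powR.
have uq0 t : 0 <= u t `^ q by exact: powR_ge0.
have cuw t : continuous (fun s => u (t + w s)).
  move=> s; apply: (@continuous_comp R R R (fun s => t + w s) u); last exact: cu.
  by apply: cvgD; [exact: cvg_cst|exact: cw].
have cuqw t : continuous (fun s => u (t + w s) `^ q) by exact: cont_powR.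
have cuqw' s : continuous (fun t => u (t + w s) `^ q).
  move=> t; apply: (@continuous_comp R R R (fun t => t + w s) (fun t => u t `^ q)); last exact: cuq.
  by apply: cvgD; [exact: cvg_id|exact: cvg_cst].
pose D : set R := `[0, pi *+ 2]%classic; have mD : measurable D by exact: measurable_itv.
pose X := rint 0 (pi *+ 2) (fun t => u t `^ q).
have X0 : 0 <= X by apply: Rintegral_ge0 => t _; exact: uq0.
have Iq : (0 <= (I `^ (q - 1))%:E)%E by rewrite lee_fin powR_ge0.
have mH : measurable_fun setT (fun z : R * R => (k z.2 * u (z.1 + w z.2) `^ q)%:E).
  apply/measurable_EFinP; apply: measurable_funM.
    exact: (measurableT_comp (continuous_measurable ck) (@measurable_snd _ _ R R)).
  apply: (measurableT_comp (continuous_measurable cuq)); apply: measurable_funD.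
    exact: measurable_fst.
  exact: (measurableT_comp (continuous_measurable cw) (@measurable_snd _ _ R R)).
have H0 x y : (0 <= (k y * u (x + w y) `^ q)%:E)%E by rewrite lee_fin mulr_ge0.
have J t : ((v t `^ q)%:E <= (I `^ (q - 1))%:E *
    \int[mu]_(s in D) (k s * u (t + w s) `^ q)%:E)%E.
  apply: weighted_jensen => //.
  - exact: measurable_funTS (continuous_measurable ck).
  - exact: measurable_funTS (continuous_measurable (cuw t)).
  - by rewrite rint_ge0E// lee_fin.
  - by rewrite rint_ge0E ?lee_fin//; exact: cont_mulR.
have mJ : measurable_fun D (fun t => \int[mu]_(s in D) (k s * u (t + w s) `^ q)%:E)%E.
  apply: (measurable_section_integral (F := fun z : R * R => (k z.2 * u (z.1 + w z.2) `^ q)%:E)) => //.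
  exact: measurable_funTS.
have E1 : ((rint 0 (pi *+ 2) (fun t => v t `^ q))%:E <= \int[mu]_(t in D)
    ((I `^ (q - 1))%:E * \int[mu]_(s in D) (k s * u (t + w s) `^ q)%:E))%E.
  rewrite -rint_ge0E//; apply: ge0_le_integral => //.
  - by move=> t _; rewrite lee_fin powR_ge0.
  - by apply/measurable_EFinP; exact: measurable_funTS (continuous_measurable cvq).
  - apply: emeasurable_funM; first exact: measurable_cst.
    exact: mJ.
rewrite -lee_fin; apply: le_trans E1 _.
rewrite ge0_integralZl//; last by move=> t _; apply: integral_ge0.
rewrite (tonelli_set (F := fun z : R * R => (k z.2 * u (z.1 + w z.2) `^ q)%:E))//; last exact: measurable_funTS.
have rotX s : 0 <= s <= pi *+ 2 -> rint 0 (pi *+ 2) (fun t => u (t + w s) `^ q) = X.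
  move=> s2; apply: (@rint_period R (w s) (fun t => u t `^ q)) => //; last exact: w2.
  by move=> t; rewrite pu.
have -> : (\int[mu]_(s in D) \int[mu]_(t in D) (k s * u (t + w s) `^ q)%:E =
    \int[mu]_(s in D) (X * k s)%:E)%E.
  apply: eq_integral => s /set_mem; rewrite /D /= in_itv /= => s2.
  by rewrite (rint_ge0E _ _ (@cont_scaleR (k s) _ (cuqw' s))) (rintZ _ _ _ (cuqw' s)) rotX// mulrC.
rewrite (rint_ge0E _ _ (@cont_scaleR X _ ck)) -EFinM lee_fin (rintZ _ _ _ ck).
rewrite mulrCA -[X in _ <= X]mulrC ler_wpM2l//.
by rewrite -(mulr_powRB1 (ltW I0) q0) mulrC ler_wpM2r// powR_ge0.
Qed.

End Tonelli.

Section Convolution.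
Context {R : realType}.
Implicit Types (f g h : Cplx R -> Cplx R) (q r t : R) (a b c : nat -> Cplx R).

Lemma cmod_cmean (u : R -> Cplx R) : continuous u ->
  cmod (cmean u) <= (pi *+ 2)^-1 * rint 0 (pi *+ 2) (fun t => cmod (u t)).
Proof.
move=> cu; rewrite /cmean cmodM cmod_real ger0_norm ?invr_ge0 ?pi2_ge0// ler_wpM2l ?invr_ge0 ?pi2_ge0//.
exact: cint_norm.
Qed.

(** Integrating against a trigonometric polynomial reads off coefficients. *)
Lemma cmean_trig f s c n : Hol f -> 0 < s < 1 ->
  cmean (fun t => f (circ s t) * \sum_(k < n) c k * (circ 1 t)^-1 ^+ k) =
  \sum_(k < n) c k * (taylor_coef f k * s%:C ^+ k).
Proof.
move=> hf s01; have s01' : 0 <= s < 1 by case/andP: s01 => /ltW ->.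
have cf := cont_circ (Hol_cont hf) s01'.
have ce k : continuous (fun t : R => (circ 1 t)^-1 ^+ k).
  by apply: cont_expC; exact: continuous_circV.
have cF k : continuous (fun t => c k * (f (circ s t) * (circ 1 t)^-1 ^+ k)).
  exact: (cont_mulC (cont_cstC _) (cont_mulC cf (ce k))).
rewrite (_ : (fun t => _) = (fun t => \sum_(k < n) c k * (f (circ s t) * (circ 1 t)^-1 ^+ k))).
  rewrite /cmean (cperiod_sum n cF).2 mulr_sumr; apply: eq_bigr => k _.
  rewrite /cperiod cintZ; last exact: (cont_mulC cf (ce k)).
  by rewrite mulrCA -/(cperiod _) -/(cmean _) -taylor_coef_cmean.
by apply/funext => t; rewrite mulr_sumr; apply: eq_bigr => k _; rewrite mulrCA.
Qed.

Lemma Hol_pseries_taylor f a : has_pseries a f -> Hol f /\ taylor_coef f = a.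
Proof. by move=> h; split; [exact: has_pseries_Hol h|exact: taylor_coefE]. Qed.

(** A Hadamard product is a convolution over the circle: for Taylor polynomials
    of [f] this is [cmean_trig], and the tails of [f] are uniformly small. *)
Lemma hadamard_cmean a b f g h rho sigma t :
  has_pseries a f -> has_pseries b g -> has_pseries (fun n => a n * b n) h ->
  0 <= rho < 1 -> 0 < sigma < 1 ->
  h (circ (rho * sigma) t) = cmean (fun s => f (circ rho (t - s)) * g (circ sigma s)).
Proof.
move=> hf hg hh r01 s01; have /andP[r0 r1] := r01; have /andP[s0 s1] := s01.
have [Hf _] := Hol_pseries_taylor hf; have [Hg gb] := Hol_pseries_taylor hg.
have s01' : 0 <= sigma < 1 by rewrite ltW.
have cg := cont_circ (Hol_cont Hg) s01'.
have cf : continuous (fun s => f (circ rho (t - s))).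
  move=> s; apply: (@continuous_comp R R (Cplx R) (fun s => t - s) (fun s => f (circ rho s))).
    by apply: cvgB; [exact: cvg_cst|exact: cvg_id].
  exact: (cont_circ (Hol_cont Hf) r01).
have [M M0 gM] := cont_bounded 0 (pi *+ 2) cg.
set L := cmean _.
suff U : psum (fun n => a n * b n) (circ (rho * sigma) t) @ \oo --> L.
  have z1 : cmod (circ (rho * sigma) t) < 1.
    by rewrite cmod_circ ?mulr_ge0 ?(ltW s0)// mulr_ilt1 ?(ltW s0).
  have /has_pseriesP /(_ _ z1) V := hh.
  by rewrite -(cvg_limC V) -(cvg_limC U).
apply/cvg_seqP => e e0.
pose e' := e / (M + 1) / 2.
have e'0 : 0 < e' by rewrite !divr_gt0// ltr_wpDl.
have eM : e' * (M + 1) = e / 2 by rewrite /e'; field; rewrite gt_eqF// ltr_wpDl.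
have [N HN] := has_pseries_tail hf r01 e'0.
exists N => n Nn.
pose c k := a k * circ rho t ^+ k.
have psE s : psum a (circ rho (t - s)) n = \sum_(k < n) c k * (circ 1 s)^-1 ^+ k.
  apply: eq_bigr => k _; rewrite /c -mulrA -exprMn; congr (_ * _ ^+ _).
  by rewrite circV circM invr1 mulr1.
have cp : continuous (fun s => psum a (circ rho (t - s)) n).
  have -> : (fun s => psum a (circ rho (t - s)) n) = (fun s => \sum_(k < n) c k * (circ 1 s)^-1 ^+ k).
    by apply/funext.
  apply: (cperiod_sum n (F := fun k s => c k * (circ 1 s)^-1 ^+ k) _).1 => k.
  have ce : continuous (fun t : R => (circ 1 t)^-1 ^+ k) by apply: cont_expC; exact: continuous_circV.
  exact: (cont_mulC (cont_cstC _) ce).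
have -> : psum (fun n => a n * b n) (circ (rho * sigma) t) n =
    cmean (fun s => psum a (circ rho (t - s)) n * g (circ sigma s)).
  rewrite (_ : (fun s => _) = (fun s => g (circ sigma s) * \sum_(k < n) c k * (circ 1 s)^-1 ^+ k)).
    rewrite cmean_trig// gb; apply: eq_bigr => k _.
    by rewrite mulrC (mulrC rho) -circ_scale exprMn /c; ring.
  by apply/funext => s; rewrite psE mulrC.
have -> : cmean (fun s => psum a (circ rho (t - s)) n * g (circ sigma s)) - L =
    cmean (fun s => (psum a (circ rho (t - s)) n - f (circ rho (t - s))) * g (circ sigma s)).
  rewrite /L /cmean -mulrBr; congr (_ * _).
  rewrite /cperiod -cintB; [|exact: (cont_mulC cp cg)|exact: (cont_mulC cf cg)].
  by congr cint; apply/funext => s; rewrite mulrBl.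
rewrite /cmean cmodM cmod_real ger0_norm ?invr_ge0 ?pi2_ge0//.
rewrite mulrC ltr_pdivrMr ?pi2_gt0//.
apply: (@le_lt_trans _ _ (e' * M * (pi *+ 2 - 0))).
  apply: cint_norm_le; first exact: pi2_ge0.
    exact: (cont_mulC (cont_subC cp cf) cg).
  move=> s hs; rewrite cmodM ler_pM ?cmod_ge0 ?gM// cmodB ltW//.
  by apply: HN => //; rewrite cmod_circ.
rewrite subr0 ltr_pM2r ?pi2_gt0//.
by clear - e0 e'0 eM M0; nra.
Qed.

(** Young's inequality for the convolution of [hadamard_cmean]. *)
Lemma hadamard_young a b f g h rho sigma (I q : R) :
  has_pseries a f -> has_pseries b g -> has_pseries (fun n => a n * b n) h ->
  0 <= rho < 1 -> 0 < sigma < 1 -> 1 <= q -> 0 < I ->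
  rint 0 (pi *+ 2) (fun t => cmod (g (circ sigma t))) <= I * (pi *+ 2) ->
  cint_pow q (rho * sigma) h <= I `^ q * cint_pow q rho f.
Proof.
move=> hf hg hh r01 s01 q1 I0 gI.
have s01' : 0 <= sigma < 1 by case/andP: s01 => /ltW ->.
have rs01 : 0 <= rho * sigma < 1.
  by have /andP[? ?] := r01; have /andP[? ?] := s01'; rewrite mulr_ge0//= mulr_ilt1.
have [Hf _] := Hol_pseries_taylor hf; have [Hg _] := Hol_pseries_taylor hg.
have [Hh _] := Hol_pseries_taylor hh.
have cf := cont_circ (Hol_cont Hf) r01.
have cg := cont_circ (Hol_cont Hg) s01'.
have ch := cont_circ (Hol_cont Hh) rs01.
have c1 : continuous (fun t => (pi *+ 2)^-1 * cmod (g (circ sigma t))).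
  have c0 := cont_cmod cg; exact: (@cont_scaleR _ (pi *+ 2)^-1 _ c0).
apply: (@young_circle R (fun t => (pi *+ 2)^-1 * cmod (g (circ sigma t)))
  (fun t => cmod (f (circ rho t))) _ (fun s => - s)) => //.
- exact: (cont_cmod cf).
- exact: (cont_cmod ch).
- by apply: cont_oppR => t; exact: cvg_id.
- by move=> t; rewrite mulr_ge0 ?cmod_ge0// invr_ge0 pi2_ge0.
- by move=> t; exact: cmod_ge0.
- by move=> t; exact: cmod_ge0.
- by move=> t; rewrite !circE cosD2pi sinD2pi.
- by move=> s /andP[s0 s1]; rewrite normrN ger0_norm.
- rewrite (rintZ _ _ _ (cont_cmod cg)).
  by rewrite ler_pdivrMl ?pi2_gt0// mulrC.
- move=> t; rewrite (hadamard_cmean t hf hg hh r01 s01).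
  have cft : continuous (fun s => f (circ rho (t - s))).
    move=> s; apply: (@continuous_comp R R (Cplx R) (fun s => t - s) (fun s => f (circ rho s))).
      by apply: cvgB; [exact: cvg_cst|exact: cvg_id].
    exact: cf.
  apply: le_trans (cmod_cmean (cont_mulC cft cg)) _.
  rewrite -rintZ; last exact: cont_cmod (cont_mulC cft cg).
  rewrite le_eqVlt; apply/orP; left; apply/eqP; congr rint; apply/funext => s.
  by rewrite cmodM mulrA mulrAC.
Qed.

Lemma HolP f : Hol f <-> forall z, cmod z < 1 -> exists l : Cplx R, is_cderiv f z l.
Proof.
split=> [hf z z1|hf z /discE/hf[l /is_cderivP[]//]].
by exists (derive1 f z); exact: Hol_cderiv.
Qed.

Lemma HolM f g : Hol f -> Hol g -> Hol (fun z => f z * g z).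
Proof.
move=> /HolP hf /HolP hg; apply/HolP => z z1.
have [l fl] := hf z z1; have [m gm] := hg z z1.
by exists (l * g z + f z * m); exact: is_cderivM.
Qed.

Lemma one_sub_neq0 (z w : Cplx R) : cmod z <= 1 -> cmod w < 1 -> 1 - z * w != 0.
Proof.
move=> z1 w1; apply/eqP => /eqP; rewrite subr_eq0 => /eqP h.
have := @cmod1 R; rewrite h cmodM => h1; have := cmod_ge0 z; have := cmod_ge0 w.
by clear - h1 z1 w1; nra.
Qed.

Lemma Hol_cauchy_kernel (a : Cplx R) : cmod a <= 1 -> Hol (fun z => (1 - a * z)^-1).
Proof.
move=> a1; apply/HolP => z z1; eexists; apply: is_cderivV; first exact: one_sub_neq0.
apply: (@is_cderiv_ext _ (fun w => - a * w + 1) _ _ _ 1) => //.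
  by move=> w _; rewrite addrC mulNr.
exact: is_cderiv_lin (is_cderiv_id _) (is_cderiv_cst _ _).
Qed.

Lemma has_pseries_dilate a f (w : Cplx R) : has_pseries a f -> cmod w <= 1 ->
  has_pseries (fun n => a n * w ^+ n) (fun z => f (w * z)).
Proof.
move=> /has_pseriesP h w1; apply/has_pseriesP => z z1.
have : cmod (w * z) < 1.
  rewrite cmodM; have := cmod_ge0 z; have := cmod_ge0 w; clear - w1 z1; nra.
move=> /h; rewrite (_ : psum _ _ = psum (fun n => a n * w ^+ n) z)//.
by apply/funext => n; apply: eq_bigr => k _; rewrite exprMn mulrA.
Qed.

Lemma Hol_dilate f (w : Cplx R) : Hol f -> cmod w <= 1 -> Hol (fun z => f (w * z)).
Proof. by move=> /Hol_pseries hf w1; exact: has_pseries_Hol (has_pseries_dilate hf w1). Qed.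

Lemma one_sub_circ r t : (1 - circ r t) * (1 - circ r (- t)) = (cmod (1 - circ r t) ^+ 2)%:C.
Proof.
rewrite !circE cosN sinN (_ : 1 - (r * cos t +i* (r * sin t)) = (1 - r * cos t) +i* (- (r * sin t)) :> Cplx R); last first.
  by apply: eqC; rewrite /= ?sub0r.
rewrite cmodE sqr_sqrtr ?addr_ge0 ?sqr_ge0//.
by apply: eqC; rewrite ?ReM ?ImM /=; ring.
Qed.

Lemma cmod_one_sub_circN r t : cmod (1 - circ r (- t)) = cmod (1 - circ r t).
Proof.
rewrite !circE cosN sinN.
have E y : 1 - (r * cos t +i* y) = (1 - r * cos t) +i* (- y) :> Cplx R.
  by apply: eqC; rewrite /= ?sub0r.
by rewrite !E !cmodE mulrN opprK sqrrN.
Qed.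

Lemma cmod_one_sub_circ_gt0 r t : 0 <= r < 1 -> 0 < cmod (1 - circ r t).
Proof.
move=> /andP[r0 r1]; apply: cmod_gt0.
by have := @one_sub_neq0 1 (circ r t); rewrite mul1r; apply; rewrite ?cmod1 ?cmod_circ.
Qed.

Lemma cont_one_sub_circ r : continuous (fun t => 1 - circ r t : Cplx R).
Proof. exact: (cont_subC (cont_cstC _) (@continuous_circ R r)). Qed.

Lemma cont_szego q r : 0 <= r < 1 -> 0 < q ->
  continuous (fun t => (cmod (1 - circ r t))^-1 `^ q).
Proof.
move=> r01 q0; apply: cont_powR => // [t|t]; last by rewrite invr_ge0 cmod_ge0.
apply: (@continuous_comp R R R (fun t => cmod (1 - circ r t)) GRing.inv).
  exact: (cont_cmod (@cont_one_sub_circ r)).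
by apply: inv_continuous; rewrite gt_eqF// cmod_one_sub_circ_gt0.
Qed.

(** Cauchy's formula for [f (w z) / (1 - tau z)] at a point of the radius: on the
    circle the second factor is conjugate to the Cauchy kernel, and their product is
    the Poisson kernel. *)
Lemma poisson_cperiod f rho sigma t : Hol f -> 0 < rho < 1 -> 0 <= sigma < 1 ->
  cperiod (fun s => f (circ rho (t + s)) * (cmod (1 - circ sigma s) ^+ 2)%:C^-1) =
  f (circ (rho * sigma) t) * (pi *+ 2 / (1 - sigma ^+ 2))%:C.
Proof.
move=> hf /andP[r0 r1] /andP[s0 s1].
pose m := Num.max rho sigma.
have m0 : 0 < m by rewrite /m lt_max r0.
have m1 : m < 1 by rewrite /m gt_max r1.
have mr : rho / m <= 1 by rewrite ler_pdivrMr// mul1r le_max lexx.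
have ms : sigma / m <= 1 by rewrite ler_pdivrMr// mul1r le_max lexx orbT.
have mr0 : 0 <= rho / m by rewrite divr_ge0 ?ltW.
have ms0 : 0 <= sigma / m by rewrite divr_ge0// ltW.
pose F z := f (circ (rho / m) t * z) * (1 - (sigma / m)%:C * z)^-1.
have hF : Hol F.
  apply: HolM; first by apply: Hol_dilate => //; rewrite cmod_circ.
  by apply: Hol_cauchy_kernel; rewrite cmod_real ger0_norm.
have aE : (sigma * m)%:C = circ (sigma * m) 0 :> Cplx R.
  by rewrite circE cos0 sin0 mulr0 mulr1.
have sm : cmod ((sigma * m)%:C : Cplx R) < m.
  by rewrite cmod_real ger0_norm ?mulr_ge0 ?(ltW m0)// gtr_pMl.
have m01 : 0 < m < 1 by rewrite m0.
have mn : m != 0 by rewrite gt_eqF.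
have := cauchy_formula hF m01 sm.
have -> : F (sigma * m)%:C = f (circ (rho * sigma) t) * (1 - sigma ^+ 2)%:C^-1.
  rewrite /F aE circM addr0 circ_scale; congr (f (circ _ _) * _^-1); first by field.
  rewrite circE cos0 sin0 mulr0 mulr1; apply: eqC; rewrite /= ?subr0//; congr (_ - _); by field.
have -> : (fun s => F (circ m s) / (1 - (sigma * m)%:C * (circ m s)^-1)) =
    (fun s => f (circ rho (t + s)) * (cmod (1 - circ sigma s) ^+ 2)%:C^-1).
  apply/funext => s; rewrite -one_sub_circ /F circM circ_scale !divfK//.
  by rewrite circV circ_scale mulfK// invfM mulrA.
move=> ->; rewrite -mulrA; congr (_ * _).
by rewrite -fmorphV -rmorphM /= mulrC.
Qed.

(** Poisson's formula for the constant function 1. *)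
Lemma rint_poisson (sigma : R) : 0 <= sigma < 1 ->
  rint 0 (pi *+ 2) (fun s => (cmod (1 - circ sigma s))^-1 ^+ 2) = pi *+ 2 / (1 - sigma ^+ 2).
Proof.
move=> s01; have h12 : 0 < (2^-1 : R) < 1 by rewrite invr_gt0 ltr0n /= invf_lt1 ?ltr1n.
have hc : Hol (fun _ : Cplx R => 1 : Cplx R).
  by apply/HolP => z _; exists 0; exact: is_cderiv_cst.
have := poisson_cperiod 0 hc h12 s01; rewrite mul1r.
rewrite (_ : (fun s => _) = (fun s => ((cmod (1 - circ sigma s))^-1 ^+ 2)%:C)).
  by move=> /(congr1 (@complex.Re R)) /= <-.
by apply/funext => s; rewrite mul1r -fmorphV exprVn.
Qed.

Lemma poisson_bound f rho sigma t : Hol f -> 0 < rho < 1 -> 0 <= sigma < 1 ->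
  cmod (f (circ (rho * sigma) t)) <= rint 0 (pi *+ 2) (fun s =>
    ((1 - sigma ^+ 2) / (pi *+ 2) * (cmod (1 - circ sigma s))^-1 ^+ 2) *
    cmod (f (circ rho (t + s)))).
Proof.
move=> hf r01 s01; have /andP[s0 s1] := s01.
have r01' : 0 <= rho < 1 by case/andP: r01 => /ltW ->.
have cf := cont_circ (Hol_cont hf) r01'.
have cft : continuous (fun s => f (circ rho (t + s))).
  move=> s; apply: (@continuous_comp R R (Cplx R) (fun s => t + s) (fun s => f (circ rho s))).
    by apply: cvgD; [exact: cvg_cst|exact: cvg_id].
  exact: cf.
have ck : continuous (fun s => (cmod (1 - circ sigma s) ^+ 2)%:C^-1 : Cplx R).
  rewrite (_ : (fun s => _) = (fun s => (1 - circ sigma s)^-1 * (1 - circ sigma (- s))^-1)); last first.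
    by apply/funext => s; rewrite -one_sub_circ invfM.
  have n0 s : 1 - circ sigma s != 0 :> Cplx R.
    by apply/eqP => h; have := cmod_one_sub_circ_gt0 s s01; rewrite h cmod0 ltxx.
  have c1 := cont_invC (@cont_one_sub_circ sigma) n0.
  apply: (cont_mulC c1) => s.
  apply: (@continuous_comp R R (Cplx R) (fun s => - s) (fun s => (1 - circ sigma s)^-1)); last exact: c1.
  exact: opp_continuous.
have S0 : 0 < 1 - sigma ^+ 2 by rewrite subr_gt0 expr_lt1.
have := poisson_cperiod t hf r01 s01 => /(congr1 (@cmod R)).
rewrite cmodM cmod_real gtr0_norm ?divr_gt0 ?pi2_gt0// => h.
have -> : cmod (f (circ (rho * sigma) t)) = (1 - sigma ^+ 2) / (pi *+ 2) *
    cmod (cperiod (fun s => f (circ rho (t + s)) * (cmod (1 - circ sigma s) ^+ 2)%:C^-1)).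
  by rewrite h mulrCA -[X in _ * (_ * X)]invf_div mulfV ?mulr1// mulf_neq0 ?invr_neq0// gt_eqF// pi2_gt0.
have cfk := cont_mulC cft ck.
apply: le_trans (ler_wpM2l _ (cint_norm 0 (pi *+ 2) cfk)) _.
  by rewrite divr_ge0 ?(ltW S0)// pi2_ge0.
rewrite -rintZ; last exact: cont_cmod.
rewrite le_eqVlt; apply/orP; left; apply/eqP; congr rint; apply/funext => s.
rewrite cmodM cmodV cmod_real ger0_norm ?sqr_ge0// exprVn; by ring.
Qed.

(** The values on the smaller circle are Poisson averages of those on the larger
    one, and averages do not increase [L^q] norms. *)
Theorem cint_pow_homo f q r s : Hol f -> 1 <= q -> 0 <= r -> r <= s -> s < 1 ->
  cint_pow q r f <= cint_pow q s f.
Proof.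
move=> hf q1 r0 rs s1.
have [s00|sn0] := eqVneq s 0; first by have -> : r = s by apply/eqP; rewrite eq_le rs s00 r0.
have s0 : 0 < s by rewrite lt_neqAle eq_sym sn0 (le_trans r0).
have [->//|rsn] := eqVneq r s.
have {}rs : r < s by rewrite lt_neqAle rsn.
pose c := r / s; have c01 : 0 <= c < 1 by rewrite divr_ge0 ?(ltW s0)//= ltr_pdivrMr// mul1r.
have -> : r = s * c by rewrite /c mulrC divfK.
have s01 : 0 < s < 1 by rewrite s0.
have s01' : 0 <= s < 1 by rewrite ltW.
have sc01 : 0 <= s * c < 1.
  by have /andP[? ?] := c01; rewrite mulr_ge0 ?(ltW s0)//= mulr_ilt1// ltW.
have S0 : 0 < 1 - c ^+ 2 by have /andP[? ?] := c01; rewrite subr_gt0 expr_lt1.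
have cf := cont_circ (Hol_cont hf) s01'.
have ck : continuous (fun t => (cmod (1 - circ c t))^-1 ^+ 2).
  rewrite (_ : (fun t => _) = (fun t => (cmod (1 - circ c t))^-1 `^ 2)); first exact: cont_szego.
  by apply/funext => t; rewrite powR_mulrn// invr_ge0 cmod_ge0.
have E : (1 : R) `^ q = 1 by rewrite powR1.
suff: cint_pow q (s * c) f <= 1 `^ q * cint_pow q s f by rewrite E mul1r.
apply: (@young_circle R (fun t => (1 - c ^+ 2) / (pi *+ 2) * (cmod (1 - circ c t))^-1 ^+ 2)
  (fun t => cmod (f (circ s t))) _ (fun t => t)) => //; clear E.
- exact: (@cont_scaleR _ ((1 - c ^+ 2) / (pi *+ 2)) _ ck).
- exact: (cont_cmod cf).
- have cs := cont_circ (Hol_cont hf) sc01; exact: (cont_cmod cs).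
- by move=> t; exact: cvg_id.
- by move=> t; rewrite mulr_ge0 ?sqr_ge0// divr_ge0 ?(ltW S0)// pi2_ge0.
- by move=> t; exact: cmod_ge0.
- by move=> t; exact: cmod_ge0.
- by move=> t; rewrite !circE cosD2pi sinD2pi.
- by move=> t /andP[t0 t1]; rewrite ger0_norm.
- rewrite rintZ// rint_poisson// le_eqVlt; apply/orP; left; apply/eqP.
  by rewrite -[X in _ * X]invf_div mulfV// mulf_neq0 ?invr_neq0// gt_eqF// pi2_gt0.
- by move=> t; exact: poisson_bound.
Qed.

End Convolution.

(** * Schur's test on the unit interval *)

Section PowerIntegrals.
Context {R : realType}.
Notation mu := (@lebesgue_measure R).
Implicit Types (f g : R -> R) (D : set R).

Lemma powRD_gt0 (x r s : R) : 0 < x -> x `^ (r + s) = x `^ r * x `^ s.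
Proof. by move=> x0; rewrite powRD// (gt_eqF x0) implybT. Qed.

Lemma le_integral_EFin D f g : measurable D -> measurable_fun D f -> measurable_fun D g ->
  (forall x, D x -> 0 <= f x <= g x) ->
  (\int[mu]_(x in D) (f x)%:E <= \int[mu]_(x in D) (g x)%:E)%E.
Proof.
move=> mD mf mg fg; apply: ge0_le_integral => //.
- by move=> x /fg /andP[]; rewrite lee_fin.
- exact/measurable_EFinP.
- exact/measurable_EFinP.
- by move=> x /fg /andP[]; rewrite lee_fin.
Qed.

Lemma integralZl_EFin D f (k : R) : measurable D -> measurable_fun D f ->
  (forall x, D x -> 0 <= f x) -> 0 <= k ->
  (\int[mu]_(x in D) (k * f x)%:E = k%:E * \int[mu]_(x in D) (f x)%:E)%E.
Proof.
move=> mD mf f0 k0; rewrite -ge0_integralZl//.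
exact/measurable_EFinP.
Qed.

Lemma integral_reflect D (c : R) f : measurable D -> measurable_fun D f ->
  (forall x, D x -> 0 <= f x) ->
  (\int[mu]_(x in D) (f x)%:E = \int[mu]_(x in [set x | D (c - x)%R]) (f (c - x)%R)%:E)%E.
Proof.
move=> mD mf f0; rewrite integral_mkcond [RHS]integral_mkcond.
set G := _ \_ D.
have mG : measurable_fun setT G by apply/(measurable_restrictT _ mD); exact/measurable_EFinP.
have G0 x : (0 <= G x)%E by rewrite /G patchE; case: ifPn => // /set_mem /f0; rewrite lee_fin.
have mGN : measurable_fun setT (fun x : R => G (- x)) by exact: measurableT_comp.
rewrite (ge0_integral_opp mG G0) (ge0_integral_shift (- c) mGN)//.
apply: eq_integral => x _; rewrite opprD opprK addrC /G !patchE.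
by rewrite (_ : (x \in [set x | D (c - x)]) = (c - x \in D))//; apply/idP/idP; rewrite !inE.
Qed.

Lemma integral_flip01 f : measurable_fun (`]0, 1[ : set R) f -> (forall x, 0 < x < 1 -> 0 <= f x) ->
  (\int[mu]_(x in `]0%R, 1%R[) (f x)%:E = \int[mu]_(x in `]0%R, 1%R[) (f (1 - x)%R)%:E)%E.
Proof.
move=> mf f0; rewrite (integral_reflect 1)//.
congr (integral _ _ _); apply/seteqP; split => x /=; rewrite !in_itv /= subr_gt0 gtrBl andbC//.
Qed.

Lemma continuous_powRD (d c x : R) : 0 < x + d -> {for x, continuous (fun x : R => (x + d) `^ c)}.
Proof.
move=> x0; apply: (@continuous_comp R R R (fun x => x + d) (fun x => x `^ c)).
  by apply: cvgD; [exact: cvg_id|exact: cvg_cst].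
by apply/differentiable_continuous/derivable1_diffP; apply: derivable_powR; rewrite in_itv /= x0.
Qed.

Lemma is_derive_powRD (d c x : R) : c != 0 -> 0 < x + d ->
  is_derive x (1 : R) (fun x : R => c^-1 * (x + d) `^ c) ((x + d) `^ (c - 1)).
Proof.
move=> c0 x0.
have h1 : is_derive x (1 : R) (fun x : R => x + d) 1.
  by apply: is_derive_eq; rewrite addr0.
have h2 : is_derive (x + d) (1 : R) (fun x : R => x `^ c) (c * (x + d) `^ (c - 1)).
  exact: is_derive1_powR.
have h3 := is_derive1_comp (f := fun x : R => x `^ c) (g := fun x => x + d) h2 h1.
have := is_deriveZ (c^-1 : R) h3 => h; apply: is_derive_eq h _.
by rewrite mulr1 -[LHS]/(c^-1 * _) mulrA mulVf// mul1r.
Qed.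

Lemma integral_powR (a b d c : R) : a < b -> 0 < a + d -> c != 0 ->
  (\int[mu]_(x in `[a, b]) ((x + d) `^ (c - 1))%:E =
   (c^-1 * ((b + d) `^ c - (a + d) `^ c))%:E)%E.
Proof.
move=> ab ad c0.
have pos x : a <= x -> 0 < x + d by move=> ax; apply: lt_le_trans ad _; rewrite lerD2r.
have cF x : a <= x -> {for x, continuous (fun x : R => c^-1 * (x + d) `^ c)}.
  by move=> ax; apply: cvgM; [exact: cvg_cst|exact: continuous_powRD (pos _ ax)].
rewrite (@continuous_FTC2 R _ (fun x : R => c^-1 * (x + d) `^ c))//.
- by rewrite -EFinB mulrBr.
- apply: continuous_in_subspaceT => x; rewrite inE /= in_itv /= => /andP[ax _].
  exact: continuous_powRD (pos _ ax).
- split.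
  + move=> x; rewrite in_itv /= => /andP[/ltW/pos x0 _].
    by have [] := is_derive_powRD c0 x0.
  + exact: cvg_at_right_filter (cF _ (lexx a)).
  + exact: cvg_at_left_filter (cF _ (ltW ab)).
- move=> x; rewrite in_itv /= => /andP[/ltW/pos x0 _].
  by rewrite derive1E; have [_] := is_derive_powRD c0 x0.
Qed.

(** Monotone convergence over the intervals from [a] to [b] as [a] tends to 0. *)
Lemma integral_oc_le (b C : R) f : 0 < b -> measurable_fun (`]0, b] : set R) f ->
  (forall x, 0 < x <= b -> 0 <= f x) ->
  (forall a, 0 < a < b -> (\int[mu]_(x in `[a, b]) (f x)%:E <= C%:E)%E) ->
  (\int[mu]_(x in `]0%R, b]) (f x)%:E <= C%:E)%E.
Proof.
move=> b0 mf f0 H.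
pose I (n : nat) : set R := `[b / n.+2%:R, b]%classic.
have I0 n : 0 < b / n.+2%:R by rewrite divr_gt0// ltr0n.
have UI : \bigcup_n I n = `]0, b]%classic.
  apply/seteqP; split => [x [n _]|x]; rewrite /I /= !in_itv /=.
    by move=> /andP[h ->]; rewrite andbT (lt_le_trans _ h).
  move=> /andP[x0 xb]; exists (Num.truncn (b / x)) => //=; rewrite in_itv /= xb andbT.
  rewrite ler_pdivrMr ?ltr0n// mulrC -ler_pdivrMr//.
  by apply/ltW/(lt_le_trans (truncnS_gt _)); rewrite ler_nat.
have sub n : I n `<=` `]0, b]%classic by rewrite -UI; exact: bigcup_sup.
have h : (\int[mu]_(u in I n) (f u)%:E @[n --> \oo] --> \int[mu]_(u in `]0%R, b]) (f u)%:E)%E.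
  rewrite -UI; apply: ge0_nondecreasing_set_cvg_integral => //.
  - apply/nondecreasing_seqP => n; apply/subsetPset => x; rewrite /I /= !in_itv /= => /andP[h1 ->].
    rewrite andbT (le_trans _ h1)// ler_pM2l// lef_pV2 ?posrE ?ltr0n// ler_nat//.
  - by move=> i; exact: measurable_itv.
  - by move=> i; apply/measurable_EFinP; apply: measurable_funS mf => //; exact: sub.
  - by move=> i x /sub; rewrite /= in_itv /= => /f0; rewrite lee_fin.
rewrite -(cvg_lim _ h)//; apply: lime_le; first by apply/cvg_ex; eexists; exact: h.
apply: nearW => n; apply: H; rewrite I0/= ltr_pdivrMr ?ltr0n// ltr_pMr//.
by rewrite ltr1n.
Qed.

Lemma measurable_powR_oo (c : R) D : measurable_fun D (fun x : R => x `^ c).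
Proof. by apply: measurable_funTS; exact: measurable_powR. Qed.

Lemma measurable_powRD (d c : R) D : measurable_fun D (fun x : R => (x + d) `^ c).
Proof.
apply: measurable_funTS; apply: (measurableT_comp (measurable_powR c)).
exact: measurable_funD.
Qed.

Lemma integral_powR0 (b c : R) : 0 < b -> 0 < c ->
  (\int[mu]_(x in `]0%R, b]) (x `^ (c - 1))%:E <= (c^-1 * b `^ c)%:E)%E.
Proof.
move=> b0 c0; apply: integral_oc_le => //.
- exact: measurable_powR_oo.
- by move=> x _; exact: powR_ge0.
move=> a /andP[a0 ab]; under eq_integral do rewrite -[X in X `^ _]addr0.
rewrite integral_powR ?addr0// ?gt_eqF// lee_fin ler_wpM2l ?invr_ge0 ?(ltW c0)//.
by rewrite gerBl powR_ge0.
Qed.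

Lemma measurable_inv : measurable_fun setT (GRing.inv : R -> R).
Proof.
rewrite -(setvU [set (0 : R)]).
apply/measurable_funU => //; first exact: measurableC.
split; last exact: measurable_fun_set1.
apply: open_continuous_measurable_fun => [|x].
  rewrite openC; exact: accessible_closed_set1 (hausdorff_accessible (@Rhausdorff R)) 0.
by rewrite inE /= => /eqP x0; exact: inv_continuous.
Qed.

Lemma measurable_max_inv (s : R) D : measurable_fun D (fun u : R => (Num.max u s)^-1).
Proof.
apply: measurable_funTS; apply: (measurableT_comp measurable_inv).
exact: measurable_maxr.
Qed.

Lemma integral_split01 (s : R) f : 0 <= s < 1 -> measurable_fun (`]0, 1[ : set R) f ->
  (forall x, 0 < x < 1 -> 0 <= f x) ->
  (\int[mu]_(x in `]0%R, 1%R[) (f x)%:E =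
   \int[mu]_(x in `]0%R, s]) (f x)%:E + \int[mu]_(x in `]s, 1%R[) (f x)%:E)%E.
Proof.
move=> /andP[s0 s1] mf f0; have E : `]0, 1[%classic = (`]0, s] `|` `]s, 1[ : set R).
  apply/seteqP; split => x /=; rewrite !in_itv /=.
    by move=> /andP[-> ->]; rewrite andbT /=; case: (leP x s) => _; [left|right].
  case=> /andP[h1 h2]; first by rewrite h1 (le_lt_trans h2).
  by rewrite h2 (le_lt_trans s0).
rewrite E ge0_integral_setU//; last first.
- apply/disj_setPS => x /= []; rewrite !in_itv /= => /andP[_ xs] /andP[sx _].
  by have := le_lt_trans xs sx; rewrite ltxx.
- by move=> x; rewrite -E /= in_itv /= lee_fin => /f0.
- by rewrite -E; apply/measurable_EFinP.
Qed.

(** The kernel of [schur_max] against its test function [u `^ (- gam)]; the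
    integral is split at [u = s]. *)
Lemma max_kernel_integral (gam s : R) : 0 < gam < 1 -> 0 < s < 1 ->
  (\int[mu]_(u in `]0%R, 1%R[) (u `^ (- gam) / Num.max u s)%:E <=
   ((gam^-1 + (1 - gam)^-1) * s `^ (- gam))%:E)%E.
Proof.
move=> /andP[g0 g1] /andP[s0 s1].
have mm D : measurable_fun D (fun u : R => u `^ (- gam) / Num.max u s).
  apply: measurable_funM; first exact: measurable_powR_oo.
  exact: measurable_max_inv.
have pos x : 0 <= x `^ (- gam) / Num.max x s.
  by rewrite divr_ge0 ?powR_ge0// le_max (ltW s0) orbT.
rewrite (integral_split01 (introT andP (conj (ltW s0) s1)) (mm _) (fun x _ => pos x)).
rewrite mulrDl [gam^-1 * _ + _]addrC EFinD; apply: leeD.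
  apply: (@le_trans _ _ (\int[mu]_(x in `]0%R, s]) (s^-1 * x `^ ((1 - gam) - 1))%:E)%E).
    apply: le_integral_EFin; [exact: measurable_itv|exact: mm| |].
      by apply: measurable_funM => //; exact: measurable_powR_oo.
    move=> x /=; rewrite in_itv /= => /andP[x0 xs]; rewrite pos/= mulrC.
    rewrite (_ : 1 - gam - 1 = - gam); last by ring.
    by rewrite (max_idPr xs).
  rewrite integralZl_EFin ?invr_ge0 ?(ltW s0)//; last 2 first.
  - exact: measurable_powR_oo.
  - by move=> x _; exact: powR_ge0.
  apply: (@le_trans _ _ ((s^-1)%:E * ((1 - gam)^-1 * s `^ (1 - gam))%:E)%E).
    by apply: lee_wpmul2l; rewrite ?lee_fin ?invr_ge0 ?(ltW s0)// integral_powR0// subr_gt0.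
  rewrite -EFinM lee_fin mulrCA ler_wpM2l ?invr_ge0 ?subr_ge0 ?(ltW g1)//.
  rewrite (powRD_gt0 _ _ s0).
  by rewrite powRr1 ?(ltW s0)// mulrA mulVf ?mul1r ?gt_eqF.
apply: (@le_trans _ _ (\int[mu]_(x in `[s, 1%R]) ((x + 0) `^ ((- gam) - 1))%:E)%E).
  apply: (@le_trans _ _ (\int[mu]_(x in `]s, 1%R[) ((x + 0) `^ ((- gam) - 1))%:E)%E).
    apply: le_integral_EFin; [exact: measurable_itv|exact: mm|exact: measurable_powRD|].
    move=> x /=; rewrite in_itv /= => /andP[sx x1]; rewrite pos/= addr0 (max_idPl (ltW sx)).
    have x0 : 0 < x by apply: lt_trans sx.
    rewrite (powRD_gt0 _ _ x0).
    by rewrite powR_inv1 ?(ltW x0).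
  apply: ge0_subset_integral => //.
  - by apply/measurable_EFinP; exact: measurable_powRD.
  - by move=> x _; rewrite lee_fin powR_ge0.
  - by move=> x /=; rewrite !in_itv /= => /andP[/ltW -> /ltW ->].
rewrite integral_powR ?addr0// ?oppr_eq0 ?gt_eqF// lee_fin powR1 invrN mulNr -mulrN opprB.
by rewrite ler_wpM2l ?invr_ge0 ?(ltW g0)// gerBl.
Qed.

(** Schur's test for the kernel [1 / max u s] with the power weight [s ^ kappa]:
    [weighted_jensen] for the measure [u ^ (- gam) / max u s du], then an exchange
    of integrals and [max_kernel_integral] once more. *)
Lemma schur_max (kappa q gam : R) (W V : R -> R) : 0 <= kappa -> 1 + kappa < q ->
  gam * q = 1 + kappa ->
  measurable_fun setT W -> measurable_fun (`]0, 1[ : set R) V ->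
  (forall u, 0 < u < 1 -> 0 <= W u) ->
  (forall s, 0 < s < 1 -> 0 <= V s) ->
  (forall s, 0 < s < 1 ->
    ((V s)%:E <= \int[mu]_(u in `]0%R, 1%R[) (W u / Num.max u s)%:E)%E) ->
  (\int[mu]_(s in `]0%R, 1%R[) (s `^ kappa * V s `^ q)%:E <=
   ((gam^-1 + (1 - gam)^-1) `^ q)%:E * \int[mu]_(u in `]0%R, 1%R[) (u `^ kappa * W u `^ q)%:E)%E.
Proof.
move=> k0 kq gq mW mV W0 V0 VW.
have q1 : 1 < q by apply: le_lt_trans kq; rewrite lerDl.
have q0 : 0 < q by apply: lt_trans q1.
have gE : gam = (1 + kappa) / q by rewrite -gq mulfK ?gt_eqF.
have g0 : 0 < gam by rewrite gE divr_gt0// ltr_wpDr.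
have g1 : gam < 1 by rewrite gE ltr_pdivrMr// mul1r.
set C := _ + _.
have C0 : 0 < C by rewrite addr_gt0 ?invr_gt0 ?subr_gt0.
pose k s (u : R) := u `^ (- gam) / Num.max u s.
pose F u := W u * u `^ gam.
have mk s D : measurable_fun D (k s).
  apply: measurable_funM; first exact: measurable_powR_oo.
  exact: measurable_max_inv.
have mp (c : R) D : measurable_fun D (fun x : R => x `^ c) by exact: measurable_powR_oo.
have mWq : measurable_fun setT (fun u => W u `^ q).
  exact: (measurableT_comp (measurable_powR q)).
have max0 (u s : R) : 0 < u -> 0 < Num.max u s by move=> u0; rewrite lt_max u0.
have J s : 0 < s < 1 -> ((V s `^ q)%:E <= ((C * s `^ (- gam)) `^ (q - 1))%:E *
    \int[mu]_(u in `]0%R, 1%R[) (u `^ (1 + kappa - gam) / Num.max u s * W u `^ q)%:E)%E.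
  move=> s01; have /andP[s0 s1] := s01.
  have := @weighted_jensen _ _ R mu (`]0, 1[ : set R) (k s) F (C * s `^ (- gam)) (V s) q.
  have -> : (\int[mu]_(x in `]0%R, 1%R[) (k s x * F x `^ q)%:E =
      \int[mu]_(u in `]0%R, 1%R[) (u `^ (1 + kappa - gam) / Num.max u s * W u `^ q)%:E)%E.
    apply: eq_integral => u /set_mem /=; rewrite in_itv /= => u01; have /andP[u0 u1] := u01.
    rewrite /k /F powRM ?powR_ge0 ?W0// -powRrM gq.
    by rewrite (powRD_gt0 (1 + kappa) _ u0); congr EFin; ring.
  apply => //.
  - exact: mk.
  - apply: measurable_funM => //; exact: measurable_funTS.
  - by move=> u /=; rewrite in_itv /= => /andP[u0 u1]; rewrite divr_ge0 ?powR_ge0// ltW// max0.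
  - by move=> u /=; rewrite in_itv /= => u01; rewrite mulr_ge0 ?powR_ge0// W0.
  - exact: ltW.
  - by rewrite mulr_gt0// powR_gt0.
  - exact: V0.
  - by apply: max_kernel_integral => //; rewrite g0.
  - apply: le_trans (VW s s01) _; rewrite le_eqVlt; apply/orP; left; apply/eqP.
    apply: eq_integral => u /set_mem /=; rewrite in_itv /= => /andP[u0 u1].
    rewrite /k /F; congr EFin; rewrite powRN; have : u `^ gam != 0 by rewrite gt_eqF// powR_gt0.
    by have := max0 u s u0; set m := Num.max _ _ => m0 h; field; rewrite h gt_eqF.
pose H (z : R * R) : R := C `^ (q - 1) *
  (z.1 `^ (gam - 1) * z.2 `^ (1 + kappa - gam) / Num.max z.2 z.1 * W z.2 `^ q).
have mH : measurable_fun setT H.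
  have m1 : measurable_fun setT (fst : R * R -> R) by exact: measurable_fst.
  have m2 : measurable_fun setT (snd : R * R -> R) by exact: measurable_snd.
  apply: measurable_funM => //; apply: measurable_funM; last exact: (measurableT_comp mWq).
  apply: measurable_funM.
    by apply: measurable_funM; [exact: (measurableT_comp (mp _ setT))|exact: (measurableT_comp (mp _ setT))].
  by apply: (measurableT_comp measurable_inv); exact: measurable_maxr.
have mHs s : measurable_fun setT (fun u => H (s, u)) by exact: (measurableT_comp mH (measurable_pair1 s)).
have mHu u : measurable_fun setT (fun s => H (s, u)) by exact: (measurableT_comp mH (measurable_pair2 u)).
have H0 s u : 0 < s < 1 -> 0 < u < 1 -> 0 <= H (s, u).
  move=> /andP[s0 s1] /andP[u0 u1]; rewrite /H /= !mulr_ge0 ?powR_ge0//.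
  by rewrite invr_ge0 ltW// max0.
apply: (@le_trans _ _ (\int[mu]_(s in `]0%R, 1%R[) \int[mu]_(u in `]0%R, 1%R[) (H (s, u))%:E)%E).
  apply: ge0_le_integral => //.
  - move=> s /=; rewrite in_itv /= => s01; rewrite lee_fin mulr_ge0 ?powR_ge0//.
  - apply/measurable_EFinP; apply: measurable_funM; first exact: mp.
    exact: (measurableT_comp (measurable_powR q)).
  - apply: (measurable_section_integral (F := EFin \o H)) => //.
    exact/measurable_funTS/measurable_EFinP.
  move=> s /=; rewrite in_itv /= => s01; have /andP[s0 s1] := s01.
  apply: (@le_trans _ _ ((s `^ kappa)%:E * (((C * s `^ (- gam)) `^ (q - 1))%:E *
      \int[mu]_(u in `]0%R, 1%R[) (u `^ (1 + kappa - gam) / Num.max u s * W u `^ q)%:E))%E).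
    by rewrite EFinM; apply: lee_wpmul2l; [rewrite lee_fin powR_ge0|exact: J].
  have pos u : 0 < u < 1 -> 0 <= u `^ (1 + kappa - gam) / Num.max u s * W u `^ q.
    by move=> /andP[u0 u1]; rewrite mulr_ge0 ?powR_ge0// divr_ge0 ?powR_ge0// ltW// max0.
  have mK : measurable_fun (`]0, 1[ : set R) (fun u => u `^ (1 + kappa - gam) / Num.max u s * W u `^ q).
    apply: measurable_funM; last exact: measurable_funTS.
    by apply: measurable_funM => //; exact: measurable_max_inv.
  rewrite -!integralZl_EFin ?powR_ge0//; last 2 first.
  - exact: (measurable_funM (measurable_cst _) mK).
  - by move=> u /=; rewrite in_itv /= => /pos h; rewrite mulr_ge0 ?powR_ge0.
  rewrite le_eqVlt; apply/orP; left; apply/eqP; apply: eq_integral => u _; congr EFin.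
  rewrite /H /= powRM ?powR_ge0 ?(ltW C0)// -powRrM.
  rewrite (_ : gam - 1 = kappa + - gam * (q - 1)); last by move: gq; clear; nra.
  by rewrite (powRD_gt0 kappa _ s0); ring.
have I01 : measurable (`]0, 1[ : set R) by exact: measurable_itv.
have H0' x y : `]0, 1[%classic x -> `]0, 1[%classic y -> (0 <= (EFin \o H) (x, y))%E.
  by rewrite /= !in_itv /= => x01 y01; rewrite lee_fin H0.
have mEH : measurable_fun (`]0, 1[ `*` `]0, 1[ : set (R * R)) (EFin \o H).
  exact/measurable_funTS/measurable_EFinP.
have mKW : measurable_fun (`]0, 1[ : set R) (fun u => u `^ kappa * W u `^ q).
  by apply: measurable_funM; [exact: mp|exact: measurable_funTS].
have KW0 u : `]0, 1[%classic u -> 0 <= u `^ kappa * W u `^ q by rewrite mulr_ge0 ?powR_ge0.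
rewrite (tonelli_set I01 I01 mEH H0') -(integralZl_EFin I01 mKW KW0 (powR_ge0 _ _)).
apply: ge0_le_integral.
- exact: I01.
- by move=> u u01; apply: integral_ge0 => s s01; exact: H0'.
- apply: (measurable_section_integral (F := EFin \o (fun z => H (z.2, z.1)))) => //.
    apply/measurable_funTS/measurable_EFinP; apply: (measurableT_comp mH).
    apply: measurable_fun_pair; [exact: measurable_snd|exact: measurable_fst].
  by move=> x y xD yD; exact: H0'.
- by apply/measurable_EFinP; exact: (measurable_funM (measurable_cst _) mKW).
move=> u /=; rewrite in_itv /= => u01; have /andP[u0 u1] := u01.
rewrite (_ : (fun s => (H (s, u))%:E) = (fun s => (C `^ (q - 1) * u `^ (1 + kappa - gam) * W u `^ q *
    (s `^ (- (1 - gam)) / Num.max s u))%:E)); last first.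
  by apply/funext => s; rewrite /H /= maxC opprB; congr EFin; ring.
have c0 : 0 <= C `^ (q - 1) * u `^ (1 + kappa - gam) * W u `^ q by rewrite !mulr_ge0 ?powR_ge0.
have mL : measurable_fun (`]0, 1[ : set R) (fun s => s `^ (- (1 - gam)) / Num.max s u).
  by apply: measurable_funM; [exact: mp|exact: measurable_max_inv].
have L0 s : `]0, 1[%classic s -> 0 <= s `^ (- (1 - gam)) / Num.max s u.
  by rewrite /= in_itv /= => /andP[s0 s1]; rewrite divr_ge0 ?powR_ge0// ltW// max0.
rewrite (integralZl_EFin I01 mL L0 c0).
apply: (@le_trans _ _ ((C `^ (q - 1) * u `^ (1 + kappa - gam) * W u `^ q)%:E *
    (C * u `^ (- (1 - gam)))%:E)%E).
  apply: lee_wpmul2l; first by rewrite lee_fin.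
  have := @max_kernel_integral (1 - gam) u; rewrite (_ : 1 - (1 - gam) = gam); last by ring.
  by rewrite [(1 - gam)^-1 + _]addrC; apply => //; rewrite subr_gt0 g1 gtrBl.
rewrite -EFinM lee_fin -(mulr_powRB1 (ltW C0) q0).
rewrite [in X in _ <= X](_ : kappa = (1 + kappa - gam) + - (1 - gam)); last by ring.
rewrite (powRD_gt0 (1 + kappa - gam) _ u0).
by rewrite le_eqVlt; apply/orP; left; apply/eqP; ring.
Qed.

End PowerIntegrals.

(** * Kernel estimates and growth of holomorphic functions *)

Lemma cint_powE {R : realType} (q r : R) f :
  cint_pow q r f = rint 0 (pi *+ 2) (fun t => cmod (f (circ r t)) `^ q).
Proof. by []. Qed.

Opaque cint_pow bergman_int rint.

Section CauchyKernel.
Context {R : realType}.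
Notation mu := (@lebesgue_measure R).
Implicit Types (f g : Cplx R -> Cplx R) (p q r s t : R).

Lemma sin_ge_lin t : 0 <= t <= 1 -> cos 1 * t <= sin t.
Proof.
move=> /andP[t0 t1]; have p3 : (1 : R) <= pi by apply: le_trans (pi_ge2 R); lra.
have [|c cI E] := @MVT_segment R sin cos 0 t t0 (fun x _ => is_derive_sin x).
  by apply: continuous_subspaceT; exact: continuous_sin.
move: E; rewrite sin0 !subr0 => ->; apply: ler_wpM2r => //.
move: cI; rewrite in_itv /= => /andP[c0 ct].
rewrite leNgt ltr_cos ?in_itv/= -?leNgt; first exact: le_trans t1.
  by rewrite ler01.
by rewrite c0 (le_trans ct) ?(le_trans t1).
Qed.

(** Near the origin by the mean value theorem and [sin_ge_lin], elsewhere because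
    the cosine decreases. *)
Lemma one_sub_cos_ge : exists2 c : R, 0 < c <= 1 & forall t, 0 <= t <= pi -> c * t ^+ 2 <= 1 - cos t.
Proof.
have p0 := @pi_gt0 R; have c1 := @cos1_gt0 R.
have p1 : (1 : R) <= pi by apply: le_trans (pi_ge2 R); lra.
have c11 : cos (1 : R) < 1.
  by rewrite -[X in _ < X]cos0 ltr_cos ?in_itv/= ?lexx ?ler01 ?(ltW p0)// ltr01.
pose c : R := Num.min (cos 1 / 2) ((1 - cos 1) / pi ^+ 2).
have cc1 : c <= cos 1 / 2 by rewrite ge_min lexx.
have cc2 : c <= (1 - cos 1) / pi ^+ 2 by rewrite ge_min lexx orbT.
have c0 : 0 < c by rewrite lt_min !divr_gt0 ?subr_gt0 ?exprn_gt0.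
clearbody c; exists c; first by rewrite c0/=; lra.
move=> t /andP[t0 tp]; have [t1|t1] := leP t 1.
  pose F (x : R) := - cos x - (cos 1 / 2) * x ^+ 2.
  have dF (x : R) : is_derive x (1 : R) F (sin x - cos 1 * x).
    rewrite /F; apply: is_derive_eq; rewrite opprK.
    by rewrite /GRing.scale /=; field.
  have [|x xI E] := @MVT_segment R F (fun x => sin x - cos 1 * x) 0 t t0 (fun x _ => dF x).
    apply: continuous_subspaceT => x; apply/differentiable_continuous/derivable1_diffP.
    by have [] := dF x.
  move: xI; rewrite in_itv /= => /andP[x0 xt].
  have h : 0 <= (sin x - cos 1 * x) * (t - 0).
    by rewrite mulr_ge0 ?subr0// subr_ge0 sin_ge_lin// x0 (le_trans xt).
  move: h; rewrite -E /F cos0 expr0n /= mulr0 subr0 opprK => h.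
  have : c * t ^+ 2 <= cos 1 / 2 * t ^+ 2 by rewrite ler_wpM2r// sqr_ge0.
  by move: h; lra.
have h : cos t < cos 1 by rewrite ltr_cos ?in_itv/= ?t0 ?tp ?ler01.
apply: (@le_trans _ _ (1 - cos 1)); last by rewrite lerD2l lerN2 ltW.
apply: le_trans (ler_wpM2r (sqr_ge0 t) cc2) _.
rewrite -mulrA ger_pMr ?subr_gt0// mulrC ler_pdivrMr ?exprn_gt0// mul1r.
by rewrite ler_sqr ?nnegrE// ltW.
Qed.

Lemma cmod_one_sub_circ_sqr r t :
  cmod (1 - circ r t) ^+ 2 = (1 - r) ^+ 2 + 2 * r * (1 - cos t).
Proof.
have -> : 1 - circ r t = (1 - r * cos t) +i* (- (r * sin t)) :> Cplx R.
  by rewrite circE; apply: eqC; rewrite /= ?sub0r.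
rewrite cmodE sqr_sqrtr ?addr_ge0 ?sqr_ge0//.
have := cos2Dsin2 t; set C := cos t; set S := sin t => h.
transitivity (1 - 2 * r * C + r ^+ 2 * (C ^+ 2 + S ^+ 2)); first by ring.
by rewrite h; ring.
Qed.

(** Up to constants, the distance of [r e^(it)] to 1 is the sum of the angular and
    the radial distances. *)
Lemma cmod_one_sub_circ_ge : exists2 c : R, 0 < c & forall r t, 0 <= r < 1 -> 0 <= t <= pi ->
  c * (t + (1 - r)) <= cmod (1 - circ r t).
Proof.
have p0 := @pi_gt0 R; have [c /andP[c0 c1] hc] := one_sub_cos_ge.
pose b : R := Num.min (c / 2) (2 * (1 + pi))^-1.
have b0 : 0 < b by rewrite lt_min divr_gt0//= invr_gt0 mulr_gt0// addr_gt0.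
have bc : b <= c / 2 by rewrite ge_min lexx.
have bp : b <= (2 * (1 + pi))^-1 by rewrite ge_min lexx orbT.
clearbody b; exists b => // r t /andP[r0 r1] tI; have /andP[t0 tp] := tI.
have cosI : 0 <= 1 - cos t by rewrite subr_ge0 cos_le1.
have E := cmod_one_sub_circ_sqr r t.
have L0 : 0 <= b * (t + (1 - r)) by rewrite mulr_ge0 ?(ltW b0)// addr_ge0// subr_ge0 ltW.
rewrite -ler_sqr ?nnegrE ?cmod_ge0// E.
have [r2|r2] := leP (1 / 2) r.
  have h := hc t tI.
  have h2 : c * t ^+ 2 <= 2 * r * (1 - cos t) by move: h cosI r2; clear; nra.
  have h3 : (t + (1 - r)) ^+ 2 <= 2 * (t ^+ 2 + (1 - r) ^+ 2).
    by move: (sqr_ge0 (t - (1 - r))); clear; nra.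
  have h4 : b ^+ 2 <= c / 2 by move: bc b0 c0 c1; clear; nra.
  rewrite exprMn; apply: le_trans (ler_pM (sqr_ge0 _) (sqr_ge0 _) h4 h3) _.
  have : 0 <= (1 - r) ^+ 2 by rewrite sqr_ge0.
  by move: h2 c1; clear; nra.
have h1 : b * (t + (1 - r)) <= 1 / 2.
  have : b * (2 * (1 + pi)) <= 1 by rewrite -ler_pdivlMr ?mul1r// mulr_gt0// addr_gt0.
  by move: b0 tp r0; clear; nra.
have : (b * (t + (1 - r))) ^+ 2 <= (1 / 2) ^+ 2 by rewrite ler_sqr ?nnegrE.
have : 0 <= 2 * r * (1 - cos t) by rewrite mulr_ge0// mulr_ge0.
by move: r2; clear; nra.
Qed.

(** By [cmod_one_sub_circ_ge] the integrand is at most a constant times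
    [(t + 1 - r) ^ (- s)] on each half circle. *)
Lemma szego_int s : 1 < s -> exists2 C : R, 0 < C & forall r, 0 <= r < 1 ->
  rint 0 (pi *+ 2) (fun t => (cmod (1 - circ r t))^-1 `^ s) <= C * (1 - r) `^ (1 - s).
Proof.
move=> s1; have s0 : 0 < s by apply: lt_trans s1.
have p0 := @pi_gt0 R; have p2 : (pi : R) *+ 2 = 2 * pi by rewrite mulr_natl.
have [c c0 hc] := cmod_one_sub_circ_ge.
exists (2 * (c^-1 `^ s / (s - 1))) => [|r r01].
  by rewrite mulr_gt0// divr_gt0 ?powR_gt0 ?invr_gt0 ?subr_gt0.
have /andP[r0 r1] := r01; set v := fun t => _.
have cv : continuous v by exact: cont_szego.
have v0 t : 0 <= v t by exact: powR_ge0.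
rewrite (@rint_split _ _ _ pi)//; last by rewrite p2; apply/andP; split; lra.
have -> : rint pi (pi *+ 2) v = rint 0 pi v.
  apply: EFin_inj; rewrite -!(rint_ge0E _ _ cv) (integral_reflect (pi *+ 2)); last 3 first.
  - exact: measurable_itv.
  - exact: measurable_funTS (continuous_measurable cv).
  - by move=> x _; exact: v0.
  rewrite (_ : [set x | _] = `[0, pi]%classic); last first.
    by apply/seteqP; split => x /=; rewrite !in_itv /= p2 => /andP[h1 h2]; apply/andP; split; lra.
  apply: eq_integral => t _; rewrite /v; congr ((_^-1 `^ _)%:E).
  by rewrite -(cmod_one_sub_circN r t) !circE (addrC (pi *+ 2)) cosD2pi sinD2pi.
rewrite -mulr2n -[X in X <= _]mulr_natl -mulrA; apply: ler_wpM2l => //.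
rewrite -lee_fin -(rint_ge0E _ _ cv).
have mD : measurable (`[0, pi] : set R) by exact: measurable_itv.
apply: (@le_trans _ _ (\int[mu]_(t in `[0%R, pi]) (c^-1 `^ s * (t + (1 - r)) `^ (1 - s - 1))%:E)%E).
  apply: le_integral_EFin => //.
  - exact: measurable_funTS (continuous_measurable cv).
  - by apply: measurable_funM => //; exact: measurable_powRD.
  - move=> t /=; rewrite in_itv /= => tI; rewrite v0/= /v.
    have /andP[t0 tp] := tI.
    have d0 : 0 < t + (1 - r) by rewrite ltr_wpDl// subr_gt0.
    rewrite (_ : 1 - s - 1 = - s); last by ring.
    have -> : (t + (1 - r)) `^ (- s) = (t + (1 - r))^-1 `^ s.
      by rewrite -(powR_inv1 (ltW d0)) -powRrM mulN1r.
    rewrite -powRM ?invr_ge0 ?(ltW c0) ?(ltW d0)// -invfM.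
    apply: ge0_ler_powR; rewrite ?nnegrE ?invr_ge0 ?cmod_ge0 ?(ltW s0)//.
      by rewrite mulr_ge0 ?ltW.
    by rewrite lef_pV2 ?posrE ?mulr_gt0 ?cmod_one_sub_circ_gt0// hc.
rewrite integralZl_EFin ?powR_ge0//; last 2 first.
- exact: measurable_powRD.
- by move=> t _; exact: powR_ge0.
rewrite integral_powR//; last 2 first.
- by rewrite add0r subr_gt0.
- by rewrite subr_eq0 lt_eqF.
rewrite -EFinM lee_fin -mulrA ler_wpM2l ?powR_ge0// add0r.
rewrite -[1 - s]opprB invrN mulNr -mulrN opprB ler_wpM2l ?invr_ge0 ?subr_ge0 ?(ltW s1)//.
by rewrite opprB gerBl powR_ge0.
Qed.

(** Hoelder's inequality against the Cauchy kernel, whose norm in the dual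
    exponent is of the order of [(1 - s) ^ (- 1 / p)] by [szego_int]. *)
Lemma cauchy_Lp p : 1 < p -> exists2 C : R, 0 < C & forall f r s, Hol f ->
  0 <= r < 1 -> 0 <= s < 1 ->
  rint 0 (pi *+ 2) (fun t => cmod (f (circ r t)) * (cmod (1 - circ s t))^-1) `^ p <=
  C * (1 - s)^-1 * cint_pow p r f.
Proof.
move=> p1; have p0 : 0 < p by apply: lt_trans p1.
have pn : p - 1 != 0 by rewrite subr_eq0 gt_eqF.
pose p' := p / (p - 1).
have p'1 : 1 < p' by rewrite /p' ltr_pdivlMr ?subr_gt0// mul1r gtrBl.
have pp : (1 - p') * (p - 1) = -1 by rewrite /p'; field.
have pp0 : p' + (1 - p') * p = 0 by rewrite /p'; field.
have p'0 : 0 < p' by apply: lt_trans p'1.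
clearbody p'; have [C C0 hC] := szego_int p'1.
exists (C `^ (p - 1)) => [|f r s hf r01 s01]; first exact: powR_gt0.
have s1 : 0 < 1 - s by case/andP: s01 => _; rewrite subr_gt0.
have cf := cont_circ (Hol_cont hf) r01.
pose S t := (cmod (1 - circ s t))^-1.
have S0 t : 0 < S t by rewrite invr_gt0 cmod_one_sub_circ_gt0.
have cS : continuous S.
  rewrite (_ : S = (fun t => (cmod (1 - circ s t))^-1 `^ 1)); first exact: cont_szego.
  by apply/funext => t; rewrite powRr1// ltW// S0.
have cSp c : continuous (fun t => S t `^ c).
  move=> t; apply: (@continuous_comp R R R S (fun x => x `^ c)); first exact: cS.
  apply/differentiable_continuous/derivable1_diffP; apply: derivable_powR.
  by rewrite in_itv /= S0.
have cf' := cont_cmod cf.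
have cfS := cont_mulR cf' cS.
have N0 : 0 <= rint 0 (pi *+ 2) (fun t => cmod (f (circ r t)) * S t).
  by apply: Rintegral_ge0 => t _; rewrite mulr_ge0 ?cmod_ge0// ltW.
have mc (u : R -> R) : continuous u -> measurable_fun (`[0, pi *+ 2] : set R) u.
  by move=> cu; exact: measurable_funTS (continuous_measurable cu).
have := @weighted_jensen _ _ R mu (`[0, pi *+ 2] : set R) (fun t => S t `^ p')
  (fun t => cmod (f (circ r t)) * S t `^ (1 - p')) (C * (1 - s) `^ (1 - p'))
  (rint 0 (pi *+ 2) (fun t => cmod (f (circ r t)) * S t)) p.
have -> : (fun x => (S x `^ p' * (cmod (f (circ r x)) * S x `^ (1 - p')))%:E) =
    (fun t => (cmod (f (circ r t)) * S t)%:E).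
  apply/funext => t; rewrite mulrCA -powRD_gt0// (_ : p' + (1 - p') = 1); last by ring.
  by rewrite powRr1// ltW.
have -> : (fun x => (S x `^ p' * (cmod (f (circ r x)) * S x `^ (1 - p')) `^ p)%:E) =
    (fun t => (cmod (f (circ r t)) `^ p)%:E).
  apply/funext => t; rewrite powRM ?cmod_ge0 ?powR_ge0// -powRrM mulrCA -powRD_gt0//.
  by rewrite pp0 powRr0 mulr1.
rewrite (rint_ge0E _ _ cfS) (rint_ge0E _ _ (cSp p')) (rint_ge0E _ _ (cont_cmod_circ hf p0 r01)).
rewrite -EFinM !lee_fin powRM ?powR_ge0 ?(ltW C0)// -powRrM pp powR_inv1 ?(ltW s1)//.
apply => //.
- exact: mc.
- exact: (mc _ (cont_mulR cf' (cSp (1 - p')))).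
- by move=> t _; exact: powR_ge0.
- by move=> t _; rewrite mulr_ge0 ?cmod_ge0 ?powR_ge0.
- exact: ltW.
- by rewrite mulr_gt0// powR_gt0.
- exact: hC.
Qed.

(** Cauchy's formula on the circle of radius [(1 + t) / 2], with [cauchy_Lp]. The
    right-hand side keeps the means rather than the Bergman norm so that the
    estimate can be integrated over [t]. *)
Lemma growth_real p : 1 < p -> exists2 C : R, 0 < C & forall f t, Hol f -> 0 <= t < 1 ->
  cmod (f t%:C) `^ p <= C / (1 - t) * cint_pow p ((1 + t) / 2) f.
Proof.
move=> p1; have p0 : 0 < p by apply: lt_trans p1.
have [C C0 hC] := cauchy_Lp p1.
exists (((pi *+ 2)^-1) `^ p * (C * 2)) => [|f t hf /andP[t0 t1]].
  by rewrite !mulr_gt0 ?powR_gt0 ?invr_gt0 ?pi2_gt0.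
pose r := (1 + t) / 2; pose s := t / r.
have r0 : 0 < r by rewrite /r; lra.
have r1 : r < 1 by rewrite /r; lra.
have tr : t < r by rewrite /r; lra.
have s01 : 0 <= s < 1 by rewrite divr_ge0 ?(ltW r0)//= ltr_pdivrMr// mul1r.
have ts : (1 - t) / 2 <= 1 - s.
  have -> : 1 - s = (r - t) / r by rewrite /s; field; rewrite gt_eqF.
  by rewrite ler_pdivlMr// /r; move: t0 t1; clear; nra.
have r01 : 0 < r < 1 by rewrite r0.
have r01' : 0 <= r < 1 by rewrite (ltW r0).
have cf := cont_circ (Hol_cont hf) r01'.
have tr' : cmod (t%:C : Cplx R) < r by rewrite cmod_real ger0_norm.
have kE u : 1 - t%:C * (circ r u)^-1 = 1 - circ s (- u) :> Cplx R by rewrite circV circ_scale.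
have ck : continuous (fun u => f (circ r u) / (1 - t%:C * (circ r u)^-1) : Cplx R).
  apply: (cont_mulC cf); apply: cont_invC => [|u].
    under eq_fun do rewrite kE.
    move=> u; apply: (@continuous_comp R R (Cplx R) (fun u => - u) (fun u => 1 - circ s u)).
      exact: opp_continuous.
    exact: cont_one_sub_circ.
  apply/eqP => h; have := cmod_one_sub_circ_gt0 u s01.
  by rewrite -cmod_one_sub_circN -kE h cmod0 ltxx.
have := congr1 (@cmod R) (cauchy_formula hf r01 tr').
rewrite cmodM cmod_real ger0_norm ?pi2_ge0// => E.
have := cint_norm 0 (pi *+ 2) ck; rewrite -/(cperiod _) E.
rewrite (_ : (fun u => cmod _) = (fun u => cmod (f (circ r u)) * (cmod (1 - circ s u))^-1)); last first.
  by apply/funext => u; rewrite cmodM cmodV kE cmod_one_sub_circN.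
rewrite -ler_pdivlMr ?pi2_gt0// => h.
apply: (@le_trans _ _ ((rint 0 (pi *+ 2) (fun u => cmod (f (circ r u)) * (cmod (1 - circ s u))^-1) / (pi *+ 2)) `^ p)).
  by apply: ge0_ler_powR; rewrite ?nnegrE ?(ltW p0) ?cmod_ge0// (le_trans _ h)// cmod_ge0.
rewrite powRM ?invr_ge0 ?pi2_ge0//; last first.
  by apply: Rintegral_ge0 => u _; rewrite mulr_ge0 ?invr_ge0 ?cmod_ge0.
rewrite mulrC -!mulrA ler_wpM2l ?powR_ge0//.
apply: le_trans (hC f r s hf r01' s01) _.
rewrite -!mulrA ler_wpM2l ?(ltW C0)// mulrA ler_wpM2r ?cint_pow_ge0//.
by rewrite -invf_div lef_pV2 ?posrE// ?divr_gt0 ?subr_gt0//; case/andP: s01.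
Qed.

(** The means increase with the radius, so the part of the area integral beyond
    the radius [(1 + r) / 2] already dominates the mean at [r]. *)
Lemma cint_pow_bergman p f r : Hol f -> 1 <= p -> 0 <= r < 1 ->
  (((1 - r) / 4 * cint_pow p r f)%:E <= bergman_int p f)%E.
Proof.
move=> hf p1 /andP[r0 r1]; have p0 : 0 < p by apply: lt_le_trans p1.
pose m := (1 + r) / 2; have m1 : m < 1 by rewrite /m; lra.
have m2 : 1 / 2 <= m by rewrite /m; lra.
have rm : r <= m by rewrite /m; lra.
rewrite bergman_polar//.
have mC := measurable_cint_pow hf p0.
have mF : measurable_fun (`]0, 1[ : set R) (fun r => r * cint_pow p r f) by exact: measurable_funM.
apply: (@le_trans _ _ (\int[mu]_(x in `]m, 1%R[) (1 / 2 * cint_pow p r f)%:E)%E).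
  rewrite integral_cst//= lebesgue_measure_itv /= lte_fin m1 -EFinB -EFinM lee_fin.
  by rewrite le_eqVlt; apply/orP; left; apply/eqP; rewrite /m; field.
have sub : `]m, 1[ `<=` (`]0, 1[ : set R).
  by move=> x /=; rewrite !in_itv /= => /andP[mx ->]; rewrite andbT (lt_trans _ mx)//; lra.
apply: (@le_trans _ _ (\int[mu]_(x in `]m, 1%R[) (x * cint_pow p x f)%:E)%E).
  apply: le_integral_EFin; [exact: measurable_itv|exact: measurable_cst|exact: measurable_funS mF|].
  move=> x /=; rewrite in_itv /= => /andP[mx x1].
  have x2 : 1 / 2 <= x by apply/ltW; apply: le_lt_trans mx.
  have x0 : 0 <= x by apply: le_trans x2; lra.
  have rx : r <= x by apply/ltW; apply: le_lt_trans mx.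
  have := cint_pow_homo hf p1 r0 rx x1; have := cint_pow_ge0 p r f.
  move: (cint_pow p r f) (cint_pow p x f) x0 x2 => c d; clear; nra.
apply: ge0_subset_integral => //; first exact/measurable_EFinP.
by move=> x /=; rewrite in_itv /= => /andP[/ltW x0 _]; rewrite lee_fin mulr_ge0// cint_pow_ge0.
Qed.

Lemma measurable_cint_pow_aff p f : Hol f -> 0 < p ->
  measurable_fun (`]0, 1[ : set R) (fun x => cint_pow p ((1 + x) / 2) f).
Proof.
move=> hf p0; apply: (@measurable_comp _ _ _ _ _ _ (`]0, 1[ : set R) (fun r => cint_pow p r f)) => //.
- by move=> y /= [x]; rewrite !in_itv /= => /andP[x0 x1] <-; apply/andP; split; lra.
- exact: measurable_cint_pow.
- by apply: measurable_funTS; apply: measurable_funM => //; exact: measurable_funD.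
Qed.

(** The radii [(1 + x) / 2] exceed [1 / 2], where the Jacobian [r] of polar
    coordinates is bounded below. *)
Lemma integral_cint_pow_le p f : Hol f -> 1 <= p ->
  (\int[mu]_(x in `]0%R, 1%R[) (cint_pow p ((1 + x) / 2) f)%:E <= 4%:E * bergman_int p f)%E.
Proof.
move=> hf p1; have p0 : 0 < p by apply: lt_le_trans p1.
have mC := measurable_cint_pow hf p0.
have mF : measurable_fun (`]0, 1[ : set R) (fun r => r * cint_pow p r f) by exact: measurable_funM.
have sub : `](1 / 2), 1[ `<=` (`]0, 1[ : set R).
  by move=> x /=; rewrite !in_itv /= => /andP[mx ->]; rewrite andbT (lt_trans _ mx)//; lra.
pose G : R -> \bar R := (fun r => (cint_pow p r f)%:E) \_ `](1 / 2), 1[.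
have mG : measurable_fun setT G.
  apply/(measurable_restrictT _ (measurable_itv _)); apply/measurable_EFinP; exact: measurable_funS mC.
have G0 x : (0 <= G x)%E by rewrite /G patchE; case: ifP => // _; rewrite lee_fin cint_pow_ge0.
have h2 : (0 : R) < 1 / 2 by lra.
have := ge0_integral_affine (1 / 2) h2 mG G0.
rewrite -[X in X = _]integral_mkcond => E.
have -> : (\int[mu]_(x in `]0%R, 1%R[) (cint_pow p ((1 + x) / 2) f)%:E =
    \int[mu]_x G (1 / 2 * x + 1 / 2)%R)%E.
  rewrite integral_mkcond; apply: eq_integral => x _; rewrite /G !patchE !mem_setE !in_itv /=.
  have -> : 1 / 2 * x + 1 / 2 = (1 + x) / 2 by field.
  have -> : (1 / 2 < (1 + x) / 2) = (0 < x) by apply/idP/idP; lra.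
  by have -> : ((1 + x) / 2 < 1) = (x < 1) by apply/idP/idP; lra.
have -> : (\int[mu]_x G (1 / 2 * x + 1 / 2)%R =
    2%:E * \int[mu]_(x in `](1 / 2)%R, 1%R[) (cint_pow p x f)%:E)%E.
  by rewrite E muleA -EFinM (_ : 2 * (1 / 2) = 1 :> R) ?mul1e//; field.
rewrite bergman_polar// (_ : 4%:E = 2%:E * 2%:E)%E; last by rewrite -EFinM; congr EFin; ring.
rewrite -muleA; apply: lee_wpmul2l => //; rewrite -integralZl_EFin//; last first.
  by move=> x /=; rewrite in_itv /= => /andP[/ltW x0 _]; rewrite mulr_ge0// cint_pow_ge0.
apply: (@le_trans _ _ (\int[mu]_(x in `](1 / 2)%R, 1%R[) (2 * (x * cint_pow p x f))%:E)%E).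
  apply: le_integral_EFin; [exact: measurable_itv|exact: measurable_funS mC| |].
    by apply: measurable_funM => //; exact: measurable_funS mF.
  move=> x /=; rewrite in_itv /= => /andP[mx x1]; rewrite cint_pow_ge0/= mulrA ler_peMl ?cint_pow_ge0//.
  lra.
apply: ge0_subset_integral => //; first by apply/measurable_EFinP; exact: measurable_funM.
by move=> x /=; rewrite in_itv /= => /andP[/ltW x0 _]; rewrite lee_fin !mulr_ge0// cint_pow_ge0.
Qed.

(** The Jacobian [r] is at most 1, and the means increase with the radius. *)
Lemma bergman_le_int p f : Hol f -> 1 <= p ->
  (bergman_int p f <= \int[mu]_(x in `]0%R, 1%R[) (cint_pow p ((1 + x) / 2) f)%:E)%E.
Proof.
move=> hf p1; have p0 : 0 < p by apply: lt_le_trans p1.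
rewrite bergman_polar//; apply: le_integral_EFin => //.
- by apply: measurable_funM => //; exact: measurable_cint_pow.
- exact: measurable_cint_pow_aff.
move=> x /=; rewrite in_itv /= => /andP[x0 x1].
rewrite mulr_ge0 ?cint_pow_ge0 ?(ltW x0)//=.
apply: (@le_trans _ _ (cint_pow p x f)); first by rewrite ler_piMl ?cint_pow_ge0// ltW.
by apply: cint_pow_homo => //; lra.
Qed.

End CauchyKernel.

(** * A Hardy inequality for Bergman integrals *)

Section Hardy.
Context {R : realType}.
Notation mu := (@lebesgue_measure R).
Implicit Types (f g h : Cplx R -> Cplx R) (q r t x : R) (a b : nat -> Cplx R).

Lemma cont_circ_radial t : continuous (fun x => circ x t : Cplx R).
Proof. by move=> x; apply: continuous_circ2; [exact: cvg_id|exact: cvg_cst]. Qed.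

Lemma cint_monomial r n : 0 <= r ->
  cint 0 r (fun x => (x ^+ n)%:C) = (r ^+ n.+1 / n.+1%:R)%:C.
Proof.
move=> r0; rewrite /cint /=; apply: eqC => /=.
  have dF x : is_derive x (1 : R) (fun x => n.+1%:R^-1 * x ^+ n.+1) (x ^+ n).
    have h : is_derive x (1 : R) (fun x : R => x ^+ n.+1) (n.+1%:R * x ^+ n).
      split; first exact: exprn_derivable.
      by rewrite exp_derive /= /GRing.scale /= mulr1.
    have {}h := is_deriveZ (n.+1%:R^-1 : R) h; apply: is_derive_eq h _.
    by rewrite /GRing.scale /= mulrA mulVf ?pnatr_eq0// mul1r.
  rewrite (rint_FTC r0 (@exprn_continuous R n) dF).
  by rewrite expr0n /= mulr0 subr0 mulrC.
by rewrite (rint_cst _ r0) mul0r.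
Qed.

Lemma cont_psum_radial b n t : continuous (fun x => psum b (circ x t) n).
Proof.
elim: n => [|n IH].
  by under eq_fun do rewrite /psum big_ord0; exact: cont_cstC.
have -> : (fun x => psum b (circ x t) n.+1) = (fun x => psum b (circ x t) n + b n * circ x t ^+ n).
  by apply/funext => x; rewrite psumS.
have ce : continuous (fun x => circ x t ^+ n : Cplx R) by apply: cont_expC; exact: cont_circ_radial.
exact: (cont_addC IH (cont_mulC (cont_cstC (b n)) ce)).
Qed.

Lemma cont_realC (u : R -> R) : continuous u -> continuous (fun x => (u x)%:C : Cplx R).
Proof. by move=> cu x; apply: continuous_Cplx; [exact: cu|exact: cst_continuous]. Qed.

Lemma cint_psum b n r t : 0 <= r ->
  cint 0 r (fun x => psum b (circ x t) n) = r%:C * psum (fun k => b k / k.+1%:R) (circ r t) n.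
Proof.
move=> r0; elim: n => [|n IH].
  by under eq_fun do rewrite /psum big_ord0; rewrite cint_cst// mul0r /psum big_ord0 mulr0.
under eq_fun do rewrite psumS.
have c1 := @cont_psum_radial b n t.
have ce : continuous (fun x => circ x t ^+ n : Cplx R) by apply: cont_expC; exact: cont_circ_radial.
 have c2 := cont_mulC (cont_cstC (b n)) ce.
rewrite (cintD _ _ c1 c2) IH psumS mulrDr; congr (_ + _).
have circ1 x : circ x t ^+ n = circ 1 t ^+ n * (x ^+ n)%:C :> Cplx R.
  by rewrite rmorphXn /= -exprMn mulrC circ_scale mulr1.
rewrite (_ : (fun x => _) = (fun x => (b n * circ 1 t ^+ n) * (x ^+ n)%:C)); last first.
  by apply/funext => x; rewrite circ1 mulrA.
have c3 := cont_realC (@exprn_continuous R n).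
rewrite (cintZ _ _ _ c3) cint_monomial// (circ1 r) rmorphM fmorphV /= rmorph_nat exprS rmorphM /=.
by ring.
Qed.

(** The function with coefficients [b n / (n + 1)] is, up to the factor [z], the
    primitive of [f] along the ray. *)
Lemma ray_int b f g r t : has_pseries b f -> has_pseries (fun n => b n / n.+1%:R) g ->
  0 < r < 1 ->
  ((r * cmod (g (circ r t)))%:E <=
   \int[mu]_(x in `[0%R, r]) (dmod f (x * cos t, x * sin t))%:E)%E.
Proof.
move=> hf hg /andP[r0 r1]; have [Hf _] := Hol_pseries_taylor hf.
have mf : measurable_fun setT (fun x : R => dmod f (x * cos t, x * sin t)).
  apply: (measurableT_comp (measurable_dmod Hf)); apply: measurable_fun_pair; exact: measurable_funM.
have mD : measurable (`[0, r] : set R) by exact: measurable_itv.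
set J := (\int[mu]_(x in _) _)%E.
apply/lee_addgt0Pr => e e0.
have e20 : 0 < e / 2 by rewrite divr_gt0.
have r01 : 0 <= r < 1 by rewrite ltW.
have [N HN] := has_pseries_tail hf r01 e20.
have z1 : cmod (circ r t) < 1 by rewrite cmod_circ// ltW.
have /has_pseriesP /(_ _ z1) /cvg_seqP /(_ _ e20) [N' HN'] := hg.
pose n := maxn N N'; have nN : (N <= n)%N by exact: leq_maxl.
have h1 := HN' n (leq_maxr _ _); have {}HN z := HN n z nN.
have cp := @cont_psum_radial b n t.
have h2 : cmod (r%:C * psum (fun k => b k / k.+1%:R) (circ r t) n) <= rint 0 r (fun x => cmod (psum b (circ x t) n)).
  by rewrite -cint_psum ?(ltW r0)//; exact: cint_norm.
have h3 : ((rint 0 r (fun x => cmod (psum b (circ x t) n)))%:E <= J + (e / 2)%:E)%E.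
  rewrite -(rint_ge0E _ _ (cont_cmod cp)).
  apply: (@le_trans _ _ (\int[mu]_(x in `[0%R, r]) (dmod f (x * cos t, x * sin t) + e / 2)%:E)%E).
    apply: le_integral_EFin => //.
    - exact: measurable_funTS (continuous_measurable (cont_cmod cp)).
    - by apply: measurable_funD => //; exact: measurable_funTS.
    - move=> x /=; rewrite in_itv /= => /andP[x0 xr]; rewrite cmod_ge0 dmod_circ ger0_norm//.
      rewrite (le_lt_trans xr r1) -lerBlDl (le_trans (cmod_sub _ _))// cmodB ltW// HN//.
      by rewrite cmod_circ.
  under eq_integral do rewrite EFinD.
  rewrite ge0_integralD//; last 3 first.
  - by move=> x _; rewrite lee_fin dmod_ge0.
  - by apply/measurable_EFinP; exact: measurable_funTS.
  - by move=> x _; rewrite lee_fin ltW.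
  apply: leeD2l; rewrite integral_cst//= lebesgue_measure_itv /= lte_fin r0 -EFinB -EFinM lee_fin subr0.
  by rewrite ler_piMr ?(ltW e20)// ltW.
have h4 : r * cmod (g (circ r t)) <= rint 0 r (fun x => cmod (psum b (circ x t) n)) + e / 2.
  move: h2; rewrite cmodM cmod_real ger0_norm ?(ltW r0)// => h2.
  have := cmod_sub (g (circ r t)) (psum (fun k => b k / k.+1%:R) (circ r t) n).
  rewrite cmodB => h5; move: h1 h2 h5 r0 r1 e20.
  move: (cmod (g _)) (cmod (psum _ _ _)) (cmod (_ - _)) (rint _ _ _) => A B C D; clear; nra.
apply: (@le_trans _ _ (rint 0 r (fun x => cmod (psum b (circ x t) n)) + e / 2)%:E).
  by rewrite lee_fin.
rewrite EFinD; apply: le_trans (leeD2r _ h3) _.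
by rewrite -addeA -EFinD -splitr.
Qed.

Lemma measurable_ray f t : Hol f -> measurable_fun setT (fun x : R => dmod f (x * cos t, x * sin t)).
Proof.
move=> Hf; apply: (measurableT_comp (measurable_dmod Hf)).
by apply: measurable_fun_pair; exact: measurable_funM.
Qed.

Lemma integral_half_le (F : R -> R) : measurable_fun (`]0, 1[ : set R) F ->
  (forall x, 0 < x < 1 -> 0 <= F x) ->
  (\int[mu]_(x in `]0%R, 1%R[) (F ((1 + x) / 2)%R)%:E <= 2%:E * \int[mu]_(x in `]0%R, 1%R[) (F x)%:E)%E.
Proof.
move=> mF F0.
pose G : R -> \bar R := (fun r => (F r)%:E) \_ `]0, 1[.
have mG : measurable_fun setT G.
  by apply/(measurable_restrictT _ (measurable_itv _)); exact/measurable_EFinP.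
have G0 x : (0 <= G x)%E.
  by rewrite /G patchE; case: ifPn => // /set_mem /=; rewrite in_itv /= => /F0; rewrite lee_fin.
have h2 : (0 : R) < 1 / 2 by lra.
have := ge0_integral_affine (1 / 2) h2 mG G0.
rewrite -[X in X = _]integral_mkcond => ->.
rewrite muleA -EFinM (_ : 2 * (1 / 2) = 1 :> R) ?mul1e; last by field.
rewrite [X in (X <= _)%E]integral_mkcond; apply: ge0_le_integral => //.
- move=> x _; rewrite patchE; case: ifPn => // /set_mem /=; rewrite in_itv /= => /andP[x0 x1].
  by rewrite lee_fin F0//; apply/andP; split; lra.
- apply/(measurable_restrictT _ (measurable_itv _)); apply/measurable_EFinP.
  apply: (@measurable_comp _ _ _ _ _ _ (`]0, 1[ : set R) F) => //.
    by move=> y /= [x]; rewrite !in_itv /= => /andP[x0 x1] <-; apply/andP; split; lra.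
  by apply: measurable_funTS; apply: measurable_funM => //; exact: measurable_funD.
- apply: (measurableT_comp mG); apply: measurable_funD => //; exact: measurable_funM.
move=> x _; rewrite patchE; case: ifPn => [|_]; last exact: G0.
move=> /set_mem /=; rewrite in_itv /= => /andP[x0 x1]; rewrite /G patchE.
have -> : 1 / 2 * x + 1 / 2 = (1 + x) / 2 by field.
by rewrite ifT// inE /= in_itv /=; apply/andP; split; lra.
Qed.

Lemma cint_powEint q r f : Hol f -> 0 < q -> 0 < r < 1 ->
  (\int[mu]_(t in `[0%R, (pi *+ 2)%R]) (dmod f (r * cos t, r * sin t) `^ q)%:E = (cint_pow q r f)%:E)%E.
Proof.
move=> hf q0 r01; rewrite cint_pow_dmod// rint_ge0E//; apply: cont_dmod => //.
by case/andP: r01.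
Qed.

Lemma measurable_polar_weight q f (w : R -> R) : Hol f -> measurable_fun setT w ->
  measurable_fun setT (fun z : R * R => w z.2 * dmod f (z.2 * cos z.1, z.2 * sin z.1) `^ q).
Proof.
move=> hf mw; apply: measurable_funM.
  exact: (measurableT_comp mw (@measurable_snd _ _ R R)).
apply: (measurableT_comp (measurable_powR q)).
apply: (measurableT_comp (measurable_dmod hf)).
have m1 : measurable_fun setT (fst : R * R -> R) by exact: measurable_fst.
have m2 : measurable_fun setT (snd : R * R -> R) by exact: measurable_snd.
apply: measurable_fun_pair; apply: measurable_funM => //.
  exact: (measurableT_comp (continuous_measurable (@continuous_cos R)) m1).
exact: (measurableT_comp (continuous_measurable (@continuous_sin R)) m1).
Qed.

Lemma polar_weight q f (w : R -> R) : Hol f -> 0 < q -> measurable_fun setT w ->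
  (forall x, 0 < x < 1 -> 0 <= w x) ->
  (\int[mu]_(t in `[0%R, (pi *+ 2)%R]) \int[mu]_(x in `]0%R, 1%R[) (w x * dmod f (x * cos t, x * sin t) `^ q)%:E =
   \int[mu]_(x in `]0%R, 1%R[) (w x * cint_pow q x f)%:E)%E.
Proof.
move=> hf q0 mw w0.
have I01 : measurable (`]0, 1[ : set R) by exact: measurable_itv.
have mC : measurable (`[0, pi *+ 2] : set R) by exact: measurable_itv.
rewrite (tonelli_set (F := fun z : R * R => (w z.2 * dmod f (z.2 * cos z.1, z.2 * sin z.1) `^ q)%:E) mC I01); last 2 first.
- apply/measurable_funTS/measurable_EFinP; exact: (measurable_polar_weight q hf mw).
- move=> x y _ /=; rewrite in_itv /= => y01; rewrite lee_fin mulr_ge0 ?powR_ge0//; exact: w0.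
apply: eq_integral => x /set_mem /=; rewrite in_itv /= => x01; have /andP[x0 x1] := x01.
rewrite integralZl_EFin//; last 3 first.
- exact: measurable_funTS (continuous_measurable (cont_dmod hf q0 x0)).
- by move=> t _; exact: powR_ge0.
- exact: w0.
by rewrite cint_powEint// EFinM.
Qed.

(** Hardy's inequality on each ray: [x h] is a primitive of [g], so its modulus at
    distance [s] from the circle is at most the integral of [|g|] up to there, which
    [schur_max] controls with [kappa = 0]. Integration over the angle gives the means.
    The factor [x ^ q] is removed by moving the radii to [(1 + x) / 2]. *)
Theorem hardy q : 1 < q -> exists2 C : R, 0 < C & forall a h g,
  has_pseries a h -> has_pseries (fun n => n.+1%:R * a n) g ->
  (bergman_int q h <= C%:E *
   \int[mu]_(x in `]0%R, 1%R[) ((1 - x) `^ q * cint_pow q x g)%:E)%E.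
Proof.
move=> q1; have q0 : 0 < q by apply: lt_trans q1.
pose gam := q^-1; pose C := (gam^-1 + (1 - gam)^-1) `^ q.
have g0 : 0 < gam by rewrite invr_gt0.
have g1 : gam < 1 by rewrite invf_lt1.
have C0 : 0 < C by rewrite powR_gt0// addr_gt0 ?invr_gt0 ?subr_gt0.
exists (2 * (2 `^ q * C)) => [|a h g hh hg]; first by rewrite !mulr_gt0// powR_gt0.
have [Hh _] := Hol_pseries_taylor hh; have [Hg _] := Hol_pseries_taylor hg.
have hq1 := ltW q1.
have hg' : has_pseries (fun n => (n.+1%:R * a n) / n.+1%:R) h.
  rewrite (_ : (fun n => _) = a)//; apply/funext => n.
  by rewrite mulrAC divff ?mul1r// pnatr_eq0.
have I01 : measurable (`]0, 1[ : set R) by exact: measurable_itv.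
have flip (F : R -> R) : measurable_fun setT F -> measurable_fun setT (fun u : R => F (1 - u)).
  by move=> mF; apply: (measurableT_comp mF); exact: measurable_funB.
have mW1 : measurable_fun setT (fun x : R => (1 - x) `^ q).
  by apply: (measurableT_comp (measurable_powR q)); exact: measurable_funB.
have ray t : (\int[mu]_(x in `]0%R, 1%R[) (x `^ q * dmod h (x * cos t, x * sin t) `^ q)%:E <=
    C%:E * \int[mu]_(x in `]0%R, 1%R[) ((1 - x) `^ q * dmod g (x * cos t, x * sin t) `^ q)%:E)%E.
  (* In the distance [u = 1 - x] to the circle, the factor [u] absorbs the
     weight [(1 - x) ^ q], which leaves Schur's test without weight. *)
  pose W u := u * dmod g ((1 - u) * cos t, (1 - u) * sin t).
  pose V s := (1 - s) * dmod h ((1 - s) * cos t, (1 - s) * sin t).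
  have mW : measurable_fun setT W.
    by apply: measurable_funM => //; exact: (flip (fun x => dmod g (x * cos t, x * sin t)) (measurable_ray t Hg)).
  have mV : measurable_fun setT V.
    apply: measurable_funM; first exact: measurable_funB.
    exact: (flip (fun x => dmod h (x * cos t, x * sin t)) (measurable_ray t Hh)).
  have key : (\int[mu]_(s in `]0%R, 1%R[) (s `^ 0 * V s `^ q)%:E <=
      C%:E * \int[mu]_(u in `]0%R, 1%R[) (u `^ 0 * W u `^ q)%:E)%E.
    apply: schur_max => //.
    - by rewrite addr0.
    - by rewrite addr0 /gam mulVf// gt_eqF.
    - exact: measurable_funTS.
    - by move=> u /andP[u0 u1]; rewrite mulr_ge0 ?dmod_ge0// ltW.
    - by move=> s /andP[s0 s1]; rewrite mulr_ge0 ?dmod_ge0// subr_ge0 ltW.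
    move=> s /andP[s0 s1].
    have s'1 : 0 < 1 - s < 1 by rewrite subr_gt0 s1 gtrBl.
    apply: (@le_trans _ _ (\int[mu]_(x in `[0%R, (1 - s)%R]) (dmod g (x * cos t, x * sin t))%:E)%E).
      apply: le_trans (ray_int t hg hg' s'1).
      have /andP[s'0 s'2] := s'1.
      by rewrite /V dmod_circ ger0_norm ?(ltW s'0)// s'2.
    rewrite (integral_reflect 1)//; last 2 first.
    - exact: measurable_funTS (measurable_ray t Hg).
    - by move=> x _; exact: dmod_ge0.
    rewrite (_ : [set x | `[0, 1 - s]%classic (1 - x)] = `[s, 1]%classic); last first.
      by apply/seteqP; split => x /=; rewrite !in_itv /= => /andP[h1 h2]; apply/andP; split; lra.
    rewrite -integral_itv_bndo_bndc; last first.
      by apply/measurable_EFinP; apply: measurable_funTS; exact: (flip _ (measurable_ray t Hg)).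
    apply: (@le_trans _ _ (\int[mu]_(u in `[s, 1%R[) (W u / Num.max u s)%:E)%E).
      rewrite le_eqVlt; apply/orP; left; apply/eqP; apply: eq_integral => u /set_mem /=.
      rewrite in_itv /= => /andP[su u1]; rewrite (max_idPl su) /W mulrAC divff ?mul1r//.
      by rewrite gt_eqF// (lt_le_trans s0).
    apply: ge0_subset_integral => //.
    - apply/measurable_EFinP; apply: measurable_funM; first exact: measurable_funTS.
      exact: measurable_max_inv.
    - move=> u /=; rewrite in_itv /= => /andP[u0 u1]; rewrite lee_fin divr_ge0//.
        by rewrite mulr_ge0 ?dmod_ge0// ltW.
      by rewrite le_max (ltW u0).
    - by move=> u /=; rewrite !in_itv /= => /andP[su ->]; rewrite andbT (lt_le_trans s0).
  rewrite integral_flip01; last 2 first.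
  - apply: measurable_funTS; apply: measurable_funM; first exact: measurable_powR.
    exact: (measurableT_comp (measurable_powR q) (measurable_ray t Hh)).
  - by move=> x _; rewrite mulr_ge0 ?powR_ge0.
  rewrite [X in (_ <= _ * X)%E]integral_flip01; last 2 first.
  - apply: measurable_funTS; apply: measurable_funM => //.
    exact: (measurableT_comp (measurable_powR q) (measurable_ray t Hg)).
  - by move=> x _; rewrite mulr_ge0 ?powR_ge0.
  apply: le_trans (le_trans _ key) _.
    rewrite le_eqVlt; apply/orP; left; apply/eqP; apply: eq_integral => s /set_mem /=.
    rewrite in_itv /= => /andP[s0 s1].
    by rewrite powRr0 mul1r /V powRM ?dmod_ge0// subr_ge0 ltW.
  apply: lee_wpmul2l; first by rewrite lee_fin ltW.
  rewrite le_eqVlt; apply/orP; left; apply/eqP; apply: eq_integral => s /set_mem /=.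
  rewrite in_itv /= => /andP[s0 s1].
  by rewrite powRr0 mul1r /W powRM ?dmod_ge0 ?ltW// opprB addrCA subrr addr0.
have int1 : (\int[mu]_(x in `]0%R, 1%R[) (x `^ q * cint_pow q x h)%:E <=
    C%:E * \int[mu]_(x in `]0%R, 1%R[) ((1 - x) `^ q * cint_pow q x g)%:E)%E.
  rewrite -(polar_weight Hh q0 (measurable_powR q)); last by move=> x _; exact: powR_ge0.
  rewrite -(polar_weight Hg q0 mW1); last by move=> x _; exact: powR_ge0.
  have mJ f (w : R -> R) : Hol f -> measurable_fun setT w -> (forall x : R, 0 < x < 1 -> 0 <= w x) ->
      measurable_fun (`[0, pi *+ 2] : set R) (fun t : R =>
      \int[mu]_(x in `]0%R, 1%R[) (w x * dmod f (x * cos t, x * sin t) `^ q)%:E)%E.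
    move=> Hf mw w0.
    apply: (measurable_section_integral (F := fun z : R * R => (w z.2 * dmod f (z.2 * cos z.1, z.2 * sin z.1) `^ q)%:E)) => //.
      apply/measurable_funTS/measurable_EFinP; exact: (measurable_polar_weight q Hf mw).
    by move=> x y _ /=; rewrite in_itv /= => y01; rewrite lee_fin mulr_ge0 ?powR_ge0// w0.
  have J0 f (w : R -> R) (t : R) : (forall x : R, 0 < x < 1 -> 0 <= w x) ->
      (0 <= \int[mu]_(x in `]0%R, 1%R[) (w x * dmod f (x * cos t, x * sin t) `^ q)%:E)%E.
    move=> w0; apply: integral_ge0 => y /=; rewrite in_itv /= => y01.
    by rewrite lee_fin mulr_ge0 ?powR_ge0// w0.
  have p1 (x : R) : 0 < x < 1 -> 0 <= x `^ q by move=> _; exact: powR_ge0.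
  have p2 (x : R) : 0 < x < 1 -> 0 <= (1 - x) `^ q by move=> _; exact: powR_ge0.
  have mC : measurable (`[0, pi *+ 2] : set R) by exact: measurable_itv.
  have m1 := mJ h _ Hh (measurable_powR q) p1.
  have m2 := mJ g _ Hg mW1 p2.
  rewrite -ge0_integralZl; [|exact: mC|exact: m2|by move=> t _; exact: J0|by rewrite lee_fin ltW].
  apply: ge0_le_integral.
  - exact: mC.
  - by move=> t _; exact: J0.
  - exact: m1.
  - by apply: emeasurable_funM => //; exact: measurable_cst.
  - by move=> t _; exact: ray.
apply: le_trans (bergman_le_int Hh hq1) _.
have mC := measurable_cint_pow Hh q0.
apply: (@le_trans _ _ (\int[mu]_(x in `]0%R, 1%R[)
    ((fun r => 2 `^ q * (r `^ q * cint_pow q r h)) ((1 + x) / 2)%R)%:E)%E).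
  apply: le_integral_EFin.
  - exact: I01.
  - exact: measurable_cint_pow_aff.
  - apply: measurable_funM; first exact: measurable_cst.
    apply: measurable_funM; last exact: measurable_cint_pow_aff.
    apply: measurable_funTS; apply: (measurableT_comp (measurable_powR q)).
    by apply: measurable_funM => //; exact: measurable_funD.
  move=> x /=; rewrite in_itv /= => /andP[x0 x1]; rewrite cint_pow_ge0/= mulrA.
  rewrite ler_peMl ?cint_pow_ge0// -powRM//; last by lra.
  have : 1 `^ q <= (2 * ((1 + x) / 2)) `^ q by apply: ge0_ler_powR; rewrite ?nnegrE ?(ltW q0)//; lra.
  by rewrite powR1.
rewrite EFinM -muleA.
have mxC : measurable_fun (`]0, 1[ : set R) (fun x => x `^ q * cint_pow q x h).
  by apply: measurable_funM; [exact: measurable_powR_oo|exact: mC].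
have xC0 x : 0 <= x `^ q * cint_pow q x h by apply: mulr_ge0; [exact: powR_ge0|exact: cint_pow_ge0].
have half : (\int[mu]_(x in `]0%R, 1%R[) (2 `^ q * (((1 + x) / 2) `^ q * cint_pow q ((1 + x) / 2) h))%:E <=
    2%:E * \int[mu]_(x in `]0%R, 1%R[) (2 `^ q * (x `^ q * cint_pow q x h))%:E)%E.
  apply: (@integral_half_le (fun x => 2 `^ q * (x `^ q * cint_pow q x h))).
  - by apply: measurable_funM; [exact: measurable_cst|exact: mxC].
  - by move=> x _; apply: mulr_ge0; [exact: powR_ge0|exact: xC0].
apply: le_trans half _.
apply: lee_wpmul2l; first by rewrite lee_fin.
rewrite EFinM -muleA (integralZl_EFin I01 mxC (fun x _ => xC0 x) (powR_ge0 _ _)).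
by apply: lee_wpmul2l; [rewrite lee_fin powR_ge0|exact: int1].
Qed.

End Hardy.

(** * Hadamard products with a mean Lipschitz derivative *)

Section HadamardTail.
Context {R : realType}.
Notation mu := (@lebesgue_measure R).
Implicit Types (f g h : Cplx R -> Cplx R) (p q r t x : R) (a b : nat -> Cplx R).

Lemma le_powRN (x y c : R) : 0 < x -> x <= y -> c <= 0 -> y `^ c <= x `^ c.
Proof.
move=> x0 xy c0; have y0 := lt_le_trans x0 xy.
rewrite -[c]opprK !(powRN _ (- c)) lef_pV2 ?posrE ?powR_gt0//.
by apply: ge0_ler_powR; rewrite ?nnegrE ?oppr_ge0 ?(ltW x0) ?(ltW y0).
Qed.

(** [hadamard_young] for all larger [I], followed by a limit. *)
Lemma hadamard_young_ge0 a b f g h rho sigma (I q : R) :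
  has_pseries a f -> has_pseries b g -> has_pseries (fun n => a n * b n) h ->
  0 <= rho < 1 -> 0 < sigma < 1 -> 1 <= q -> 0 <= I ->
  rint 0 (pi *+ 2) (fun t => cmod (g (circ sigma t))) <= I * (pi *+ 2) ->
  cint_pow q (rho * sigma) h <= I `^ q * cint_pow q rho f.
Proof.
move=> hf hg hh r01 s01 q1 I0 gI; have q0 : 0 < q by apply: lt_le_trans q1.
have C0 := cint_pow_ge0 q rho f.
have [C00|Cn0] := eqVneq (cint_pow q rho f) 0.
  have I1 : 0 < I + 1 by rewrite ltr_wpDl.
  have := @hadamard_young _ _ _ _ _ _ _ _ (I + 1) q hf hg hh r01 s01 q1 I1.
  rewrite C00 !mulr0; apply; apply: le_trans gI _.
  by rewrite ler_wpM2r ?pi2_ge0// lerDl.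
have {Cn0} Cp : 0 < cint_pow q rho f by rewrite lt_neqAle eq_sym Cn0.
apply/ler_addgt0Pr => e e0.
have e1 : 0 < e / cint_pow q rho f by rewrite divr_gt0.
have /cvgrPdist_le /(_ _ e1) /nbhs_ballP [d /= d0 hd] := @continuous_abs_powR R q q0 I.
have d2 : 0 < d / 2 by rewrite divr_gt0.
have I2 : 0 < I + d / 2 by rewrite ltr_wpDl.
have := hd (I + d / 2); rewrite /ball /= opprD addrA subrr sub0r normrN gtr0_norm//.
rewrite ltr_pdivrMr// ltr_pMr// ltr1n => /(_ isT).
rewrite (ger0_norm I0) (gtr0_norm I2) distrC => /(le_trans (ler_norm _)).
rewrite ler_pdivlMr// mulrBl lerBlDr addrC [X in _ <= X]addrC (addrC (d / 2)) [X in _ <= X]addrC => h2.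
rewrite addrC; apply: le_trans h2; apply: (hadamard_young hf hg hh) => //.
apply: le_trans gI _; rewrite ler_wpM2r ?pi2_ge0// lerDl ltW//.
Qed.

(** By monotonicity [N x] bounds [N] from below on the interval between [x] and
    [(1 + x) / 2], on which the weight is at least [(1 - x) / 2]. *)
Lemma weighted_growth p (N : R -> R) (Lam x : R) : 0 < p ->
  measurable_fun (`]0, 1[ : set R) N ->
  (forall x, 0 < x < 1 -> 0 <= N x) ->
  (forall x y, 0 < x -> x <= y -> y < 1 -> N x <= N y) ->
  (\int[mu]_(x in `]0%R, 1%R[) ((1 - x) * N x `^ p)%:E <= Lam%:E)%E ->
  0 < x < 1 -> N x `^ p * (1 - x) ^+ 2 <= 4 * Lam.
Proof.
move=> p0 mN N0 Nhomo NLam.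
have mNp : measurable_fun (`]0, 1[ : set R) (fun x => N x `^ p).
  exact: (measurableT_comp (measurable_powR p)).
have m1x D : measurable_fun D (fun x : R => 1 - x) by apply: measurable_funTS; exact: measurable_funB.
have mF : measurable_fun (`]0, 1[ : set R) (fun x => (1 - x) * N x `^ p) by exact: measurable_funM.
have F0 x' : 0 < x' < 1 -> 0 <= (1 - x') * N x' `^ p.
  by move=> /andP[_ x1]; rewrite mulr_ge0 ?powR_ge0// subr_ge0 ltW.
move=> x01; have /andP[x0 x1] := x01; pose y := (1 + x) / 2.
have xy : x < y by rewrite /y; lra.
have y1 : y < 1 by rewrite /y; lra.
have : ((N x `^ p * ((1 - x) / 2) * (y - x))%:E <= Lam%:E)%E.
  apply: le_trans NLam.
  apply: (@le_trans _ _ (\int[mu]_(u in `]x, y[) (N x `^ p * ((1 - x) / 2))%:E)%E).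
    by rewrite integral_cst//= lebesgue_measure_itv /= lte_fin xy -EFinB -EFinM.
  have sub : `]x, y[ `<=` (`]0, 1[ : set R).
    by move=> u /=; rewrite !in_itv /= => /andP[xu uy]; rewrite (lt_trans x0 xu) (lt_trans uy).
  apply: (@le_trans _ _ (\int[mu]_(u in `]x, y[) ((1 - u) * N u `^ p)%:E)%E).
    apply: le_integral_EFin; [exact: measurable_itv|exact: measurable_cst|exact: measurable_funS mF|].
    move=> u /=; rewrite in_itv /= => /andP[xu uy]; have u1 := lt_trans uy y1.
    rewrite mulr_ge0 ?powR_ge0 ?divr_ge0 ?subr_ge0 ?(ltW x1)//= mulrC.
    apply: ler_pM; rewrite ?powR_ge0 ?divr_ge0 ?subr_ge0 ?(ltW x1)//.
      by move: uy; rewrite /y; lra.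
    apply: ge0_ler_powR; rewrite ?nnegrE ?(ltW p0)//.
    - exact: N0.
    - by apply: N0; rewrite (lt_trans x0 xu).
    - by apply: Nhomo => //; exact: ltW.
  by apply: ge0_subset_integral => //; exact/measurable_EFinP.
rewrite lee_fin (_ : y - x = (1 - x) / 2); last by rewrite /y; field.
by move: (N x `^ p) => n; clear; nra.
Qed.

(** [N x] dominates the mean modulus of [g], so that Young's inequality bounds
    the means of the Hadamard product [h] by those of [f]. The power [N ^ q] is then
    split as [N ^ p * N ^ (q - p)], with the second factor estimated by
    [weighted_growth]; [2 / p - 1 / q] is the exponent for which the powers of
    [1 - x] cancel. *)
Lemma hadamard_tail_bound p q : 0 < p -> p < q -> 1 <= q -> 2 / p - 1 / q < 1 ->
  exists2 C : R, 0 < C & forall a b f g h (N : R -> R) (del Lam r0 : R),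
  has_pseries a f -> has_pseries b g -> has_pseries (fun n => a n * b n) h ->
  0 <= r0 < 1 -> 0 <= del -> 0 <= Lam ->
  (forall r, r0 < r < 1 -> cint_pow q r f <= del * (1 - r) `^ ((2 / p - 1 / q - 1) * q)) ->
  measurable_fun (`]0, 1[ : set R) N ->
  (forall x, 0 < x < 1 -> 0 <= N x) ->
  (forall x y, 0 < x -> x <= y -> y < 1 -> N x <= N y) ->
  (forall x, 0 < x < 1 ->
    rint 0 (pi *+ 2) (fun t => cmod (g (circ ((1 + x) / 2) t))) <= N x * (pi *+ 2)) ->
  (\int[mu]_(x in `]0%R, 1%R[) ((1 - x) * N x `^ p)%:E <= Lam%:E)%E ->
  (\int[mu]_(x in `]r0, 1%R[) ((1 - x) `^ q * cint_pow q x h)%:E <=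
    (C * del * Lam `^ (q / p))%:E)%E.
Proof.
move=> p0 pq q1 al1; have q0 : 0 < q by apply: lt_le_trans q1.
set bet := (2 / p - 1 / q - 1) * q.
have bet0 : bet < 0 by rewrite /bet pmulr_llt0// subr_lt0.
pose e := (q - p) / p; have e0 : 0 < e by rewrite divr_gt0// subr_gt0.
have qpe : q = p + p * e by rewrite /e; field; rewrite gt_eqF.
have qp1 : q / p - 1 = e by rewrite /e; field; rewrite gt_eqF.
have bete : q + bet = 1 + 2 * e by rewrite /bet /e; field; rewrite !gt_eqF.
have C0 : 0 < 2 `^ (- bet) * 4 `^ e by rewrite mulr_gt0 ?powR_gt0.
exists (2 `^ (- bet) * 4 `^ e) => //.
move=> a b f g h N del Lam r0 hf hg hh /andP[r00 r01] del0 Lam0 fdel mN N0 Nhomo gN NLam.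
have [Hh _] := Hol_pseries_taylor hh.
have I01 : measurable (`]0, 1[ : set R) by exact: measurable_itv.
have mNp : measurable_fun (`]0, 1[ : set R) (fun x => N x `^ p).
  exact: (measurableT_comp (measurable_powR p)).
have m1x D : measurable_fun D (fun x : R => 1 - x) by apply: measurable_funTS; exact: measurable_funB.
have mF : measurable_fun (`]0, 1[ : set R) (fun x => (1 - x) * N x `^ p) by exact: measurable_funM.
have F0 x : 0 < x < 1 -> 0 <= (1 - x) * N x `^ p.
  by move=> /andP[_ x1]; rewrite mulr_ge0 ?powR_ge0// subr_ge0 ltW.
have NA x : 0 < x < 1 -> N x `^ p * (1 - x) ^+ 2 <= 4 * Lam.
  exact: (weighted_growth p0 mN N0 Nhomo NLam).
have sub : `]r0, 1[ `<=` (`]0, 1[ : set R).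
  by move=> u /=; rewrite !in_itv /= => /andP[xu ->]; rewrite andbT (le_lt_trans r00).
have mH : measurable_fun (`]r0, 1[ : set R) (fun x => (1 - x) `^ q * cint_pow q x h).
  apply: measurable_funM.
    by apply: (measurableT_comp (measurable_powR q)).
  exact: measurable_funS (measurable_cint_pow Hh q0).
pose K := 2 `^ (- bet) * del * (4 * Lam) `^ e.
have K0 : 0 <= K by rewrite !mulr_ge0 ?powR_ge0.
apply: (@le_trans _ _ (\int[mu]_(x in `]r0, 1%R[) (K * ((1 - x) * N x `^ p))%:E)%E).
  apply: le_integral_EFin; [exact: measurable_itv|exact: mH| |].
    by apply: measurable_funM; [exact: measurable_cst|exact: measurable_funS mF].
  move=> x xI; have := sub _ xI; move: xI; rewrite /= !in_itv /= => /andP[r0x _] x01.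
  have /andP[x0 x1] := x01.
  apply/andP; split; first by apply: mulr_ge0; [exact: powR_ge0|exact: cint_pow_ge0].
  (* [x = rh * sg], and both factors are at distance comparable to [1 - x]
     from 1. *)
  pose sg := (1 + x) / 2; pose rh := x / sg.
  have sg0 : 0 < sg by rewrite /sg; lra.
  have sg1 : sg < 1 by rewrite /sg; lra.
  have xE : x = rh * sg by rewrite /rh divfK// gt_eqF.
  have xrh : x <= rh by rewrite /rh ler_pdivlMr// ler_piMr// ltW.
  have rh1 : (1 - x) / 2 <= 1 - rh.
    have -> : 1 - rh = (sg - x) / sg by rewrite /rh; field; rewrite gt_eqF.
    by rewrite ler_pdivlMr// /sg; move: x0 x1; clear; nra.
  have x1' : 0 < 1 - x by rewrite subr_gt0.
  have rh1' : rh < 1 by rewrite -subr_gt0; apply: lt_le_trans rh1; rewrite divr_gt0.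
  have rh01 : 0 <= rh < 1 by rewrite rh1' (le_trans (ltW x0)).
  have sg01 : 0 < sg < 1 by rewrite sg0.
  have h1 : cint_pow q x h <= N x `^ q * (del * (1 - rh) `^ bet).
    rewrite {1}xE; apply: (le_trans (hadamard_young_ge0 hf hg hh rh01 sg01 q1 (N0 x x01) (gN x x01))).
    by apply: ler_wpM2l; [exact: powR_ge0|apply: fdel; rewrite rh1' (lt_le_trans r0x)].
  have h2 : (1 - rh) `^ bet <= 2 `^ (- bet) * (1 - x) `^ bet.
    apply: (@le_trans _ _ (((1 - x) / 2) `^ bet)).
      by apply: le_powRN => //; [rewrite divr_gt0|exact: ltW].
    rewrite powRM ?invr_ge0 ?(ltW x1')// mulrC; apply: ler_wpM2r; first exact: powR_ge0.
    by rewrite -powR_inv1// -powRrM mulN1r.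
  have h3 : N x `^ q <= N x `^ p * ((4 * Lam) `^ e * (1 - x) `^ (- (2 * e))).
    have -> : N x `^ q = N x `^ p * (N x `^ p) `^ e.
      have [N00|Nn0] := eqVneq (N x) 0; first by rewrite N00 !powR0 ?gt_eqF// mul0r.
      have Np : 0 < N x by rewrite lt_neqAle eq_sym Nn0 N0.
      by rewrite [in X in X = _]qpe (powRD_gt0 _ _ Np) powRrM.
    apply: ler_wpM2l; first exact: powR_ge0.
    rewrite powRN ler_pdivlMr ?powR_gt0// powRrM powR_mulrn ?(ltW x1')// -powRM ?powR_ge0 ?sqr_ge0//.
    apply: ge0_ler_powR; rewrite ?nnegrE ?(ltW e0)//.
    - by rewrite mulr_ge0 ?powR_ge0 ?sqr_ge0.
    - by rewrite mulr_ge0.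
    - exact: NA.
  apply: (@le_trans _ _ ((1 - x) `^ q * (N x `^ p * ((4 * Lam) `^ e * (1 - x) `^ (- (2 * e))) *
      (del * (2 `^ (- bet) * (1 - x) `^ bet))))).
    apply: ler_wpM2l; first exact: powR_ge0.
    apply: le_trans h1 _; apply: ler_pM h3 _; rewrite ?powR_ge0//.
      by rewrite mulr_ge0 ?powR_ge0.
    by rewrite ler_wpM2l.
  have E : 1 - x = (1 - x) `^ q * (1 - x) `^ bet * (1 - x) `^ (- (2 * e)).
    by rewrite -!powRD_gt0// bete addrK powRr1// ltW.
  rewrite /K [X in _ <= _ * (X * _)]E le_eqVlt; apply/orP; left; apply/eqP; ring.
apply: (@le_trans _ _ (\int[mu]_(x in `]0%R, 1%R[) (K * ((1 - x) * N x `^ p))%:E)%E).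
  apply: ge0_subset_integral => //.
    by apply/measurable_EFinP; apply: measurable_funM; [exact: measurable_cst|exact: mF].
  by move=> u /=; rewrite in_itv /= => u01; rewrite lee_fin mulr_ge0// F0.
rewrite (integralZl_EFin I01 mF _ K0); last by move=> x /=; rewrite in_itv /=; exact: F0.
apply: (@le_trans _ _ (K%:E * Lam%:E)%E); first by apply: lee_wpmul2l; rewrite ?lee_fin.
rewrite -EFinM lee_fin /K powRM// le_eqVlt; apply/orP; left; apply/eqP.
have qp0 : 0 < q / p by rewrite divr_gt0.
rewrite -(mulr_powRB1 Lam0 qp0) qp1; ring.
Qed.

End HadamardTail.

(** * Dominated convergence and Bessel's inequality *)

Section SeriesTools.
Context {R : realType}.
Implicit Types (f g h : Cplx R -> Cplx R) (p q r t x : R) (a b : nat -> Cplx R).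

Lemma sum_tail (V : zmodType) (F : nat -> V) m n : (m <= n)%N ->
  \sum_(k < n) F k - \sum_(k < m) F k = \sum_(m <= k < n) F k.
Proof.
move=> mn; rewrite -!(big_mkord xpredT) (big_cat_nat (n := m))//=.
by rewrite addrAC subrr add0r.
Qed.

Lemma bounded_tail (w : nat -> R) (M : R) : (forall k, 0 <= w k) ->
  (forall n, \sum_(k < n) w k <= M) ->
  forall e : R, 0 < e -> exists N, forall n, (N <= n)%N -> \sum_(N <= k < n) w k < e.
Proof.
move=> w0 wM e e0.
have nd : {homo (fun n => \sum_(k < n) w k) : m n / (m <= n)%N >-> m <= n}.
  apply: homo_leq => [//|y x z|n]; first exact: le_trans.
  by rewrite big_ord_recr /= lerDl.
have bd : has_ubound (range (fun n => \sum_(k < n) w k)) by exists M => _ [n _ <-].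
have cv := nondecreasing_cvgn nd bd.
have e2 : 0 < e / 2 by rewrite divr_gt0.
have [N HN] := real_series_cvg cv e2; exists N => n Nn.
rewrite -sum_tail//; have := HN n Nn; have := HN N (leqnn N); rewrite !ltr_norml.
by move=> /andP[h1 h2] /andP[h3 h4]; lra.
Qed.

Lemma abs_cvg (u : nat -> Cplx R) (M : R) : (forall n, \sum_(k < n) cmod (u k) <= M) ->
  exists l : Cplx R, (fun n => \sum_(k < n) u k) @ \oo --> l.
Proof.
move=> uM; apply: cplx_cauchy_cvg => e e0.
have e2 : 0 < e / 2 by rewrite divr_gt0.
have [N HN] := bounded_tail (fun k => cmod_ge0 (u k)) uM e2.
exists N => m n Nm Nn.
have h i : (N <= i)%N -> cmod (\sum_(k < i) u k - \sum_(k < N) u k) < e / 2.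
  by move=> Ni; rewrite sum_tail//; apply: le_lt_trans (cmod_sum _ _) (HN i Ni).
have -> : \sum_(k < m) u k - \sum_(k < n) u k =
  (\sum_(k < m) u k - \sum_(k < N) u k) - (\sum_(k < n) u k - \sum_(k < N) u k) by ring.
apply: le_lt_trans (cmodBD _ _) _; have := h m Nm; have := h n Nn.
by move: (cmod _) (cmod _) => A B; clear; lra.
Qed.

(** Tannery's theorem: dominated convergence for series. *)
Lemma tannery (u : nat -> nat -> Cplx R) (v : nat -> Cplx R) (w : nat -> R) (M : R)
    (l : nat -> Cplx R) (L : Cplx R) :
  (forall j k, cmod (u j k) <= w k) -> (forall n, \sum_(k < n) w k <= M) ->
  (forall k, (fun j => u j k) @ \oo --> v k) ->
  (forall j, (fun n => \sum_(k < n) u j k) @ \oo --> l j) ->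
  ((fun n => \sum_(k < n) v k) @ \oo --> L) ->
  l @ \oo --> L.
Proof.
move=> uw wM uv ul vL.
have w0 k : 0 <= w k by apply: le_trans (uw 0%N k); exact: cmod_ge0.
have vw k : cmod (v k) <= w k.
  by apply: (@cmod_lim_le R _ _ _ 0 (uv k)) => j _; exact: uw.
have tail := bounded_tail w0 wM.
have tailb (s : nat -> Cplx R) (S : Cplx R) (e : R) N :
    (forall k, cmod (s k) <= w k) -> (fun n => \sum_(k < n) s k) @ \oo --> S ->
    (forall n, (N <= n)%N -> \sum_(N <= k < n) w k < e) ->
    cmod (S - \sum_(k < N) s k) <= e.
  move=> sw sS tN.
  have h := cvgCB sS (@cvgCc R (\sum_(k < N) s k)).
  apply: (@cmod_lim_le R _ _ _ N h) => n Nn.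
  rewrite sum_tail//.
  apply: le_trans (cmod_sum _ _) _; apply: le_trans (ltW (tN n Nn)).
  by apply: ler_sum => k _.
apply/cvg_seqP => e e0.
have e4 : 0 < e / 4 by rewrite divr_gt0.
have [N HN] := tail _ e4.
have fin : (fun j => \sum_(k < N) u j k) @ \oo --> \sum_(k < N) v k.
  elim: {HN} N => [|N IH].
    by under eq_fun do rewrite big_ord0; rewrite big_ord0; exact: cvgCc.
  under eq_fun do rewrite big_ord_recr /=; rewrite big_ord_recr /=.
  exact: (cvgCD IH (uv N)).
have /cvg_seqP /(_ _ e4) [J HJ] := fin.
exists J => j Jj; have h1 := HJ j Jj.
have h2 := tailb _ _ _ _ (uw j) (ul j) HN.
have h3 := tailb _ _ _ _ vw vL HN.
have -> : l j - L = (l j - \sum_(k < N) u j k) + ((\sum_(k < N) u j k - \sum_(k < N) v k) -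
    (L - \sum_(k < N) v k)) by ring.
apply: le_lt_trans (cmodD _ _) _.
have := cmodBD (\sum_(k < N) u j k - \sum_(k < N) v k) (L - \sum_(k < N) v k).
move: h1 h2 h3 e0; move: (cmod _) (cmod _) (cmod _) (cmod _) => A B C D; clear; lra.
Qed.

Definition cshift a n : Cplx R := if n is m.+1 then a m else 0.

Lemma has_pseries_shift a f : has_pseries a f -> has_pseries (cshift a) (fun z => z * f z).
Proof.
move=> /has_pseriesP hf; apply/has_pseriesP => z z1.
have E n : psum (cshift a) z n.+1 = z * psum a z n.
  rewrite /psum big_ord_recl /= mul0r add0r mulr_sumr; apply: eq_bigr => k _.
  by rewrite /bump /= add1n exprS mulrCA.
have h := cvgCM (@cvgCc R z) (hf z z1).
apply/cvg_seqP => e e0; have /cvg_seqP /(_ e e0) [N HN] := h.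
by exists N.+1 => -[//|n] Nn; rewrite E; exact: HN.
Qed.

Lemma has_pseries_uniq a b f : has_pseries a f -> has_pseries b f -> a = b.
Proof. by move=> /taylor_coefE <- /taylor_coefE <-. Qed.

(** Multiplying back by [1 - z] gives a telescoping recurrence for the
    coefficients of the quotient. *)
Lemma has_pseries_psums a f : has_pseries a f ->
  has_pseries (fun n => \sum_(k < n.+1) a k) (fun z => f z * (1 - 1 * z)^-1).
Proof.
move=> hf; have Hf := has_pseries_Hol hf.
pose g z := f z * (1 - 1 * z)^-1.
have c1 : cmod (1 : Cplx R) <= 1 by rewrite cmod1.
have Hg : Hol g := HolM Hf (Hol_cauchy_kernel c1).
have hg := Hol_pseries Hg; set c := taylor_coef g in hg *.
have h : has_pseries (fun n => -1 * cshift c n + c n) f.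
  have h0 := @has_pseries_lin R _ _ _ _ (-1) (has_pseries_shift hg) hg.
  apply: (has_pseries_ext h0) => z z1.
  have n0 : 1 - 1 * z != 0 by apply: one_sub_neq0 => //; rewrite cmod1.
  by rewrite /g; move: n0; rewrite mul1r => n0; field.
have E := has_pseries_uniq hf h.
suff E2 : (fun n => \sum_(k < n.+1) a k) = c by rewrite E2; exact: hg.
apply/funext => n; rewrite E; elim: n => [|n IH].
  by rewrite big_ord1 /= mulr0 add0r.
rewrite big_ord_recr IH; transitivity (c n + (-1 * c n + c n.+1)); first by [].
  by ring.
Qed.

Lemma has_pseries1 : has_pseries (fun n : nat => (n == 0%N)%:R : Cplx R) (fun _ => 1).
Proof.
apply/has_pseriesP => z _; apply/cvg_seqP => e e0; exists 1%N => -[//|n] _.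
rewrite /psum big_ord_recl big1 /= ?mul1r ?addr0 ?expr0 ?subrr ?cmod0// => k _.
by rewrite mul0r.
Qed.

Lemma has_pseries_geo : has_pseries (fun _ : nat => 1 : Cplx R) (fun z => (1 - 1 * z)^-1).
Proof.
have := has_pseries_psums has_pseries1.
rewrite [X in has_pseries X _ -> _](_ : _ = (fun _ => 1)); last first.
  by apply/funext => n; rewrite big_ord_recl big1 ?addr0.
by move=> hh; apply: (has_pseries_ext hh) => z _; rewrite mul1r.
Qed.

Lemma has_pseries_geo2 : has_pseries (fun n : nat => n.+1%:R : Cplx R)
  (fun z => (1 - 1 * z)^-1 * (1 - 1 * z)^-1).
Proof.
have := has_pseries_psums has_pseries_geo.
by rewrite [X in has_pseries X _ -> _](_ : _ = (fun n => n.+1%:R))//; apply/funext => n; rewrite sumr_const card_ord.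
Qed.

Lemma cmod_sqrC (z : Cplx R) : (cmod z ^+ 2)%:C = z * Num.conj z.
Proof. by rewrite -normCK normC_cmod rmorphXn. Qed.

Lemma circ1_conj t : Num.conj (circ 1 t : Cplx R) = (circ 1 t)^-1.
Proof. by rewrite invC_norm normC_cmod cmod_circ// rmorph1 expr1n invr1 mul1r. Qed.

(** Bessel's inequality: the sum on the left is the mean of [f] against the
    conjugate of its own Taylor polynomial, and also the mean square of that
    polynomial. *)
Lemma bessel f r n : Hol f -> 0 < r < 1 ->
  \sum_(k < n) (cmod (taylor_coef f k) * r ^+ k) ^+ 2 <= (pi *+ 2)^-1 * cint_pow 2 r f.
Proof.
move=> hf r01; have /andP[r0 r1] := r01.
have r01' : 0 <= r < 1 by rewrite ltW.
set a := taylor_coef f.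
pose c k : Cplx R := Num.conj (a k * r%:C ^+ k).
pose e (t : R) : Cplx R := \sum_(k < n) c k * (circ 1 t)^-1 ^+ k.
pose p z := psum a z n.
pose a' k := if (k < n)%N then a k else 0.
have hp : has_pseries a' p.
  apply/has_pseriesP => z _; apply/cvg_seqP => d d0; exists n => m nm.
  rewrite (_ : psum a' z m = p z) ?subrr ?cmod0// /psum /p /psum.
  rewrite -(big_mkord xpredT (fun k => a' k * z ^+ k)) (big_cat_nat (n := n))//=.
  rewrite [X in _ + X]big_nat_cond [X in _ + X]big1 ?addr0.
    by rewrite big_mkord; apply: eq_bigr => k _; rewrite /a' ltn_ord.
  by move=> k; rewrite andbT /a' leqNgt => /andP[/negbTE -> _]; rewrite mul0r.
have [Hp pa] := Hol_pseries_taylor hp.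
have eE t : e t = Num.conj (p (circ r t)).
  rewrite /p /psum rmorph_sum /=; apply: eq_bigr => k _.
  have -> : circ r t = r%:C * circ 1 t by rewrite circ_scale mulr1.
  by rewrite exprMn mulrA rmorphM rmorphXn /= circ1_conj.
set S := \sum_(k < n) _.
have SE : \sum_(k < n) c k * (a k * r%:C ^+ k) = S%:C.
  rewrite /S rmorph_sum /=; apply: eq_bigr => k _.
  rewrite /c mulrC -cmod_sqrC cmodM cmodX cmod_real ger0_norm ?(ltW r0)//.
have h1 : cmean (fun t => f (circ r t) * e t) = S%:C by rewrite cmean_trig.
have h2 : cmean (fun t => p (circ r t) * e t) = S%:C.
  by rewrite cmean_trig// pa -SE; apply: eq_bigr => k _; rewrite /a' ltn_ord.
have cf := cont_circ (Hol_cont hf) r01'.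
have cp := cont_circ (Hol_cont Hp) r01'.
have ce : continuous e.
  apply: (cperiod_sum n (F := fun k t => c k * (circ 1 t)^-1 ^+ k) _).1 => k.
  have ce : continuous (fun t : R => (circ 1 t)^-1 ^+ k) by apply: cont_expC; exact: continuous_circV.
  exact: (cont_mulC (cont_cstC _) ce).
have sq u : continuous u -> continuous (fun t : R => cmod (u t : Cplx R) ^+ 2).
  move=> cu; have cm := cont_cmod cu; exact: (cont_mulR cm cm).
have C2 : cint_pow 2 r f = rint 0 (pi *+ 2) (fun t => cmod (f (circ r t)) ^+ 2).
  by rewrite cint_powE; congr rint; apply/funext => t; rewrite powR_mulrn// cmod_ge0.
have P2 : rint 0 (pi *+ 2) (fun t => cmod (p (circ r t)) ^+ 2) = pi *+ 2 * S.
  have /(congr1 (@complex.Re R)) := h2; rewrite /cmean /cperiod.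
  rewrite (_ : (fun t => _) = (fun t => (cmod (p (circ r t)) ^+ 2)%:C)); last first.
    by apply/funext => t; rewrite eE cmod_sqrC.
  rewrite /cint /= mul0r subr0 => <-.
  by rewrite mulrA mulfV ?mul1r// gt_eqF// pi2_gt0.
have S0 : 0 <= S by apply: sumr_ge0 => k _; exact: sqr_ge0.
have : S <= (pi *+ 2)^-1 * rint 0 (pi *+ 2) (fun t => cmod (f (circ r t) * e t)).
  by have := cmod_cmean (cont_mulC cf ce); rewrite h1 cmod_real ger0_norm.
have h3 : rint 0 (pi *+ 2) (fun t => cmod (f (circ r t) * e t)) <=
    2^-1 * (rint 0 (pi *+ 2) (fun t => cmod (f (circ r t)) ^+ 2) + pi *+ 2 * S).
  rewrite -P2 -(rintD _ _ (sq _ cf) (sq _ cp)) -rintZ; last exact: (cont_addR (sq _ cf) (sq _ cp)).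
  apply: rint_le.
  - exact: (cont_cmod (cont_mulC cf ce)).
  - have := cont_addR (sq _ cf) (sq _ cp); exact: cont_scaleR.
  move=> t _; rewrite cmodM eE.
  have -> : cmod (Num.conj (p (circ r t))) = cmod (p (circ r t)).
    by rewrite /cmod norm_conjC.
  move: (cmod _) (cmod _) => A B; have := sqr_ge0 (A - B); clear; nra.
rewrite -C2 in h3.
move=> h4; have p0 := @pi2_gt0 R.
have {h4} : pi *+ 2 * S <= rint 0 (pi *+ 2) (fun t => cmod (f (circ r t) * e t)).
  by move: h4; rewrite -ler_pdivlMl ?invr_gt0// invrK mulrC.
move=> /le_trans/(_ h3) h4; rewrite ler_pdivlMl//.
move: h4; move: (pi *+ 2 * S) (cint_pow _ _ _) => A B; clear; lra.
Qed.

End SeriesTools.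

(** * Partial sums of Taylor coefficients *)

Section MeanDominated.
Context {R : realType}.
Notation mu := (@lebesgue_measure R).
Implicit Types (f g h : Cplx R -> Cplx R) (p q r t x : R) (a b : nat -> Cplx R).

(** The property of the coefficient sequences [b] that both operators produce
    from a function of [A^p]: the means of order one of the sum are dominated
    by a function with the weighted [L^p] bound of the embedding. *)
Definition mean_dom p (Lam : R) b := exists2 Phi, has_pseries b Phi & exists N : R -> R,
  [/\ measurable_fun (`]0, 1[ : set R) N,
      forall x, 0 < x < 1 -> 0 <= N x,
      forall x y, 0 < x -> x <= y -> y < 1 -> N x <= N y,
      forall x, 0 < x < 1 ->
        rint 0 (pi *+ 2) (fun t => cmod (Phi (circ ((1 + x) / 2) t))) <= N x * (pi *+ 2) &
      (\int[mu]_(x in `]0%R, 1%R[) ((1 - x) * N x `^ p)%:E <= Lam%:E)%E].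

Lemma powR_mono x y r : 0 <= r -> 0 <= x -> x <= y -> x `^ r <= y `^ r.
Proof. by move=> r0 x0 xy; apply: ge0_ler_powR; rewrite // nnegrE ?(le_trans x0). Qed.

Lemma le_root p x y : 0 < p -> 0 <= x -> x `^ p <= y -> x <= y `^ p^-1.
Proof.
move=> p0 x0 xy; have pi0 : 0 <= p^-1 by rewrite invr_ge0 ltW.
have := powR_mono pi0 (powR_ge0 x p) xy.
by rewrite -powRrM mulfV ?gt_eqF// powRr1.
Qed.

Lemma bergman_int_ge0 p f : (0 <= bergman_int p f)%E.
Proof.
by apply: integral_ge0 => w _; rewrite lee_fin powR_ge0.
Qed.

Lemma bergman_fineK p f : Bergman p f -> (fine (bergman_int p f))%:E = bergman_int p f.
Proof. by move=> [_ fin]; rewrite fineK// ge0_fin_numE// bergman_int_ge0. Qed.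

Lemma fine_bergman_ge0 p f : 0 <= fine (bergman_int p f).
Proof. exact/fine_ge0/bergman_int_ge0. Qed.

Lemma cint_pow_bergman_fine p f r : Bergman p f -> 1 <= p -> 0 <= r < 1 ->
  cint_pow p r f <= 4 / (1 - r) * fine (bergman_int p f).
Proof.
move=> bf p1 r01; have [hf _] := bf; have /andP[r0 r1] := r01.
have := cint_pow_bergman hf p1 r01; rewrite -(bergman_fineK bf) lee_fin /= => h.
have d0 : 0 < 1 - r by rewrite subr_gt0.
rewrite mulrAC ler_pdivlMr// mulrC.
by move: h; move: (cint_pow _ _ _) (fine _) => A B; clear; lra.
Qed.

(** Partial sums of Taylor coefficients: their generating function is
    [(f z / (1 - z) - f 0) / z], and Hoelder's inequality against the Cauchy
    kernel controls its means. *)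
Lemma mean_dom_psums p : 1 < p -> exists2 C : R, 0 < C & forall f, Bergman p f ->
  mean_dom p (C * fine (bergman_int p f)) (fun n => \sum_(k < n.+2) taylor_coef f k).
Proof.
move=> p1; have p0 : 0 < p by apply: lt_trans p1.
have pn : p != 0 by rewrite gt_eqF.
have [C1 C10 h1] := cauchy_Lp p1; have [C2 C20 h2] := growth_real p1.
pose c : R := (2 * C1) `^ p^-1 / pi + 2 * C2 `^ p^-1 * 2 `^ p^-1.
have c0 : 0 < c by rewrite addr_gt0// ?divr_gt0 ?mulr_gt0 ?powR_gt0 ?pi_gt0 ?mulr_gt0.
exists (c `^ p * 4) => [|f bf]; first by rewrite mulr_gt0// powR_gt0.
have [hf _] := bf; set a := taylor_coef f; have fa : has_pseries a f := Hol_pseries hf.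
have hS := has_pseries_psums fa; set b := fun n => _.
have rb : radius1 b := radius1_shift (has_pseries_radius1 hS).
have hb := psfunP rb; set Phi := psfun b in hb *.
have p1' := ltW p1.
(* [z Phi z = f z / (1 - z) - f 0] *)
have PhiE z : cmod z < 1 -> z * Phi z = f z * (1 - z)^-1 - a 0%N.
  move=> z1; have /has_pseriesP /(_ _ z1) k1 := has_pseries_shift hb.
  have /has_pseriesP /(_ _ z1) k2 := hS; rewrite mul1r in k2.
  have k3 := cvgCB k2 (@cvgCc R (a 0%N)).
  rewrite -(cvg_limC k1) -(cvg_limC k3); symmetry; apply: cvg_limC.
  apply/cvg_seqP => e e0; have /cvg_seqP /(_ _ e0) [N HN] := k1.
  rewrite (cvg_limC k1); exists N.+1 => -[//|n] Nn.
  rewrite (_ : _ - a 0%N = psum (cshift b) z n.+1); first exact/HN/ltnW.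
  rewrite /psum [in LHS]big_ord_recl [in RHS]big_ord_recl /= big_ord1 mul0r add0r expr0 mulr1 addrAC subrr add0r.
  by apply: eq_bigr => k _; rewrite /bump /= add1n.
pose X x := ((1 - x)^-1 * cint_pow p ((1 + x) / 2) f) `^ p^-1.
have aux x : 0 < x < 1 -> [/\ 0 < 1 - x, 0 < (1 + x) / 2 < 1 & 0 <= (1 + x) / 2 < 1].
  by move=> /andP[x0 x1]; split; [lra|apply/andP; split; lra|apply/andP; split; lra].
have mX : measurable_fun (`]0, 1[ : set R) X.
  apply: (measurableT_comp (measurable_powR _)); apply: measurable_funM.
    apply: measurable_funTS; apply: (measurableT_comp measurable_inv).
    exact: measurable_funB.
  exact: measurable_cint_pow_aff.
have X0 x : 0 <= X x by exact: powR_ge0.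
exists Phi => //; exists (fun x => c * X x); split.
- by apply: measurable_funM => //; exact: measurable_cst.
- by move=> x _; rewrite mulr_ge0 ?(ltW c0).
- move=> x y x0 xy y1; apply: ler_wpM2l; first exact: ltW.
  have x1 := le_lt_trans xy y1.
  have pi0 : 0 <= p^-1 by rewrite invr_ge0 ltW.
  have dx : 0 <= (1 - x)^-1 by rewrite invr_ge0 subr_ge0 ltW.
  apply: (powR_mono pi0 (mulr_ge0 dx (cint_pow_ge0 _ _ _))).
  apply: (ler_pM dx (cint_pow_ge0 _ _ _)).
    by rewrite lef_pV2 ?posrE ?subr_gt0// lerD2l lerN2.
  by apply: (cint_pow_homo hf p1'); lra.
- move=> x x01; have [d0 s01 s01'] := aux x x01; set s := (1 + x) / 2 in s01 s01' *.
  have /andP[s0 s1] := s01; have s2 : 1 / 2 <= s by rewrite /s; case/andP: x01; lra.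
  have ds : (1 - s)^-1 = 2 * (1 - x)^-1 by rewrite /s; field; rewrite gt_eqF//; case/andP: x01; lra.
  have cf := cont_circ (Hol_cont hf) s01'.
  have cP := cont_circ (Hol_cont (has_pseries_Hol hb)) s01'.
  pose S t := (cmod (1 - circ s t))^-1.
  have cS : continuous S.
    rewrite (_ : S = (fun t => (cmod (1 - circ s t))^-1 `^ 1)); first exact: cont_szego.
    by apply/funext => t; rewrite powRr1// invr_ge0 cmod_ge0.
  have cfS := cont_mulR (cont_cmod cf) cS.
  (* Of the two terms of [z Phi z], the first is estimated by Hoelder's
     inequality and the second by the growth of [f] at the origin. *)
  have b1 : rint 0 (pi *+ 2) (fun t => cmod (f (circ s t)) * S t) <= (2 * C1) `^ p^-1 * X x.
    have dC : 0 <= (1 - x)^-1 * cint_pow p s f by apply: mulr_ge0; [rewrite invr_ge0 ltW|exact: cint_pow_ge0].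
    have C12 : 0 <= 2 * C1 by rewrite mulr_ge0// ltW.
    rewrite /X -(powRM _ C12 dC).
    apply: le_root => //.
      by apply: Rintegral_ge0 => t _; rewrite mulr_ge0 ?invr_ge0 ?cmod_ge0.
    apply: le_trans (h1 f s s hf s01' s01') _.
    rewrite ds -/s; move: (1 - x)^-1 (cint_pow p s f) => A B; rewrite le_eqVlt; apply/orP; left; apply/eqP; ring.
  have b2 : cmod (a 0%N) <= C2 `^ p^-1 * 2 `^ p^-1 * X x.
    have dC : 0 <= (1 - x)^-1 * cint_pow p s f by apply: mulr_ge0; [rewrite invr_ge0 ltW|exact: cint_pow_ge0].
    have dC2 : 0 <= 2 * ((1 - x)^-1 * cint_pow p s f) by apply: mulr_ge0 => //.
    rewrite /X -mulrA -(powRM _ _ dC)// -(powRM _ (ltW C20) dC2).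
    apply: (le_root p0 (cmod_ge0 _)).
    have h01 : 0 <= (0 : R) < 1 by rewrite lexx ltr01.
    rewrite -(has_pseries0 fa); have := h2 f 0 hf h01; rewrite subr0 addr0 divr1 => h3.
    apply: le_trans h3 _; apply: ler_wpM2l; first exact: ltW.
    rewrite mulrA -ds; apply: (@le_trans _ _ (cint_pow p s f)).
      by apply: (cint_pow_homo hf p1') => //; lra.
    apply: ler_peMl; first exact: cint_pow_ge0.
    by rewrite invf_ge1 ?subr_gt0//; lra.
  have pt t : cmod (Phi (circ s t)) <= 2 * (cmod (f (circ s t)) * S t) + 2 * cmod (a 0%N).
    have z1 : cmod (circ s t) < 1 by rewrite cmod_circ// ltW.
    have := congr1 (@cmod R) (PhiE _ z1); rewrite cmodM cmod_circ ?(ltW s0)// => E.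
    have := cmodBD (f (circ s t) * (1 - circ s t)^-1) (a 0%N).
    rewrite -E cmodM cmodV -/(S t).
    have := cmod_ge0 (Phi (circ s t)).
    by move: s2; move: (cmod (Phi _)) (cmod (f _) * S t) (cmod (a _)) => A B D; clear; nra.
  apply: (@le_trans _ _ (rint 0 (pi *+ 2) (fun t => 2 * (cmod (f (circ s t)) * S t) + 2 * cmod (a 0%N)))).
    apply: rint_le => //.
      exact: (cont_cmod cP).
    exact: (cont_addR (@cont_scaleR R 2 _ cfS) (@cst_continuous R R (2 * cmod (a 0%N)))).
  rewrite (rintD _ _ (@cont_scaleR R 2 _ cfS) (@cst_continuous R R (2 * cmod (a 0%N)))).
  rewrite (rintZ _ _ _ cfS) rint_cst ?pi2_ge0// subr0.
  have pp := @pi_gt0 R; have p2 : (pi : R) *+ 2 = 2 * pi by rewrite mulr_natl.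
  apply: (@le_trans _ _ (2 * ((2 * C1) `^ p^-1 * X x) + 2 * (C2 `^ p^-1 * 2 `^ p^-1 * X x) * (pi *+ 2))).
    apply: lerD; first by rewrite ler_wpM2l.
    by rewrite ler_wpM2r ?pi2_ge0// ler_wpM2l.
  rewrite /c p2; move: (_ `^ p^-1) (_ `^ p^-1) (_ `^ p^-1) (X x) (pi : R) pp => A B D E P P0.
  rewrite le_eqVlt; apply/orP; left; apply/eqP; field; by rewrite gt_eqF.
- have I01 : measurable (`]0, 1[ : set R) by exact: measurable_itv.
  have mC := measurable_cint_pow_aff hf p0.
  have C0 x : `]0, 1[%classic x -> 0 <= cint_pow p ((1 + x) / 2) f by move=> _; exact: cint_pow_ge0.
  apply: (@le_trans _ _ (\int[mu]_(x in `]0%R, 1%R[) (c `^ p * cint_pow p ((1 + x) / 2) f)%:E)%E).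
    rewrite le_eqVlt; apply/orP; left; apply/eqP; apply: eq_integral => x /set_mem /=.
    rewrite in_itv /= => x01; have [d0 _ _] := aux x x01; congr EFin.
    rewrite (powRM _ (ltW c0) (X0 x)) /X -powRrM mulVf// powRr1; last first.
      by apply: mulr_ge0; [rewrite invr_ge0 ltW|exact: cint_pow_ge0].
    by rewrite mulrCA mulVKf// gt_eqF.
  rewrite (integralZl_EFin I01 mC C0 (powR_ge0 _ _)) EFinM (bergman_fineK bf) EFinM -muleA.
  by apply: lee_wpmul2l; [rewrite lee_fin powR_ge0|exact: integral_cint_pow_le].
Qed.

End MeanDominated.

(** * Restriction to a radius *)

Section RadialMoments.
Context {R : realType}.
Notation mu := (@lebesgue_measure R).
Implicit Types (f g h : Cplx R -> Cplx R) (p q r t x : R) (a b : nat -> Cplx R).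

(** The modulus on the radius from 0 to 1, measurable on the whole line. *)
Definition radial f x := dmod f (x * cos 0, x * sin 0).

Lemma radialE f x : 0 <= x < 1 -> radial f x = cmod (f x%:C).
Proof.
move=> /andP[x0 x1]; rewrite /radial dmod_circ ger0_norm// x1.
by rewrite circE cos0 sin0 mulr1 mulr0.
Qed.

Lemma radial_ge0 f x : 0 <= radial f x.
Proof. exact: dmod_ge0. Qed.

Lemma measurable_radial f D : Hol f -> measurable_fun D (radial f).
Proof. by move=> hf; apply: measurable_funTS; exact: measurable_ray. Qed.

(** [growth_real] with the mean estimated by [cint_pow_bergman]. *)
Lemma growth_bergman p : 1 < p -> exists2 C : R, 0 < C & forall f x, Bergman p f -> 0 <= x < 1 ->
  radial f x <= C * fine (bergman_int p f) `^ p^-1 * (1 - x) `^ (- (2 / p)).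
Proof.
move=> p1; have p0 : 0 < p by apply: lt_trans p1.
have [C C0 hC] := growth_real p1.
exists ((8 * C) `^ p^-1) => [|f x bf x01]; first by rewrite powR_gt0// mulr_gt0.
have [hf _] := bf; have /andP[x0 x1] := x01; have d0 : 0 < 1 - x by rewrite subr_gt0.
have F0 := fine_bergman_ge0 p f.
have -> : (1 - x) `^ (- (2 / p)) = ((1 - x) `^ (- 2)) `^ p^-1 by rewrite -powRrM mulNr.
rewrite -powRM ?mulr_ge0 ?(ltW C0)// -powRM ?mulr_ge0 ?powR_ge0 ?(ltW C0)//.
rewrite radialE//; apply: (le_root p0 (cmod_ge0 _)).
apply: le_trans (hC f x hf x01) _.
have s01 : 0 <= (1 + x) / 2 < 1 by apply/andP; split; lra.
have := cint_pow_bergman_fine bf (ltW p1) s01.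
have -> : 4 / (1 - (1 + x) / 2) = 8 / (1 - x) by field; rewrite !gt_eqF//; lra.
move=> h; apply: (@le_trans _ _ (C / (1 - x) * (8 / (1 - x) * fine (bergman_int p f)))).
  by apply: ler_wpM2l h; rewrite divr_ge0 ?ltW.
rewrite -[- 2]/(- 2%:R) powR_invn ?(ltW d0)// le_eqVlt; apply/orP; left; apply/eqP.
by move: (fine _) => A; field; rewrite gt_eqF.
Qed.

(** The growth rate [(1 - x) ^ (- 2 / p)] is integrable because [p > 2]. *)
Lemma radial_int_tail p : 2 < p -> exists2 C : R, 0 < C & forall f e, Bergman p f -> 0 < e <= 1 ->
  (\int[mu]_(x in `](1 - e)%R, 1%R[) (radial f x)%:E <=
   (C * fine (bergman_int p f) `^ p^-1 * e `^ (1 - 2 / p))%:E)%E.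
Proof.
move=> p2; have p1 : 1 < p by apply: lt_trans p2; lra.
have p0 : 0 < p by apply: lt_trans p1.
have s0 : 0 < 1 - 2 / p by rewrite subr_gt0 ltr_pdivrMr// mul1r.
have [C C0 hC] := growth_bergman p1.
exists (C * (1 - 2 / p)^-1) => [|f e bf /andP[e0 e1]]; first by rewrite mulr_gt0// invr_gt0.
have [hf _] := bf; set K := C * _.
have K0 : 0 <= C * fine (bergman_int p f) `^ p^-1 by rewrite mulr_ge0 ?powR_ge0 ?ltW.
set B := fine _ in K0 *.
have mW : measurable_fun (`](1 - e), 1[ : set R) (fun x => (1 - x) `^ (- (2 / p))).
  by apply: (measurableT_comp (measurable_powR _)); exact: measurable_funB.
apply: (@le_trans _ _ (\int[mu]_(x in `](1 - e)%R, 1%R[) (C * B `^ p^-1 * (1 - x) `^ (- (2 / p)))%:E)%E).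
  apply: le_integral_EFin; [exact: measurable_itv|exact: measurable_radial| |].
    by apply: measurable_funM; [exact: measurable_cst|exact: mW].
  move=> x /=; rewrite in_itv /= => /andP[ex x1]; rewrite radial_ge0/=.
  by apply: hC => //; rewrite x1 andbT; lra.
rewrite integralZl_EFin ?powR_ge0//; last by move=> x _; exact: powR_ge0.
rewrite (integral_reflect 1)//; last by move=> x _; exact: powR_ge0.
rewrite (_ : [set x | `]1 - e, 1[%classic (1 - x)] = `]0, e[%classic); last first.
  by apply/seteqP; split => x /=; rewrite !in_itv /= => /andP[h1 h2]; apply/andP; split; lra.
apply: (@le_trans _ _ ((C * B `^ p^-1)%:E * ((1 - 2 / p)^-1 * e `^ (1 - 2 / p))%:E)%E); last first.
  by rewrite -EFinM lee_fin /K le_eqVlt; apply/orP; left; apply/eqP; ring.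
apply: lee_wpmul2l; first by rewrite lee_fin.
apply: le_trans (integral_powR0 e0 s0).
apply: (@le_trans _ _ (\int[mu]_(x in `]0%R, e[) (x `^ (1 - 2 / p - 1))%:E)%E).
  rewrite le_eqVlt; apply/orP; left; apply/eqP; apply: eq_integral => x _.
  have E1 : 1 - (1 - x) = x by ring.
  have E2 : 1 - 2 / p - 1 = - (2 / p) by ring.
  by rewrite E1 E2.
apply: ge0_subset_integral => //.
- by apply/measurable_EFinP; exact: measurable_powR_oo.
- by move=> x _; rewrite lee_fin powR_ge0.
- by move=> x /=; rewrite !in_itv /= => /andP[-> /ltW ->].
Qed.

(** Bessel's inequality and the growth of the means of order two give
    [sum |a k| t ^ k = O((1 - t) ^ (- (1 / 2 + 1 / p)))], which is integrable. *)
Lemma coef_summable p f : 2 < p -> Bergman p f ->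
  exists M : R, forall n, \sum_(k < n) cmod (taylor_coef f k) / k.+1%:R <= M.
Proof.
move=> p2 bf; have p1 : 1 < p by apply: lt_trans p2; lra.
have p0 : 0 < p by apply: lt_trans p1.
have ip : 0 < p^-1 by rewrite invr_gt0.
have ip2 : p^-1 < 1 / 2 by rewrite mul1r ltf_pV2 ?posrE.
have [hf _] := bf; set a := taylor_coef f; set B := fine (bergman_int p f).
have B0 : 0 <= B by exact: fine_bergman_ge0.
have p20 := @pi2_gt0 R; set P := (pi : R) *+ 2 in p20.
have C2 r : 0 <= r < 1 -> cint_pow 2 r f <= (P + 4 * B) * (1 - r) `^ (- (2 * p^-1)).
  move=> r01; have /andP[r0 r1] := r01; have d0 : 0 < 1 - r by rewrite subr_gt0.
  pose lam := (1 - r) `^ (- p^-1); have l0 : 0 < lam by rewrite powR_gt0.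
  have cp := cont_cmod_circ hf p0 r01.
  have h0 : (0 : R) < 2 by [].
  rewrite cint_powE.
  apply: (@le_trans _ _ (rint 0 P (fun t => lam `^ 2 + lam `^ (2 - p) * cmod (f (circ r t)) `^ p))).
    apply: rint_le; first exact: cont_cmod_circ hf h0 r01.
      exact: (cont_addR (@cst_continuous R R (lam `^ 2)) (@cont_scaleR R (lam `^ (2 - p)) _ cp)).
    move=> t _; have c0 := cmod_ge0 (f (circ r t)); set c := cmod _ in c0 *.
    have [cl|lc] := leP c lam.
      apply: (@le_trans _ _ (lam `^ 2)); first exact: powR_mono.
      by rewrite lerDl mulr_ge0 ?powR_ge0.
    have cpos : 0 < c by apply: lt_trans lc.
    apply: (@le_trans _ _ (lam `^ (2 - p) * c `^ p)); last by rewrite lerDr powR_ge0.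
    rewrite (_ : c `^ 2 = c `^ (2 - p) * c `^ p); last by rewrite -powRD_gt0// subrK.
    by rewrite ler_wpM2r ?powR_ge0// le_powRN ?(ltW lc)// subr_le0 ltW.
  rewrite (rintD _ _ (@cst_continuous R R (lam `^ 2)) (@cont_scaleR R (lam `^ (2 - p)) _ cp)).
  rewrite (rintZ _ _ _ cp) (rint_cst _ (ltW p20)) subr0 -cint_powE.
  have h := cint_pow_bergman_fine bf (ltW p1) r01; rewrite -/B in h.
  have e1 : lam `^ 2 = (1 - r) `^ (- (2 * p^-1)) by rewrite /lam -powRrM mulNr mulrC.
  have e2 : lam `^ (2 - p) = (1 - r) `^ (- (2 * p^-1)) * (1 - r).
    transitivity ((1 - r) `^ (- (2 * p^-1)) * (1 - r) `^ 1); last by rewrite powRr1 ?ltW.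
    by rewrite /lam -powRrM -powRD_gt0//; congr (_ `^ _); field; rewrite gt_eqF.
  rewrite e1 e2; apply: (@le_trans _ _ ((1 - r) `^ (- (2 * p^-1)) * P +
      (1 - r) `^ (- (2 * p^-1)) * (1 - r) * (4 / (1 - r) * B))).
    by rewrite lerD2l ler_wpM2l// mulr_ge0 ?powR_ge0 ?ltW.
  rewrite le_eqVlt; apply/orP; left; apply/eqP; move: (_ `^ _) => X.
  by field; rewrite gt_eqF.
pose s := 1 / 2 + p^-1.
have s1 : 0 < 1 - s by rewrite /s; lra.
pose E := (P^-1 * ((P + 4 * B) * (2^-1) `^ (- (2 * p^-1))) + 1) / 2.
have PB : 0 <= P + 4 * B by rewrite addr_ge0 ?(ltW p20)// mulr_ge0.
have E0 : 0 <= E.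
  by rewrite /E divr_ge0// addr_ge0// mulr_ge0 ?invr_ge0 ?(ltW p20)// mulr_ge0// powR_ge0.
have abel t n : 0 < t < 1 -> \sum_(k < n) cmod (a k) * t ^+ k <= E * (1 - t) `^ (- s).
  move=> /andP[t0 t1]; have d0 : 0 < 1 - t by rewrite subr_gt0.
  pose r := Num.sqrt t; have r0 : 0 < r by rewrite sqrtr_gt0.
  have rr : r ^+ 2 = t by rewrite sqr_sqrtr// ltW.
  have r1 : r < 1 by rewrite -[X in _ < X]sqrtr1 ltr_sqrt.
  have rt : (1 - t) / 2 <= 1 - r by rewrite -rr; move: r0 r1; clear; nra.
  have r01 : 0 < r < 1 by rewrite r0.
  have r01' : 0 <= r < 1 by rewrite ltW.
  pose lam := (1 - t) `^ (p^-1 - 1 / 2); have l0 : 0 < lam by rewrite powR_gt0.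
  have bes := bessel n hf r01; rewrite -/a -/P in bes.
  have S1 : \sum_(k < n) cmod (a k) ^+ 2 * t ^+ k <=
      P^-1 * ((P + 4 * B) * (2^-1) `^ (- (2 * p^-1))) * (1 - t) `^ (- (2 * p^-1)).
    apply: (@le_trans _ _ (P^-1 * cint_pow 2 r f)).
      apply: le_trans bes; rewrite le_eqVlt; apply/orP; left; apply/eqP; apply: eq_bigr => k _.
      by rewrite exprMn -exprM mulnC exprM rr.
    rewrite -mulrA; apply: ler_wpM2l; first by rewrite invr_ge0 ltW.
    apply: le_trans (C2 r r01') _; rewrite -mulrA; apply: ler_wpM2l.
      by rewrite addr_ge0 ?mulr_ge0 ?(ltW p20).
    rewrite -powRM ?invr_ge0 ?(ltW d0)//; apply: le_powRN.
    - by rewrite mulr_gt0 ?invr_gt0.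
    - by rewrite mulrC.
    - by rewrite oppr_le0 mulr_ge0 ?ltW.
  have S2 : \sum_(k < n) t ^+ k <= (1 - t)^-1 by apply: geo_sum_le; rewrite (ltW t0).
  apply: (@le_trans _ _ (2^-1 * (lam * (\sum_(k < n) cmod (a k) ^+ 2 * t ^+ k) +
      lam^-1 * (\sum_(k < n) t ^+ k)))).
    rewrite !mulr_sumr -big_split /= mulr_sumr; apply: ler_sum => k _.
    have tk : 0 <= t ^+ k by rewrite exprn_ge0// ltW.
    have h : 2 * cmod (a k) <= lam * cmod (a k) ^+ 2 + lam^-1.
      have : 0 <= lam^-1 * (lam * cmod (a k) - 1) ^+ 2 by rewrite mulr_ge0 ?sqr_ge0 ?invr_ge0 ?ltW.
      have ll : lam^-1 * lam = 1 by rewrite mulVf// gt_eqF.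
      have -> : lam^-1 * (lam * cmod (a k) - 1) ^+ 2 = (lam^-1 * lam) * (lam * cmod (a k) ^+ 2 - 2 * cmod (a k)) + lam^-1 by ring.
      by rewrite ll mul1r; lra.
    have := ler_wpM2r tk h; lra.
  apply: (@le_trans _ _ (2^-1 * (lam * (P^-1 * ((P + 4 * B) * (2^-1) `^ (- (2 * p^-1))) * (1 - t) `^ (- (2 * p^-1))) +
      lam^-1 * (1 - t)^-1))).
    apply: ler_wpM2l => //; apply: lerD; apply: ler_wpM2l => //; last by rewrite invr_ge0 ltW.
    exact: ltW.
  have e1 : lam * (1 - t) `^ (- (2 * p^-1)) = (1 - t) `^ (- s).
    by rewrite /lam -powRD_gt0//; congr (_ `^ _); rewrite /s; ring.
  have e2 : lam^-1 * (1 - t)^-1 = (1 - t) `^ (- s).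
    rewrite /lam -powRN; transitivity ((1 - t) `^ (- (p^-1 - 1 / 2)) * (1 - t) `^ (-1)).
      by rewrite powR_inv1 ?ltW.
    by rewrite -powRD_gt0//; congr (_ `^ _); rewrite /s; field; rewrite gt_eqF.
  rewrite e2 mulrCA e1 le_eqVlt; apply/orP; left; apply/eqP; rewrite /E; ring.
exists (E * (1 - s)^-1) => n.
pose u t := \sum_(k < n) cmod (a k) * t ^+ k.
have uE : (forall m, (m <= n)%N -> continuous (fun t : R => \sum_(k < m) cmod (a k) * t ^+ k) /\
    rint 0 1 (fun t => \sum_(k < m) cmod (a k) * t ^+ k) = \sum_(k < m) cmod (a k) / k.+1%:R).
  elim=> [|m IH] mn.
    under eq_fun do rewrite big_ord0; rewrite big_ord0.
    by split; [exact: cst_continuous|rewrite rint_cst// mul0r].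
  have [c1 E1] := IH (ltnW mn).
  have c2 := @cont_scaleR R (cmod (a m)) _ (@exprn_continuous R m).
  have EE : (fun t : R => \sum_(k < m.+1) cmod (a k) * t ^+ k) =
      (fun t => \sum_(k < m) cmod (a k) * t ^+ k + cmod (a m) * t ^+ m).
    by apply/funext => t; rewrite big_ord_recr.
  rewrite EE; split; first exact: (cont_addR c1 c2).
  rewrite (rintD _ _ c1 c2) E1 (rintZ _ _ _ (@exprn_continuous R m)) big_ord_recr /=.
  congr (_ + _ * _); have := @cint_monomial R 1 m ler01.
  by move=> /(congr1 (@complex.Re R)) /= ->; rewrite expr1n mul1r.
have [cu <-] := uE n (leqnn n); rewrite -/u in cu *.
rewrite -lee_fin -(rint_ge0E _ _ cu) -integral_itv_obnd_cbnd -?integral_itv_bndo_bndc; first last.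
- by apply/measurable_EFinP; exact: measurable_funTS (continuous_measurable cu).
- by apply/measurable_EFinP; exact: measurable_funTS (continuous_measurable cu).
apply: (@le_trans _ _ (\int[mu]_(t in `]0%R, 1%R[) (E * (1 - t) `^ (- s))%:E)%E).
  apply: le_integral_EFin; [exact: measurable_itv|exact: measurable_funTS (continuous_measurable cu)| |].
    apply: measurable_funM; first exact: measurable_cst.
    by apply: measurable_funTS; apply: (measurableT_comp (measurable_powR _)); exact: measurable_funB.
  move=> t /=; rewrite in_itv /= => t01; rewrite abel// andbT sumr_ge0// => k _.
  by rewrite mulr_ge0 ?cmod_ge0// exprn_ge0// ltW//; case/andP: t01.
rewrite integral_flip01; last 2 first.
- apply: measurable_funM; first exact: measurable_cst.
  by apply: measurable_funTS; apply: (measurableT_comp (measurable_powR _)); exact: measurable_funB.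
- by move=> t _; rewrite mulr_ge0 ?powR_ge0.
apply: (@le_trans _ _ (\int[mu]_(t in `]0%R, 1%R]) (E * t `^ (1 - s - 1))%:E)%E).
  apply: (@le_trans _ _ (\int[mu]_(t in `]0%R, 1%R[) (E * t `^ (1 - s - 1))%:E)%E).
    rewrite le_eqVlt; apply/orP; left; apply/eqP; apply: eq_integral => x _.
    have E1 : 1 - (1 - x) = x by ring.
    have E2 : 1 - s - 1 = - s by ring.
    by rewrite E1 E2.
  apply: ge0_subset_integral => //.
  - apply/measurable_EFinP; apply: measurable_funM; [exact: measurable_cst|exact: measurable_powR_oo].
  - by move=> x _; rewrite lee_fin mulr_ge0 ?powR_ge0.
  - by move=> x /=; rewrite !in_itv /= => /andP[-> /ltW ->].
rewrite integralZl_EFin//; last 2 first.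
- exact: measurable_powR_oo.
- by move=> x _; exact: powR_ge0.
rewrite [(E * _^-1)%:E]EFinM; apply: lee_wpmul2l; first by rewrite lee_fin.
by have := integral_powR0 ltr01 s1; rewrite powR1 mulr1.
Qed.

End RadialMoments.

(** * Moments *)

Section Moments.
Context {R : realType}.
Notation mu := (@lebesgue_measure R).
Implicit Types (f g h : Cplx R -> Cplx R) (p q r t x : R) (a b c : nat -> Cplx R).

(** For [f] in [A^p] with [p > 2] this is the integral of [t ^ n * f t] over the
    interval from 0 to 1. *)
Definition moment f n : Cplx R := limn (series (fun k => taylor_coef f k / (n + k + 1)%:R)).

Lemma series_ord (u : nat -> Cplx R) : series u = (fun n => \sum_(k < n) u k).
Proof. by apply/funext => n; rewrite /series /= big_mkord. Qed.

Lemma cmod_div_nat (z : Cplx R) n : cmod (z / n.+1%:R) = cmod z / n.+1%:R.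
Proof. by rewrite cmodM cmodV cmod_nat. Qed.

Lemma moment_term_le a n k : cmod (a k / (n + k + 1)%:R) <= cmod (a k) / k.+1%:R.
Proof.
rewrite addn1 cmod_div_nat ler_wpM2l ?cmod_ge0// lef_pV2 ?posrE ?ltr0n// ler_nat.
by rewrite ltnS leq_addl.
Qed.

Lemma momentP p f n : 2 < p -> Bergman p f ->
  (fun K => \sum_(k < K) taylor_coef f k / (n + k + 1)%:R) @ \oo --> moment f n.
Proof.
move=> p2 bf; have [M HM] := coef_summable p2 bf.
have [l hl] : exists l : Cplx R, (fun K => \sum_(k < K) taylor_coef f k / (n + k + 1)%:R) @ \oo --> l.
  apply: (@abs_cvg R (fun k => taylor_coef f k / (n + k + 1)%:R) M) => m; apply: le_trans (HM m); apply: ler_sum => k _.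
  exact: moment_term_le.
by rewrite /moment series_ord (cvg_limC hl).
Qed.

(** The primitive of the sum of [a] that vanishes at the origin. *)
Definition prim a r : Cplx R := r%:C * psfun (fun m => a m / m.+1%:R) r%:C.

Lemma radius1_prim a : radius1 a -> radius1 (fun m => a m / m.+1%:R).
Proof.
move=> ha; apply: (radius1_le (C := 1) ha) => n; rewrite cmod_div_nat mul1r.
rewrite ler_pdivrMr ?ltr0n// -mulrA mulrC -mulrA ler_peMr ?cmod_ge0//.
by rewrite -natrM ler1n muln_gt0.
Qed.

Lemma circr0 r : circ r 0 = r%:C :> Cplx R.
Proof. by rewrite circE cos0 sin0 mulr1 mulr0. Qed.

Lemma prim_ray a f r : has_pseries a f -> 0 < r < 1 ->
  ((cmod (prim a r))%:E <= \int[mu]_(x in `[0%R, r]) (radial f x)%:E)%E.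
Proof.
move=> hf r01; have ha := psfunP (radius1_prim (has_pseries_radius1 hf)).
have := ray_int 0 hf ha r01; have /andP[r0 _] := r01.
by rewrite circr0 /prim cmodM cmod_real ger0_norm ?(ltW r0).
Qed.

Lemma iter_cshift a n m : iter n cshift a m = if (m < n)%N then 0 else a (m - n)%N.
Proof.
elim: n m => [|n IH] m; first by rewrite subn0.
by rewrite iterS; case: m => [|m] //=; rewrite IH ltnS subSS.
Qed.

Lemma has_pseries_iter_shift a f n : has_pseries a f ->
  has_pseries (iter n cshift a) (fun z => z ^+ n * f z).
Proof.
move=> hf; elim: n => [|n IH].
  by apply: (has_pseries_ext hf) => z _; rewrite expr0 mul1r.
by apply: (has_pseries_ext (has_pseries_shift IH)) => z _; rewrite exprS mulrA.
Qed.

Lemma prim_shift a f n r : has_pseries a f -> 0 < r < 1 ->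
  (fun K => \sum_(k < K) a k / (n + k + 1)%:R * r%:C ^+ (n + k + 1)) @ \oo -->
  prim (iter n cshift a) r.
Proof.
move=> hf /andP[r0 r1]; have ha := has_pseries_radius1 (@has_pseries_iter_shift _ _ n hf).
have z1 : cmod (r%:C : Cplx R) < 1 by rewrite cmod_real ger0_norm// ltW.
have /has_pseriesP /(_ _ z1) k1 := psfunP (radius1_prim ha).
have k2 := cvgCM (@cvgCc R r%:C) k1.
apply/cvg_seqP => e e0; have /cvg_seqP /(_ _ e0) [N HN] := k2.
exists N => K NK; have := HN (n + K)%N (leq_trans NK (leq_addl _ _)).
rewrite (_ : r%:C * psum _ _ _ = \sum_(k < K) a k / (n + k + 1)%:R * r%:C ^+ (n + k + 1))//.
rewrite /psum big_split_ord /= big1 ?add0r => [|k _]; last first.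
  by rewrite iter_cshift ltn_ord !mul0r.
rewrite mulr_sumr; apply: eq_bigr => k _.
by rewrite iter_cshift ltnNge leq_addr /= addKn addn1 exprS mulrCA.
Qed.

Definition radii (j : nat) : R := 1 - j.+2%:R^-1.

Lemma radii01 j : 0 < radii j < 1.
Proof.
rewrite /radii subr_gt0 invf_lt1 ?ltr0n// ltr1n /= gtrBl invr_gt0.
by rewrite ltr0n.
Qed.

Lemma radii_cvg : (fun j => (radii j)%:C : Cplx R) @ \oo --> (1 : Cplx R).
Proof.
apply/cvg_seqP => e e0; exists (Num.truncn e^-1) => j hj.
have -> : ((radii j)%:C : Cplx R) - 1 = (- j.+2%:R^-1)%:C.
  by rewrite /radii rmorphB rmorphN /= rmorph1 addrAC subrr sub0r.
rewrite cmod_real normrN ger0_norm ?invr_ge0// invf_plt ?posrE ?ltr0n//.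
by apply: lt_le_trans (truncnS_gt _) _; rewrite ler_nat ltnS (leq_trans hj).
Qed.

Lemma radiiX_cvg n : (fun j => (radii j)%:C ^+ n : Cplx R) @ \oo --> (1 : Cplx R).
Proof.
elim: n => [|n IH]; first by under eq_fun do rewrite expr0; exact: cvgCc.
under eq_fun do rewrite exprS; have := cvgCM radii_cvg IH; by rewrite mulr1.
Qed.

(** Abel's theorem: the series of the moment converges absolutely, hence is the
    limit of its values at radii tending to 1. *)
Lemma moment_abel p f n : 2 < p -> Bergman p f ->
  (fun j => prim (iter n cshift (taylor_coef f)) (radii j)) @ \oo --> moment f n.
Proof.
move=> p2 bf; have [hf _] := bf; set a := taylor_coef f.
have [M HM] := coef_summable p2 bf.
apply: (@tannery R (fun j k => a k / (n + k + 1)%:R * (radii j)%:C ^+ (n + k + 1))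
  (fun k => a k / (n + k + 1)%:R) (fun k => cmod (a k) / k.+1%:R) M).
- move=> j k; have /andP[r0 r1] := radii01 j.
  rewrite cmodM cmodX cmod_real (ger0_norm (ltW r0)).
  apply: le_trans (moment_term_le a n k); rewrite ler_piMr ?cmod_ge0//.
  by rewrite exprn_ile1// ltW.
- exact: HM.
- move=> k; have := cvgCM (@cvgCc R (a k / (n + k + 1)%:R)) (radiiX_cvg (n + k + 1)).
  by rewrite mulr1.
- by move=> j; exact: prim_shift (Hol_pseries hf) (radii01 j).
- exact: momentP p2 bf.
Qed.

(** By [moment_abel] the left-hand side is a limit of integrals of [f] times a
    polynomial along radii shorter than 1. *)
Lemma moment_bound p f c N (M : R) : 2 < p -> Bergman p f ->
  (forall r, 0 < r < 1 ->
    (\int[mu]_(x in `[0%R, r]) (cmod (psum c x%:C N) * radial f x)%:E <= M%:E)%E) ->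
  cmod (\sum_(n < N) c n * moment f n) <= M.
Proof.
move=> p2 bf HM; have [hf _] := bf; set a := taylor_coef f.
have fa : has_pseries a f := Hol_pseries hf.
pose d K m := \sum_(n < K) c n * iter n cshift a m.
have hd K : has_pseries (d K) (fun z => psum c z K * f z) /\
    forall r, 0 < r < 1 -> prim (d K) r = \sum_(n < K) c n * prim (iter n cshift a) r.
  elim: K => [|K [IH1 IH2]].
    have -> : d 0%N = (fun _ => 0) by apply/funext => m; rewrite /d big_ord0.
    split.
      apply/has_pseriesP => z _; rewrite /psum big_ord0 mul0r; apply/cvg_seqP => e e0.
      by exists 0%N => m _; rewrite big1 ?subrr ?cmod0// => i _; rewrite mul0r.
    move=> r _; rewrite big_ord0 /prim.
    rewrite (_ : psfun _ _ = 0) ?mulr0//; apply: cvg_limC; apply/cvg_seqP => e e0.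
    by exists 0%N => m _; rewrite series_psum /psum big1 ?subrr ?cmod0// => i _; rewrite !mul0r.
  have h := @has_pseries_iter_shift _ _ K fa.
  have h2 := @has_pseries_lin R _ _ _ _ (c K) h IH1.
  have E : d K.+1 = (fun m => c K * iter K cshift a m + d K m).
    by apply/funext => m; rewrite /d big_ord_recr addrC.
  rewrite E; split.
    by apply: (has_pseries_ext h2) => z _; rewrite psumS; ring.
  move=> r r01; rewrite big_ord_recr /= -IH2// /prim.
  have /andP[r0 r1] := r01.
  have z1 : cmod (r%:C : Cplx R) < 1 by rewrite cmod_real ger0_norm// ltW.
  have k1 := psfunP (radius1_prim (has_pseries_radius1 h)).
  have k2 := psfunP (radius1_prim (has_pseries_radius1 IH1)).
  have k3 := @has_pseries_lin R _ _ _ _ (c K) k1 k2.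
  rewrite (_ : (fun m => (c K * iter K cshift a m + d K m) / m.+1%:R) =
    (fun m => c K * (iter K cshift a m / m.+1%:R) + d K m / m.+1%:R)); last first.
    by apply/funext => m; rewrite mulrDl mulrA.
  by rewrite (has_pseries_psfun k3 z1); ring.
have cv : (fun j => prim (d N) (radii j)) @ \oo --> \sum_(n < N) c n * moment f n.
  rewrite (_ : (fun j => _) = (fun j => \sum_(n < N) c n * prim (iter n cshift a) (radii j))); last first.
    by apply/funext => j; exact: (hd N).2 _ (radii01 j).
  have S K : (fun j => \sum_(n < K) c n * prim (iter n cshift a) (radii j)) @ \oo -->
      \sum_(n < K) c n * moment f n.
    elim: K => [|K IH].
      rewrite (_ : (fun j => _) = (fun _ => 0)); last by apply/funext => j; rewrite big_ord0.
      by rewrite big_ord0; exact: cvgCc.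
    rewrite (_ : (fun j => _) = (fun j => \sum_(n < K) c n * prim (iter n cshift a) (radii j) +
      c K * prim (iter K cshift a) (radii j))); last by apply/funext => j; rewrite big_ord_recr.
    rewrite big_ord_recr /=.
    exact: (cvgCD IH (cvgCM (@cvgCc R (c K)) (@moment_abel _ _ K p2 bf))).
  exact: S.
apply: (@cmod_lim_le R _ _ _ 0 cv) => j _; have r01 := radii01 j; have /andP[r0 r1] := r01.
rewrite -lee_fin; apply: le_trans (prim_ray (hd N).1 r01) _; apply: le_trans (HM _ r01).
rewrite le_eqVlt; apply/orP; left; apply/eqP; apply: eq_integral => x /set_mem /=.
rewrite in_itv /= => /andP[x0 xr]; have x01 : 0 <= x < 1 by rewrite x0 (le_lt_trans xr).
by rewrite !radialE// cmodM.
Qed.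

Lemma radial_int_fin p f : 2 < p -> Bergman p f ->
  (\int[mu]_(x in `]0%R, 1%R[) (radial f x)%:E)%E \is a fin_num.
Proof.
move=> p2 bf; have [C C0 hC] := radial_int_tail p2.
have e1 : 0 < (1 : R) <= 1 by rewrite ltr01 lexx.
have := hC f 1 bf e1; rewrite subrr => h.
rewrite ge0_fin_numE ?(le_lt_trans h) ?ltry//.
by apply: integral_ge0 => x _; rewrite lee_fin radial_ge0.
Qed.

Lemma measurable_psum_real c N : measurable_fun setT (fun x : R => cmod (psum c x%:C N)).
Proof.
rewrite (_ : (fun x : R => _) = (fun w : R * R => cmod (psum c (w.1 +i* w.2) N)) \o (fun x => (x, 0)))//.
apply: measurableT_comp; first exact: measurable_psum.
by apply: measurable_fun_pair => //; exact: measurable_cst.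
Qed.

Lemma radial_itv_le (F : R -> R) r : 0 < r < 1 -> measurable_fun setT F ->
  (forall x, 0 <= F x) ->
  (\int[mu]_(x in `[0%R, r]) (F x)%:E <= \int[mu]_(x in `]0%R, 1%R[) (F x)%:E)%E.
Proof.
move=> /andP[r0 r1] mF F0.
rewrite -integral_itv_obnd_cbnd; last by apply/measurable_EFinP; exact: measurable_funTS.
apply: ge0_subset_integral => //.
- by apply/measurable_EFinP; exact: measurable_funTS.
- by move=> x _; rewrite lee_fin.
- by move=> x /=; rewrite !in_itv /= => /andP[-> xr]; rewrite (le_lt_trans xr).
Qed.

Lemma moment_le p f n : 2 < p -> Bergman p f ->
  cmod (moment f n) <= fine (\int[mu]_(x in `]0%R, 1%R[) (radial f x)%:E)%E.
Proof.
move=> p2 bf; have [hf _] := bf; pose c k : Cplx R := (k == n)%:R.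
have E : \sum_(k < n.+1) c k * moment f k = moment f n.
  rewrite big_ord_recr /= big1 ?add0r; first by rewrite /c eqxx mul1r.
  by move=> k _; rewrite /c ltn_eqF ?mul0r.
rewrite -E; apply: (moment_bound p2 bf) => r r01; rewrite fineK ?(radial_int_fin p2 bf)//.
have mr := @measurable_radial R f setT hf.
apply: le_trans (radial_itv_le r01 mr (radial_ge0 f)).
apply: le_integral_EFin; [exact: measurable_itv| |exact: measurable_radial|].
  exact: measurable_funTS (measurable_funM (measurable_psum_real c n.+1) mr).
move=> x /=; rewrite in_itv /= => /andP[x0 xr]; have /andP[r0 r1] := r01.
rewrite mulr_ge0 ?cmod_ge0 ?radial_ge0//= ler_piMl ?radial_ge0//.
rewrite psumS /psum big1 ?add0r => [|k _]; last by rewrite /c ltn_eqF ?mul0r.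
rewrite /c eqxx mul1r cmodX cmod_real ger0_norm// exprn_ile1//.
by rewrite (le_trans xr)// ltW.
Qed.

Lemma measurable_szego_radial r t : measurable_fun setT (fun x : R => (cmod (1 - circ (x * r) t))^-1 ^+ 2).
Proof.
rewrite (_ : (fun x => _) = (fun x => ((1 - x * r) ^+ 2 + 2 * (x * r) * (1 - cos t))^-1)); last first.
  by apply/funext => x; rewrite exprVn cmod_one_sub_circ_sqr.
apply: (measurableT_comp measurable_inv); apply: measurable_funD.
  by apply: measurable_funX; apply: measurable_funB => //; exact: measurable_funM.
by apply: measurable_funM => //; apply: measurable_funM => //; exact: measurable_funM.
Qed.

(** Summing [(n + 1) x ^ n z ^ n] shows that [Phi z] is the integral of
    [f x / (1 - x z) ^ 2] over the radius. *)
Lemma moment_pseries_bound p f Phi r t : 2 < p -> Bergman p f ->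
  has_pseries (fun n => n.+1%:R * moment f n) Phi -> 0 <= r < 1 ->
  ((cmod (Phi (circ r t)))%:E <= \int[mu]_(x in `]0%R, 1%R[)
    (radial f x * (cmod (1 - circ (x * r) t))^-1 ^+ 2)%:E)%E.
Proof.
move=> p2 bf hPhi r01; have [hf _] := bf; have /andP[r0 r1] := r01.
set J := (\int[mu]_(x in _) _)%E.
have J0 : (0 <= J)%E.
  by apply: integral_ge0 => x _; rewrite lee_fin mulr_ge0 ?radial_ge0// sqr_ge0.
have [->|Jfin] := eqVneq J +oo%E; first by rewrite leey.
have /fineK JE : J \is a fin_num by rewrite ge0_fin_numE// ltey.
set I := fine (\int[mu]_(x in `]0%R, 1%R[) (radial f x)%:E)%E.
have I0 : 0 <= I by apply/fine_ge0/integral_ge0 => x _; rewrite lee_fin radial_ge0.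
have IE : (\int[mu]_(x in `]0%R, 1%R[) (radial f x)%:E)%E = I%:E.
  by rewrite fineK// (radial_int_fin p2 bf).
rewrite -JE lee_fin; apply/ler_addgt0Pr => e e0.
pose d := e / (I + 1) / 2.
have I1 : 0 < I + 1 by rewrite ltr_wpDl.
have d0 : 0 < d by rewrite !divr_gt0.
have dE : d * (I + 1) = e / 2 by rewrite /d; field; rewrite gt_eqF.
have e2 : 0 < e / 2 by rewrite divr_gt0.
have z1 : cmod (circ r t) < 1 by rewrite cmod_circ.
have /has_pseriesP /(_ _ z1) /cvg_seqP /(_ _ e2) [N1 HN1] := hPhi.
have [N2 HN2] := has_pseries_tail (@has_pseries_geo2 R) r01 d0.
pose N := maxn N1 N2; have h1 := HN1 N (leq_maxl _ _).
have h2 z := HN2 N z (leq_maxr _ _).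
pose c n : Cplx R := n.+1%:R * circ r t ^+ n.
have mS := measurable_szego_radial r t.
have mr := @measurable_radial R f setT hf.
have bnd : cmod (\sum_(n < N) c n * moment f n) <= fine J + d * I.
  apply: (moment_bound p2 bf) => s s01.
  apply: le_trans (radial_itv_le s01 (measurable_funM (measurable_psum_real c N) mr) _) _.
    by move=> x; rewrite mulr_ge0 ?cmod_ge0 ?radial_ge0.
  apply: (@le_trans _ _ (\int[mu]_(x in `]0%R, 1%R[)
     (radial f x * (cmod (1 - circ (x * r) t))^-1 ^+ 2 + d * radial f x)%:E)%E).
    apply: le_integral_EFin; first exact: measurable_itv.
    - exact: measurable_funTS (measurable_funM (measurable_psum_real c N) mr).
    - apply: measurable_funTS; apply: measurable_funD; apply: measurable_funM => //.
    move=> x /=; rewrite in_itv /= => /andP[x0 x1].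
    rewrite mulr_ge0 ?cmod_ge0 ?radial_ge0//= mulrC (mulrC d) -mulrDr ler_wpM2l ?radial_ge0//.
    have pE : psum c x%:C N = psum (fun n => n.+1%:R) (circ (x * r) t) N.
      by apply: eq_bigr => n _; rewrite /c -mulrA -exprMn [circ r t * _]mulrC circ_scale.
    have wr : cmod (circ (x * r) t) <= r.
      by rewrite cmod_circ; [rewrite ler_piMl// ltW|rewrite mulr_ge0// ltW].
    have := h2 _ wr; rewrite -pE; set G := (1 - 1 * _)^-1 * _.
    have -> : (cmod (1 - circ (x * r) t))^-1 ^+ 2 = cmod G by rewrite /G mul1r cmodM cmodV.
    have := cmod_sub (psum c x%:C N) G; rewrite cmodB.
    by move: (cmod _) (cmod G) (cmod _) => A B D; clear; lra.
  under eq_integral do rewrite EFinD.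
  rewrite ge0_integralD//; last 4 first.
  - by move=> x _; rewrite lee_fin mulr_ge0 ?radial_ge0// sqr_ge0.
  - by apply/measurable_EFinP; apply: measurable_funTS; exact: measurable_funM.
  - by move=> x _; rewrite lee_fin mulr_ge0 ?radial_ge0// ltW.
  - by apply/measurable_EFinP; apply: measurable_funTS; exact: measurable_funM.
  rewrite -/J integralZl_EFin ?(ltW d0)//; last 2 first.
  - exact: measurable_radial.
  - by move=> x _; exact: radial_ge0.
  by rewrite IE -JE -EFinM -EFinD.
have sE : psum (fun n => n.+1%:R * moment f n) (circ r t) N = \sum_(n < N) c n * moment f n.
  by apply: eq_bigr => n _; rewrite /c mulrAC.
have := cmod_sub (Phi (circ r t)) (psum (fun n => n.+1%:R * moment f n) (circ r t) N).
rewrite cmodB => h3; move: h1 h3; rewrite sE; move: bnd dE d0 I0.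
move: (cmod _) (cmod _) (cmod _) (fine J) => A B D E; clear; nra.
Qed.

End Moments.

(** * The generating function of the moments *)

Section MomentsDominated.
Context {R : realType}.
Notation mu := (@lebesgue_measure R).
Implicit Types (f g h : Cplx R -> Cplx R) (p q r t x : R) (a b c : nat -> Cplx R).

Lemma measurable_szego_pair r : measurable_fun setT
  (fun w : R * R => (cmod (1 - circ (w.2 * r) w.1))^-1 ^+ 2).
Proof.
rewrite (_ : (fun w => _) =
  (fun w : R * R => ((1 - w.2 * r) ^+ 2 + 2 * (w.2 * r) * (1 - cos w.1))^-1)); last first.
  by apply/funext => w; rewrite exprVn cmod_one_sub_circ_sqr.
have m1 : measurable_fun setT (fst : R * R -> R) by exact: measurable_fst.
have m2 : measurable_fun setT (snd : R * R -> R) by exact: measurable_snd.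
have m2r : measurable_fun setT (fun w : R * R => w.2 * r) by exact: measurable_funM.
apply: (measurableT_comp measurable_inv); apply: measurable_funD.
  by apply: measurable_funX; exact: measurable_funB.
apply: measurable_funM; first exact: measurable_funM.
apply: measurable_funB => //.
exact: (measurableT_comp (continuous_measurable (@continuous_cos R)) m1).
Qed.

(** By [rint_poisson] the mean modulus of [Phi] on the circle of radius [s] is at
    most the integral of [|f u| / (1 - (u s) ^ 2)], whose kernel is comparable with
    [1 / max (1 - u) (1 - x)]. Schur's test with [kappa = 1] then needs [p > 2], and
    [growth_real] bounds the resulting integral along the radius by the Bergman
    integral. *)
Lemma mean_dom_moments p : 2 < p -> exists2 C : R, 0 < C & forall f, Bergman p f ->
  mean_dom p (C * fine (bergman_int p f)) (fun n => n.+1%:R * moment f n).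
Proof.
move=> p2; have p1 : 1 < p by apply: lt_trans p2; lra.
have p0 : 0 < p by apply: lt_trans p1.
have [C1 C10 h1] := growth_real p1.
pose gam := 2 / p; pose G := (gam^-1 + (1 - gam)^-1) `^ p.
have g0 : 0 < gam by rewrite divr_gt0.
have g1 : gam < 1 by rewrite ltr_pdivrMr// mul1r.
have G0 : 0 < G by rewrite powR_gt0// addr_gt0 ?invr_gt0 ?subr_gt0.
(* [G] is the constant of Schur's test and [C1] that of the growth along the
   radius; 4 comes from [integral_cint_pow_le], and [2 `^ p] from the factor 2
   in front of the dominating function. *)
exists (2 `^ p * (G * (C1 * 4))) => [|f bf]; first by rewrite mulr_gt0 ?powR_gt0// mulr_gt0// mulr_gt0.
have [hf _] := bf; have mr := @measurable_radial R f setT hf.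
have I01 : measurable (`]0, 1[ : set R) by exact: measurable_itv.
set I := fine (\int[mu]_(x in `]0%R, 1%R[) (radial f x)%:E)%E.
have IE : (\int[mu]_(x in `]0%R, 1%R[) (radial f x)%:E)%E = I%:E.
  by rewrite fineK// (radial_int_fin p2 bf).
set b := fun n => _.
have rb : radius1 b.
  apply: (radius1_le (C := I) (has_pseries_radius1 (@has_pseries_geo R))) => n.
  rewrite cmodM cmod_nat cmod1 mulr1 mulrC ler_wpM2r//; exact: moment_le p2 bf.
have hb := psfunP rb; set Phi := psfun b in hb.
pose k x u := radial f u / Num.max (1 - u) (1 - x).
pose K x : \bar R := (\int[mu]_(u in `]0%R, 1%R[) (k x u)%:E)%E.
have max0 (u x : R) : u < 1 -> 0 < Num.max (1 - u) (1 - x) by move=> u1; rewrite lt_max subr_gt0 u1.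
have k0 x u : 0 < u < 1 -> 0 <= k x u.
  by move=> /andP[_ u1]; rewrite divr_ge0 ?radial_ge0// ltW// max0.
have mk2 : measurable_fun setT (fun w : R * R => k w.1 w.2).
  have m1 : measurable_fun setT (fst : R * R -> R) by exact: measurable_fst.
  have m2 : measurable_fun setT (snd : R * R -> R) by exact: measurable_snd.
  apply: measurable_funM; first exact: (measurableT_comp mr m2).
  apply: (measurableT_comp measurable_inv).
  by apply: measurable_maxr; exact: measurable_funB.
have mk x D : measurable_fun D (k x).
  by apply: measurable_funTS; exact: (measurableT_comp mk2 (measurable_pair1 x)).
have K0 x : (0 <= K x)%E by apply: integral_ge0 => u; rewrite /= in_itv /= lee_fin => /k0.
have Kfin x : x < 1 -> K x \is a fin_num.
  move=> x1; rewrite ge0_fin_numE//.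
  apply: (@le_lt_trans _ _ ((1 - x)^-1 * I)%:E); last exact: ltry.
  have d0 : 0 < 1 - x by rewrite subr_gt0.
  rewrite EFinM -IE -integralZl_EFin ?invr_ge0 ?(ltW d0)//; last 2 first.
  - exact: measurable_funTS.
  - by move=> u _; exact: radial_ge0.
  apply: le_integral_EFin => //.
    by apply: measurable_funM; [exact: measurable_cst|exact: measurable_funTS].
  move=> u /=; rewrite in_itv /= => u01; rewrite k0//= mulrC ler_wpM2l ?radial_ge0//.
  by have /andP[_ u1] := u01; rewrite lef_pV2 ?posrE ?max0// le_max lexx orbT.
have mK : measurable_fun (`]0, 1[ : set R) (fun x => fine (K x)).
  have mf : measurable_fun setT (@fine R) by [].
  apply: (measurableT_comp mf).
  apply: (measurable_section_integral (F := fun w : R * R => (k w.1 w.2)%:E)) => //.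
    exact/measurable_funTS/measurable_EFinP.
  by move=> x y _ /=; rewrite in_itv /= lee_fin => /k0.
exists Phi => //; exists (fun x => 2 * fine (K x)); split.
- by apply: measurable_funM => //; exact: measurable_cst.
- by move=> x _; rewrite mulr_ge0// fine_ge0.
- move=> x y x0 xy y1; rewrite ler_wpM2l// fine_le ?Kfin//; first exact: le_lt_trans y1.
  apply: le_integral_EFin => // u /=; rewrite in_itv /= => u01; rewrite k0//= ler_wpM2l ?radial_ge0//.
  have /andP[_ u1] := u01; rewrite lef_pV2 ?posrE ?max0//.
  have yx : 1 - y <= 1 - x by rewrite lerD2l lerN2.
  by rewrite ge_max !le_max lexx /= yx orbT.
- move=> x /andP[x0 x1]; pose s := (1 + x) / 2.
  have s01 : 0 <= s < 1 by rewrite /s; apply/andP; split; lra.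
  have /andP[s0 s1] := s01.
  have cP := cont_cmod (cont_circ (Hol_cont (has_pseries_Hol hb)) s01).
  have mC : measurable (`[0, pi *+ 2] : set R) by exact: measurable_itv.
  pose H (w : R * R) := radial f w.2 * (cmod (1 - circ (w.2 * s) w.1))^-1 ^+ 2.
  have H0 w : 0 <= H w by rewrite mulr_ge0 ?radial_ge0// sqr_ge0.
  have mH : measurable_fun setT H.
    apply: measurable_funM; last exact: measurable_szego_pair.
    exact: (measurableT_comp mr (@measurable_snd _ _ R R)).
  rewrite -lee_fin -(rint_ge0E _ _ cP).
  apply: (@le_trans _ _ (\int[mu]_(t in `[0%R, (pi *+ 2)%R]) \int[mu]_(u in `]0%R, 1%R[) (H (t, u))%:E)%E).
    apply: ge0_le_integral => //.
    - by move=> t _; rewrite lee_fin cmod_ge0.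
    - by apply/measurable_EFinP; exact: measurable_funTS (continuous_measurable cP).
    - apply: (measurable_section_integral (F := EFin \o H)) => //.
        exact/measurable_funTS/measurable_EFinP.
      by move=> u v _ _; rewrite lee_fin.
    - by move=> t _; exact: moment_pseries_bound p2 bf hb s01.
  rewrite (tonelli_set (F := EFin \o H) mC I01); last 2 first.
  - exact/measurable_funTS/measurable_EFinP.
  - by move=> u v _ _; rewrite lee_fin.
  apply: (@le_trans _ _ (\int[mu]_(u in `]0%R, 1%R[) (2 * (pi *+ 2) * k x u)%:E)%E); last first.
    rewrite integralZl_EFin ?mulr_ge0 ?pi2_ge0//; last by move=> u /=; rewrite in_itv /= => /k0.
    rewrite -/(K x) -(fineK (Kfin x x1)) -EFinM lee_fin /= le_eqVlt; apply/orP; left; apply/eqP.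
    by rewrite mulrAC.
  apply: ge0_le_integral => //.
  - by move=> u _; apply: integral_ge0 => t _; rewrite lee_fin.
  - apply: (measurable_section_integral (F := EFin \o (fun w => H (w.2, w.1)))) => //.
      apply/measurable_funTS/measurable_EFinP; apply: (measurableT_comp mH).
      by apply: measurable_fun_pair; [exact: measurable_snd|exact: measurable_fst].
    by move=> u v _ _; rewrite lee_fin.
  - by apply/measurable_EFinP; apply: measurable_funM; [exact: measurable_cst|exact: mk].
  move=> u /=; rewrite in_itv /= => u01; have /andP[u0 u1] := u01.
  have us01 : 0 <= u * s < 1.
    by rewrite mulr_ge0 ?(ltW u0)//= (le_lt_trans _ s1)// ler_piMl// ltW.
  have cS : continuous (fun t => (cmod (1 - circ (u * s) t))^-1 ^+ 2).
    rewrite (_ : (fun t => _) = (fun t => (cmod (1 - circ (u * s) t))^-1 `^ 2)); first exact: cont_szego.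
    by apply/funext => t; rewrite powR_mulrn// invr_ge0 cmod_ge0.
  rewrite /H /= (rint_ge0E _ _ (@cont_scaleR R (radial f u) _ cS)) (rintZ _ _ _ cS) rint_poisson//.
  have /andP[us0 us1] := us01.
  rewrite lee_fin /k [X in _ <= X]mulrCA ler_wpM2l ?radial_ge0//.
  have m0 := max0 u x u1; set m := Num.max _ _ in m0 *.
  have mle : m <= 2 * (1 - (u * s) ^+ 2).
    have h : m <= 2 * (1 - u * s).
      rewrite /m ge_max; apply/andP; split; last by rewrite /s; move: u0 u1 x0 x1; clear; nra.
      by move: u0 u1 s0 s1; clear; nra.
    by apply: le_trans h _; move: us0 us1; move: (u * s) => y; clear; nra.
  have d0 : 0 < 1 - (u * s) ^+ 2 by rewrite subr_gt0 expr_lt1.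
  rewrite ler_pdivrMr// mulrAC ler_pdivlMr// mulrC -mulrA [_ * (1 - _)]mulrC mulrA.
  by rewrite ler_wpM2r ?pi2_ge0.
- pose W u := radial f (1 - u); pose V s := fine (K (1 - s)).
  have mW : measurable_fun setT W by apply: (measurableT_comp mr); exact: measurable_funB.
  have flip (F : R -> R) : measurable_fun (`]0, 1[ : set R) F -> measurable_fun (`]0, 1[ : set R) (fun u : R => F (1 - u)).
    move=> mF; apply: (@measurable_comp _ _ _ _ _ _ (`]0, 1[ : set R) F) => //.
      by move=> y /= [x]; rewrite !in_itv /= => /andP[x0 x1] <-; apply/andP; split; lra.
    by apply: measurable_funTS; exact: measurable_funB.
  have schur : (\int[mu]_(s in `]0%R, 1%R[) (s `^ 1 * V s `^ p)%:E <=
      G%:E * \int[mu]_(u in `]0%R, 1%R[) (u `^ 1 * W u `^ p)%:E)%E.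
    apply: schur_max => //.
    - by rewrite /gam divfK ?gt_eqF.
    - exact: flip mK.
    - by move=> u _; exact: radial_ge0.
    - by move=> s _; exact/fine_ge0/K0.
    move=> s /andP[s0 s1]; have s'1 : 1 - s < 1 by rewrite gtrBl.
    rewrite /V (fineK (Kfin _ s'1)) /K integral_flip01//; last by move=> u /k0.
    rewrite le_eqVlt; apply/orP; left; apply/eqP; apply: eq_integral => u _.
    have E1 (v : R) : 1 - (1 - v) = v by ring.
    by rewrite /k /W !E1.
  have m1 : measurable_fun (`]0, 1[ : set R) (fun x => (1 - x) * (2 * fine (K x)) `^ p).
    apply: measurable_funM; first by apply: measurable_funTS; exact: measurable_funB.
    apply: (measurableT_comp (measurable_powR p)).
    by apply: measurable_funM => //; exact: measurable_cst.
  rewrite integral_flip01//; last by move=> x /andP[_ x1]; rewrite mulr_ge0 ?powR_ge0// subr_ge0 ltW.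
  have mV : measurable_fun (`]0, 1[ : set R) (fun s => s `^ 1 * V s `^ p).
    apply: measurable_funM; first exact: measurable_powR_oo.
    apply: (measurableT_comp (measurable_powR p)); exact: flip mK.
  apply: (@le_trans _ _ (\int[mu]_(s in `]0%R, 1%R[) (2 `^ p * (s `^ 1 * V s `^ p))%:E)%E).
    rewrite le_eqVlt; apply/orP; left; apply/eqP; apply: eq_integral => s /set_mem /=.
    rewrite in_itv /= => /andP[s0 s1]; have E1 : 1 - (1 - s) = s by ring.
    rewrite E1 powRM ?fine_ge0 ?K0// powRr1 ?(ltW s0)// /V; congr EFin; ring.
  rewrite integralZl_EFin ?powR_ge0//; last by move=> s _; rewrite mulr_ge0 ?powR_ge0.
  rewrite -mulrA EFinM; apply: lee_wpmul2l; first by rewrite lee_fin powR_ge0.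
  apply: le_trans schur _; rewrite -mulrA EFinM; apply: lee_wpmul2l; first by rewrite lee_fin ltW.
  rewrite -mulrA EFinM EFinM (bergman_fineK bf).
  have mC := measurable_cint_pow_aff hf p0.
  apply: (@le_trans _ _ (\int[mu]_(x in `]0%R, 1%R[) (C1 * cint_pow p ((1 + x) / 2) f)%:E)%E); last first.
    rewrite (integralZl_EFin I01 mC _ (ltW C10)); last by move=> x _; exact: cint_pow_ge0.
    by apply: lee_wpmul2l; [rewrite lee_fin ltW|exact: integral_cint_pow_le hf (ltW p1)].
  have mWp : measurable_fun (`]0, 1[ : set R) (fun u => u `^ 1 * W u `^ p).
    apply: measurable_funM; first exact: measurable_powR_oo.
    by apply: measurable_funTS; exact: (measurableT_comp (measurable_powR p)).
  rewrite integral_flip01//; last by move=> u _; rewrite mulr_ge0 ?powR_ge0.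
  apply: le_integral_EFin => //.
  - exact: flip mWp.
  - by apply: measurable_funM => //; exact: measurable_cst.
  move=> x /=; rewrite in_itv /= => /andP[x0 x1]; have d0 : 0 < 1 - x by rewrite subr_gt0.
  have x01 : 0 <= x < 1 by rewrite (ltW x0).
  have E1 : 1 - (1 - x) = x by ring.
  rewrite mulr_ge0 ?powR_ge0//= /W E1 powRr1 ?(ltW d0)// radialE//.
  have := h1 f x hf x01; rewrite mulrAC ler_pdivlMr// mulrC.
  by rewrite mulrC.
Qed.

End MomentsDominated.

(** * Mean Lipschitz conditions *)

Section MeanLipschitz.
Context {R : realType}.
Implicit Types (f g h : Cplx R -> Cplx R) (p q r t x al : R) (a b c : nat -> Cplx R).

Lemma near_left1 (P : R -> Prop) : (\forall r \near (1 : R)^'-, P r) <->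
  exists2 r0 : R, 0 < r0 < 1 & forall r, r0 < r < 1 -> P r.
Proof.
split=> [[e /= e0 he]|[r0 /andP[r00 r01] hr]].
  exists (Num.max (1 / 2) (1 - e)).
    by rewrite lt_max gt_max divr_gt0//= gtrBl e0 andbT; lra.
  move=> r /andP[]; rewrite gt_max => /andP[r2 re] r1; apply: he => //=.
  rewrite ger0_norm ?subr_ge0 ?(ltW r1)//; lra.
near=> r; apply: hr; apply/andP; split; near: r; first exact: nbhs_left_gt.
exact: nbhs_left_lt.
Unshelve. all: by end_near. Qed.

Lemma pmeanE q r f : pmean q r f = ((pi *+ 2)^-1 * cint_pow q r f) `^ q^-1.
Proof. by rewrite /pmean mulr_natl. Qed.

Lemma pmean_le q r f (y : R) : 0 < q -> 0 <= y ->
  (pmean q r f <= y) = (cint_pow q r f <= pi *+ 2 * y `^ q).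
Proof.
move=> q0 y0; have qi : 0 <= q^-1 by rewrite invr_ge0 ltW.
have c0 : 0 <= (pi *+ 2)^-1 * cint_pow q r f by rewrite mulr_ge0 ?cint_pow_ge0// invr_ge0 pi2_ge0.
rewrite pmeanE -ler_pdivrMl ?pi2_gt0//; apply/idP/idP => h; last first.
  have := powR_mono qi c0 h.
  by rewrite -powRrM mulfV ?gt_eqF// powRr1.
have := powR_mono (ltW q0) (powR_ge0 _ _) h.
by rewrite -powRrM mulVf ?gt_eqF// powRr1.
Qed.

Lemma Hol_derive1 f : Hol f -> Hol (derive1 f).
Proof. by move=> /Hol_pseries /has_pseries_derive1 /has_pseries_Hol. Qed.

Lemma pmean_weight q r f al (k : R) : 0 < q -> 0 <= k ->
  (`|pmean q r f| <= k * `|(1 - r) `^ (al - 1)|) =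
  (cint_pow q r f <= pi *+ 2 * k `^ q * (1 - r) `^ ((al - 1) * q)).
Proof.
move=> q0 k0; rewrite !ger0_norm ?powR_ge0// pmean_le ?mulr_ge0 ?powR_ge0//.
by rewrite powRM ?powR_ge0// -powRrM mulrA.
Qed.

(** The bound near the unit circle extends to all radii because the means increase
    and the weight is at least 1. *)
Lemma Lip_cint_pow q al f : 1 <= q -> al <= 1 -> Lip q al f ->
  exists2 K : R, 0 <= K & forall r, 0 <= r < 1 ->
    cint_pow q r (derive1 f) <= K * (1 - r) `^ ((al - 1) * q).
Proof.
move=> q1 al1 [hf]; have q0 : 0 < q by apply: lt_le_trans q1.
have hf' := Hol_derive1 hf.
have e0 : (al - 1) * q <= 0 by rewrite mulr_le0_ge0 ?subr_le0// ltW.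
move/eqOP => [k0 [_ hk]].
have kk : k0 < Num.max k0 0 + 1 by rewrite ltr_pwDr// le_max lexx.
have /near_left1[r0 /andP[r00 r01] hr] := hk _ kk.
set k := Num.max k0 0 + 1 in hr; have k1 : 0 <= k by rewrite addr_ge0// le_max lexx orbT.
pose m := (1 + r0) / 2; have m01 : r0 < m < 1 by rewrite /m; apply/andP; split; lra.
have /andP[m0 m1] := m01.
have K0 : 0 <= pi *+ 2 * k `^ q by rewrite mulr_ge0 ?pi2_ge0 ?powR_ge0.
exists (pi *+ 2 * k `^ q + cint_pow q m (derive1 f)) => [|r /andP[r0' r1]].
  by rewrite addr_ge0 ?cint_pow_ge0.
rewrite mulrDl; have [mr|rm] := leP m r.
  apply: ler_wpDr; first by rewrite mulr_ge0 ?cint_pow_ge0 ?powR_ge0.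
  by rewrite -pmean_weight//; apply: hr; rewrite (lt_le_trans m0 mr).
apply: ler_wpDl; first by rewrite mulr_ge0 ?powR_ge0.
apply: le_trans (cint_pow_homo hf' q1 r0' (ltW rm) m1) _.
rewrite -[X in X <= _]mulr1 ler_wpM2l ?cint_pow_ge0//.
have := @le_powRN R (1 - r) 1 ((al - 1) * q); rewrite powR1; apply=> //; lra.
Qed.

Lemma cint_pow_Lip q al f (K r0 : R) : 0 < q -> Hol f -> 0 <= K -> 0 < r0 < 1 ->
  (forall r, r0 < r < 1 -> cint_pow q r (derive1 f) <= K * (1 - r) `^ ((al - 1) * q)) ->
  Lip q al f.
Proof.
move=> q0 hf K0 r01 hK; split=> //; apply/eqOP.
pose k := ((pi *+ 2)^-1 * K) `^ q^-1.
have K'0 : 0 <= (pi *+ 2)^-1 * K by rewrite mulr_ge0// invr_ge0 pi2_ge0.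
exists k; split; first exact/ger0_real/powR_ge0.
move=> k' kk'; have k'0 : 0 <= k' by rewrite (le_trans _ (ltW kk'))// powR_ge0.
apply/near_left1; exists r0 => // r /hK hr; rewrite pmean_weight//; apply: le_trans hr _.
rewrite ler_wpM2r ?powR_ge0//.
have -> : K = pi *+ 2 * k `^ q.
  rewrite /k -powRrM mulVf ?gt_eqF// powRr1// mulrA mulfV ?mul1r// gt_eqF//.
  exact: pi2_gt0.
rewrite ler_wpM2l ?pi2_ge0//; apply: powR_mono; rewrite ?(ltW q0) ?powR_ge0//.
exact: ltW.
Qed.

Lemma lip_cint_pow q al f : 0 < q -> lip q al f <->
  Hol f /\ forall del : R, 0 < del -> exists2 r0 : R, 0 < r0 < 1 & forall r, r0 < r < 1 ->
    cint_pow q r (derive1 f) <= del * (1 - r) `^ ((al - 1) * q).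
Proof.
move=> q0; split=> [[hf h]|[hf h]]; split=> //.
  move=> del d0; pose k := ((pi *+ 2)^-1 * del) `^ q^-1.
  have K'0 : 0 < (pi *+ 2)^-1 * del by rewrite mulr_gt0// invr_gt0 pi2_gt0.
  have k0 : 0 < k by rewrite powR_gt0.
  have /near_left1[r0 r01 hr] := (eqoP _ _ _).1 h k k0; exists r0 => // r /hr.
  rewrite pmean_weight ?(ltW k0)//.
  suff -> : pi *+ 2 * k `^ q = del by [].
  rewrite /k -powRrM mulVf ?gt_eqF// powRr1 ?(ltW K'0)// mulrA mulfV ?mul1r// gt_eqF//.
  exact: pi2_gt0.
apply/eqoP => k k0; apply/near_left1.
have [|r0 r01 hr] := h (pi *+ 2 * k `^ q); first by rewrite mulr_gt0 ?pi2_gt0 ?powR_gt0.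
by exists r0 => // r /hr; rewrite pmean_weight// ltW.
Qed.

End MeanLipschitz.

(** * Cauchy estimates and uniform convergence *)

Section UniformConvergence.
Context {R : realType}.
Implicit Types (f g h : Cplx R -> Cplx R) (p q r t x al : R) (a b c : nat -> Cplx R).

Lemma finite_sum_vanish (F : nat -> nat -> R) :
  (forall k (e : R), 0 < e -> exists N, forall j, (N <= j)%N -> F j k < e) ->
  forall K (e : R), 0 < e -> exists N, forall j, (N <= j)%N -> \sum_(k < K) F j k < e.
Proof.
move=> hF; elim=> [|K IH] e e0; first by exists 0%N => j _; rewrite big_ord0.
have e2 : 0 < e / 2 by rewrite divr_gt0.
have [N1 h1] := IH _ e2; have [N2 h2] := hF K _ e2.
exists (maxn N1 N2) => j; rewrite geq_max => /andP[/h1 j1 /h2 j2].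
by rewrite big_ord_recr [e]splitr /= ltrD.
Qed.

(** Coefficientwise convergence to [0] under a uniform Cauchy estimate is
    uniform convergence on smaller discs: the tails are dominated by a fixed
    geometric series. *)
Lemma coef_unif_cvg0 (a_ : nat -> nat -> Cplx R) (f_ : nat -> Cplx R -> Cplx R) (M r rho : R) :
  (forall j, has_pseries (a_ j) (f_ j)) -> 0 <= r -> r < rho -> rho < 1 ->
  (forall j k, cmod (a_ j k) * rho ^+ k <= M) ->
  (forall k, (fun j => a_ j k) @ \oo --> (0 : Cplx R)) ->
  forall e : R, 0 < e -> exists N, forall j z, (N <= j)%N -> cmod z <= r -> cmod (f_ j z) <= e.
Proof.
move=> hf r0 rr rho1 aM a0 e e0; have rho0 : 0 < rho := le_lt_trans r0 rr.
have t01 : 0 <= r / rho < 1 by rewrite divr_ge0 ?(ltW rho0)//= ltr_pdivrMr// mul1r.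
have M0 : 0 <= M by apply: le_trans (aM 0%N 0%N); rewrite mulr_ge0 ?cmod_ge0.
pose w k := M * (r / rho) ^+ k.
have w0 k : 0 <= w k by rewrite mulr_ge0// exprn_ge0//; case/andP: t01.
have aw j k : cmod (a_ j k) * r ^+ k <= w k.
  rewrite /w expr_div_n mulrA ler_pdivlMr ?exprn_gt0// mulrAC ler_wpM2r ?exprn_ge0//.
have ws n : \sum_(k < n) w k <= M * (1 - r / rho)^-1.
  by rewrite -mulr_sumr ler_wpM2l// geo_sum_le.
have e2 : 0 < e / 2 by rewrite divr_gt0.
have [K hK] := bounded_tail w0 ws e2.
have [|N hN] := @finite_sum_vanish (fun j k => cmod (a_ j k) * r ^+ k) _ K _ e2.
  move=> k d d0; have /cvg_seqP /(_ d d0)[N hN] := a0 k; exists N => j /hN.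
  rewrite subr0; apply: le_lt_trans; rewrite ler_piMr ?cmod_ge0// exprn_ile1//.
  exact/ltW/(lt_trans rr).
exists N => j z Nj zr; apply: (has_pseries_norm (hf j) zr (lt_trans rr rho1)) => n.
have t0 k : 0 <= cmod (a_ j k) * r ^+ k by rewrite mulr_ge0 ?cmod_ge0 ?exprn_ge0.
apply: (@le_trans _ _ (\sum_(k < maxn n K) cmod (a_ j k) * r ^+ k)).
  rewrite -subr_ge0 (@sum_tail _ (fun k => cmod (a_ j k) * r ^+ k)) ?leq_maxl//.
  by apply: sumr_ge0 => k _.
rewrite -(subrK (\sum_(k < K) cmod (a_ j k) * r ^+ k) (\sum_(k < maxn n K) _)).
rewrite (@sum_tail _ (fun k => cmod (a_ j k) * r ^+ k)) ?leq_maxr// [leRHS]splitr.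
apply: lerD; last exact/ltW/hN.
apply: le_trans (ltW (hK (maxn n K) (leq_maxr _ _))).
by apply: ler_sum => k _; exact: aw.
Qed.

Lemma cint_pow_sup q r f (e : R) : Hol f -> 0 < q -> 0 <= r < 1 ->
  (forall z, cmod z <= r -> cmod (f z) <= e) -> cint_pow q r f <= e `^ q * (pi *+ 2).
Proof.
move=> hf q0 r01 fe; have /andP[r0 r1] := r01.
rewrite cint_powE -[X in _ * X]subr0 -rint_cst ?pi2_ge0//.
apply: rint_le; [exact: cont_cmod_circ|exact: cst_continuous|] => t _.
by apply: powR_mono; rewrite ?(ltW q0) ?cmod_ge0//; apply: fe; rewrite cmod_circ.
Qed.

(** Cauchy's estimate from the mean modulus, with [weighted_growth] in place of a
    norm. *)
Lemma mean_dom_coef p (Lam : R) b x k : 0 < p -> mean_dom p Lam b -> 0 < x < 1 ->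
  cmod (b k) * ((1 + x) / 2) ^+ k <= (4 * Lam / (1 - x) ^+ 2) `^ p^-1.
Proof.
move=> p0 [Phi hb [N [mN N0 Nh NP NL]]] x01; have /andP[x0 x1] := x01.
have s01 : 0 < (1 + x) / 2 < 1 by apply/andP; split; lra.
have /andP[s0 s1] := s01; have s01' : 0 <= (1 + x) / 2 < 1 by rewrite ltW.
have [HP E] := Hol_pseries_taylor hb.
apply: (@le_trans _ _ (N x)); last first.
  apply: le_root; rewrite ?N0// ler_pdivlMr ?exprn_gt0 ?subr_gt0//.
  exact: weighted_growth p0 mN N0 Nh NL x01.
rewrite -[X in X ^+ k]ger0_norm ?(ltW s0)// -cmod_real -cmodX -cmodM -E taylor_coef_cmean//.
have cP := cont_circ (Hol_cont HP) s01'.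
have cV : continuous (fun t => (circ 1 t : Cplx R)^-1 ^+ k).
  by apply: cont_expC; exact: continuous_circV.
apply: le_trans (cmod_cmean _) _; first exact: cont_mulC cP cV.
rewrite mulrC ler_pdivrMr ?pi2_gt0//; apply: le_trans (NP x x01).
rewrite le_eqVlt; apply/orP; left; apply/eqP; congr rint; apply/funext => t.
by rewrite cmodM cmodX cmodV cmod_circ// invr1 expr1n mulr1.
Qed.

Lemma radius1_mul a b : radius1 a -> radius1 b -> radius1 (fun n => a n * b n).
Proof.
(* [r <= s ^ 2], so that each factor is estimated at radius [s]. *)
move=> ha hb r /andP[r0 r1]; pose s := (1 + r) / 2.
have s01 : 0 <= s < 1 by rewrite /s; apply/andP; split; lra.
have [M hM] := ha s s01; have [L hL] := hb s s01; have /andP[s0 s1] := s01.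
have M0 : 0 <= M by apply: le_trans (hM 0%N); rewrite mulr_ge0 ?cmod_ge0.
exists (M * L) => n; apply: (@le_trans _ _ (cmod (a n) * s ^+ n * (cmod (b n) * s ^+ n))).
  rewrite cmodM mulrACA -exprD addnn -mul2n exprM ler_wpM2l ?mulr_ge0 ?cmod_ge0//.
  rewrite lerXn2r ?nnegrE ?sqr_ge0// /s; nra.
by apply: ler_pM; rewrite ?mulr_ge0 ?cmod_ge0 ?exprn_ge0.
Qed.

End UniformConvergence.

(** * Sufficiency of the Lipschitz conditions *)

Section Sufficiency.
Context {R : realType}.
Notation mu := (@lebesgue_measure R).
Implicit Types (f g h : Cplx R -> Cplx R) (p q r t x al : R) (a b c eta : nat -> Cplx R).

(** The estimate behind both sufficiency statements. Hardy's inequality passes to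
    the derivative [Dh] of [z h], which is the Hadamard product of [g'] with the
    generating function of [b]. Radii beyond [r0] are controlled by the size [del] of
    the means of [g'] there, radii up to [r0] by the size [e] of [Dh]. *)
Lemma split_bound p q : 0 < p -> p < q -> 1 < q -> 2 / p - 1 / q < 1 ->
  exists2 C : R, 0 < C & forall eta g b Lam h Dh r0 (del e : R),
  has_pseries eta g -> mean_dom p Lam b -> 0 <= Lam ->
  has_pseries (fun n => eta n.+1 * b n) h ->
  has_pseries (fun n => n.+1%:R * eta n.+1 * b n) Dh ->
  0 <= r0 < 1 -> 0 <= del -> 0 <= e ->
  (forall z, cmod z <= r0 -> 0 < r0 -> cmod (Dh z) <= e) ->
  (forall r, r0 < r < 1 ->
     cint_pow q r (derive1 g) <= del * (1 - r) `^ ((2 / p - 1 / q - 1) * q)) ->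
  (bergman_int q h <= (C * (e `^ q + del * Lam `^ (q / p)))%:E)%E.
Proof.
move=> p0 pq q1 al1; have q0 : 0 < q by apply: lt_trans q1.
have [C1 C10 h1] := @hardy R q q1.
have [C2 C20 h2] := hadamard_tail_bound p0 pq (ltW q1) al1.
exists (C1 * (pi *+ 2 + C2)) => [|eta g b Lam h Dh r0 del e hg mb Lam0 hh hDh /andP[r00 r01] del0 e0 Dhe gdel].
  by rewrite mulr_gt0// addr_gt0// pi2_gt0.
have [Phi hPhi [N [mN N0 Nh NP NL]]] := mb.
have hDh' : has_pseries (fun n => n.+1%:R * (eta n.+1 * b n)) Dh.
  by rewrite (_ : (fun n => _) = (fun n => n.+1%:R * eta n.+1 * b n))//; apply/funext => n; rewrite mulrA.
have HDh := has_pseries_Hol hDh.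
apply: le_trans (h1 _ _ _ hh hDh') _.
rewrite -mulrA EFinM; apply: lee_wpmul2l; first by rewrite lee_fin ltW.
pose G x := (1 - x) `^ q * cint_pow q x Dh.
have mG : measurable_fun (`]0, 1[ : set R) G.
  apply: measurable_funM; last exact: measurable_cint_pow.
  apply: measurable_funTS; apply: (measurableT_comp (measurable_powR q)).
  exact: measurable_funB.
have G0 x : 0 <= G x by apply: mulr_ge0; [exact: powR_ge0|exact: cint_pow_ge0].
rewrite (integral_split01 (introT andP (conj r00 r01)) mG (fun x _ => G0 x)).
have tail := h2 _ _ _ _ _ _ _ _ _ (has_pseries_derive1 hg) hPhi hDh (introT andP (conj r00 r01)) del0 Lam0 gdel mN N0 Nh NP NL.
apply: (@le_trans _ _ ((e `^ q * (pi *+ 2))%:E + (C2 * del * Lam `^ (q / p))%:E)%E).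
  apply: leeD => //.
  apply: (@le_trans _ _ (\int[mu]_(x in `]0%R, r0]) (e `^ q * (pi *+ 2))%:E)%E).
    apply: le_integral_EFin; [exact: measurable_itv| |exact: measurable_cst|].
      apply: measurable_funS mG => // x /=; rewrite !in_itv /= => /andP[-> xr].
      exact: le_lt_trans xr r01.
    move=> x /=; rewrite in_itv /= => /andP[x0 xr]; rewrite G0/=.
    have x01 : 0 <= x < 1 by rewrite (ltW x0) (le_lt_trans xr).
    apply: (@le_trans _ _ (1 * cint_pow q x Dh)).
      apply: ler_wpM2r; first exact: cint_pow_ge0.
      have x1 : 0 <= 1 - x by rewrite subr_ge0 ltW//; case/andP: x01.
      have x1' : 1 - x <= 1 by rewrite gerBl ltW.
      by have := powR_mono (ltW q0) x1 x1'; rewrite powR1.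
    rewrite mul1r; apply: cint_pow_sup => // z zx; apply: Dhe; first exact: le_trans zx xr.
    exact: lt_le_trans x0 xr.
  rewrite integral_cst ?measurable_itv//= lebesgue_measure_itv /= lte_fin.
  case: ifPn => [r0p|_]; last by rewrite mule0 lee_fin mulr_ge0 ?powR_ge0 ?pi2_ge0.
  rewrite -EFinD -EFinM lee_fin subr0 ler_piMr ?(ltW r01)// mulr_ge0 ?powR_ge0 ?pi2_ge0//.
rewrite -EFinD lee_fin mulrDl; have := @pi2_ge0 R; move: (pi *+ 2) => P P0.
have := powR_ge0 e q; have := powR_ge0 Lam (q / p).
move: (e `^ q) (Lam `^ (q / p)) => E1 E2; move: (ltW C20) del0 P0; clear => ? ? ? ? ?.
have : 0 <= C2 * E1 by rewrite mulr_ge0.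
have : 0 <= P * (del * E2) by rewrite mulr_ge0 ?mulr_ge0.
nra.
Qed.

Lemma Lip_bergman_bound p q eta g : 0 < p -> p < q -> 1 < q -> 2 / p - 1 / q < 1 ->
  has_pseries eta g -> Lip q (2 / p - 1 / q) g ->
  exists2 C : R, 0 <= C & forall b Lam h, mean_dom p Lam b -> 0 <= Lam ->
  has_pseries (fun n => eta n.+1 * b n) h ->
  (bergman_int q h <= (C * Lam `^ (q / p))%:E)%E.
Proof.
move=> p0 pq q1 al1 hg Lg; have q0 : 0 < q by apply: lt_trans q1.
have [C C0 hC] := split_bound p0 pq q1 al1.
have [K K0 hK] := Lip_cint_pow (ltW q1) (ltW al1) Lg.
exists (C * K); first by rewrite mulr_ge0// ltW.
move=> b Lam h mb Lam0 hh; have [Phi hPhi _] := mb.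
have hD := psfunP (radius1_mul (has_pseries_radius1 (has_pseries_derive1 hg)) (has_pseries_radius1 hPhi)).
have := hC _ _ _ _ _ _ 0 K 0 hg mb Lam0 hh hD _ K0 (lexx 0).
rewrite lexx ltr01 powR0 ?gt_eqF// add0r mulrA; apply=> //.
  by move=> z _; rewrite ltxx.
by move=> r /andP[r0 r1]; apply: hK; rewrite (ltW r0).
Qed.

(** Close to the circle the contribution is small by the little-o condition,
    uniformly in [j]; on a fixed smaller disc [D j] converges to 0 uniformly. *)
Lemma lip_bergman_vanish p q eta g : 0 < p -> p < q -> 1 < q -> 2 / p - 1 / q < 1 ->
  has_pseries eta g -> lip q (2 / p - 1 / q) g ->
  forall (b_ : nat -> nat -> Cplx R) (Lam : R) (h_ : nat -> Cplx R -> Cplx R),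
  (forall j, mean_dom p Lam (b_ j)) -> 0 <= Lam ->
  (forall j, has_pseries (fun n => eta n.+1 * b_ j n) (h_ j)) ->
  (forall k, (fun j => b_ j k) @ \oo --> (0 : Cplx R)) ->
  forall e : R, 0 < e -> exists N, forall j, (N <= j)%N -> (bergman_int q (h_ j) <= e%:E)%E.
Proof.
move=> p0 pq q1 al1 hg Lg b_ Lam h_ mb Lam0 hh b0 e e0; have q0 : 0 < q by apply: lt_trans q1.
have [C C0 hC] := split_bound p0 pq q1 al1.
have [_ hl] := (lip_cint_pow _ _ q0).1 Lg.
have L0 : 0 <= Lam `^ (q / p) := powR_ge0 _ _.
have L1 : 0 < Lam `^ (q / p) + 1 by rewrite ltr_pwDr.
pose del := e / (2 * C) / (Lam `^ (q / p) + 1).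
have d0 : 0 < del by rewrite !divr_gt0// mulr_gt0.
have [r0 /andP[r00 r01] hr] := hl del d0.
pose e1 := (e / (2 * C)) `^ q^-1; have e10 : 0 < e1 by rewrite powR_gt0// divr_gt0// mulr_gt0.
have rg := has_pseries_radius1 (has_pseries_derive1 hg).
have rD j : radius1 (fun n => n.+1%:R * eta n.+1 * b_ j n).
  by have [Phi hPhi _] := mb j; exact: radius1_mul rg (has_pseries_radius1 hPhi).
pose D j := psfun (fun n => n.+1%:R * eta n.+1 * b_ j n).
have hD j : has_pseries (fun n => n.+1%:R * eta n.+1 * b_ j n) (D j) by exact: psfunP.
(* Both factors satisfy Cauchy estimates on the circle of radius [s], hence
   their products do on the one of radius [s ^ 2], which exceeds [r0]. *)
pose s := (1 + r0) / 2; have s01 : 0 <= s < 1 by rewrite /s; apply/andP; split; lra.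
have /andP[s0 s1] := s01; have [A hA] := rg s s01.
have A0 : 0 <= A by apply: le_trans (hA 0%N); rewrite mulr_ge0 ?cmod_ge0.
have rs : r0 < s * s by rewrite /s; nra.
have ss1 : s * s < 1 by nra.
have [||N hN] := coef_unif_cvg0 (M := A * (4 * Lam / (1 - r0) ^+ 2) `^ p^-1) hD (ltW r00) rs ss1 _ _ e10.
- move=> j k; rewrite cmodM exprMn mulrACA.
  have r0' : 0 < r0 < 1 by rewrite r00.
  apply: ler_pM; rewrite ?mulr_ge0 ?cmod_ge0 ?exprn_ge0//.
  exact: mean_dom_coef p0 (mb j) r0'.
- by move=> k; have := cvgCM (@cvgCc R (k.+1%:R * eta k.+1)) (b0 k); rewrite mulr0.
exists N => j Nj; have r0i : 0 <= r0 < 1 by rewrite (ltW r00).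
apply: le_trans (hC _ _ _ _ _ _ _ _ _ hg (mb j) Lam0 (hh j) (hD j) r0i (ltW d0) (ltW e10) _ hr) _.
  by move=> z zr _; exact: hN.
have C2 : 0 < 2 * C by rewrite mulr_gt0.
have CE : C * (e / (2 * C)) = e / 2 by field; rewrite gt_eqF.
rewrite lee_fin /e1 -powRrM mulVf ?gt_eqF// powRr1 ?divr_ge0 ?(ltW e0) ?(ltW C2)//.
rewrite mulrDr CE [leRHS]splitr lerD2l -CE ler_wpM2l ?(ltW C0)//.
rewrite /del mulrAC ler_pdivrMr// ler_wpM2l ?divr_ge0 ?(ltW e0) ?(ltW C2)// lerDl//.
Qed.

End Sufficiency.

(** * Subsequences and limits in Bergman spaces *)

Section Subsequences.
Context {R : realType}.
Implicit Types (u : nat -> nat -> Cplx R).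

Lemma ultra_real_limit (U : set_system nat) (u : nat -> R) (M : R) : UltraFilter U ->
  (forall j, `|u j| <= M) -> exists v : R, forall e, 0 < e -> U [set j | `|u j - v| < e].
Proof.
move=> UU uM; have FU : ProperFilter U := @ultra_proper _ _ UU.
have US : U [set j | u j \in `[- M, M]].
  by apply: filterS (@filterT _ U FU) => j _ /=; rewrite in_itv /= -ler_norml.
have [v [_ hv]] := @segment_compact R (- M) M (u @ U) _ US.
exists v => e e0; case: (in_ultra_setVsetC [set j | `|u j - v| < e] UU) => // UC.
have nb : nbhs v [set x : R | `|x - v| < e].
  by apply/nbhs_ballP; exists e => //= x; rewrite /ball /= distrC.
have UC' : (u @ U) [set x : R | ~ (`|x - v| < e)] := UC.
by have [x [h1 h2]] := hv _ _ UC' nb.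
Qed.

Lemma ultra_cplx_limit (U : set_system nat) (u : nat -> Cplx R) (M : R) : UltraFilter U ->
  (forall j, cmod (u j) <= M) -> exists v : Cplx R, forall e, 0 < e -> U [set j | cmod (u j - v) < e].
Proof.
move=> UU uM; have FU : ProperFilter U := @ultra_proper _ _ UU.
have [|x hx] := ultra_real_limit (u := fun j => complex.Re (u j)) (M := M) UU.
  by move=> j; exact: le_trans (Re_cmod _) (uM j).
have [|y hy] := ultra_real_limit (u := fun j => complex.Im (u j)) (M := M) UU.
  by move=> j; exact: le_trans (Im_cmod _) (uM j).
exists (x +i* y) => e e0; have e2 : 0 < e / 2 by rewrite divr_gt0.
apply: filterS (@filterI _ U FU _ _ (hx _ e2) (hy _ e2)) => j /= [h1 h2].
have -> : u j - (x +i* y) = (complex.Re (u j) - x)%:C + 'i * (complex.Im (u j) - y)%:C.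
  by apply: eqC; case: (u j) => a b /=; rewrite ?mul0r ?mul1r ?subr0 ?add0r ?addr0 ?mulr0 ?subrr.
apply: le_lt_trans (cmodD _ _) _; rewrite [e]splitr; apply: ltrD; first by rewrite cmod_real.
rewrite cmodM cmod_real (_ : cmod 'i = 1) ?mul1r//.
by rewrite cmodE /= expr0n expr1n add0r sqrtr1.
Qed.

(** A sequence of coefficient sequences that is bounded in each entry has a
    subsequence that converges in each entry. A free ultrafilter selects all
    the limits at once, which replaces the diagonal argument. *)
Lemma coef_subsequence u (M : nat -> R) : (forall j k, cmod (u j k) <= M k) ->
  exists (phi : nat -> nat) (v : nat -> Cplx R),
    {homo phi : m n / (m < n)%N} /\ forall k, (fun j => u (phi j) k) @ \oo --> v k.
Proof.
move=> uM; have [U [UU sU]] := ultraFilterLemma eventually_filter.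
have FU : ProperFilter U := @ultra_proper _ _ UU.
have /choice[v hv] : forall k, exists v : Cplx R, forall e, 0 < e -> U [set j | cmod (u j k - v) < e].
  by move=> k; apply: (ultra_cplx_limit (M := M k) UU) => j; exact: uM.
(* [A n] asks for precision [1 / (n + 1)] on the coefficients up to [n]. It
   belongs to a free ultrafilter, hence has members beyond any index. *)
pose A n := [set j | forall k, (k <= n)%N -> cmod (u j k - v k) < n.+1%:R^-1].
have UA n : U (A n).
  have e0 : (0 : R) < n.+1%:R^-1 by rewrite invr_gt0 ltr0n.
  suff h m : U [set j | forall k, (k < m)%N -> cmod (u j k - v k) < n.+1%:R^-1].
    by apply: filterS (h n.+1) => j hj k kn; apply: hj.
  elim: m => [|m IH]; first by apply: filterS (@filterT _ U FU) => j _ k.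
  apply: filterS (@filterI _ U FU _ _ IH (hv m _ e0)) => j [/= h1 h2] k.
  by rewrite ltnS leq_eqVlt => /predU1P[->|/h1].
have /choice[nxt hnxt] : forall nm : nat * nat, exists j, (nm.2 < j)%N /\ A nm.1 j.
  move=> [n m] /=; have Um : U [set j | (m < j)%N] by apply: sU; exists m.+1.
  by have [j [h1 h2]] := @filter_ex _ U FU _ (@filterI _ U FU _ _ Um (UA n)); exists j.
pose phi := fix F n := if n is m.+1 then nxt (m.+1, F m) else nxt (0%N, 0%N).
exists phi, v; split.
  by apply: homo_ltn; [exact: ltn_trans|move=> n /=; exact: (hnxt (n.+1, phi n)).1].
have hA n : A n (phi n) by case: n => [|n]; [exact: (hnxt (0%N, 0%N)).2|exact: (hnxt (n.+1, phi n)).2].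
move=> k; apply/cvg_seqP => e e0; exists (maxn k (Num.truncn e^-1)) => j.
rewrite geq_max => /andP[kj ej]; apply: lt_le_trans (hA j k kj) _.
rewrite -[leRHS]invrK lef_pV2 ?posrE ?invr_gt0 ?ltr0n//.
apply/ltW/(lt_le_trans (truncnS_gt _)); by rewrite ler_nat ltnS.
Qed.

End Subsequences.

Section BergmanLimits.
Context {R : realType}.
Notation mu := (@lebesgue_measure R).
Implicit Types (f g h : Cplx R -> Cplx R) (p q r t x al : R) (a b c eta : nat -> Cplx R).

Lemma bergman_int_ext p f g : p != 0 -> (forall z, cmod z < 1 -> f z = g z) -> bergman_int p f = bergman_int p g.
Proof.
move=> p0 fg; rewrite (bergman_int_dmod f p0) (bergman_int_dmod g p0); apply: eq_integral => -[x y] _.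
rewrite /dmod /=; case: ifPn => // h; rewrite fg// disc_pair//.
Qed.

Lemma powR_add_le p (x y : R) : 0 <= p -> 0 <= x -> 0 <= y -> (x + y) `^ p <= 2 `^ p * (x `^ p + y `^ p).
Proof.
move=> p0; wlog xy : x y / x <= y => [H x0 y0|x0 y0].
  by case/orP: (le_total x y) => ?; [|rewrite addrC [x `^ p + _]addrC]; exact: H.
apply: (@le_trans _ _ ((2 * y) `^ p)).
  by apply: powR_mono; rewrite ?addr_ge0//; lra.
by rewrite powRM// ler_wpM2l ?powR_ge0// lerDr powR_ge0.
Qed.

Lemma bergman_int_lin p f g (c : Cplx R) : 0 < p -> Hol f -> Hol g ->
  (bergman_int p (fun z => c * f z + g z)%R <=
   (2 `^ p)%:E * ((cmod c `^ p)%:E * bergman_int p f + bergman_int p g))%E.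
Proof.
move=> p0 hf hg; have pn : p != 0 by rewrite gt_eqF.
have hl : Hol (fun z => c * f z + g z).
  by apply: (@has_pseries_Hol R); exact: (@has_pseries_lin R _ _ _ _ c (Hol_pseries hf) (Hol_pseries hg)).
have mf := measurable_dmod_pow p hf; have mg := measurable_dmod_pow p hg.
rewrite (bergman_int_dmod f pn) (bergman_int_dmod g pn) bergman_int_dmod//.
have IZ (k : R) (F : R * R -> R) : 0 <= k -> measurable_fun setT F -> (forall w, 0 <= F w) ->
    (k%:E * \int[mu \x mu]_w (F w)%:E = \int[mu \x mu]_w (k * F w)%:E)%E.
  move=> k0 mF F0; rewrite -ge0_integralZl//; first exact/measurable_EFinP.
  by move=> w _; rewrite lee_fin.
have mcf : measurable_fun setT (fun w => cmod c `^ p * dmod f w `^ p) by exact: measurable_funM.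
rewrite (IZ _ _ (powR_ge0 (cmod c) p) mf); last by move=> w; exact: powR_ge0.
have <- : (\int[mu \x mu]_w (cmod c `^ p * dmod f w `^ p + dmod g w `^ p)%:E =
    \int[mu \x mu]_w (cmod c `^ p * dmod f w `^ p)%:E + \int[mu \x mu]_w (dmod g w `^ p)%:E)%E.
  rewrite -ge0_integralD//.
  - by move=> w _; rewrite lee_fin mulr_ge0 ?powR_ge0.
  - exact/measurable_EFinP.
  - by move=> w _; rewrite lee_fin powR_ge0.
  - exact/measurable_EFinP.
rewrite (IZ _ _ (powR_ge0 2 p) (measurable_funD mcf mg)); last first.
  by move=> w /=; rewrite addr_ge0 ?mulr_ge0 ?powR_ge0.
apply: ge0_le_integral => //.
- by move=> w _; rewrite lee_fin powR_ge0.
- by apply/measurable_EFinP; exact: (measurable_dmod_pow p hl).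
- by apply/measurable_EFinP; apply: measurable_funM => //; exact: measurable_funD.
move=> w _; rewrite lee_fin /=.
rewrite -powRM ?cmod_ge0 ?dmod_ge0//.
apply: le_trans (powR_add_le (ltW p0) _ (dmod_ge0 _ _)); last by rewrite mulr_ge0 ?cmod_ge0 ?dmod_ge0.
apply: powR_mono; rewrite ?(ltW p0) ?dmod_ge0// /dmod; case: ifP => _; last by rewrite mulr0 addr0.
by rewrite -cmodM cmodD.
Qed.

Lemma Bergman_lin p f g (c : Cplx R) : 0 < p -> Bergman p f -> Bergman p g ->
  Bergman p (fun z => c * f z + g z).
Proof.
move=> p0 bf bg; have [hf _] := bf; have [hg _] := bg; split.
  by apply: (@has_pseries_Hol R); exact: (@has_pseries_lin R _ _ _ _ c (Hol_pseries hf) (Hol_pseries hg)).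
apply: le_lt_trans (bergman_int_lin c p0 hf hg) _.
move: (bergman_fineK bf) (bergman_fineK bg) => <- <-; exact: ltry.
Qed.

Lemma bergman_fine_lin p f g (c : Cplx R) : 0 < p -> Bergman p f -> Bergman p g ->
  fine (bergman_int p (fun z => c * f z + g z)) <=
  2 `^ p * (cmod c `^ p * fine (bergman_int p f) + fine (bergman_int p g)).
Proof.
move=> p0 bf bg; have [hf _] := bf; have [hg _] := bg.
rewrite -lee_fin (bergman_fineK (Bergman_lin c p0 bf bg)) !EFinM EFinD EFinM.
by rewrite (bergman_fineK bf) (bergman_fineK bg); exact: bergman_int_lin.
Qed.

(** The free parameter [e] makes the bound small for functions of small norm. *)
Lemma coef_bergman p f k r (e : R) : 1 <= p -> Bergman p f -> 0 < r < 1 -> 0 < e ->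
  cmod (taylor_coef f k) * r ^+ k <=
  e + e `^ (1 - p) * ((pi *+ 2)^-1 * (4 / (1 - r) * fine (bergman_int p f))).
Proof.
move=> p1 bf r01 e0; have [hf _] := bf; have /andP[r0 r1] := r01.
have p0 : 0 < p by apply: lt_le_trans p1.
have r01' : 0 <= r < 1 by rewrite ltW.
rewrite -[X in X ^+ k]ger0_norm ?(ltW r0)// -cmod_real -cmodX -cmodM taylor_coef_cmean//.
have cP := cont_circ (Hol_cont hf) r01'.
have cV : continuous (fun t => (circ 1 t : Cplx R)^-1 ^+ k).
  by apply: cont_expC; exact: continuous_circV.
apply: le_trans (cmod_cmean _) _; first exact: cont_mulC cP cV.
rewrite (_ : (fun t => cmod _) = (fun t => cmod (f (circ r t)))); last first.
  by apply/funext => t; rewrite cmodM cmodX cmodV cmod_circ// invr1 expr1n mulr1.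
have P0 : (pi : R) *+ 2 != 0 by rewrite gt_eqF// pi2_gt0.
rewrite -[X in X + _]mulr1 -[X in e * X](mulVf P0) mulrCA -[X in _ <= _ + X]mulrCA.
rewrite -mulrDr ler_wpM2l ?invr_ge0 ?pi2_ge0//.
apply: le_trans (lerD (lexx _) (ler_wpM2l (powR_ge0 e _) (cint_pow_bergman_fine bf p1 r01'))).
have cp := cont_cmod_circ hf p0 r01'.
rewrite cint_powE -[X in e * X]subr0 -rint_cst ?pi2_ge0//.
have cc : continuous (fun _ : R => e : R) := @cst_continuous R R e.
have ce := @cont_scaleR R (e `^ (1 - p)) _ cp.
rewrite -(rintZ _ _ _ cp) -(rintD _ _ cc ce).
apply: rint_le; [exact: cont_cmod cP|exact: cont_addR cc ce|] => t _.
have [le1|/ltW ge1] := leP (cmod (f (circ r t))) e.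
  by rewrite ler_wpDr ?mulr_ge0 ?powR_ge0.
have f0 := lt_le_trans e0 ge1.
apply: ler_wpDl; first exact: ltW.
have := @le_powRN R e (cmod (f (circ r t))) (1 - p) e0 ge1; rewrite subr_le0 => /(_ p1) h.
apply: le_trans (ler_wpM2r (powR_ge0 _ _) h).
by rewrite -powRD_gt0// subrK powRr1// ltW.
Qed.

(** Fatou's lemma. *)
Lemma Bergman_lim p (f_ : nat -> Cplx R -> Cplx R) h (M : R) : 0 < p ->
  (forall j, Bergman p (f_ j)) -> (forall j, fine (bergman_int p (f_ j)) <= M) -> Hol h ->
  (forall z, cmod z < 1 -> (fun j => f_ j z) @ \oo --> h z) ->
  (bergman_int p h <= M%:E)%E.
Proof.
move=> p0 bf fM hh fh; have pn : p != 0 by rewrite gt_eqF.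
pose F j w := (dmod (f_ j) w `^ p)%:E.
have mF j : measurable_fun setT (F j).
  have [hf _] := bf j; by apply/measurable_EFinP; exact: (measurable_dmod_pow p hf).
have F0 j w : setT w -> (0 <= F j w)%E by move=> _; rewrite lee_fin powR_ge0.
rewrite bergman_int_dmod//.
have -> : (\int[mu \x mu]_w (dmod h w `^ p)%:E = \int[mu \x mu]_w limn_einf (F^~ w))%E.
  apply: eq_integral => -[x y] _; symmetry.
  suff : (F^~ (x, y) : nat -> \bar R) @ \oo --> (dmod h (x, y) `^ p)%:E.
    by move/cvg_limn_einf_sup => [].
  apply: cvg_EFin; first by apply: nearW.
  rewrite (_ : fine \o _ = (fun j => `|dmod (f_ j) (x, y)| `^ p)); last first.
    by apply/funext => j /=; rewrite ger0_norm ?dmod_ge0.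
  rewrite -[dmod h _]ger0_norm ?dmod_ge0//.
  apply: (@continuous_cvg _ _ _ _ _ _ (fun t : R => `|t| `^ p)); first exact: continuous_abs_powR.
  rewrite /dmod /=; case: ifPn => hxy; last exact: cvg_cst.
  have zx : cmod (x +i* y : Cplx R) < 1 by rewrite disc_pair.
  apply/cvgrPdist_lt => e e0; have /cvg_seqP /(_ e e0)[N hN] := fh _ zx.
  exists N => // j /= /hN; apply: le_lt_trans; rewrite distrC ler_norml; apply/andP; split.
    rewrite lerNl opprB; apply: le_trans (cmod_sub _ _) _.
    by rewrite -cmodN opprB.
  exact: cmod_sub.
apply: le_trans; first exact: (fatou (mu \x mu)%E measurableT mF F0).
rewrite limn_einf_lim; apply: lime_le; first exact: is_cvg_einfs.
apply: nearW => n; apply: (@le_trans _ _ (bergman_int p (f_ n))).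
  rewrite bergman_int_dmod//; apply: ereal_inf_lbound; exists n => //=.
by rewrite -(bergman_fineK (bf n)) lee_fin.
Qed.

End BergmanLimits.

(** * Compact operators *)

Section Compactness.
Context {R : realType}.
Implicit Types (f g h : Cplx R -> Cplx R) (p q r t x al : R) (a b c eta : nat -> Cplx R).
Implicit Types (F : nat -> Cplx R -> Cplx R) (T : (Cplx R -> Cplx R) -> Cplx R -> Cplx R).

Definition bergman_bounded p (M : R) F :=
  forall j, Bergman p (F j) /\ fine (bergman_int p (F j)) <= M.

Definition coef_vanish F := forall k, (fun j => taylor_coef (F j) k) @ \oo --> (0 : Cplx R).

(** Sequential continuity at [0] for the weak topology of bounded sets. *)
Definition vanishing p q T := forall F M, bergman_bounded p M F -> coef_vanish F ->
  forall e : R, 0 < e -> exists N, forall j, (N <= j)%N -> fine (bergman_int q (T (F j))) <= e.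

Lemma taylor_coef_lin f h (c : Cplx R) k : Hol f -> Hol h ->
  taylor_coef (fun z => c * f z + h z) k = c * taylor_coef f k + taylor_coef h k.
Proof.
by move=> hf hh; rewrite (taylor_coefE (@has_pseries_lin R _ _ _ _ c (Hol_pseries hf) (Hol_pseries hh))).
Qed.

Lemma powRVK p x : 0 < p -> 0 <= x -> (x `^ p^-1) `^ p = x.
Proof. by move=> p0 x0; rewrite -powRrM mulVf ?gt_eqF// powRr1. Qed.

Lemma bergman_norm_le p f (M : R) : 0 < p -> bergman_norm p f <= M ->
  fine (bergman_int p f) <= M `^ p.
Proof.
move=> p0 h; rewrite -(powRVK p0 (fine_bergman_ge0 p f)).
by apply: powR_mono; rewrite ?(ltW p0) ?powR_ge0.
Qed.

Lemma bergman_norm_cvg0 p F : 0 < p ->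
  ((fun n => bergman_norm p (F n)) @ \oo --> (0 : R)) <->
  (forall e : R, 0 < e -> exists N, forall j, (N <= j)%N -> fine (bergman_int p (F j)) <= e).
Proof.
move=> p0; split=> [/cvgrPdist_lt h e e0|h].
  have [|N _ hN] := h (e `^ p^-1); first exact: powR_gt0.
  exists N => j /hN /=; rewrite sub0r normrN ger0_norm ?powR_ge0// => /ltW /(bergman_norm_le p0).
  by rewrite powRVK// ltW.
apply/cvgrPdist_le => e e0; have [|N hN] := h (e `^ p); first exact: powR_gt0.
exists N => // j /= /hN Nj; rewrite sub0r normrN ger0_norm ?powR_ge0//.
have pi0 : 0 <= p^-1 by rewrite invr_ge0 ltW.
have := powR_mono pi0 (fine_bergman_ge0 p (F j)) Nj.
by rewrite -[(e `^ p) `^ _]powRrM mulfV ?gt_eqF// powRr1// ltW.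
Qed.

Definition coef_bound p M r : R := 1 + (pi *+ 2)^-1 * (4 / (1 - r) * M).

Lemma bergman_bounded_coef p M F r : 1 <= p -> bergman_bounded p M F -> 0 < r < 1 ->
  forall j k, cmod (taylor_coef (F j) k) * r ^+ k <= coef_bound p M r.
Proof.
move=> p1 bf r01 j k; have [bj Mj] := bf j.
apply: le_trans (coef_bergman k p1 bj r01 ltr01) _; rewrite powR1 mul1r /coef_bound.
rewrite lerD2l ler_wpM2l ?invr_ge0 ?pi2_ge0// ler_wpM2l// divr_ge0// subr_ge0 ltW//.
by case/andP: r01.
Qed.

Lemma bergman_unif_cvg0 p M F r : 1 <= p -> bergman_bounded p M F -> coef_vanish F ->
  0 <= r < 1 ->
  forall e : R, 0 < e -> exists N, forall j z, (N <= j)%N -> cmod z <= r -> cmod (F j z) <= e.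
Proof.
move=> p1 bf f0 /andP[r0 r1]; pose s := (1 + r) / 2.
have rs : r < s by rewrite /s; lra.
have s1 : s < 1 by rewrite /s; lra.
have s01 : 0 < s < 1 by rewrite s1 (le_lt_trans r0).
apply: (coef_unif_cvg0 _ r0 rs s1 (bergman_bounded_coef p1 bf s01) f0) => j.
by have [[hj _] _] := bf j; exact: Hol_pseries.
Qed.

Lemma half_to_one x : x < 1 -> x < (1 + x) / 2 /\ (1 + x) / 2 < 1.
Proof. by move=> x1; split; lra. Qed.

(** Montel's theorem for bounded sets of the Bergman space; the limit stays in
    the space by Fatou's lemma. *)
Lemma bergman_subsequence p M F : 1 <= p -> bergman_bounded p M F ->
  exists (phi : nat -> nat) h, [/\ {homo phi : m n / (m < n)%N}, Bergman p h &
    coef_vanish (fun j z => (- 1) * h z + F (phi j) z)].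
Proof.
move=> p1 bf; have p0 : 0 < p by apply: lt_le_trans p1.
have h12 : 0 < (2^-1 : R) < 1 by rewrite invr_gt0 ltr0n /= invf_lt1 ?ltr1n.
have [|phi [v [phih hv]]] := @coef_subsequence R (fun j k => taylor_coef (F j) k)
    (fun k => coef_bound p M 2^-1 / 2^-1 ^+ k).
  by move=> j k; rewrite ler_pdivlMr ?exprn_gt0//; exact: bergman_bounded_coef.
have vb r k : 0 < r < 1 -> cmod (v k) * r ^+ k <= coef_bound p M r.
  move=> r01; have /andP[r0 r1] := r01; rewrite -ler_pdivlMr ?exprn_gt0//.
  apply: (@cmod_lim_le R _ _ _ 0 (hv k)) => j _; rewrite ler_pdivlMr ?exprn_gt0//.
  exact: bergman_bounded_coef.
have rv : radius1 v.
  move=> r /andP[r0 r1]; pose s := (1 + r) / 2.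
  have rs : r <= s by rewrite /s; lra.
  have s0 : 0 < s by rewrite /s; lra.
  have s1 : s < 1 by rewrite /s; lra.
  have s01 : 0 < s < 1 by rewrite s0.
  exists (coef_bound p M s) => k; apply: le_trans (vb s k s01).
  by rewrite ler_wpM2l ?cmod_ge0// lerXn2r ?nnegrE ?(ltW s0).
have hh := psfunP rv; set h := psfun v in hh; have Hh := has_pseries_Hol hh.
have hD j := @has_pseries_lin R _ _ _ _ (-1) hh (Hol_pseries (bf (phi j)).1.1).
have c0 k : (fun j => (- 1) * v k + taylor_coef (F (phi j)) k) @ \oo --> (0 : Cplx R).
  have := cvgCD (@cvgCc R (- 1 * v k)) (hv k); by rewrite mulN1r addNr.
have bh : (bergman_int p h <= M%:E)%E.
  apply: (@Bergman_lim R p (fun j => F (phi j)) h M p0 _ _ Hh); [|by move=> j; exact: (bf (phi j)).2|].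
    by move=> j; exact: (bf (phi j)).1.
  move=> z z1.
  apply/cvg_seqP => e e0; pose s := (1 + cmod z) / 2.
  have [zs s1] := half_to_one z1.
  have s01 : 0 < s < 1 by rewrite s1 (le_lt_trans (cmod_ge0 z)).
  have e2 : 0 < e / 2 by rewrite divr_gt0.
  have [|N hN] := coef_unif_cvg0 (M := coef_bound p M s + coef_bound p M s) hD (cmod_ge0 z) zs s1 _ c0 e2.
    move=> j k; rewrite mulN1r addrC; apply: le_trans (ler_wpM2r _ (cmodBD _ _)) _.
      by rewrite exprn_ge0// ltW//; case/andP: s01.
    by rewrite mulrDl; apply: lerD; [exact: bergman_bounded_coef|exact: vb].
  exists N => j Nj; have := hN j z Nj (lexx _); rewrite mulN1r addrC => hj.
  by apply: le_lt_trans hj _; rewrite ltr_pdivrMr// ltr_pMr// ltr1n.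
exists phi, h; split; [exact: phih|split; [exact: Hh|exact: le_lt_trans bh (ltry _)]|].
by move=> k; rewrite (_ : (fun j => _) = (fun j => (- 1) * v k + taylor_coef (F (phi j)) k))//;
  apply/funext => j; rewrite (taylor_coefE (hD j)).
Qed.

Lemma cvgC0_unique (u : nat -> Cplx R) (l : Cplx R) :
  (forall e : R, 0 < e -> exists2 n, cmod (u n) < e & cmod (u n - l) < e) -> l = 0.
Proof.
move=> h; apply: cmod_eq0; apply/eqP; rewrite eq_le cmod_ge0 andbT.
apply/ler_addgt0Pr => e e0; have e2 : 0 < e / 2 by rewrite divr_gt0.
have [n n1 n2] := h _ e2; rewrite add0r [e]splitr.
have -> : l = u n - (u n - l) by rewrite opprB addrC subrK.
by apply: le_trans (cmodBD _ _) _; apply: lerD; exact: ltW.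
Qed.

(** Compactness is decided by sequences that are bounded and converge to [0]
    coefficientwise: from a bounded sequence one such is obtained by extracting
    a subsequence and subtracting its limit. Conversely the images of such a
    sequence have vanishing coefficients in the limit, so that [0] is the only limit
    point of the images. *)
Lemma compact_vanishing p q T : 1 <= p -> 1 <= q -> linear_Bergman p q T ->
  (forall F M, bergman_bounded p M F -> coef_vanish F -> coef_vanish (fun j => T (F j))) ->
  compact_Bergman p q T <-> vanishing p q T.
Proof.
move=> p1 q1 LT TC; have [TB TL] := LT.
have p0 : 0 < p by apply: lt_le_trans p1.
have q0 : 0 < q by apply: lt_le_trans q1.
have qn : q != 0 by rewrite gt_eqF.
split=> [[_ cT] F M bf f0 e e0|vT].
  apply: contrapT => hno.
  have /choice[psi hpsi] : forall N, exists j, (N <= j)%N /\ e < fine (bergman_int q (T (F j))).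
    move=> N; apply: contrapT => hN; apply: hno; exists N => j Nj.
    by rewrite leNgt; apply/negP => lt; apply: hN; exists j.
  have [|phi [h [phih bh]]] := cT (fun n => F (psi n)) (M `^ p^-1).
    move=> n; have [bn Mn] := bf (psi n); split=> //.
    by apply: powR_mono; rewrite ?invr_ge0 ?(ltW p0) ?fine_bergman_ge0.
  set u := fun n => T (F (psi (phi n))); move=> /(bergman_norm_cvg0 _ q0) cu.
  have phin n : (n <= phi n)%N.
    by elim: n => // n IH; apply: leq_ltn_trans IH (phih _ _ (ltnSn n)).
  have psin N n : (N <= n)%N -> (N <= psi (phi n))%N.
    by move=> Nn; apply: leq_trans (hpsi _).1; exact: leq_trans (phin n).
  have bu n : Bergman q (u n) by apply: TB; exact: (bf _).1.
  have buh n : Bergman q (fun z => (- 1) * h z + u n z) by exact: (Bergman_lin (-1) q0 bh (bu n)).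
  have Euh n : fine (bergman_int q (fun z => u n z - h z)) = fine (bergman_int q (fun z => (- 1) * h z + u n z)).
    by congr fine; apply: bergman_int_ext => // z _; rewrite mulN1r addrC.
  have hk k : taylor_coef h k = 0.
    apply: (cvgC0_unique (u := fun n => taylor_coef (u n) k)) => e' e'0.
    have /cvg_seqP /(_ e' e'0)[N1 hN1] := TC F M bf f0 k.
    (* The Cauchy estimate at radius [1 / 2] has the form [d + K * B] with [B] the
       Bergman integral; with this [d] it gives a coefficient of modulus at most
       [e' / 2] once [B] is at most [d / K]. *)
    pose d := e' / (2 * 2 ^+ k.+1); have d0 : 0 < d by rewrite divr_gt0// mulr_gt0// exprn_gt0.
    pose K := d `^ (1 - q) * ((pi *+ 2)^-1 * (4 / (1 - 2^-1))).
    have K0 : 0 < K.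
      rewrite mulr_gt0 ?powR_gt0// mulr_gt0 ?invr_gt0 ?pi2_gt0// divr_gt0// subr_gt0 invf_lt1 ?ltr1n//.
    have [|N2 hN2] := cu (d / K); first by rewrite divr_gt0.
    pose n := maxn N1 N2; exists n; first by rewrite -[taylor_coef _ _]subr0; apply: hN1; apply: psin; exact: leq_maxl.
    have h12 : 0 < (2^-1 : R) < 1 by rewrite invr_gt0 ltr0n /= invf_lt1 ?ltr1n.
    have hn : fine (bergman_int q (fun z => (- 1) * h z + u n z)) <= d / K.
      by rewrite -Euh; apply: hN2; exact: leq_maxr.
    have := coef_bergman k q1 (buh n) h12 d0.
    rewrite (_ : d `^ (1 - q) * _ = K * fine (bergman_int q (fun z => (- 1) * h z + u n z))); last first.
      by rewrite /K !mulrA.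
    rewrite taylor_coef_lin; [|exact: bh.1|exact: (bu n).1].
    rewrite mulN1r addrC => hc.
    have {}hc : cmod (taylor_coef (u n) k - taylor_coef h k) * 2^-1 ^+ k <= d + d.
      by apply: le_trans hc _; rewrite lerD2l -ler_pdivlMl// mulrC.
    have t0 : (0 : R) < 2 ^+ k by rewrite exprn_gt0.
    rewrite exprVn ler_pdivrMr// in hc; apply: le_lt_trans hc _.
    have -> : (d + d) * 2 ^+ k = e' / 2 by rewrite /d exprS; field; rewrite gt_eqF.
    by rewrite ltr_pdivrMr// ltr_pMr// ltr1n.
  have h0 z : cmod z < 1 -> h z = 0.
    move=> z1; have /has_pseriesP /(_ z z1) := Hol_pseries bh.1.
    rewrite (_ : psum _ z = fun=> 0) => [hz|]; first by rewrite -(cvg_limC hz); apply: cvg_limC; exact: cvgCc.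
    by apply/funext => n; rewrite /psum big1// => i _; rewrite hk mul0r.
  have [N hN] := cu e e0; have := hN N (leqnn _).
  rewrite (_ : bergman_int _ _ = bergman_int q (u N)); last first.
    by apply: bergman_int_ext => // z z1; rewrite h0// subr0.
  by rewrite leNgt (hpsi _).2.
split=> // F M hF; have bF : bergman_bounded p (M `^ p) F.
  by move=> j; have [bj Mj] := hF j; split=> //; exact: bergman_norm_le.
have [phi [h [phih bh v0]]] := bergman_subsequence p1 bF.
exists phi, (T h); split; [exact: phih|exact: (TB _ bh)|].
have bu : bergman_bounded p (2 `^ p * (cmod (-1 : Cplx R) `^ p * fine (bergman_int p h) + M `^ p))
    (fun j z => (- 1) * h z + F (phi j) z).
  move=> j; have [bj Mj] := bF (phi j); split; first exact: Bergman_lin.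
  apply: le_trans (bergman_fine_lin (-1) p0 bh bj) _.
  by rewrite ler_wpM2l ?powR_ge0// lerD2l.
apply/(bergman_norm_cvg0 _ q0) => e e0; have [N hN] := vT _ _ bu v0 e e0.
exists N => j /hN; have bj := (bF (phi j)).1.
rewrite (@bergman_int_ext R q (fun z => T (F (phi j)) z - T h z) (T (fun z => (- 1) * h z + F (phi j) z)) qn) => // z z1.
by rewrite (TL _ _ _ bh bj) ?discE// mulN1r addrC.
Qed.

End Compactness.

(** * The generalized Hilbert operator *)

Section Operators.
Context {R : realType}.
Notation mu := (@lebesgue_measure R).
Implicit Types (f g h : Cplx R -> Cplx R) (p q r t x al : R) (a b c eta : nat -> Cplx R).
Implicit Types (F : nat -> Cplx R -> Cplx R) (T : (Cplx R -> Cplx R) -> Cplx R -> Cplx R).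

Lemma mean_dom_le p (L1 L2 : R) b : L1 <= L2 -> mean_dom p L1 b -> mean_dom p L2 b.
Proof.
move=> L12 [Phi hPhi [N [mN N0 Nh NP NL]]]; exists Phi => //; exists N; split=> //.
by apply: le_trans NL _; rewrite lee_fin.
Qed.

Lemma Bergman_1 q : 1 <= q -> Bergman q (fun=> 1 : Cplx R).
Proof.
move=> q1; have q0 : 0 < q by apply: lt_le_trans q1.
have h1 : Hol (fun=> 1 : Cplx R) by move=> z _; exact: derivable_cst.
split=> //; apply: (le_lt_trans (bergman_le_int h1 q1)).
apply: (@le_lt_trans _ _ (\int[mu]_(x in `]0%R, 1%R[) ((1 : R) `^ q * (pi *+ 2))%:E)%E).
  apply: le_integral_EFin; [exact: measurable_itv|exact: measurable_cint_pow_aff|exact: measurable_cst|].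
  move=> x /=; rewrite in_itv /= => /andP[x0 x1]; apply/andP; split; first exact: cint_pow_ge0.
  apply: cint_pow_sup => //; last by move=> z _; rewrite cmod1.
  by apply/andP; split; lra.
rewrite integral_cst ?measurable_itv//= lebesgue_measure_itv /= lte_fin ltr01.
by rewrite -EFinD -EFinM ltry.
Qed.

Lemma bergman_int_mulz q f : 0 < q -> Hol f -> (bergman_int q (fun z => z * f z)%R <= bergman_int q f)%E.
Proof.
move=> q0 hf; have qn : q != 0 by rewrite gt_eqF.
have hz : Hol (fun z => z * f z) by exact: has_pseries_Hol (has_pseries_shift (Hol_pseries hf)).
rewrite (bergman_int_dmod f qn) (bergman_int_dmod (fun z => z * f z) qn).
apply: ge0_le_integral => //.
- by move=> w _; rewrite lee_fin powR_ge0.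
- by apply/measurable_EFinP; exact: (measurable_dmod_pow q hz).
- by apply/measurable_EFinP; exact: (measurable_dmod_pow q hf).
move=> [x y] _; rewrite lee_fin; apply: powR_mono; rewrite ?(ltW q0) ?dmod_ge0//.
rewrite /dmod /=; case: ifPn => // xy; rewrite cmodM ler_piMl ?cmod_ge0//.
by rewrite ltW// disc_pair.
Qed.

Lemma genHilbert_pseries p eta g f : 2 < p -> has_pseries eta g -> Bergman p f ->
  has_pseries (fun n => n.+1%:R * eta n.+1 * moment f n) (genHilbert eta f).
Proof.
move=> p2 hg bf; apply: psfunP; apply: radius1_mul.
  exact: has_pseries_radius1 (has_pseries_derive1 hg).
apply: (radius1_le (C := fine (\int[mu]_(x in `]0%R, 1%R[) (radial f x)%:E)%E) (has_pseries_radius1 (@has_pseries_geo R))) => n.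
rewrite cmod1 mulr1; apply: le_trans (moment_le n p2 bf) _.
rewrite ler_peMr// ?ler1n//; apply: fine_ge0; apply: integral_ge0 => x _.
by rewrite lee_fin radial_ge0.
Qed.

(** The form in which the sufficiency estimates apply, with [b n] equal to
    [(n + 1)] times the moment. *)
Lemma genHilbert_pseries_factored p eta g f : 2 < p -> has_pseries eta g -> Bergman p f ->
  has_pseries (fun n => eta n.+1 * (n.+1%:R * moment f n)) (genHilbert eta f).
Proof.
move=> p2 hg bf; rewrite (_ : (fun n => _) = (fun n => n.+1%:R * eta n.+1 * moment f n)).
  exact: genHilbert_pseries hg bf.
by apply/funext => n; rewrite mulrA [eta _ * _]mulrC.
Qed.

Lemma moment_lin p f h (k : Cplx R) n : 2 < p -> Bergman p f -> Bergman p h ->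
  moment (fun z => k * f z + h z) n = k * moment f n + moment h n.
Proof.
move=> p2 bf bh; have p0 : 0 < p by apply: lt_trans p2.
have [hf _] := bf; have [hh _] := bh.
have := cvgCD (cvgCM (@cvgCc R k) (@momentP R p f n p2 bf)) (@momentP R p h n p2 bh).
rewrite (_ : (fun K => _) = (fun K => \sum_(j < K) taylor_coef (fun z => k * f z + h z) j / (n + j + 1)%:R)).
  move=> c1; have c2 := @momentP R p _ n p2 (Bergman_lin k p0 bf bh).
  by rewrite -(cvg_limC c2) (cvg_limC c1).
apply/funext => K; rewrite mulr_sumr -big_split /=; apply: eq_bigr => j _.
by rewrite taylor_coef_lin// mulrDl mulrA.
Qed.

Lemma has_pseries_eq a b f g z : has_pseries a f -> has_pseries b g -> a = b -> cmod z < 1 -> f z = g z.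
Proof. by move=> hf hg ab z1; rewrite -(has_pseries_psfun hf z1) ab (has_pseries_psfun hg z1). Qed.

Lemma genHilbert_lin p eta g f h (k : Cplx R) z : 2 < p -> has_pseries eta g ->
  Bergman p f -> Bergman p h -> cmod z < 1 ->
  genHilbert eta (fun w => k * f w + h w) z = k * genHilbert eta f z + genHilbert eta h z.
Proof.
move=> p2 hg bf bh z1; have p0 : 0 < p by apply: lt_trans p2.
have h1 := genHilbert_pseries p2 hg (Bergman_lin k p0 bf bh).
have h2 := @has_pseries_lin R _ _ _ _ k (genHilbert_pseries p2 hg bf) (genHilbert_pseries p2 hg bh).
apply: (has_pseries_eq h1 h2 _ z1); apply/funext => n.
by rewrite (moment_lin k n p2 bf bh) mulrDr mulrCA.
Qed.

(** Moments are small because [f] is small on compact subsets and the integral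
    of [radial f] near [1] is uniformly small. *)
Lemma moment_vanish p M F n : 2 < p -> bergman_bounded p M F -> coef_vanish F ->
  (fun j => moment (F j) n) @ \oo --> (0 : Cplx R).
Proof.
move=> p2 bF F0; have p1 : 1 < p by apply: lt_trans p2; lra.
have p0 : 0 < p by apply: lt_trans p1.
have [C C0 hC] := radial_int_tail p2.
have s0 : 0 < 1 - 2 / p by rewrite subr_gt0 ltr_pdivrMr// mul1r.
have M0 : 0 <= M by have [_] := bF 0%N; exact: le_trans (fine_bergman_ge0 _ _).
apply/cvg_seqP => e e0; have e2 : 0 < e / 2 by rewrite divr_gt0.
(* [d] makes the integral over the last [d] of the radius at most [e / 2];
   adding 1 keeps [B] positive when [M] is 0. *)
pose B := C * M `^ p^-1 + 1; have B0 : 0 < B by rewrite ltr_wpDl// mulr_ge0 ?powR_ge0// ltW.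
pose d := Num.min 1 ((e / 2 / B) `^ (1 - 2 / p)^-1).
have d0 : 0 < d by rewrite lt_min ltr01 powR_gt0// divr_gt0.
have d1 : d <= 1 by rewrite ge_min lexx.
have d01 : 0 < d <= 1 by rewrite d0.
have tail j : (\int[mu]_(x in `](1 - d)%R, 1%R[) (radial (F j) x)%:E <= (e / 2)%:E)%E.
  have [bj Mj] := bF j; apply: le_trans (hC _ _ bj d01) _; rewrite lee_fin.
  have pi0 : 0 <= p^-1 by rewrite invr_ge0 ltW.
  have hd : d `^ (1 - 2 / p) <= e / 2 / B.
    have h : d <= (e / 2 / B) `^ (1 - 2 / p)^-1 by rewrite ge_min lexx orbT.
    apply: le_trans (powR_mono (ltW s0) (ltW d0) h) _.
    by rewrite -powRrM mulVf ?gt_eqF// powRr1// ltW// divr_gt0.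
  apply: (@le_trans _ _ (B * (e / 2 / B))); last by rewrite mulrC divfK ?gt_eqF.
  apply: ler_pM; rewrite ?powR_ge0 ?mulr_ge0 ?powR_ge0 ?(ltW C0)//.
  apply: (@le_trans _ _ (C * M `^ p^-1)); last by rewrite lerDl.
  by rewrite ler_wpM2l ?(ltW C0)//; apply: powR_mono; rewrite ?fine_bergman_ge0.
have r01 : 0 <= 1 - d < 1 by rewrite subr_ge0 d1 gtrBl.
have e4 : 0 < e / 4 by rewrite divr_gt0.
have [N hN] := bergman_unif_cvg0 (ltW p1) bF F0 r01 e4.
exists N => j Nj; have [bj _] := bF j; have [hj _] := bj; rewrite subr0.
apply: le_lt_trans (moment_le n p2 bj) _; rewrite -lte_fin fineK ?(radial_int_fin p2 bj)//.
have mr := @measurable_radial R (F j) setT hj.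
rewrite (integral_split01 r01 (measurable_funTS mr) (fun x _ => radial_ge0 _ x)).
apply: (@le_lt_trans _ _ ((e / 4)%:E + (e / 2)%:E)%E); last by rewrite -EFinD lte_fin; lra.
apply: leeD => //.
apply: (@le_trans _ _ (\int[mu]_(x in `]0%R, (1 - d)%R]) (e / 4)%:E)%E).
  apply: le_integral_EFin; [exact: measurable_itv|exact: measurable_funTS|exact: measurable_cst|].
  move=> x /=; rewrite in_itv /= => /andP[x0 xd]; rewrite radial_ge0/=.
  have x01 : 0 <= x < 1 by rewrite (ltW x0) (le_lt_trans xd)//; case/andP: r01.
  by rewrite radialE//; apply: hN; rewrite // cmod_real ger0_norm ?(ltW x0).
rewrite integral_cst ?measurable_itv//= lebesgue_measure_itv /= lte_fin.
case: ifPn => [r0p|_]; last by rewrite mule0 lee_fin ltW.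
rewrite -EFinD -EFinM lee_fin subr0 ler_piMr ?(ltW e4)//.
by case/andP: r01 => _ /ltW.
Qed.

Lemma genHilbert_coef_vanish p eta g F M : 2 < p -> has_pseries eta g ->
  bergman_bounded p M F -> coef_vanish F -> coef_vanish (fun j => genHilbert eta (F j)).
Proof.
move=> p2 hg bF F0 k.
rewrite (_ : (fun j => _) = (fun j => k.+1%:R * eta k.+1 * moment (F j) k)); last first.
  by apply/funext => j; rewrite (taylor_coefE (genHilbert_pseries p2 hg (bF j).1)).
by have := cvgCM (@cvgCc R (k.+1%:R * eta k.+1)) (moment_vanish k p2 bF F0); rewrite mulr0.
Qed.

Lemma genHilbert_bound p q eta g : 2 < p -> p < q -> 2 / p - 1 / q < 1 ->
  has_pseries eta g -> Lip q (2 / p - 1 / q) g ->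
  exists2 C : R, 0 <= C & forall f, Bergman p f ->
    (bergman_int q (genHilbert eta f) <= (C * fine (bergman_int p f) `^ (q / p))%:E)%E.
Proof.
move=> p2 pq al1 hg Lg; have p0 : 0 < p by apply: lt_trans p2.
have q1 : 1 < q by apply: lt_trans pq; apply: lt_trans p2; lra.
have [C C0 hC] := Lip_bergman_bound p0 pq q1 al1 hg Lg.
have [K K0 hK] := mean_dom_moments p2.
exists (C * K `^ (q / p)) => [|f bf]; first by rewrite mulr_ge0 ?powR_ge0.
rewrite -mulrA -powRM ?(ltW K0) ?fine_bergman_ge0//.
apply: (hC _ _ _ (hK _ bf)); first by rewrite mulr_ge0 ?(ltW K0) ?fine_bergman_ge0.
exact: genHilbert_pseries_factored hg bf.
Qed.

Lemma genHilbert_vanishing p q eta g : 2 < p -> p < q -> 2 / p - 1 / q < 1 ->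
  has_pseries eta g -> lip q (2 / p - 1 / q) g -> vanishing p q (genHilbert eta).
Proof.
move=> p2 pq al1 hg Lg F M bF F0 e e0; have p0 : 0 < p by apply: lt_trans p2.
have q1 : 1 < q by apply: lt_trans pq; apply: lt_trans p2; lra.
have [K K0 hK] := mean_dom_moments p2.
have M0 : 0 <= M by have [_] := bF 0%N; exact: le_trans (fine_bergman_ge0 _ _).
have [||||N hN] := lip_bergman_vanish p0 pq q1 al1 hg Lg (b_ := fun j n => n.+1%:R * moment (F j) n)
    (Lam := K * M) (h_ := fun j => genHilbert eta (F j)) _ _ _ _ e0.
- by move=> j; apply: mean_dom_le (hK _ (bF j).1); rewrite ler_wpM2l ?(ltW K0)// (bF j).2.
- by rewrite mulr_ge0// ltW.
- by move=> j; exact: genHilbert_pseries_factored p2 hg (bF j).1.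
- by move=> k; have := cvgCM (@cvgCc R k.+1%:R) (moment_vanish k p2 bF F0); rewrite mulr0.
exists N => j /hN h; rewrite -lee_fin fineK// ge0_fin_numE ?bergman_int_ge0//.
exact: le_lt_trans h (ltry _).
Qed.

End Operators.

(** * The Rhaly operator *)

Section RhalyOperator.
Context {R : realType}.
Implicit Types (f g h : Cplx R -> Cplx R) (p q r t x al : R) (a b c eta : nat -> Cplx R).
Implicit Types (F : nat -> Cplx R -> Cplx R) (T : (Cplx R -> Cplx R) -> Cplx R -> Cplx R).

Lemma Rhaly_pseries eta g f : has_pseries eta g -> Hol f ->
  has_pseries (fun n => eta n * \sum_(k < n.+1) taylor_coef f k) (Rhaly eta f).
Proof.
move=> hg hf; apply: psfunP; apply: radius1_mul; first exact: has_pseries_radius1 hg.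
exact: has_pseries_radius1 (has_pseries_psums (Hol_pseries hf)).
Qed.

Lemma Rhaly_lin eta g f h (k : Cplx R) z : has_pseries eta g -> Hol f -> Hol h -> cmod z < 1 ->
  Rhaly eta (fun w => k * f w + h w) z = k * Rhaly eta f z + Rhaly eta h z.
Proof.
move=> hg hf hh z1.
have hl := has_pseries_Hol (@has_pseries_lin R _ _ _ _ k (Hol_pseries hf) (Hol_pseries hh)).
have h2 := @has_pseries_lin R _ _ _ _ k (Rhaly_pseries hg hf) (Rhaly_pseries hg hh).
apply: (has_pseries_eq (Rhaly_pseries hg hl) h2 _ z1); apply/funext => n.
rewrite [k * (_ * _)]mulrCA -mulrDr; congr (_ * _); rewrite mulr_sumr -big_split /=; apply: eq_bigr => j _.
by rewrite taylor_coef_lin.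
Qed.

Lemma psum_vanish F n : coef_vanish F ->
  (fun j => \sum_(k < n) taylor_coef (F j) k) @ \oo --> (0 : Cplx R).
Proof.
move=> F0; elim: n => [|n IH].
  by under eq_fun do rewrite big_ord0; exact: cvgCc.
under eq_fun do rewrite big_ord_recr.
by have := cvgCD IH (F0 n); rewrite addr0.
Qed.

Lemma Rhaly_coef_vanish eta g F : has_pseries eta g -> (forall j, Hol (F j)) ->
  coef_vanish F -> coef_vanish (fun j => Rhaly eta (F j)).
Proof.
move=> hg hF F0 k.
rewrite (_ : (fun j => _) = (fun j => eta k * \sum_(i < k.+1) taylor_coef (F j) i)); last first.
  by apply/funext => j; rewrite (taylor_coefE (Rhaly_pseries hg (hF j))).
by have := cvgCM (@cvgCc R (eta k)) (@psum_vanish F k.+1 F0); rewrite mulr0.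
Qed.

(** Removing the constant term and a factor [z] brings the Rhaly operator to the
    form [sum of eta (n + 1) * b n * z ^ n], which it shares with the Hilbert
    operator. *)
Definition rhaly_tail eta f :=
  psfun (fun n => eta n.+1 * \sum_(k < n.+2) taylor_coef f k).

Lemma rhaly_tail_pseries eta g f : has_pseries eta g -> Hol f ->
  has_pseries (fun n => eta n.+1 * \sum_(k < n.+2) taylor_coef f k) (rhaly_tail eta f).
Proof.
move=> hg hf; apply: psfunP.
exact: radius1_shift (has_pseries_radius1 (Rhaly_pseries hg hf)).
Qed.

Lemma RhalyE eta g f z : has_pseries eta g -> Hol f -> cmod z < 1 ->
  Rhaly eta f z = eta 0%N * taylor_coef f 0 * 1 + z * rhaly_tail eta f z.
Proof.
move=> hg hf z1; have h1 := has_pseries_shift (rhaly_tail_pseries hg hf).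
have h2 := @has_pseries_lin R _ _ _ _ (eta 0%N * taylor_coef f 0) (@has_pseries1 R) h1.
apply: (has_pseries_eq (Rhaly_pseries hg hf) h2 _ z1); apply/funext => -[|n] /=.
  by rewrite big_ord1 mulr1 addr0.
by rewrite mulr0 add0r.
Qed.

Lemma Rhaly_tail_bound q eta g f : 1 <= q -> has_pseries eta g -> Hol f ->
  (bergman_int q (Rhaly eta f) <= (2 `^ q)%:E *
    ((cmod (eta 0%N * taylor_coef f 0) `^ q)%:E * bergman_int q (fun=> 1%R : Cplx R) +
     bergman_int q (rhaly_tail eta f)))%E.
Proof.
move=> q1 hg hf; have q0 : 0 < q by apply: lt_le_trans q1.
have qn : q != 0 by rewrite gt_eqF.
have hU := rhaly_tail_pseries hg hf; have HU := has_pseries_Hol hU.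
have HzU := has_pseries_Hol (has_pseries_shift hU).
rewrite (bergman_int_ext qn (fun z => @RhalyE eta g f z hg hf)).
have [h1 _] := Bergman_1 q1.
apply: le_trans (bergman_int_lin _ q0 h1 HzU) _.
apply: lee_wpmul2l; first by rewrite lee_fin powR_ge0.
by apply: leeD => //; exact: bergman_int_mulz.
Qed.

Lemma coef0_growth p : 1 < p -> exists2 C : R, 0 < C & forall f, Bergman p f ->
  cmod (taylor_coef f 0) <= C * fine (bergman_int p f) `^ p^-1.
Proof.
move=> p1; have [C C0 hC] := growth_bergman p1; exists C => // f bf.
have h01 : 0 <= (0 : R) < 1 by rewrite lexx ltr01.
have := hC f 0 bf h01; rewrite radialE// subr0 powR1 mulr1.
by rewrite (has_pseries0 (Hol_pseries bf.1)).
Qed.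

Lemma Rhaly_bound p q eta g : 2 < p -> p < q -> 2 / p - 1 / q < 1 ->
  has_pseries eta g -> Lip q (2 / p - 1 / q) g ->
  exists2 C : R, 0 <= C & forall f, Bergman p f ->
    (bergman_int q (Rhaly eta f) <= (C * fine (bergman_int p f) `^ (q / p))%:E)%E.
Proof.
move=> p2 pq al1 hg Lg; have p0 : 0 < p by apply: lt_trans p2.
have p1 : 1 < p by apply: lt_trans p2; lra.
have q1 : 1 < q by apply: lt_trans pq.
have q0 : 0 < q by apply: lt_trans q1.
have [C C0 hC] := Lip_bergman_bound p0 pq q1 al1 hg Lg.
have [K K0 hK] := mean_dom_psums p1.
have [A A0 hA] := coef0_growth p1.
have b1 := Bergman_1 (ltW q1); set B1 := fine (bergman_int q (fun=> 1 : Cplx R)).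
have B10 : 0 <= B1 := fine_bergman_ge0 _ _.
exists (2 `^ q * ((cmod (eta 0%N) * A) `^ q * B1 + C * K `^ (q / p))) => [|f bf].
  by rewrite mulr_ge0 ?powR_ge0// addr_ge0 ?mulr_ge0 ?powR_ge0.
have [hf _] := bf; set Bf := fine (bergman_int p f); have Bf0 : 0 <= Bf := fine_bergman_ge0 _ _.
apply: le_trans (Rhaly_tail_bound (ltW q1) hg hf) _.
rewrite -mulrA EFinM; apply: lee_wpmul2l; first by rewrite lee_fin powR_ge0.
rewrite mulrDl EFinD; apply: leeD.
  rewrite -(bergman_fineK b1) -/B1 -EFinM lee_fin mulrAC ler_wpM2r//.
  rewrite (_ : Bf `^ (q / p) = (Bf `^ p^-1) `^ q); last by rewrite -powRrM mulrC.
  rewrite -powRM ?mulr_ge0 ?cmod_ge0 ?powR_ge0 ?(ltW A0)//.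
  apply: powR_mono; rewrite ?(ltW q0) ?cmod_ge0//.
  by rewrite cmodM -mulrA ler_wpM2l ?cmod_ge0//; exact: hA.
rewrite -mulrA -powRM ?(ltW K0)//.
apply: (hC _ _ _ (hK _ bf)); first by rewrite mulr_ge0 ?(ltW K0).
exact: rhaly_tail_pseries hg hf.
Qed.

Lemma Rhaly_vanishing p q eta g : 2 < p -> p < q -> 2 / p - 1 / q < 1 ->
  has_pseries eta g -> lip q (2 / p - 1 / q) g -> vanishing p q (Rhaly eta).
Proof.
move=> p2 pq al1 hg Lg F M bF F0 e e0; have p0 : 0 < p by apply: lt_trans p2.
have p1 : 1 < p by apply: lt_trans p2; lra.
have q1 : 1 < q by apply: lt_trans pq.
have q0 : 0 < q by apply: lt_trans q1.
have [K K0 hK] := mean_dom_psums p1.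
have M0 : 0 <= M by have [_] := bF 0%N; exact: le_trans (fine_bergman_ge0 _ _).
have b1 := Bergman_1 (ltW q1); set B1 := fine (bergman_int q (fun=> 1 : Cplx R)).
have B10 : 0 <= B1 := fine_bergman_ge0 _ _.
have t0 : (0 : R) < 2 `^ q by rewrite powR_gt0.
pose e1 := e / 2 `^ q / 2; have e10 : 0 < e1 by rewrite !divr_gt0.
have [||||N1 hN1] := lip_bergman_vanish p0 pq q1 al1 hg Lg (b_ := fun j n => \sum_(k < n.+2) taylor_coef (F j) k)
    (Lam := K * M) (h_ := fun j => rhaly_tail eta (F j)) _ _ _ _ e10.
- by move=> j; apply: mean_dom_le (hK _ (bF j).1); rewrite ler_wpM2l ?(ltW K0)// (bF j).2.
- by rewrite mulr_ge0// ltW.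
- by move=> j; exact: rhaly_tail_pseries hg (bF j).1.1.
- by move=> k; exact: psum_vanish.
pose d := (e1 / (B1 + 1)) `^ q^-1; have B11 : 0 < B1 + 1 by rewrite ltr_wpDl.
have d0 : 0 < d by rewrite powR_gt0// divr_gt0.
have := cvgCM (@cvgCc R (eta 0%N)) (F0 0%N); rewrite mulr0 => /cvg_seqP /(_ d d0)[N2 hN2].
exists (maxn N1 N2) => j; rewrite geq_max => /andP[/hN1 j1 /hN2]; rewrite subr0 => /ltW j2.
have hj : (bergman_int q (Rhaly eta (F j)) <= e%:E)%E.
  apply: le_trans (Rhaly_tail_bound (ltW q1) hg (bF j).1.1) _.
  apply: (@le_trans _ _ ((2 `^ q)%:E * (e1%:E + e1%:E))%E); last first.
    by rewrite -EFinD -EFinM lee_fin -splitr mulrC divfK ?gt_eqF.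
  apply: lee_wpmul2l; first by rewrite lee_fin ltW.
  apply: leeD j1; rewrite -(bergman_fineK b1) -/B1 -EFinM lee_fin.
  have := powR_mono (ltW q0) (cmod_ge0 _) j2.
  rewrite [d `^ q]powRVK ?(ltW (divr_gt0 _ _))// => h.
  apply: (@le_trans _ _ (e1 / (B1 + 1) * (B1 + 1))); last by rewrite divfK ?gt_eqF.
  by apply: ler_pM; rewrite ?powR_ge0// lerDl.
rewrite -lee_fin fineK// ge0_fin_numE ?bergman_int_ge0//.
exact: le_lt_trans hj (ltry _).
Qed.

End RhalyOperator.

(** * Test functions *)

Section TestFunctions.
Context {R : realType}.
Notation mu := (@lebesgue_measure R).
Implicit Types (f g h u : Cplx R -> Cplx R) (p q r t x al a s : R) (b c eta : nat -> Cplx R).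

Lemma integral_powR_tail (d sg : R) : 0 < d -> 1 < sg ->
  (\int[mu]_(x in `]0%R, 1%R[) ((1 - x + d) `^ (- sg))%:E <= ((sg - 1)^-1 * d `^ (1 - sg))%:E)%E.
Proof.
move=> d0 s1; have s0 : 0 < sg - 1 by rewrite subr_gt0.
have mP D : measurable_fun D (fun x : R => (x + d) `^ (- sg)) by exact: measurable_powRD.
rewrite (_ : (\int[mu]_(x in `]0%R, 1%R[) ((1 - x + d) `^ (- sg))%:E =
    \int[mu]_(x in `]0%R, 1%R[) ((x + d) `^ (- sg))%:E)%E); last first.
  by rewrite [RHS]integral_flip01// => x _; exact: powR_ge0.
have n0 : 1 - sg != 0 by rewrite subr_eq0 lt_eqF.
have d0' : 0 < 0 + d by rewrite add0r.
apply: (@le_trans _ _ (\int[mu]_(x in `[0%R, 1%R]) ((x + d) `^ (1 - sg - 1))%:E)%E).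
  rewrite (_ : 1 - sg - 1 = - sg); last by ring.
  apply: ge0_subset_integral => //.
  - by apply/measurable_EFinP; exact: mP.
  - by move=> x _; rewrite lee_fin powR_ge0.
  by move=> x /=; rewrite !in_itv /= => /andP[x0 x1]; rewrite !ltW.
rewrite (integral_powR ltr01 d0' n0) lee_fin add0r -[1 - sg]opprB invrN mulNr -mulrN opprB opprB.
by rewrite ler_wpM2l ?invr_ge0 ?(ltW s0)// lerBlDr lerDl powR_ge0.
Qed.

(** Powers of the Szego kernel: the Bergman integral of [(1 - a z) ^ (- s)] is of
    the order of [(1 - a) ^ (2 - s p)], which the weight compensates. *)
Lemma szego_family_bound p s : 1 <= p -> 2 < s * p -> exists2 C : R, 0 <= C & forall a K u,
  0 <= a < 1 -> 0 <= K -> Hol u ->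
  (forall z, cmod z < 1 ->
     cmod (u z) <= K * (1 - a) `^ (s - 2 / p) * (cmod (1 - a%:C * z))^-1 `^ s) ->
  Bergman p u /\ fine (bergman_int p u) <= C * K `^ p.
Proof.
move=> p1 sp; have p0 : 0 < p by apply: lt_le_trans p1.
have s0 : 0 < s by rewrite -(pmulr_lgt0 _ p0); apply: lt_trans sp.
have sp1 : 1 < s * p by apply: lt_trans sp; lra.
have [C C0 hC] := szego_int sp1.
pose sg := s * p - 1; have sg1 : 1 < sg by rewrite /sg; lra.
have sg0 : 0 < sg - 1 by rewrite subr_gt0.
exists (C * 4 `^ sg * (sg - 1)^-1) => [|a K u a01 K0 hu uK].
  by rewrite !mulr_ge0 ?powR_ge0 ?(ltW C0)// invr_ge0 ltW.
have /andP[a0 a1] := a01; have d0 : 0 < 1 - a by rewrite subr_gt0.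
suff h : (bergman_int p u <= (C * 4 `^ sg * (sg - 1)^-1 * K `^ p)%:E)%E.
  have bu : Bergman p u by split; [exact: hu|exact: le_lt_trans h (ltry _)].
  by split; [exact: bu|rewrite -lee_fin (bergman_fineK bu)].
apply: (le_trans (bergman_le_int hu p1)).
pose W := (K * (1 - a) `^ (s - 2 / p)) `^ p.
have W0 : 0 <= W by exact: powR_ge0.
have mP D : measurable_fun D (fun x : R => (1 - x + (1 - a)) `^ (- sg)).
  apply: measurable_funTS; apply: (measurableT_comp (measurable_powR (- sg))).
  by apply: measurable_funD => //; exact: measurable_funB.
apply: (@le_trans _ _ (\int[mu]_(x in `]0%R, 1%R[) (W * C * 4 `^ sg * (1 - x + (1 - a)) `^ (- sg))%:E)%E).
  apply: le_integral_EFin; [exact: measurable_itv|exact: measurable_cint_pow_aff| |].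
    by apply: measurable_funM; [exact: measurable_cst|exact: mP].
  move=> x /=; rewrite in_itv /= => /andP[x0 x1]; rewrite cint_pow_ge0 /=.
  pose r := (1 + x) / 2; have r01 : 0 <= r < 1 by rewrite /r; apply/andP; split; lra.
  have /andP[r0 r1] := r01.
  have ar : 0 <= a * r < 1 by rewrite mulr_ge0//= (le_lt_trans _ a1)// ler_piMr// ltW.
  apply: (@le_trans _ _ (W * (C * (1 - a * r) `^ (1 - s * p)))).
    have cS := @cont_szego R (s * p) _ ar (lt_trans ltr01 sp1).
    apply: le_trans (ler_wpM2l W0 (hC _ ar)); rewrite cint_powE -(rintZ _ _ _ cS).
    apply: rint_le; [exact: cont_cmod_circ|exact: (@cont_scaleR R W _ cS)|] => t _.
    have k1 : 0 <= K * (1 - a) `^ (s - 2 / p) by rewrite mulr_ge0 ?powR_ge0.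
    rewrite powRrM -(powRM _ k1 (powR_ge0 _ _)).
    apply: powR_mono; [exact: ltW|exact: cmod_ge0|].
    by have := uK (circ r t); rewrite circ_scale cmod_circ//; apply.
  rewrite -!mulrA; apply: ler_wpM2l => //; apply: ler_wpM2l; first exact: ltW.
  rewrite (_ : 1 - s * p = - sg); last by rewrite /sg opprB.
  have e0 : 0 < 1 - x + (1 - a) by rewrite addr_gt0// subr_gt0.
  (* [1 - a r] is at least [1 - a] and at least [(1 - x) / 2]. *)
  have ge4 : (1 - x + (1 - a)) / 4 <= 1 - a * r by rewrite /r; move: a0 a1 x0 x1; clear; nra.
  have ns : - sg <= 0 by rewrite oppr_le0 ltW// (lt_trans ltr01).
  have e4 : 0 < (1 - x + (1 - a)) / 4 by rewrite divr_gt0.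
  apply: le_trans (le_powRN e4 ge4 ns) _.
  rewrite powRM ?(ltW e0)// ?invr_ge0// mulrC ler_wpM2r ?powR_ge0//.
  by rewrite -powR_inv1// -powRrM mulrNN mul1r.
rewrite integralZl_EFin ?measurable_itv//; last 2 first.
- by move=> x _; exact: powR_ge0.
- by rewrite !mulr_ge0 ?powR_ge0 ?(ltW C0).
apply: le_trans (lee_wpmul2l _ (integral_powR_tail d0 sg1)) _.
  by rewrite lee_fin !mulr_ge0 ?powR_ge0 ?(ltW C0).
rewrite -EFinM lee_fin /W powRM ?powR_ge0// -powRrM.
have -> : (1 - a) `^ ((s - 2 / p) * p) = (1 - a) `^ (sg - 1).
  by congr (_ `^ _); rewrite /sg; field; rewrite gt_eqF.
have E : (1 - a) `^ (sg - 1) * (1 - a) `^ (1 - sg) = 1.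
  by rewrite -powRD_gt0// -[1 - sg]opprB subrr powRr0.
rewrite le_eqVlt; apply/orP; left; apply/eqP.
move: E; move: ((1 - a) `^ (sg - 1)) ((1 - a) `^ (1 - sg)) (K `^ p) (4 `^ sg) ((sg - 1)^-1) => A B D G H E.
by transitivity (C * G * H * D * (A * B)); [ring|rewrite E mulr1].
Qed.

Lemma has_pseriesZ b f (w : Cplx R) : has_pseries b f -> has_pseries (fun n => w * b n) (fun z => w * f z).
Proof.
move=> hf; have h := @has_pseries_lin R _ _ _ _ (w - 1) hf hf.
rewrite (_ : (fun n => w * b n) = (fun n => (w - 1) * b n + b n)).
  by apply: (has_pseries_ext h) => z _; rewrite mulrBl mul1r subrK.
by apply/funext => n; rewrite mulrBl mul1r subrK.
Qed.

Lemma has_pseries_koebe : has_pseries (fun n : nat => n%:R : Cplx R)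
  (fun z => z * ((1 - 1 * z)^-1 * (1 - 1 * z)^-1)).
Proof.
have := has_pseries_shift (@has_pseries_geo2 R).
by rewrite [X in has_pseries X _ -> _](_ : _ = (fun n => n%:R))//; apply/funext => -[|n].
Qed.

Definition szego_test a (w : R) : Cplx R -> Cplx R := fun z => w%:C * (1 - 1 * (a%:C * z))^-1.

(** This is [z] times the derivative of [szego_test a w]. *)
Definition szego_diff_test a (w : R) : Cplx R -> Cplx R := fun z =>
  w%:C * (a%:C * z * ((1 - 1 * (a%:C * z))^-1 * (1 - 1 * (a%:C * z))^-1)).

(** The factor [1 - z] makes the partial sums of the coefficients telescope to
    [w n a ^ n], so that the image under the Rhaly operator is a multiple of
    [z g' (a z)]. *)
Definition rhaly_test a (w : R) : Cplx R -> Cplx R := fun z =>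
  - 1 * (z * szego_diff_test a w z) + szego_diff_test a w z.

Lemma cmod_real01 a : 0 <= a < 1 -> cmod (a%:C : Cplx R) <= 1.
Proof. by move=> /andP[a0 a1]; rewrite cmod_real ger0_norm// ltW. Qed.

Lemma szego_test_pseries a w : 0 <= a < 1 -> has_pseries (fun n => w%:C * a%:C ^+ n) (szego_test a w).
Proof.
move=> a01; have := @has_pseriesZ _ _ w%:C (has_pseries_dilate (@has_pseries_geo R) (cmod_real01 a01)).
by under eq_fun do rewrite mul1r.
Qed.

Lemma szego_diff_test_pseries a w : 0 <= a < 1 -> has_pseries (fun n => w%:C * (n%:R * a%:C ^+ n)) (szego_diff_test a w).
Proof.
move=> a01; exact: @has_pseriesZ _ _ w%:C (has_pseries_dilate has_pseries_koebe (cmod_real01 a01)).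
Qed.

Lemma rhaly_test_pseries a w : 0 <= a < 1 -> has_pseries
  (fun n => - 1 * cshift (fun n => w%:C * (n%:R * a%:C ^+ n)) n + w%:C * (n%:R * a%:C ^+ n)) (rhaly_test a w).
Proof.
move=> a01; have h := @szego_diff_test_pseries a w a01.
exact: (@has_pseries_lin R _ _ _ _ (-1) (has_pseries_shift h) h).
Qed.

Lemma cmod_szego_test a w z : 0 <= w -> cmod (szego_test a w z) = w * (cmod (1 - a%:C * z))^-1.
Proof. by move=> w0; rewrite /szego_test cmodM cmodV mul1r cmod_real ger0_norm. Qed.

Lemma cmod_szego_diff_test a w z : 0 <= a < 1 -> 0 <= w -> cmod z < 1 ->
  cmod (szego_diff_test a w z) <= w * (cmod (1 - a%:C * z))^-1 ^+ 2.
Proof.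
move=> /andP[a0 a1] w0 z1; rewrite /szego_diff_test !cmodM !cmodV mul1r !cmod_real !ger0_norm// ler_wpM2l//.
rewrite -expr2 ler_piMl ?sqr_ge0//; have := cmod_ge0 z; move: (cmod z) z1 => y; move: a0 a1; clear.
by move=> *; nra.
Qed.

(** As [|1 - z|] is at most [2 |1 - a z|], the factor [1 - z] cancels one power of
    the kernel. *)
Lemma cmod_rhaly_test a w z : 0 <= a < 1 -> 0 <= w -> cmod z < 1 ->
  cmod (rhaly_test a w z) <= 2 * w * (cmod (1 - a%:C * z))^-1.
Proof.
move=> a01 w0 z1; have /andP[a0 a1] := a01.
have -> : rhaly_test a w z = (1 - z) * szego_diff_test a w z by rewrite /rhaly_test mulN1r addrC mulrBl mul1r.
have k0 : 0 < cmod (1 - a%:C * z).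
  by apply: cmod_gt0; apply: one_sub_neq0 => //; exact: cmod_real01.
have z2 : cmod (1 - z) <= 2 * cmod (1 - a%:C * z).
  have -> : 1 - z = (1 - a%:C * z) - (1 - a)%:C * z.
    by rewrite rmorphB rmorph1; ring.
  apply: le_trans (cmodBD _ _) _; rewrite mulr_natl mulr2n lerD2l cmodM cmod_real.
  rewrite ger0_norm ?subr_ge0 ?(ltW a1)//.
  apply: (@le_trans _ _ (1 - cmod (a%:C * z))); last first.
    by have := cmod_sub 1 (a%:C * z); rewrite cmod1.
  rewrite cmodM cmod_real ger0_norm//; have := cmod_ge0 z; move: (cmod z) z1 => y; move: a0 a1; clear.
  by move=> *; nra.
rewrite cmodM; apply: le_trans (ler_pM (cmod_ge0 _) (cmod_ge0 _) z2 (cmod_szego_diff_test a01 w0 z1)) _.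
rewrite le_eqVlt; apply/orP; left; apply/eqP; field.
by rewrite gt_eqF.
Qed.

Lemma szego_diff_coef_le (w a : R) n : 0 <= w -> 0 <= a < 1 -> cmod (w%:C * (n%:R * a%:C ^+ n) : Cplx R) <= w * n%:R.
Proof.
move=> w0 /andP[a0 a1]; rewrite !cmodM cmodX !cmod_real !ger0_norm// ler_wpM2l//.
by rewrite cmod_nat ler_piMr// exprn_ile1// ltW.
Qed.

End TestFunctions.

(** * Necessity of the Lipschitz conditions *)

Section Necessity.
Context {R : realType}.
Implicit Types (f g h u : Cplx R -> Cplx R) (p q r t x al a s w : R) (b c eta : nat -> Cplx R).

Lemma cint_pow_ext q r f g : 0 <= r < 1 -> (forall z, cmod z < 1 -> f z = g z) ->
  cint_pow q r f = cint_pow q r g.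
Proof.
move=> /andP[r0 r1] fg; rewrite !cint_powE; congr rint; apply/funext => t.
by rewrite fg// cmod_circ.
Qed.

Lemma cint_powZ q r f (k : Cplx R) : Hol f -> 0 < q -> 0 <= r < 1 ->
  cint_pow q r (fun z => k * f z) = cmod k `^ q * cint_pow q r f.
Proof.
move=> hf q0 r01; have cf := cont_cmod_circ hf q0 r01.
rewrite !cint_powE -(rintZ _ _ _ cf); congr rint; apply/funext => t.
by rewrite cmodM powRM ?cmod_ge0.
Qed.

Lemma cint_pow_lin q r f g (k : Cplx R) : Hol f -> Hol g -> 0 < q -> 0 <= r < 1 ->
  cint_pow q r (fun z => k * f z + g z) <= 2 `^ q * (cmod k `^ q * cint_pow q r f + cint_pow q r g).
Proof.
move=> hf hg q0 r01.
have hl := has_pseries_Hol (@has_pseries_lin R _ _ _ _ k (Hol_pseries hf) (Hol_pseries hg)).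
have cf := cont_cmod_circ hf q0 r01; have cg := cont_cmod_circ hg q0 r01.
have cl := cont_cmod_circ hl q0 r01.
have ck := @cont_scaleR R (cmod k `^ q) _ cf.
have cs := cont_addR ck cg.
rewrite !cint_powE -(rintZ _ _ _ cf) -(rintD _ _ ck cg) -(rintZ _ _ _ cs).
apply: rint_le; [exact: cl|exact: (@cont_scaleR R _ _ cs)|] => t _.
rewrite -(powRM _ (cmod_ge0 k) (cmod_ge0 _)).
have k0 : 0 <= cmod k * cmod (f (circ r t)) by rewrite mulr_ge0 ?cmod_ge0.
apply: le_trans (powR_add_le (ltW q0) k0 (cmod_ge0 _)).
apply: powR_mono; [exact: ltW|exact: cmod_ge0|].
by rewrite -cmodM cmodD.
Qed.

(** Two families of functions, bounded in [A^p] and tending to [0], whose images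
    under [T] control the means of [g']. *)
Definition detects p q g (T : (Cplx R -> Cplx R) -> Cplx R -> Cplx R) :=
  exists (C M : R) (K : nat -> R) (u v : R -> Cplx R -> Cplx R),
  0 <= C /\ forall a, 1 / 2 <= a < 1 ->
  [/\ Bergman p (u a) /\ fine (bergman_int p (u a)) <= M,
      Bergman p (v a) /\ fine (bergman_int p (v a)) <= M,
      forall k, cmod (taylor_coef (u a) k) <= K k * (1 - a) `^ (1 - 2 / p),
      forall k, cmod (taylor_coef (v a) k) <= K k * (1 - a) `^ (1 - 2 / p) &
      Bergman q (T (u a)) -> Bergman q (T (v a)) ->
      cint_pow q (a * a) (derive1 g) <= C * (1 - a) `^ ((2 / p - 1 / q - 1) * q) *
        (fine (bergman_int q (T (u a))) + fine (bergman_int q (T (v a))))].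

Lemma unweight p q (d X D S : R) : 0 < d -> 0 < p -> 0 < q ->
  (d `^ (1 - 2 / p)) `^ q * X <= D / d * S -> X <= D * d `^ ((2 / p - 1 / q - 1) * q) * S.
Proof.
move=> d0 p0 q0; rewrite -powRrM => h.
have e0 : 0 < d `^ ((1 - 2 / p) * q) by rewrite powR_gt0.
rewrite -(ler_pM2l e0); apply: (le_trans h); rewrite mulrA.
have E : d `^ ((1 - 2 / p) * q) * d `^ ((2 / p - 1 / q - 1) * q) = d^-1.
  rewrite -powRD_gt0// (_ : _ + _ = - 1); first by rewrite powR_inv1// ltW.
  by field; rewrite !gt_eqF.
by rewrite mulrCA E.
Qed.

(** The image of the test function is [w a z g' (a z)], whose mean at the radius
    [a] is a multiple of that of [g'] at the radius [a ^ 2]. *)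
Lemma Rhaly_detects p q eta g : 2 < p -> p < q -> has_pseries eta g ->
  detects p q g (Rhaly eta).
Proof.
move=> p2 pq hg; have p1 : 1 < p by apply: lt_trans p2; lra.
have p0 : 0 < p by apply: lt_trans p1.
have q1 : 1 < q by apply: lt_trans pq.
have q0 : 0 < q by apply: lt_trans q1.
have sp : 2 < 1 * p by rewrite mul1r.
have [C C0 hC] := szego_family_bound (ltW p1) sp.
pose w a : R := (1 - a) `^ (1 - 2 / p).
exists (4 `^ q * 4), (C * 2 `^ p), (fun k => 2 * k%:R), (fun a => rhaly_test a (w a)), (fun a => rhaly_test a (w a)).
split=> [|a /andP[a2 a1]]; first by rewrite mulr_ge0 ?powR_ge0.
have a0 : 0 < a by apply: lt_le_trans a2; lra.
have a01 : 0 <= a < 1 by rewrite (ltW a0).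
have w0 : 0 <= w a := powR_ge0 _ _.
have hu := @rhaly_test_pseries R a (w a) a01; have Hu := has_pseries_Hol hu.
have d0 : 0 < 1 - a by rewrite subr_gt0.
have hb : Bergman p (rhaly_test a (w a)) /\ fine (bergman_int p (rhaly_test a (w a))) <= C * 2 `^ p.
  apply: (hC a _ _ a01 _ Hu) => // z z1.
  by rewrite powRr1 ?invr_ge0 ?cmod_ge0//; exact: cmod_rhaly_test.
have hk k : cmod (taylor_coef (rhaly_test a (w a)) k) <= 2 * k%:R * w a.
  rewrite (taylor_coefE hu) mulN1r addrC; apply: le_trans (cmodBD _ _) _.
  rewrite mulrAC mulr2n mulrDl mul1r mulrDl; apply: lerD; first exact: szego_diff_coef_le.
  case: k => [|k] /=; first by rewrite cmod0 mulr0.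
  by apply: le_trans (szego_diff_coef_le _ w0 a01) _; rewrite ler_wpM2l// ler_nat.
split=> // bT _.
have E z : cmod z < 1 -> Rhaly eta (rhaly_test a (w a)) z =
    z * ((w a * a)%:C * derive1 g (a%:C * z)).
  have h1 := Rhaly_pseries hg Hu.
  have h2 := has_pseries_shift (@has_pseriesZ R _ _ (w a * a)%:C
    (has_pseries_dilate (has_pseries_derive1 hg) (cmod_real01 a01))).
  apply: (has_pseries_eq h1 h2); apply/funext => n; rewrite (taylor_coefE hu).
  have -> : \sum_(k < n.+1) (- 1 * cshift (fun n => (w a)%:C * (n%:R * a%:C ^+ n)) k + (w a)%:C * (k%:R * a%:C ^+ k)) =
      (w a)%:C * (n%:R * a%:C ^+ n).
    elim: n => [|n IH]; first by rewrite big_ord1 /= mulr0 add0r.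
    by rewrite big_ord_recr IH /= mulN1r addNKr.
  case: n => [|n] /=; first by rewrite mul0r !mulr0.
  by rewrite rmorphM /= exprS; ring.
have aa01 : 0 <= a * a < 1 by rewrite mulr_ge0 ?(ltW a0)//=; move: a0 a1; clear; nra.
have Hg := Hol_derive1 (has_pseries_Hol hg).
have cE : cint_pow q a (Rhaly eta (rhaly_test a (w a))) = (w a * (a * a)) `^ q * cint_pow q (a * a) (derive1 g).
  have cg := cont_cmod_circ Hg q0 aa01.
  rewrite (cint_pow_ext q a01 E) !cint_powE -(rintZ _ _ _ cg); congr rint; apply/funext => t.
  rewrite (circ_scale a a t) (cmodM (circ a t)) (cmod_circ _ (ltW a0)) (cmodM (w a * a)%:C).
  rewrite cmod_real ger0_norm ?mulr_ge0 ?(ltW a0)//.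
  by rewrite mulrA powRM ?cmod_ge0 ?mulr_ge0 ?(ltW a0)//; congr (_ `^ _ * _); ring.
have := cint_pow_bergman_fine bT (ltW q1) a01; rewrite cE => hB.
set B := fine _ in hB *; set X := cint_pow _ _ _ in hB *.
have X0 : 0 <= X := cint_pow_ge0 _ _ _.
have B0 : 0 <= B := fine_bergman_ge0 _ _.
apply: (@le_trans _ _ (4 `^ q * 4 * (1 - a) `^ ((2 / p - 1 / q - 1) * q) * B)); last first.
  by rewrite ler_wpM2l ?lerDl// !mulr_ge0 ?powR_ge0.
apply: unweight => //; rewrite -/(w a).
apply: (@le_trans _ _ (4 `^ q * ((w a * (a * a)) `^ q * X))).
  rewrite mulrA ler_wpM2r// -powRM ?mulr_ge0 ?(ltW a0)//.
  apply: powR_mono; rewrite ?(ltW q0)// mulrCA ler_peMr//.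
  by move: a2; clear; nra.
by rewrite -(mulrA (4 `^ q) 4) -(mulrA (4 `^ q)) ler_wpM2l ?powR_ge0.
Qed.

(** The identity [(n + 1) / (n + k + 1) + k / (n + k + 1) = 1] recombines the
    moments of the two test functions into a geometric series. *)
Lemma szego_moments p a w n : 2 < p -> 0 <= a < 1 ->
  Bergman p (szego_test a w) -> Bergman p (szego_diff_test a ((1 - a) * w)) ->
  (1 - a)%:C * (n.+1%:R * moment (szego_test a w) n) + moment (szego_diff_test a ((1 - a) * w)) n = w%:C.
Proof.
move=> p2 a01 b1 b2; have /andP[a0 a1] := a01.
have h1 := @szego_test_pseries R a w a01; have h2 := @szego_diff_test_pseries R a ((1 - a) * w) a01.
have na : 1 - a%:C != 0 :> Cplx R.
  by have := @one_sub_neq0 R 1 a%:C; rewrite mul1r; apply; rewrite ?cmod1// cmod_real ger0_norm.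
have c1 := cvgCD (cvgCM (@cvgCc R ((1 - a)%:C * n.+1%:R)) (@momentP R p _ n p2 b1)) (@momentP R p _ n p2 b2).
have /has_pseriesP /(_ a%:C) := @has_pseries_geo R.
rewrite cmod_real ger0_norm// => /(_ a1) hg.
have c2 := cvgCM (@cvgCc R ((1 - a)%:C * w%:C)) hg.
rewrite mulrA; have -> : w%:C = (1 - a)%:C * w%:C * (1 - 1 * a%:C)^-1.
  by rewrite mul1r rmorphB rmorph1; field.
move: c1; rewrite (_ : (fun K => _) = (fun K => (1 - a)%:C * w%:C * psum (fun=> 1) a%:C K)) => [c1|].
  by rewrite -(cvg_limC c1) (cvg_limC c2).
apply/funext => K.
rewrite (taylor_coefE h1) (taylor_coefE h2) /psum !mulr_sumr -big_split /=; apply: eq_bigr => k _.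
have nk : (n + k + 1)%:R != 0 :> Cplx R by rewrite pnatr_eq0 addn1.
rewrite rmorphM rmorphB rmorph1 /= mul1r.
apply: (mulIf nk); rewrite mulrDl !mulrA !divfK// !natrD -natr1; ring.
Qed.

(** By [szego_moments], [w g' = (1 - a) D + H v] where [D] multiplies the
    coefficients of [H u] by [n + 1]. As a Hadamard product with [(1 - z) ^ (- 2)],
    whose mean modulus on the circle of radius [a] is at most [1 / (1 - a)], [D] costs
    a factor that [1 - a] compensates. *)
Lemma genHilbert_detects p q eta g : 2 < p -> p < q -> has_pseries eta g ->
  detects p q g (genHilbert eta).
Proof.
move=> p2 pq hg; have p1 : 1 < p by apply: lt_trans p2; lra.
have p0 : 0 < p by apply: lt_trans p1.
have q1 : 1 < q by apply: lt_trans pq.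
have q0 : 0 < q by apply: lt_trans q1.
have sp1 : 2 < 1 * p by rewrite mul1r.
have sp2 : 2 < 2 * p by apply: (lt_trans p2); rewrite ltr_pMl// ltr1n.
have [C1 C10 hC1] := szego_family_bound (ltW p1) sp1.
have [C2 C20 hC2] := szego_family_bound (ltW p1) sp2.
pose w a : R := (1 - a) `^ (1 - 2 / p).
(* The kernel has exponent 2 in the second family, whose normalization is
   therefore [(1 - a) ^ (2 - 2 / p) = (1 - a) * w a]. *)
exists (2 `^ q * 4), (C1 + C2), (fun k => 1 + k%:R), (fun a => szego_test a (w a)), (fun a => szego_diff_test a ((1 - a) * w a)).
split=> [|a /andP[a2 a1]]; first by rewrite mulr_ge0 ?powR_ge0.
have a0 : 0 < a by apply: lt_le_trans a2; lra.
have a01 : 0 <= a < 1 by rewrite (ltW a0).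
have w0 : 0 <= w a := powR_ge0 _ _.
have d0 : 0 < 1 - a by rewrite subr_gt0.
have dw0 : 0 <= (1 - a) * w a by rewrite mulr_ge0// ltW.
have hu := @szego_test_pseries R a (w a) a01; have Hu := has_pseries_Hol hu.
have hv := @szego_diff_test_pseries R a ((1 - a) * w a) a01; have Hv := has_pseries_Hol hv.
have bu : Bergman p (szego_test a (w a)) /\ fine (bergman_int p (szego_test a (w a))) <= C1 * 1 `^ p.
  apply: (hC1 a _ _ a01 _ Hu) => // z z1.
  by rewrite powRr1 ?invr_ge0 ?cmod_ge0// mul1r cmod_szego_test.
have bv : Bergman p (szego_diff_test a ((1 - a) * w a)) /\
    fine (bergman_int p (szego_diff_test a ((1 - a) * w a))) <= C2 * 1 `^ p.
  apply: (hC2 a _ _ a01 _ Hv) => // z z1.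
  rewrite mul1r powR_mulrn ?invr_ge0 ?cmod_ge0//.
  have -> : (1 - a) `^ (2 - 2 / p) = (1 - a) * w a.
    by rewrite /w -{2}[1 - a]powRr1 ?(ltW d0)// -powRD_gt0//; congr (_ `^ _); ring.
  exact: cmod_szego_diff_test.
rewrite powR1 !mulr1 in bu bv.
have [bu1 bu2] := bu; have [bv1 bv2] := bv.
split.
- by split=> //; apply: le_trans bu2 _; rewrite lerDl.
- by split=> //; apply: le_trans bv2 _; rewrite lerDr.
- move=> k; rewrite (taylor_coefE hu) cmodM cmodX !cmod_real !ger0_norm ?(ltW a0)// mulrC.
  rewrite ler_wpM2r//; apply: (@le_trans _ _ 1); last by rewrite lerDl.
  by rewrite exprn_ile1// ltW.
- move=> k; rewrite (taylor_coefE hv); apply: le_trans (szego_diff_coef_le _ dw0 a01) _.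
  rewrite mulrC; apply: ler_pM => //; first by rewrite lerDr.
  by rewrite ler_piMl// gerBl ltW.
move=> bTu bTv; set u := szego_test a (w a) in bTu bu1 bu2 hu Hu *; set v := szego_diff_test _ _ in bTv bv1 bv2 hv Hv *.
have hTu := genHilbert_pseries p2 hg bu1; have hTv := genHilbert_pseries p2 hg bv1.
have rD : radius1 (fun n => n.+1%:R * eta n.+1 * moment u n * n.+1%:R).
  exact: radius1_mul (has_pseries_radius1 hTu) (has_pseries_radius1 (@has_pseries_geo2 R)).
have hD := psfunP rD; set D := psfun _ in hD; have HD := has_pseries_Hol hD.
have E z : cmod z < 1 -> (w a)%:C * derive1 g z = (1 - a)%:C * D z + genHilbert eta v z.
  have h1 := @has_pseriesZ R _ _ (w a)%:C (has_pseries_derive1 hg).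
  have h2 := @has_pseries_lin R _ _ _ _ (1 - a)%:C hD hTv.
  apply: (has_pseries_eq h1 h2); apply/funext => n.
  by rewrite -(szego_moments n p2 a01 bu1 bv1) -/u -/v; ring.
have aa01 : 0 <= a * a < 1 by rewrite mulr_ge0 ?(ltW a0)//=; move: a0 a1; clear; nra.
have /andP[aa0 aa1] := aa01.
have Hg := Hol_derive1 (has_pseries_Hol hg).
have a01' : 0 < a < 1 by rewrite a0.
have I0 : 0 <= (1 - a)^-1 by rewrite invr_ge0 ltW.
have hI : rint 0 (pi *+ 2) (fun t => cmod ((1 - 1 * circ a t)^-1 * (1 - 1 * circ a t)^-1)) <=
    (1 - a)^-1 * (pi *+ 2).
  rewrite (_ : (fun t => _) = (fun t => (cmod (1 - circ a t))^-1 ^+ 2)); last first.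
    by apply/funext => t; rewrite cmodM cmodV mul1r expr2.
  rewrite rint_poisson// mulrC ler_wpM2r ?pi2_ge0// lef_pV2 ?posrE ?subr_gt0//.
    by rewrite lerD2l lerN2 expr2 ler_piMl// ltW.
have DH := hadamard_young_ge0 hTu (@has_pseries_geo2 R) hD a01 a01' (ltW q1) I0 hI.
have HTv := has_pseries_Hol hTv.
have cL := cint_pow_lin (1 - a)%:C HD HTv q0 aa01.
rewrite -(cint_pow_ext q aa01 E) (cint_powZ _ Hg q0 aa01) !cmod_real !ger0_norm ?(ltW d0)// in cL.
have hBu := cint_pow_bergman_fine bTu (ltW q1) a01.
have hBv := cint_pow_bergman_fine bTv (ltW q1) aa01.
have Bv0 := fine_bergman_ge0 q (genHilbert eta v).
apply: (unweight d0 p0 q0); apply: (le_trans cL).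
rewrite -!mulrA; apply: ler_wpM2l; first exact: powR_ge0.
rewrite mulrA mulrDr; apply: lerD.
  apply: le_trans _ hBu; rewrite -[leRHS]mul1r.
  apply: le_trans (ler_wpM2l (powR_ge0 _ _) DH) _.
  by rewrite mulrA -powRM ?(ltW d0)// mulfV ?gt_eqF// powR1 lexx.
apply: (le_trans hBv); rewrite ler_wpM2r// ler_wpM2l// lef_pV2 ?posrE ?subr_gt0//.
by rewrite lerD2l lerN2 ler_piMl// ltW.
Qed.

End Necessity.

(** * Boundedness and compactness characterized *)

Section Characterization.
Context {R : realType}.
Implicit Types (f g h : Cplx R -> Cplx R) (p q r : R) (T : (Cplx R -> Cplx R) -> Cplx R -> Cplx R).

(** Test functions of parameter [sqrt r] detect the mean at the radius [r]; the
    weights in [1 - sqrt r] and in [1 - r] are comparable. *)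
Lemma sqrt_weight (bet r : R) : bet <= 0 -> 1 / 4 < r < 1 ->
  [/\ 1 / 2 <= Num.sqrt r < 1, Num.sqrt r * Num.sqrt r = r, 1 - Num.sqrt r <= 1 - r &
      (1 - Num.sqrt r) `^ bet <= 2 `^ (- bet) * (1 - r) `^ bet].
Proof.
move=> b0 /andP[r4 r1]; have r0 : 0 < r by apply: lt_trans r4; lra.
have E : Num.sqrt r * Num.sqrt r = r by rewrite -expr2 sqr_sqrtr// ltW.
have s0 : 0 < Num.sqrt r by rewrite sqrtr_gt0.
move: s0 E; move: (Num.sqrt r) => s s0 E.
have s1 : s < 1 by move: E r1 s0; clear; nra.
have s2 : 1 / 2 <= s by move: E r4 s0; clear; nra.
split=> //; first by rewrite s2.
  by move: E s0 s1; clear; nra.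
have d0 : 0 < (1 - r) / 2 by rewrite divr_gt0// subr_gt0.
have d1 : (1 - r) / 2 <= 1 - s by move: E s0 s1; clear; nra.
apply: le_trans (le_powRN d0 d1 b0) _.
rewrite powRM ?subr_ge0 ?(ltW r1)// ?invr_ge0// mulrC ler_wpM2r ?powR_ge0//.
by rewrite -powR_inv1// -powRrM mulN1r.
Qed.

Lemma exponent_le0 p q : 2 < p -> p < q -> 2 / p - 1 / q < 1 -> (2 / p - 1 / q - 1) * q <= 0.
Proof.
move=> p2 pq al1; have q0 : 0 < q by apply: lt_trans pq; apply: lt_trans p2.
by rewrite mulr_le0_ge0 ?subr_le0 ?ltW.
Qed.

Lemma detects_Lip p q g T (K : R -> R) : 2 < p -> p < q -> 2 / p - 1 / q < 1 -> Hol g ->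
  detects p q g T -> (forall f, Bergman p f -> Bergman q (T f)) ->
  (forall M f, Bergman p f -> fine (bergman_int p f) <= M -> fine (bergman_int q (T f)) <= K M) ->
  Lip q (2 / p - 1 / q) g.
Proof.
move=> p2 pq al1 hg [C [M [K' [u [v [C0 hd]]]]]] TB TK.
have q0 : 0 < q by apply: lt_trans pq; apply: lt_trans p2.
set bet := (2 / p - 1 / q - 1) * q; have b0 : bet <= 0 := exponent_le0 p2 pq al1.
have h4 : 0 < (1 / 4 : R) < 1 by apply/andP; split; lra.
have K0 : 0 <= K M.
  have h12 : 1 / 2 <= (1 / 2 : R) < 1 by apply/andP; split; lra.
  have [[bu uM] _ _ _ _] := hd _ h12.
  by apply: le_trans (TK _ _ bu uM); exact: fine_bergman_ge0.
apply: (@cint_pow_Lip R q _ g (C * 2 `^ (- bet) * (K M + K M)) (1 / 4) q0 hg _ h4).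
  by rewrite !mulr_ge0 ?powR_ge0// addr_ge0.
move=> r r41; have [s12 sE _ sw] := sqrt_weight b0 r41.
have [[bu uM] [bv vM] _ _] := hd _ s12; rewrite sE => /(_ (TB _ bu) (TB _ bv)) h.
apply: (le_trans h); rewrite -/bet.
have hS := lerD (TK _ _ bu uM) (TK _ _ bv vM).
have S0 : 0 <= fine (bergman_int q (T (u (Num.sqrt r)))) + fine (bergman_int q (T (v (Num.sqrt r)))).
  by rewrite addr_ge0 ?fine_bergman_ge0.
rewrite [leRHS]mulrAC; apply: ler_pM; [|exact: S0| |exact: hS].
  by rewrite mulr_ge0 ?powR_ge0.
by rewrite -mulrA ler_wpM2l.
Qed.

(** If the little-o condition failed along radii tending to 1, the test functions
    for these radii would form a bounded sequence that tends to 0 coefficientwise,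
    with images bounded away from 0. *)
Lemma detects_lip p q g T : 2 < p -> p < q -> 2 / p - 1 / q < 1 -> Hol g ->
  detects p q g T -> (forall f, Bergman p f -> Bergman q (T f)) -> vanishing p q T ->
  lip q (2 / p - 1 / q) g.
Proof.
move=> p2 pq al1 hg [C [M [K [u [v [C0 hd]]]]]] TB vT.
have p0 : 0 < p by apply: lt_trans p2.
have q0 : 0 < q by apply: lt_trans pq.
set bet := (2 / p - 1 / q - 1) * q; have b0 : bet <= 0 := exponent_le0 p2 pq al1.
apply/(lip_cint_pow _ _ q0); split=> // del del0; apply: contrapT => hno.
have rho (n : nat) : 0 < (1 - n.+2%:R^-1 / 2 : R) < 1.
  have i0 : 0 < n.+2%:R^-1 :> R by rewrite invr_gt0 ltr0n.
  have i1 : n.+2%:R^-1 <= 1 :> R by rewrite invf_le1 ?ltr0n// ler1n.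
  by move: i0 i1; move: (n.+2%:R^-1 : R) => y; clear => y0 y1; apply/andP; split; lra.
have /choice[r_ hr_] : forall n, exists r : R, 1 - n.+2%:R^-1 / 2 < r < 1 /\
    del * (1 - r) `^ bet < cint_pow q r (derive1 g).
  move=> n; apply: contrapT => hn; apply: hno; exists (1 - n.+2%:R^-1 / 2) => // r rn.
  by rewrite leNgt; apply/negP => lt; apply: hn; exists r.
have r41 n : 1 / 4 < r_ n < 1.
  have [/andP[h1 h2] _] := hr_ n; rewrite h2 andbT; apply: le_lt_trans h1.
  have : n.+2%:R^-1 <= 1 :> R by rewrite invf_le1 ?ltr0n// ler1n.
  by move: (n.+2%:R^-1 : R) => y; clear => y1; lra.
pose a n := Num.sqrt (r_ n).
have ha n : 1 / 2 <= a n < 1 by have [] := sqrt_weight b0 (r41 n).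
have s0 : 0 < 1 - 2 / p by rewrite subr_gt0 ltr_pdivrMr// mul1r.
have da n : 1 - a n < n.+1%:R^-1.
  have [_ _ h _] := sqrt_weight b0 (r41 n); apply: (le_lt_trans h).
  have [/andP[h1 _] _] := hr_ n.
  have i0 : 0 < n.+2%:R^-1 :> R by rewrite invr_gt0 ltr0n.
  have i1 : n.+2%:R^-1 <= n.+1%:R^-1 :> R by rewrite lef_pV2 ?posrE ?ltr0n// ler_nat.
  move: h1 i0 i1; move: (n.+2%:R^-1 : R) (n.+1%:R^-1 : R) (r_ n) => y y' z; clear => *; lra.
have van (w : nat -> Cplx R -> Cplx R) :
    (forall n k, cmod (taylor_coef (w n) k) <= K k * (1 - a n) `^ (1 - 2 / p)) -> coef_vanish w.
  move=> wK k; apply/cvg_seqP => e e0.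
  have K1 : 0 < `|K k| + 1 by rewrite ltr_wpDl.
  pose d := (e / (`|K k| + 1)) `^ (1 - 2 / p)^-1.
  have d0 : 0 < d by rewrite powR_gt0// divr_gt0.
  exists (Num.truncn d^-1) => n nd; rewrite subr0; apply: (le_lt_trans (wK n k)).
  have an0 : 0 <= 1 - a n by rewrite subr_ge0 ltW//; case/andP: (ha n).
  have nd' : n.+1%:R^-1 <= d.
    rewrite -[leRHS]invrK lef_pV2 ?posrE ?invr_gt0 ?ltr0n//.
    by apply/ltW/(lt_le_trans (truncnS_gt _)); rewrite ler_nat ltnS.
  have h := powR_mono (ltW s0) an0 (le_trans (ltW (da n)) nd').
  rewrite /d -powRrM mulVf ?gt_eqF// powRr1 ?divr_ge0 ?(ltW e0) ?(ltW K1)// in h.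
  apply: (@le_lt_trans _ _ (`|K k| * (e / (`|K k| + 1)))).
    by apply: le_trans (ler_wpM2r (powR_ge0 _ _) (ler_norm _)) _; rewrite ler_wpM2l.
  by rewrite mulrCA -[ltRHS]mulr1 ltr_pM2l// ltr_pdivrMr// mul1r ltrDl.
have bU : bergman_bounded p M (fun n => u (a n)) by move=> n; have [] := hd _ (ha n).
have bV : bergman_bounded p M (fun n => v (a n)) by move=> n; have [] := hd _ (ha n).
have vU : coef_vanish (fun n => u (a n)) by apply: van => n; have [] := hd _ (ha n).
have vV : coef_vanish (fun n => v (a n)) by apply: van => n; have [] := hd _ (ha n).
pose D := C * 2 `^ (- bet) + 1; have D0 : 0 < D by rewrite ltr_wpDl// mulr_ge0 ?powR_ge0.
pose e := del / D / 2; have e0 : 0 < e by rewrite !divr_gt0.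
have [N1 h1] := vT _ _ bU vU e e0; have [N2 h2] := vT _ _ bV vV e e0.
set n := maxn N1 N2; have [_] := hr_ n; apply/negP; rewrite -leNgt.
have [_ sE _ sw] := sqrt_weight b0 (r41 n).
have [[bu _] [bv _] _ _] := hd _ (ha n); rewrite sE => /(_ (TB _ bu) (TB _ bv)) h.
have hS := lerD (h1 n (leq_maxl _ _)) (h2 n (leq_maxr _ _)).
apply: (le_trans h); rewrite -/bet.
apply: (@le_trans _ _ (C * (2 `^ (- bet) * (1 - r_ n) `^ bet) * (e + e))).
  apply: ler_pM; [by rewrite mulr_ge0 ?powR_ge0|by rewrite addr_ge0 ?fine_bergman_ge0| |exact: hS].
  by rewrite ler_wpM2l.
rewrite mulrA mulrAC ler_wpM2r ?powR_ge0// -splitr.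
rewrite mulrCA ler_piMr ?(ltW del0)// ler_pdivrMr// mul1r.
by rewrite lerDl.
Qed.

Lemma lip_Lip q al g : 0 < q -> lip q al g -> Lip q al g.
Proof.
move=> q0 /(lip_cint_pow _ _ q0)[hg] /(_ 1 ltr01)[r0 r01 h].
exact: (@cint_pow_Lip R q al g 1 r0 q0 hg ler01 r01 h).
Qed.

Lemma bound_linear p q T (C : R) : (forall f, Bergman p f -> Hol (T f)) ->
  (forall (k : Cplx R) f h, Bergman p f -> Bergman p h -> forall z, cmod z < 1 ->
     T (fun w => k * f w + h w) z = k * T f z + T h z) ->
  (forall f, Bergman p f -> (bergman_int q (T f) <= (C * fine (bergman_int p f) `^ (q / p))%:E)%E) ->
  linear_Bergman p q T.
Proof.
move=> TH TL TC; split=> [f bf|k f h bf bh z /discE]; last exact: TL.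
by split; [exact: TH|apply: le_lt_trans (TC _ bf) (ltry _)].
Qed.

(** Boundedness and compactness of an operator that obeys the estimates of both
    directions; the Rhaly and the Hilbert operators both do. *)
Lemma characterization p q g T : 2 < p -> p < q -> 2 / p - 1 / q < 1 -> Hol g ->
  (forall f, Bergman p f -> Hol (T f)) ->
  (forall (k : Cplx R) f h, Bergman p f -> Bergman p h -> forall z, cmod z < 1 ->
     T (fun w => k * f w + h w) z = k * T f z + T h z) ->
  (forall F M, bergman_bounded p M F -> coef_vanish F -> coef_vanish (fun j => T (F j))) ->
  (Lip q (2 / p - 1 / q) g -> exists2 C : R, 0 <= C & forall f, Bergman p f ->
    (bergman_int q (T f) <= (C * fine (bergman_int p f) `^ (q / p))%:E)%E) ->
  (lip q (2 / p - 1 / q) g -> vanishing p q T) ->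
  detects p q g T ->
  (bounded_Bergman p q T <-> Lip q (2 / p - 1 / q) g) /\
  (compact_Bergman p q T <-> lip q (2 / p - 1 / q) g).
Proof.
move=> p2 pq al1 hg TH TL Tcoef TLip Tlip Tdet.
have p1 : 1 < p by apply: lt_trans p2; lra.
have p0 : 0 < p by apply: lt_trans p1.
have q1 : 1 < q by apply: lt_trans pq.
have q0 : 0 < q by apply: lt_trans q1.
split; split.
- move=> [[TB _] [M hM]].
  apply: (detects_Lip (K := fun B => (`|M| * B `^ p^-1) `^ q) p2 pq al1 hg Tdet TB) => B f bf fB.
  apply: bergman_norm_le => //; apply: (le_trans (hM f bf)).
  apply: (le_trans (ler_wpM2r (powR_ge0 _ _) (ler_norm M))).
  by rewrite ler_wpM2l//; apply: powR_mono; rewrite ?invr_ge0 ?(ltW p0) ?fine_bergman_ge0.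
- move=> /TLip[C C0 hC]; split; first exact: bound_linear TH TL hC.
  exists (C `^ q^-1) => f bf; have h := hC f bf.
  have qi : 0 <= q^-1 by rewrite invr_ge0 ltW.
  have bT : Bergman q (T f) by split; [exact: TH|exact: le_lt_trans h (ltry _)].
  rewrite -(bergman_fineK bT) lee_fin in h.
  apply: (le_trans (powR_mono qi (fine_bergman_ge0 _ _) h)).
  rewrite powRM ?powR_ge0// -powRrM /bergman_norm.
  by rewrite (_ : q / p * q^-1 = p^-1)//; field; rewrite !gt_eqF.
- move=> cT; have [LT _] := cT; have [TB _] := LT.
  by apply: (detects_lip p2 pq al1 hg Tdet TB); apply/(compact_vanishing (ltW p1) (ltW q1) LT Tcoef).
- move=> lg; have [C C0 hC] := TLip (lip_Lip q0 lg).
  by apply/(compact_vanishing (ltW p1) (ltW q1) (bound_linear TH TL hC) Tcoef); exact: Tlip.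
Qed.

End Characterization.

Theorem corollary2 (R : realType) (p q : R) (eta : nat -> Cplx R)
    (g : Cplx R -> Cplx R)
    (hg : Hol g) (hgs : has_pseries eta g)
    (hp : 2 < p) (hpq : p < q) (hpq1 : 2 / p - 1 / q < 1) :
  ((bounded_Bergman p q (Rhaly eta) <-> bounded_Bergman p q (genHilbert eta))
   /\ (bounded_Bergman p q (genHilbert eta) <-> Lip q (2 / p - 1 / q) g))
  /\
  ((compact_Bergman p q (Rhaly eta) <-> compact_Bergman p q (genHilbert eta))
   /\ (compact_Bergman p q (genHilbert eta) <-> lip q (2 / p - 1 / q) g)).
Proof.
have [RB RK] : (bounded_Bergman p q (Rhaly eta) <-> Lip q (2 / p - 1 / q) g) /\
    (compact_Bergman p q (Rhaly eta) <-> lip q (2 / p - 1 / q) g).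
  apply: (characterization hp hpq hpq1 hg).
  - by move=> f [hf _]; exact: has_pseries_Hol (Rhaly_pseries hgs hf).
  - by move=> k f h [hf _] [hh _] z; exact: Rhaly_lin hgs hf hh.
  - by move=> F M bF; apply: (Rhaly_coef_vanish hgs) => j; exact: (bF j).1.1.
  - exact: Rhaly_bound hgs.
  - exact: Rhaly_vanishing hgs.
  - exact: Rhaly_detects hgs.
have [HB HK] : (bounded_Bergman p q (genHilbert eta) <-> Lip q (2 / p - 1 / q) g) /\
    (compact_Bergman p q (genHilbert eta) <-> lip q (2 / p - 1 / q) g).
  apply: (characterization hp hpq hpq1 hg).
  - by move=> f bf; exact: has_pseries_Hol (genHilbert_pseries hp hgs bf).
  - by move=> k f h bf bh z; exact: genHilbert_lin hp hgs bf bh.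
  - by move=> F M; exact: genHilbert_coef_vanish hp hgs.
  - exact: genHilbert_bound hgs.
  - exact: genHilbert_vanishing hgs.
  - exact: genHilbert_detects hgs.
by split; split; rewrite ?RB ?HB ?RK ?HK.
Qed.
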